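(* Fix an integer $n\geq1$. The model Riemann–Hilbert problem described in the context has a unique solution $M$, given by $$M(p)=C\begin{bmatrix} f(p) & f(p+\tau)\\ h(p) & h(p+\tau)\end{bmatrix}\ \ (0\le \mathrm{Im}\,p<\tfrac12\mathrm{Im}\,\tau),\qquad M(p)=C\begin{bmatrix} -f(p+\tau) & f(p)\\ -h(p+\tau) & h(p)\end{bmatrix}\ \ (\tfrac12\mathrm{Im}\,\tau<\mathrm{Im}\,p<\mathrm{Im}\,\tau),$$ extended to the whole plane by $M(p+\tau)=M(p)$, where, writing $\theta_j(\cdot)=\theta_j(\cdot;2\tau)$, $$f(p)={\rm e}^{-i\pi p}\frac{\theta_1(p-\mathscr D-\tau)\,\theta_2(p)}{\theta_1(p-\mathscr D)\,\theta_1(p)}\ (n\text{ even}),\qquad f(p)={\rm e}^{-i\pi p}\frac{\theta_1(p-\mathscr D-\tau)\,\theta_3(p)}{\theta_1(p-\mathscr D)\,\theta_1(p)}\ (n\text{ odd}),$$ $$h(p)={\rm e}^{-i\pi p+i\pi\tau+2i\pi\mathscr D-\frac{i\pi}2}\frac{\theta_1(p-\mathscr D-\tau)\,\theta_3(p)}{\theta_1(p-\mathscr D)\,\theta_4(p)}\ (n\text{ even}),\qquad h(p)={\rm e}^{-i\pi p+i\pi\tau+2i\pi\mathscr D-\frac{i\pi}2}\frac{\theta_1(p-\mathscr D-\tau)\,\theta_2(p)}{\theta_1(p-\mathscr D)\,\theta_4(p)}\ (n\text{ odd}),$$ and $$C=\begin{bmatrix}\frac{\theta_1(\mathscr D)}{\theta_1(\mathscr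 D+\tau)}&0\\0&\frac{\theta_1(\mathscr D+\tau)}{\theta_1(\mathscr D)}\end{bmatrix}\frac{\theta_1'(0)}{\theta_2(0)}\ (n\text{ even}),\qquad C=\begin{bmatrix}\frac{\theta_1(\mathscr D)}{\theta_1(\mathscr D+\tau)}&0\\0&\frac{\theta_1(\mathscr D+\tau)}{\theta_1(\mathscr D)}\end{bmatrix}\frac{\theta_1'(0)}{\theta_3(0)}\ (n\text{ odd}).$$ Moreover, $f$ and $h$ are meromorphic on $\mathbb{C}$ and, regarded on the doubled curve $\mathcal E_{2\tau}=\mathbb{C}/(\mathbb{Z}+2\tau\mathbb{Z})$, satisfy $\mathrm{div}(f)\geq-(0)-(\mathscr D)+(\mathscr D+\tau)$, $f(p+1)=(-1)^{n-1}f(p)$, $f(p+2\tau)=-f(p)$, and $\mathrm{div}(h)\geq-(\tau)-(\mathscr D)+(\mathscr D+\tau)$, $h(p+1)=(-1)^{n-1}h(p)$, $h(p+2\tau)=-h(p)$; these properties characterize $f$ and $h$ each up to a multiplicative constant.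
   Context: Let $\tau\in i\mathbb{R}_{>0}$, $\Lambda_\tau=\mathbb{Z}+\tau\mathbb{Z}$, $\mathcal E_\tau=\mathbb{C}/\Lambda_\tau$, and fix $\mathscr D\in(0,1)$. Let $\gamma$ be the image in $\mathcal E_\tau$ of the line $\{\mathrm{Im}\,p=\tfrac12\mathrm{Im}\,\tau\}$, oriented by increasing real part; for $p$ on it, $p_+$ and $p_-$ denote boundary values from above (larger $\mathrm{Im}\,p$) and from below. Jacobi theta functions are in the normalization $\theta_j(p;\tau')=\vartheta_j(\pi p\,|\,\tau')$ of DLMF 20.2 with nome $q={\rm e}^{i\pi\tau'}$: $\theta_1(p;\tau')=2\sum_{k\ge0}(-1)^kq^{(k+1/2)^2}\sin((2k+1)\pi p)$, $\theta_2(p;\tau')=2\sum_{k\ge0}q^{(k+1/2)^2}\cos((2k+1)\pi p)$, $\theta_3(p;\tau')=1+2\sum_{k\ge1}q^{k^2}\cos(2k\pi p)$, $\theta_4(p;\tau')=1+2\sum_{k\ge1}(-1)^kq^{k^2}\cos(2k\pi p)$. For a meromorphic function $F$, $\mathrm{div}(F)\ge\sum$ means poles/zeros bounded as indicated (modulo the relevant lattice), $(a)$ denoting the point $a$. Model problem (for given $n$): find a $2\times2$ matrix-valued function $M$ on $\mathbb{C}\setminus\bigcup_{k\in\mathbb Z}\{\mathrm{Im}\,p=(k+\tfrac12)\mathrm{Im}\,\tau\}$, meromorphic there, such that: (1) $M(p+1)=(-1)^{n-1}M(p)$ and $M(p+\tau)=M(p)$; (2) near $p\equiv0 \bmod \Lambda_\tau$,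 $M(p)=\begin{bmatrix}p^{-1}+\mathcal O(1)&\mathcal O(1)\\\mathcal O(1)&p^{-1}+\mathcal O(1)\end{bmatrix}$; (3) near $p\equiv\mathscr D \bmod\Lambda_\tau$ the first column is $\mathcal O((p-\mathscr D)^{-1})$ and the second column is $\mathcal O(p-\mathscr D)$; (4) there are no other poles; (5) $M$ has continuous boundary values on the lines $\{\mathrm{Im}\,p=(k+\tfrac12)\mathrm{Im}\,\tau\}$ satisfying $M(p_+)=M(p_-)\begin{bmatrix}0&1\\-1&0\end{bmatrix}$. *)

(* Defs.v *)
From Stdlib Require Import Reals ZArith.
From Stdlib Require Import ClassicalEpsilon.
From Coquelicot Require Import Coquelicot.
Open Scope R_scope.

Definition Cexp (z : C) : C :=
  (exp (Re z) * cos (Im z), exp (Re z) * sin (Im z)).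
Definition Csin (z : C) : C :=
  ((Cexp (Ci * z) - Cexp (- (Ci * z))) / (2 * Ci))%C.
Definition Ccos (z : C) : C :=
  ((Cexp (Ci * z) + Cexp (- (Ci * z))) / 2)%C.

Definition CSeries (a : nat -> C) : C :=
  (Series (fun k => Re (a k)), Series (fun k => Im (a k))).

Definition qhalf (tau' : C) (k : nat) : C :=
  Cexp (Ci * PI * tau' * RtoC ((INR k + /2) ^ 2))%C.
Definition qint (tau' : C) (k : nat) : C :=
  Cexp (Ci * PI * tau' * RtoC (INR k ^ 2))%C.

(* Jacobi theta functions, DLMF 20.2 normalization, theta_j(p;tau') = vartheta_j(pi p | tau') *)
Definition theta1 (p tau' : C) : C :=
  (2 * CSeries (fun k => RtoC ((-1) ^ k) * qhalf tau' k
                         * Csin (RtoC (2 * INR k + 1) * PI * p)))%C.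
Definition theta2 (p tau' : C) : C :=
  (2 * CSeries (fun k => qhalf tau' k * Ccos (RtoC (2 * INR k + 1) * PI * p)))%C.
Definition theta3 (p tau' : C) : C :=
  (1 + 2 * CSeries (fun k => qint tau' (S k) * Ccos (RtoC (2 * INR (S k)) * PI * p)))%C.
Definition theta4 (p tau' : C) : C :=
  (1 + 2 * CSeries (fun k => RtoC ((-1) ^ (S k)) * qint tau' (S k)
                              * Ccos (RtoC (2 * INR (S k)) * PI * p)))%C.

Definition Cdiff (f : C -> C) (z : C) : Prop :=
  @ex_derive C_AbsRing C_NormedModule f z.
Definition Cderiv (f : C -> C) (z : C) : C :=
  epsilon (inhabits (RtoC 0)) (fun l => @is_derive C_AbsRing C_NormedModule f z l).

Definition holo_at (f : C -> C) (z : C) : Prop :=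
  exists r : R, 0 < r /\ forall w : C, Cmod (w - z) < r -> Cdiff f w.

Definition meromorphic_at (f : C -> C) (z : C) : Prop :=
  exists (m : nat) (g : C -> C) (r : R), 0 < r /\ holo_at g z /\
    forall w : C, 0 < Cmod (w - z) < r -> f w = (g w / Cpow (w - z) m)%C.

Definition at_most_simple_pole (f : C -> C) (a : C) : Prop :=
  exists (g : C -> C) (r : R), 0 < r /\ holo_at g a /\
    forall w : C, 0 < Cmod (w - a) < r -> f w = (g w / (w - a))%C.

Definition bounded_near (f : C -> C) (a : C) : Prop :=
  exists r K : R, 0 < r /\ forall w : C, 0 < Cmod (w - a) < r -> Cmod (f w) <= K.

Definition in_lattice (w1 w2 : C) (z : C) : Prop :=
  exists a b : Z, z = (RtoC (IZR a) * w1 + RtoC (IZR b) * w2)%C.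

Definition on_line (tau : C) (k : Z) (p : C) : Prop := Im p = (IZR k + /2) * Im tau.
Definition on_lines (tau : C) (p : C) : Prop := exists k : Z, on_line tau k p.

Definition Mat2 : Type := ((C * C) * (C * C))%type.
Definition mk2 (a b c d : C) : Mat2 := ((a, b), (c, d)).
Definition m11 (A : Mat2) : C := fst (fst A).
Definition m12 (A : Mat2) : C := snd (fst A).
Definition m21 (A : Mat2) : C := fst (snd A).
Definition m22 (A : Mat2) : C := snd (snd A).
Definition mmul (A B : Mat2) : Mat2 :=
  mk2 (m11 A * m11 B + m12 A * m21 B)%C (m11 A * m12 B + m12 A * m22 B)%C
      (m21 A * m11 B + m22 A * m21 B)%C (m21 A * m12 B + m22 A * m22 B)%C.
Definition mscal (c : C) (A : Mat2) : Mat2 :=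
  mk2 (c * m11 A)%C (c * m12 A)%C (c * m21 A)%C (c * m22 A)%C.
Definition Jmat : Mat2 := mk2 0 1 (-1) 0.
Definition entries_all (P : (C -> C) -> Prop) (M : C -> Mat2) : Prop :=
  P (fun w => m11 (M w)) /\ P (fun w => m12 (M w)) /\
  P (fun w => m21 (M w)) /\ P (fun w => m22 (M w)).

Definition sgn (n : nat) : C := RtoC ((-1) ^ (n - 1)).

Section RHP.
Variables (n : nat) (tau : C) (D : R).

(* points of the domain that are not (possible) poles *)
Definition good (p : C) : Prop :=
  ~ on_lines tau p /\ ~ in_lattice 1 tau p /\ ~ in_lattice 1 tau (p - RtoC D)%C.

Definition line_pt (k : Z) (t : R) : C := (t, (IZR k + /2) * Im tau).

Definition RHP_solution (M : C -> Mat2) : Prop :=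
  (forall p, ~ on_lines tau p -> entries_all (fun f => meromorphic_at f p) M) /\
  (forall p, good p -> M (p + 1)%C = mscal (sgn n) (M p) /\ M (p + tau)%C = M p) /\
  bounded_near (fun w => m11 (M w) - / w)%C 0 /\ bounded_near (fun w => m12 (M w)) 0 /\
  bounded_near (fun w => m21 (M w)) 0 /\ bounded_near (fun w => m22 (M w) - / w)%C 0 /\
  bounded_near (fun w => (w - RtoC D) * m11 (M w))%C (RtoC D) /\
  bounded_near (fun w => (w - RtoC D) * m21 (M w))%C (RtoC D) /\
  bounded_near (fun w => m12 (M w) / (w - RtoC D))%C (RtoC D) /\
  bounded_near (fun w => m22 (M w) / (w - RtoC D))%C (RtoC D) /\
  (forall p, good p -> entries_all (fun f => holo_at f p) M) /\
  (forall k : Z, exists Bp Bm : R -> Mat2,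
     (forall t : R, continuous Bp t /\ continuous Bm t) /\
     (forall t : R,
        filterlim M (within (fun w => Im (line_pt k t) < Im w) (locally (line_pt k t)))
                  (locally (Bp t)) /\
        filterlim M (within (fun w => Im w < Im (line_pt k t)) (locally (line_pt k t)))
                  (locally (Bm t))) /\
     (forall t : R, Bp t = mmul (Bm t) Jmat)).

Definition th1 (p : C) : C := theta1 p (2 * tau)%C.
Definition th2 (p : C) : C := theta2 p (2 * tau)%C.
Definition th3 (p : C) : C := theta3 p (2 * tau)%C.
Definition th4 (p : C) : C := theta4 p (2 * tau)%C.

Definition f_sol (p : C) : C :=
  (Cexp (- (Ci * PI * p)) *
   (th1 (p - RtoC D - tau) * (if Nat.even n then th2 p else th3 p))
   / (th1 (p - RtoC D) * th1 p))%C.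

Definition h_sol (p : C) : C :=
  (Cexp (- (Ci * PI * p) + Ci * PI * tau + 2 * Ci * PI * RtoC D - Ci * PI / 2) *
   (th1 (p - RtoC D - tau) * (if Nat.even n then th3 p else th2 p))
   / (th1 (p - RtoC D) * th4 p))%C.

Definition a_const : C := (th1 (RtoC D) / th1 (RtoC D + tau))%C.
Definition kappa : C :=
  (Cderiv th1 0 / (if Nat.even n then th2 0 else th3 0))%C.
Definition Cmat : Mat2 := mk2 (a_const * kappa)%C 0 0 (kappa / a_const)%C.

Definition M_strip (p : C) : Mat2 :=
  if Rlt_dec (Im p) (Im tau / 2)
  then mmul Cmat (mk2 (f_sol p) (f_sol (p + tau)%C) (h_sol p) (h_sol (p + tau)%C))
  else mmul Cmat (mk2 (- f_sol (p + tau))%C (f_sol p) (- h_sol (p + tau))%C (h_sol p)).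

Definition M_sol (p : C) : Mat2 :=
  M_strip (p - RtoC (IZR (Int_part (Im p / Im tau))) * tau)%C.

Definition cong2 (z w : C) : Prop := in_lattice 1 (2 * tau)%C (z - w)%C.

(* F : div(F) >= -(a) - (D) + (D + tau) on C/(Z + 2 tau Z),
   F(p+1) = (-1)^(n-1) F(p), F(p + 2 tau) = - F(p). *)
Definition fh_props (a : C) (F : C -> C) : Prop :=
  (forall z, meromorphic_at F z) /\
  (forall z, ~ cong2 z a -> ~ cong2 z (RtoC D) -> holo_at F z) /\
  (forall z, cong2 z a \/ cong2 z (RtoC D) -> at_most_simple_pole F z) /\
  (forall z, cong2 z (RtoC D + tau)%C -> F z = 0) /\
  (forall z, ~ cong2 z a -> ~ cong2 z (RtoC D) ->
       F (z + 1)%C = (sgn n * F z)%C /\ F (z + 2 * tau)%C = (- F z)%C).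

End RHP.

(* Main.v *)
(** Write Θ(z) = Σ q^(k²) e^(2πikz) over all integers k; the four theta functions are Θ at
    half-period shifts.  The zeros of Θ are exactly the expected ones because Θ is the
    limit of finite Jacobi triple products (Tannery), which stay bounded away from 0 at
    every other point.  Quotients of theta functions therefore have the asserted
    divisors, and checking the model problem for M reduces to quasi-periodicity, with
    J² = -1 matching f(p + 2τ) = -f(p).

    Uniqueness: the jump interchanges the columns of M up to sign, so each row unfolds to
    one function on C that is 1-periodic up to sign, 2τ-antiperiodic and continuous across the former
    jump lines, hence holomorphic there (Goursat on rectangles cut along the line).  Its
    poles are those of f, respectively h, and it vanishes at D + τ.  Dividing by f
    (respectively h) leaves an elliptic function on C/(Z + 2τZ) with at most one simple
    pole; the residue there vanishes by integrating around a period rectangle, so the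
    quotient is constant by Liouville.  The normalization at 0 fixes the constant.  The
    same argument characterizes f and h by their divisors and multipliers. *)

Require Import Defs.
From Stdlib Require Import Reals ZArith Lra Lia Psatz ClassicalEpsilon FunctionalExtensionality.
From Coquelicot Require Import Coquelicot.
Open Scope R_scope.

(** The model problem and the divisor conditions leave the values of a function at its poles and on
    the jump lines free. Uniqueness is therefore argued for functions known only on the dense open
    set [offgrid], and [reg] records that such a function agrees there with a holomorphic germ;
    germs are glued by density. All contour integrals run over rectangles with sides parallel to the
    axes. The value of the index integral is never computed: a lower bound for its imaginary part
    suffices to divide by it. Holomorphy across a horizontal line follows because the Cauchy kernel
    integral is differentiable for merely continuous boundary data. The theta zeros need no infinite
    product. The finite product divided by its value at X = 2 bounds the theta partial sums from
    below, since the constant coefficient is at most that value. The numerator of f or h has,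
    besides the factor vanishing at D + τ, a theta factor with a zero at a half-period e. This is
    the possible simple pole of the quotient by f or h. For D = 1/2 the point e can meet D or D + τ,
    so regularity at e is treated separately. *)

(** * Elementary estimates for the complex modulus *)

Lemma Cmod_sub_sym (z w : C) : Cmod (z - w) = Cmod (w - z).
Proof. rewrite <- Cmod_opp; f_equal; ring. Qed.

Lemma Cmod_sub_triangle (a b c : C) : Cmod (a - c) <= Cmod (a - b) + Cmod (b - c).
Proof. replace (a - c)%C with ((a - b) + (b - c))%C by ring; apply Cmod_triangle. Qed.

Lemma Cmod_minus_le (a b : C) : Cmod (a - b) <= Cmod a + Cmod b.
Proof. unfold Cminus; rewrite <- (Cmod_opp b); apply Cmod_triangle. Qed.

Lemma Cmod_triangle_inv (a b : C) : Cmod a - Cmod b <= Cmod (a - b).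
Proof.
  pose proof (Cmod_triangle (a - b) b) as H.
  replace (a - b + b)%C with a in H by ring; lra.
Qed.

Lemma Cmod_le_abs (z : C) : Cmod z <= Rabs (Re z) + Rabs (Im z).
Proof.
  unfold Cmod, Re, Im.
  rewrite <- (sqrt_Rsqr (Rabs (fst z) + Rabs (snd z)))
    by (pose proof (Rabs_pos (fst z)); pose proof (Rabs_pos (snd z)); lra).
  apply sqrt_le_1_alt; unfold Rsqr.
  pose proof (Rabs_pos (fst z)); pose proof (Rabs_pos (snd z)).
  rewrite <- (pow2_abs (fst z)), <- (pow2_abs (snd z)); nra.
Qed.

Lemma im_le_Cmod (z : C) : Rabs (Im z) <= Cmod z.
Proof. eapply Rle_trans; [apply Rmax_r | apply Rmax_Cmod]. Qed.

Lemma Re_minus (a b : C) : Re (a - b) = Re a - Re b.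
Proof. reflexivity. Qed.
Lemma Im_minus (a b : C) : Im (a - b) = Im a - Im b.
Proof. reflexivity. Qed.

Lemma Csub_neq_0 (a b : C) : a <> b -> (a - b)%C <> 0.
Proof. intros H E; apply H; apply Ceq_minus; exact E. Qed.

Lemma Cmod_sub_pos (a b : C) : a <> b -> 0 < Cmod (a - b).
Proof. intros H; apply Cmod_gt_0, Csub_neq_0, H. Qed.

Lemma Cmod_small_eq (a b : C) : (forall e, 0 < e -> Cmod (a - b) <= e) -> a = b.
Proof.
  intros H; apply Ceq_minus, Cmod_eq_0.
  apply Rle_antisym; [|apply Cmod_ge_0].
  apply Rnot_lt_le; intros Hp; specialize (H (Cmod (a - b) / 2)); lra.
Qed.

(** * Complex derivatives *)

Definition ccont (f : C -> C) (z : C) : Prop :=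
  forall e, 0 < e -> exists d, 0 < d /\
    forall w, Cmod (w - z) < d -> Cmod (f w - f z) < e.

(** First-order expansion without division: the case w = z is included, so sums, products and
    compositions are estimated directly. [cder_is_derive] ties it to the derivative of the
    library. *)
Definition cder (f : C -> C) (z l : C) : Prop :=
  forall e, 0 < e -> exists d, 0 < d /\
    forall w, Cmod (w - z) < d -> Cmod (f w - f z - l * (w - z)) <= e * Cmod (w - z).

Definition cdf (f : C -> C) (z : C) : Prop := exists l, cder f z l.

Lemma cder_is_derive (f : C -> C) (z l : C) :
  cder f z l <-> @is_derive C_AbsRing C_NormedModule f z l.
Proof.
  split.
  - intros H; split.
    + apply is_linear_scal_l.
    + intros x Hx.
      assert (E : z = x) by (apply (@is_filter_lim_locally_unique C_AbsRing (AbsRing_NormedModule C_AbsRing) z x); exact Hx).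
      subst x; intros eps.
      destruct (H eps (cond_pos eps)) as [d [Hd H']].
      exists (mkposreal d Hd); intros w Hw.
      specialize (H' w Hw).
      change (Cmod (f w - f z - (w - z) * l)%C <= eps * Cmod (w - z)).
      rewrite (Cmult_comm (w - z) l); exact H'.
  - intros [_ H] e He.
    destruct (H z (fun P HP => HP) (mkposreal e He)) as [d Hd].
    exists d; split; [apply cond_pos|]; intros w Hw.
    specialize (Hd w Hw).
    change (Cmod (f w - f z - (w - z) * l)%C <= e * Cmod (w - z)) in Hd.
    rewrite (Cmult_comm (w - z) l) in Hd; exact Hd.
Qed.

Lemma cdf_Cdiff (f : C -> C) (z : C) : cdf f z <-> Cdiff f z.
Proof. split; intros [l H]; exists l; apply cder_is_derive; exact H. Qed.

Lemma cder_ccont (f : C -> C) (z l : C) : cder f z l -> ccont f z.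
Proof.
  intros H e He.
  destruct (H 1 Rlt_0_1) as [d [Hd H']].
  pose proof (Cmod_ge_0 l) as Hl.
  exists (Rmin d (e / (2 + Cmod l))); split.
  { apply Rmin_pos; [exact Hd | apply Rdiv_lt_0_compat; lra]. }
  intros w Hw.
  assert (H1 : Cmod (w - z) < d) by (eapply Rlt_le_trans; [exact Hw | apply Rmin_l]).
  assert (H2 : Cmod (w - z) < e / (2 + Cmod l)) by (eapply Rlt_le_trans; [exact Hw | apply Rmin_r]).
  specialize (H' w H1).
  replace (f w - f z)%C with ((f w - f z - l * (w - z)) + l * (w - z))%C by ring.
  eapply Rle_lt_trans; [apply Cmod_triangle|]. rewrite Cmod_mult.
  apply (Rmult_lt_compat_r (2 + Cmod l)) in H2; [|lra].
  replace (e / (2 + Cmod l) * (2 + Cmod l)) with e in H2 by (field; lra).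
  pose proof (Cmod_ge_0 (w - z)); nra.
Qed.

Lemma cdf_ccont (f : C -> C) (z : C) : cdf f z -> ccont f z.
Proof. intros [l H]; exact (cder_ccont f z l H). Qed.

Lemma cder_unique (f : C -> C) (z l m : C) : cder f z l -> cder f z m -> l = m.
Proof.
  intros Hl Hm; apply Cmod_small_eq; intros e He.
  destruct (Hl (e / 2)) as [d1 [Hd1 H1]]; [lra|].
  destruct (Hm (e / 2)) as [d2 [Hd2 H2]]; [lra|].
  set (h := Rmin d1 d2 / 2).
  assert (Hh : 0 < h) by (unfold h; pose proof (Rmin_pos d1 d2 Hd1 Hd2); lra).
  assert (Hh1 : h < d1) by (unfold h in *; pose proof (Rmin_l d1 d2); lra).
  assert (Hh2 : h < d2) by (unfold h in *; pose proof (Rmin_r d1 d2); lra).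
  assert (E : (z + h - z)%C = RtoC h) by ring.
  specialize (H1 (z + h)%C); specialize (H2 (z + h)%C); rewrite E in H1, H2.
  rewrite Cmod_R, Rabs_pos_eq in H1, H2 by lra.
  specialize (H1 Hh1); specialize (H2 Hh2).
  assert (H3 : Cmod (l - m) * h <= e * h).
  { rewrite <- (Rabs_pos_eq h) at 1 by lra. rewrite <- Cmod_R, <- Cmod_mult.
    replace ((l - m) * h)%C with
      ((f (z + h) - f z - m * h) - (f (z + h) - f z - l * h))%C by ring.
    eapply Rle_trans; [apply Cmod_minus_le|]; lra. }
  nra.
Qed.

Lemma cder_ext_loc (f g : C -> C) (z l : C) (r : R) :
  0 < r -> (forall w, Cmod (w - z) < r -> f w = g w) -> cder f z l -> cder g z l.
Proof.
  intros Hr E H e He; destruct (H e He) as [d [Hd H']].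
  exists (Rmin d r); split; [apply Rmin_pos; lra|]; intros w Hw.
  rewrite <- !E.
  - apply H'; eapply Rlt_le_trans; [exact Hw|apply Rmin_l].
  - replace (z - z)%C with (RtoC 0) by ring; rewrite Cmod_0; lra.
  - eapply Rlt_le_trans; [exact Hw|apply Rmin_r].
Qed.

Lemma cdf_ext_loc (f g : C -> C) (z : C) (r : R) :
  0 < r -> (forall w, Cmod (w - z) < r -> f w = g w) -> cdf f z -> cdf g z.
Proof. intros Hr E [l H]; exists l; exact (cder_ext_loc f g z l r Hr E H). Qed.

Lemma cder_const (c z : C) : cder (fun _ => c) z 0.
Proof.
  intros e He; exists 1; split; [lra|]; intros w _.
  replace (c - c - 0 * (w - z))%C with (RtoC 0) by ring.
  rewrite Cmod_0; pose proof (Cmod_ge_0 (w - z)); nra.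
Qed.

Lemma cder_id (z : C) : cder (fun w => w) z 1.
Proof.
  intros e He; exists 1; split; [lra|]; intros w _.
  replace (w - z - 1 * (w - z))%C with (RtoC 0) by ring.
  rewrite Cmod_0; pose proof (Cmod_ge_0 (w - z)); nra.
Qed.

Lemma cder_plus (f g : C -> C) (z l m : C) :
  cder f z l -> cder g z m -> cder (fun w => f w + g w)%C z (l + m)%C.
Proof.
  intros Hf Hg e He.
  destruct (Hf (e / 2)) as [d1 [Hd1 H1]]; [lra|].
  destruct (Hg (e / 2)) as [d2 [Hd2 H2]]; [lra|].
  exists (Rmin d1 d2); split; [apply Rmin_pos; lra|]; intros w Hw.
  assert (A1 : Cmod (w - z) < d1) by (eapply Rlt_le_trans; [exact Hw|apply Rmin_l]).
  assert (A2 : Cmod (w - z) < d2) by (eapply Rlt_le_trans; [exact Hw|apply Rmin_r]).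
  specialize (H1 w A1); specialize (H2 w A2).
  replace (f w + g w - (f z + g z) - (l + m) * (w - z))%C with
    ((f w - f z - l * (w - z)) + (g w - g z - m * (w - z)))%C by ring.
  eapply Rle_trans; [apply Cmod_triangle|]; lra.
Qed.

Lemma cder_mult (f g : C -> C) (z l m : C) :
  cder f z l -> cder g z m -> cder (fun w => f w * g w)%C z (l * g z + f z * m)%C.
Proof.
  intros Hf Hg e He.
  pose proof (Cmod_ge_0 l) as Pl; pose proof (Cmod_ge_0 (f z)) as Pf.
  pose proof (Cmod_ge_0 (g z)) as Pg.
  set (K := Cmod (g z) + 1 + Cmod l + Cmod (f z)).
  set (e' := Rmin 1 (e / (3 * K))).
  assert (HK : 0 < K) by (unfold K; lra).
  assert (He' : 0 < e') by (apply Rmin_pos; [lra | apply Rdiv_lt_0_compat; lra]).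
  assert (He1 : e' <= 1) by apply Rmin_l.
  assert (HeK : e' * (3 * K) <= e).
  { apply Rle_trans with (e / (3 * K) * (3 * K)).
    - apply Rmult_le_compat_r; [lra | apply Rmin_r].
    - right; field; lra. }
  destruct (Hf e' He') as [d1 [Hd1 H1]].
  destruct (Hg e' He') as [d2 [Hd2 H2]].
  destruct (cder_ccont g z m Hg e' He') as [d3 [Hd3 H3]].
  exists (Rmin d1 (Rmin d2 d3)); split; [repeat apply Rmin_pos; lra|]; intros w Hw.
  assert (A1 : Cmod (w - z) < d1) by (eapply Rlt_le_trans; [exact Hw|apply Rmin_l]).
  assert (A0 : Cmod (w - z) < Rmin d2 d3) by (eapply Rlt_le_trans; [exact Hw|apply Rmin_r]).
  assert (A2 : Cmod (w - z) < d2) by (eapply Rlt_le_trans; [exact A0|apply Rmin_l]).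
  assert (A3 : Cmod (w - z) < d3) by (eapply Rlt_le_trans; [exact A0|apply Rmin_r]).
  specialize (H1 w A1); specialize (H2 w A2); specialize (H3 w A3).
  replace (f w * g w - f z * g z - (l * g z + f z * m) * (w - z))%C with
    ((f w - f z - l * (w - z)) * g w + (l * (g w - g z) * (w - z)
      + f z * (g w - g z - m * (w - z))))%C by ring.
  eapply Rle_trans; [apply Cmod_triangle|].
  eapply Rle_trans; [apply Rplus_le_compat_l, Cmod_triangle|].
  rewrite !Cmod_mult.
  assert (Hg1 : Cmod (g w) <= Cmod (g z) + 1).
  { replace (g w) with ((g w - g z) + g z)%C by ring.
    eapply Rle_trans; [apply Cmod_triangle|]; lra. }
  set (h := Cmod (w - z)) in *.
  assert (Hh : 0 <= h) by apply Cmod_ge_0.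
  assert (B1 : Cmod (f w - f z - l * (w - z)) * Cmod (g w) <= e' * h * K).
  { apply Rmult_le_compat; try apply Cmod_ge_0; [exact H1 | unfold K; lra]. }
  assert (B2 : Cmod l * Cmod (g w - g z) * h <= K * e' * h).
  { apply Rmult_le_compat_r; [exact Hh|]. apply Rmult_le_compat; try apply Cmod_ge_0; unfold K; lra. }
  assert (B3 : Cmod (f z) * Cmod (g w - g z - m * (w - z)) <= K * (e' * h)).
  { apply Rmult_le_compat; try apply Cmod_ge_0; [unfold K; lra | exact H2]. }
  assert (B4 : e' * (3 * K) * h <= e * h) by (apply Rmult_le_compat_r; assumption).
  lra.
Qed.

Lemma cder_comp (f g : C -> C) (z l m : C) :
  cder f (g z) l -> cder g z m -> cder (fun w => f (g w)) z (l * m)%C.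
Proof.
  intros Hf Hg e He.
  pose proof (Cmod_ge_0 l) as Pl; pose proof (Cmod_ge_0 m) as Pm.
  set (e1 := e / (2 * (Cmod m + 1))).
  assert (He1 : 0 < e1) by (apply Rdiv_lt_0_compat; lra).
  set (e2 := Rmin 1 (e / (2 * (Cmod l + 1)))).
  assert (He2 : 0 < e2) by (apply Rmin_pos; [lra | apply Rdiv_lt_0_compat; lra]).
  destruct (Hf e1 He1) as [d1 [Hd1 H1]].
  destruct (Hg e2 He2) as [d2 [Hd2 H2]].
  destruct (cder_ccont g z m Hg d1 Hd1) as [d3 [Hd3 H3]].
  exists (Rmin d2 d3); split; [apply Rmin_pos; lra|]; intros w Hw.
  assert (A2 : Cmod (w - z) < d2) by (eapply Rlt_le_trans; [exact Hw|apply Rmin_l]).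
  assert (A3 : Cmod (w - z) < d3) by (eapply Rlt_le_trans; [exact Hw|apply Rmin_r]).
  specialize (H2 w A2); specialize (H3 w A3); specialize (H1 (g w) H3).
  replace (f (g w) - f (g z) - l * m * (w - z))%C with
    ((f (g w) - f (g z) - l * (g w - g z)) + l * (g w - g z - m * (w - z)))%C by ring.
  eapply Rle_trans; [apply Cmod_triangle|]. rewrite Cmod_mult.
  set (h := Cmod (w - z)) in *.
  assert (Hh : 0 <= h) by apply Cmod_ge_0.
  assert (B0 : Cmod (g w - g z) <= (Cmod m + 1) * h).
  { replace (g w - g z)%C with ((g w - g z - m * (w - z)) + m * (w - z))%C by ring.
    eapply Rle_trans; [apply Cmod_triangle|]. rewrite Cmod_mult. fold h.
    assert (e2 * h <= 1 * h) by (apply Rmult_le_compat_r; [exact Hh | apply Rmin_l]). lra. }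
  assert (B1 : e1 * Cmod (g w - g z) <= e / 2 * h).
  { apply Rle_trans with (e1 * ((Cmod m + 1) * h)).
    - apply Rmult_le_compat_l; [lra | exact B0].
    - right; unfold e1; field; lra. }
  assert (B2 : Cmod l * Cmod (g w - g z - m * (w - z)) <= e / 2 * h).
  { apply Rle_trans with ((Cmod l + 1) * (e / (2 * (Cmod l + 1)) * h)).
    - apply Rmult_le_compat; try apply Cmod_ge_0; [lra|].
      eapply Rle_trans; [exact H2|]. apply Rmult_le_compat_r; [exact Hh | apply Rmin_r].
    - right; field; lra. }
  lra.
Qed.

Lemma cder_inv_id (z : C) : z <> 0 -> cder Cinv z (- / (z * z))%C.
Proof.
  intros Hz e He.
  assert (Pz : 0 < Cmod z) by (apply Cmod_gt_0, Hz).
  set (a := Cmod z) in *.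
  (* The error is (w - z)²/(z²w), and |w| > |z|/2 on the chosen ball, which gives the factor
     2/|z|³. *)
  set (K := 2 / (a * a * a)).
  assert (HK : 0 < K) by (unfold K; apply Rdiv_lt_0_compat; [lra | repeat apply Rmult_lt_0_compat; lra]).
  exists (Rmin (a / 2) (e / K)); split.
  { apply Rmin_pos; [lra | apply Rdiv_lt_0_compat; lra]. }
  intros w Hw.
  assert (A1 : Cmod (w - z) < a / 2) by (eapply Rlt_le_trans; [exact Hw|apply Rmin_l]).
  assert (A2 : Cmod (w - z) < e / K) by (eapply Rlt_le_trans; [exact Hw|apply Rmin_r]).
  assert (Hwa : a / 2 < Cmod w).
  { pose proof (Cmod_triangle_inv z w) as T. rewrite Cmod_sub_sym in T. fold a in T. lra. }
  assert (Hw0 : w <> 0) by (apply Cmod_gt_0; lra).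
  replace (/ w - / z - - / (z * z) * (w - z))%C with ((w - z) * (w - z) * / (z * z * w))%C
    by (field; split; assumption).
  assert (Hn : (z * z * w)%C <> 0) by (repeat apply Cmult_neq_0; assumption).
  rewrite !Cmod_mult, Cmod_inv, !Cmod_mult by exact Hn. fold a.
  set (h := Cmod (w - z)) in *.
  assert (Hh : 0 <= h) by apply Cmod_ge_0.
  assert (B : / (a * a * Cmod w) <= K).
  { unfold K. replace (2 / (a * a * a)) with (/ (a * a * (a / 2))) by (field; lra).
    apply Rinv_le_contravar; [repeat apply Rmult_lt_0_compat; lra|].
    apply Rmult_le_compat_l; [nra | lra]. }
  assert (B2 : h * K <= e).
  { apply Rle_trans with (e / K * K); [apply Rmult_le_compat_r; lra | right; field; lra]. }
  assert (B3 : h * / (a * a * Cmod w) <= e).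
  { eapply Rle_trans; [apply Rmult_le_compat_l; [exact Hh | exact B] | exact B2]. }
  rewrite Rmult_assoc, (Rmult_comm e). apply Rmult_le_compat_l; assumption.
Qed.

Lemma cdf_const (c z : C) : cdf (fun _ => c) z.
Proof. eexists; apply cder_const. Qed.
Lemma cdf_id (z : C) : cdf (fun w => w) z.
Proof. eexists; apply cder_id. Qed.
Lemma cdf_plus (f g : C -> C) (z : C) : cdf f z -> cdf g z -> cdf (fun w => f w + g w)%C z.
Proof. intros [l Hl] [m Hm]; eexists; apply cder_plus; eassumption. Qed.
Lemma cdf_mult (f g : C -> C) (z : C) : cdf f z -> cdf g z -> cdf (fun w => f w * g w)%C z.
Proof. intros [l Hl] [m Hm]; eexists; apply cder_mult; eassumption. Qed.
Lemma cdf_comp (f g : C -> C) (z : C) : cdf f (g z) -> cdf g z -> cdf (fun w => f (g w)) z.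
Proof. intros [l Hl] [m Hm]; eexists; apply (cder_comp f g); eassumption. Qed.
Lemma cdf_opp (f : C -> C) (z : C) : cdf f z -> cdf (fun w => - f w)%C z.
Proof.
  intros H; apply (cdf_ext_loc (fun w => (-1) * f w)%C _ z 1 Rlt_0_1).
  - intros; ring.
  - apply cdf_mult; [apply cdf_const | exact H].
Qed.
Lemma cdf_minus (f g : C -> C) (z : C) : cdf f z -> cdf g z -> cdf (fun w => f w - g w)%C z.
Proof. intros Hf Hg; apply cdf_plus; [exact Hf | apply cdf_opp, Hg]. Qed.
Lemma cdf_inv (f : C -> C) (z : C) : cdf f z -> f z <> 0 -> cdf (fun w => / f w)%C z.
Proof.
  intros Hf H0; apply (cdf_comp Cinv f); [|exact Hf].
  eexists; apply cder_inv_id; exact H0.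
Qed.
Lemma cdf_div (f g : C -> C) (z : C) :
  cdf f z -> cdf g z -> g z <> 0 -> cdf (fun w => f w / g w)%C z.
Proof. intros Hf Hg H0; apply cdf_mult; [exact Hf | apply cdf_inv; assumption]. Qed.

Create HintDb cd discriminated.
#[export] Hint Resolve cdf_const cdf_id cdf_plus cdf_mult cdf_opp cdf_minus cdf_inv cdf_div : cd.

(** * Pointwise continuity of complex functions *)

Lemma ccont_ball (f : C -> C) (z : C) : ccont f z -> f z <> 0 ->
  exists d, 0 < d /\ forall w, Cmod (w - z) < d -> f w <> 0.
Proof.
  intros H H0; destruct (H (Cmod (f z))) as [d [Hd H']]; [apply Cmod_gt_0, H0|].
  exists d; split; [exact Hd|]; intros w Hw E.
  specialize (H' w Hw); rewrite E in H'.
  replace (0 - f z)%C with (- f z)%C in H' by ring. rewrite Cmod_opp in H'; lra.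
Qed.

Lemma ccont_plus (f g : C -> C) (z : C) : ccont f z -> ccont g z -> ccont (fun w => f w + g w)%C z.
Proof.
  intros Hf Hg e He.
  destruct (Hf (e / 2)) as [d1 [Hd1 H1]]; [lra|].
  destruct (Hg (e / 2)) as [d2 [Hd2 H2]]; [lra|].
  exists (Rmin d1 d2); split; [apply Rmin_pos; lra|]; intros w Hw.
  assert (A1 : Cmod (w - z) < d1) by (eapply Rlt_le_trans; [exact Hw|apply Rmin_l]).
  assert (A2 : Cmod (w - z) < d2) by (eapply Rlt_le_trans; [exact Hw|apply Rmin_r]).
  specialize (H1 w A1); specialize (H2 w A2).
  replace (f w + g w - (f z + g z))%C with ((f w - f z) + (g w - g z))%C by ring.
  eapply Rle_lt_trans; [apply Cmod_triangle|]; lra.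
Qed.

Lemma ccont_mult (f g : C -> C) (z : C) : ccont f z -> ccont g z -> ccont (fun w => f w * g w)%C z.
Proof.
  intros Hf Hg e He.
  pose proof (Cmod_ge_0 (f z)) as Pf; pose proof (Cmod_ge_0 (g z)) as Pg.
  set (K := Cmod (f z) + 1 + Cmod (g z)).
  assert (HK : 0 < K) by (unfold K; lra).
  set (e' := Rmin 1 (e / (2 * K))).
  assert (He' : 0 < e') by (apply Rmin_pos; [lra | apply Rdiv_lt_0_compat; lra]).
  assert (HeK : e' * (2 * K) <= e).
  { apply Rle_trans with (e / (2 * K) * (2 * K)).
    - apply Rmult_le_compat_r; [lra | apply Rmin_r].
    - right; field; lra. }
  assert (He1 : e' <= 1) by apply Rmin_l.
  destruct (Hf e' He') as [d1 [Hd1 H1]].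
  destruct (Hg e' He') as [d2 [Hd2 H2]].
  exists (Rmin d1 d2); split; [apply Rmin_pos; lra|]; intros w Hw.
  assert (A1 : Cmod (w - z) < d1) by (eapply Rlt_le_trans; [exact Hw|apply Rmin_l]).
  assert (A2 : Cmod (w - z) < d2) by (eapply Rlt_le_trans; [exact Hw|apply Rmin_r]).
  specialize (H1 w A1); specialize (H2 w A2).
  replace (f w * g w - f z * g z)%C with ((f w - f z) * g z + f w * (g w - g z))%C by ring.
  eapply Rle_lt_trans; [apply Cmod_triangle|]. rewrite !Cmod_mult.
  assert (Hfw : Cmod (f w) <= Cmod (f z) + 1).
  { replace (f w) with ((f w - f z) + f z)%C by ring.
    eapply Rle_trans; [apply Cmod_triangle|]; lra. }
  assert (B1 : Cmod (f w - f z) * Cmod (g z) <= e' * Cmod (g z)) by (apply Rmult_le_compat_r; lra).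
  assert (B2 : Cmod (f w) * Cmod (g w - g z) <= (Cmod (f z) + 1) * e').
  { apply Rmult_le_compat; try apply Cmod_ge_0; lra. }
  unfold K in *. nra.
Qed.

Lemma ccont_ext_loc (f g : C -> C) (z : C) (r : R) :
  0 < r -> (forall w, Cmod (w - z) < r -> f w = g w) -> ccont f z -> ccont g z.
Proof.
  intros Hr E H e He; destruct (H e He) as [d [Hd H']].
  exists (Rmin d r); split; [apply Rmin_pos; lra|]; intros w Hw.
  rewrite <- !E.
  - apply H'; eapply Rlt_le_trans; [exact Hw|apply Rmin_l].
  - replace (z - z)%C with (RtoC 0) by ring; rewrite Cmod_0; lra.
  - eapply Rlt_le_trans; [exact Hw|apply Rmin_r].
Qed.

(** * The complex exponential *)

Lemma Cexp_0 : Cexp 0 = 1.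
Proof.
  unfold Cexp; simpl. rewrite exp_0, cos_0, sin_0.
  unfold RtoC; f_equal; ring.
Qed.

Lemma Cexp_plus (z w : C) : Cexp (z + w) = (Cexp z * Cexp w)%C.
Proof.
  unfold Cexp, Cmult, Re, Im; simpl.
  rewrite exp_plus, cos_plus, sin_plus; f_equal; ring.
Qed.

Lemma Cmod_Cexp (z : C) : Cmod (Cexp z) = exp (Re z).
Proof.
  unfold Cmod, Cexp; simpl.
  replace (exp (Re z) * cos (Im z) * (exp (Re z) * cos (Im z) * 1) +
    exp (Re z) * sin (Im z) * (exp (Re z) * sin (Im z) * 1))
    with (Rsqr (exp (Re z)) * (Rsqr (sin (Im z)) + Rsqr (cos (Im z))))
    by (unfold Rsqr; ring).
  rewrite sin2_cos2, Rmult_1_r. apply sqrt_Rsqr, Rlt_le, exp_pos.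
Qed.

Lemma Cexp_neq_0 (z : C) : Cexp z <> 0.
Proof. apply Cmod_gt_0; rewrite Cmod_Cexp; apply exp_pos. Qed.

Lemma Cexp_opp (z : C) : Cexp (- z) = (/ Cexp z)%C.
Proof.
  assert (H : (Cexp (- z) * Cexp z = 1)%C).
  { rewrite <- Cexp_plus. replace (- z + z)%C with (RtoC 0) by ring. apply Cexp_0. }
  pose proof (Cexp_neq_0 z) as H0.
  transitivity (Cexp (- z) * Cexp z * / Cexp z)%C; [field; exact H0|].
  rewrite H; field; exact H0.
Qed.

Lemma Cexp_RtoC (x : R) : Cexp x = RtoC (exp x).
Proof.
  unfold Cexp; simpl. rewrite cos_0, sin_0. unfold RtoC; f_equal; ring.
Qed.

Section ExpTaylor.
Variables a b : R.
(** The real and imaginary parts of exp(s(a + ib)) are [U 1 0 s] and [U 0 1 s]. Differentiation in s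
    stays in this family and acts linearly on (c, d), so two applications of the real mean value
    theorem give a quadratic remainder. *)
Let U (c d s : R) : R := exp (s * a) * (c * cos (s * b) + d * sin (s * b)).

Let U_derive (c d s : R) : is_derive (U c d) s (U (a * c + b * d) (a * d - b * c) s).
Proof. unfold U. auto_derive; [trivial | ring]. Qed.

Let U_bound (c d s : R) : 0 <= s <= 1 -> Rabs (U c d s) <= exp (Rabs a) * (Rabs c + Rabs d).
Proof.
  intros Hs; unfold U. rewrite Rabs_mult.
  apply Rmult_le_compat; try apply Rabs_pos.
  - rewrite Rabs_pos_eq by (apply Rlt_le, exp_pos).
    assert (Hsa : s * a <= Rabs a).
    { pose proof (Rle_abs a); pose proof (Rabs_pos a).
      destruct (Rle_dec 0 a); nra. }
    destruct (Rle_lt_or_eq_dec _ _ Hsa) as [H|H]; [left; apply exp_increasing, H | rewrite H; lra].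
  - eapply Rle_trans; [apply Rabs_triang|]. rewrite !Rabs_mult.
    pose proof (COS_bound (s * b)); pose proof (SIN_bound (s * b)).
    assert (Rabs (cos (s * b)) <= 1) by (apply Rabs_le; lra).
    assert (Rabs (sin (s * b)) <= 1) by (apply Rabs_le; lra).
    pose proof (Rabs_pos c); pose proof (Rabs_pos d); nra.
Qed.

Let U_mvt (c d s : R) : 0 <= s <= 1 ->
  Rabs (U c d s - U c d 0) <= exp (Rabs a) * (Rabs (a * c + b * d) + Rabs (a * d - b * c)).
Proof.
  intros Hs.
  destruct (MVT_gen (U c d) 0 s (U (a * c + b * d) (a * d - b * c))) as [x [Hx E]].
  - intros x _; apply U_derive.
  - intros x _; apply derivable_continuous_pt. exists (U (a * c + b * d) (a * d - b * c) x).
    apply is_derive_Reals, U_derive.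
  - rewrite Rmin_left, Rmax_right in Hx by lra.
    rewrite E, Rabs_mult, (Rabs_pos_eq (s - 0)) by lra.
    pose proof (U_bound (a * c + b * d) (a * d - b * c) x ltac:(lra)).
    pose proof (Rabs_pos (U (a * c + b * d) (a * d - b * c) x)). nra.
Qed.

Let U_taylor (c d : R) :
  Rabs (U c d 1 - c - (a * c + b * d)) <=
  exp (Rabs a) * ((Rabs a + Rabs b) * (Rabs a + Rabs b)) * (Rabs c + Rabs d).
Proof.
  set (g := fun s => U c d s - s * (a * c + b * d)).
  set (g' := fun s => U (a * c + b * d) (a * d - b * c) s - (a * c + b * d)).
  assert (Hg : forall s, is_derive g s (g' s)).
  { intros s. unfold g, g'.
    apply (is_derive_minus (U c d) (fun s => s * (a * c + b * d))); [apply U_derive|].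
    auto_derive; [trivial | ring]. }
  destruct (MVT_gen g 0 1 g') as [x [Hx E]].
  - intros x _; apply Hg.
  - intros x _; apply derivable_continuous_pt. exists (g' x). apply is_derive_Reals, Hg.
  - rewrite Rmin_left, Rmax_right in Hx by lra.
    assert (E0 : U c d 0 = c).
    { unfold U. rewrite !Rmult_0_l, exp_0, cos_0, sin_0; ring. }
    assert (E1 : U c d 1 - c - (a * c + b * d) = g 1 - g 0).
    { unfold g; rewrite E0; ring. }
    rewrite E1, E, Rminus_0_r, Rmult_1_r. unfold g'.
    assert (E2 : U (a * c + b * d) (a * d - b * c) 0 = a * c + b * d).
    { unfold U. rewrite !Rmult_0_l, exp_0, cos_0, sin_0; ring. }
    rewrite <- E2 at 2.
    eapply Rle_trans; [apply U_mvt; lra|].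
    rewrite Rmult_assoc. apply Rmult_le_compat_l; [apply Rlt_le, exp_pos|].
    set (c' := a * c + b * d). set (d' := a * d - b * c).
    assert (H1 : Rabs c' <= Rabs a * Rabs c + Rabs b * Rabs d).
    { unfold c'; eapply Rle_trans; [apply Rabs_triang|]. rewrite !Rabs_mult; lra. }
    assert (H2 : Rabs d' <= Rabs a * Rabs d + Rabs b * Rabs c).
    { unfold d'; eapply Rle_trans; [apply Rabs_triang|]. rewrite Rabs_Ropp, !Rabs_mult; lra. }
    assert (H3 : Rabs (a * c' + b * d') <= Rabs a * Rabs c' + Rabs b * Rabs d').
    { eapply Rle_trans; [apply Rabs_triang|]. rewrite !Rabs_mult; lra. }
    assert (H4 : Rabs (a * d' - b * c') <= Rabs a * Rabs d' + Rabs b * Rabs c').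
    { eapply Rle_trans; [apply Rabs_triang|]. rewrite Rabs_Ropp, !Rabs_mult; lra. }
    pose proof (Rabs_pos a); pose proof (Rabs_pos b); pose proof (Rabs_pos c); pose proof (Rabs_pos d).
    apply Rle_trans with ((Rabs a + Rabs b) * (Rabs c' + Rabs d')); [lra|].
    rewrite Rmult_assoc. apply Rmult_le_compat_l; lra.
Qed.

Lemma Cexp_taylor_components :
  Cmod (Cexp (a, b) - 1 - (a, b)) <= 4 * Cmod (a, b) ^ 2 * exp (Cmod (a, b)).
Proof.
  eapply Rle_trans; [apply Cmod_le_abs|].
  pose proof (U_taylor 1 0) as H1. pose proof (U_taylor 0 1) as H2.
  rewrite Rabs_R1, Rabs_R0 in H1, H2.
  assert (E1 : Re (Cexp (a, b) - 1 - (a, b)) = U 1 0 1 - 1 - (a * 1 + b * 0)).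
  { unfold U, Re, Cexp; simpl. rewrite !Rmult_1_l; ring. }
  assert (E2 : Im (Cexp (a, b) - 1 - (a, b)) = U 0 1 1 - 0 - (a * 0 + b * 1)).
  { unfold U, Im, Cexp; simpl. rewrite !Rmult_1_l; ring. }
  rewrite E1, E2.
  set (r := Cmod (a, b)).
  assert (Ha : Rabs a <= r) by apply (re_le_Cmod (a, b)).
  assert (Hr2 : r ^ 2 = a ^ 2 + b ^ 2) by apply (Cmod2_alt (a, b)).
  assert (Hex : exp (Rabs a) <= exp r).
  { destruct Ha as [Ha|Ha]; [left; apply exp_increasing, Ha | rewrite Ha; lra]. }
  (* This factor 2, once for each of the two components, makes the constant 4. *)
  assert (Hsq : (Rabs a + Rabs b) * (Rabs a + Rabs b) <= 2 * r ^ 2).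
  { rewrite Hr2, <- (pow2_abs a), <- (pow2_abs b).
    pose proof (Rle_0_sqr (Rabs a - Rabs b)) as Q; unfold Rsqr in Q; lra. }
  pose proof (exp_pos (Rabs a)). 
  pose proof (Rle_0_sqr (Rabs a + Rabs b)) as Q; unfold Rsqr in Q.
  assert (exp (Rabs a) * ((Rabs a + Rabs b) * (Rabs a + Rabs b)) <= exp r * (2 * r ^ 2)).
  { apply Rmult_le_compat; lra. }
  lra.
Qed.

End ExpTaylor.

Lemma Cexp_taylor (z : C) : Cmod (Cexp z - 1 - z) <= 4 * Cmod z ^ 2 * exp (Cmod z).
Proof. destruct z as [a b]; apply Cexp_taylor_components. Qed.

Lemma cder_Cexp (z : C) : cder Cexp z (Cexp z).
Proof.
  intros e He.
  pose proof (exp_pos (Re z)) as P. pose proof (exp_pos 1) as P1.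
  set (K := exp (Re z) * 4 * exp 1).
  assert (HK : 0 < K) by (unfold K; repeat apply Rmult_lt_0_compat; lra).
  exists (Rmin 1 (e / K)); split; [apply Rmin_pos; [lra | apply Rdiv_lt_0_compat; lra]|].
  intros w Hw.
  assert (A1 : Cmod (w - z) < 1) by (eapply Rlt_le_trans; [exact Hw|apply Rmin_l]).
  assert (A2 : Cmod (w - z) < e / K) by (eapply Rlt_le_trans; [exact Hw|apply Rmin_r]).
  replace (Cexp w) with (Cexp z * Cexp (w - z))%C
    by (rewrite <- Cexp_plus; f_equal; ring).
  replace (Cexp z * Cexp (w - z) - Cexp z - Cexp z * (w - z))%C
    with (Cexp z * (Cexp (w - z) - 1 - (w - z)))%C by ring.
  rewrite Cmod_mult, Cmod_Cexp.
  pose proof (Cexp_taylor (w - z)) as T.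
  set (h := Cmod (w - z)) in *.
  assert (Hh : 0 <= h) by apply Cmod_ge_0.
  assert (Hex : exp h <= exp 1) by (left; apply exp_increasing, A1).
  assert (T2 : 4 * h ^ 2 * exp h <= 4 * h ^ 2 * exp 1).
  { apply Rmult_le_compat_l; [nra | exact Hex]. }
  apply Rle_trans with (K * h * h).
  - unfold K. replace (exp (Re z) * 4 * exp 1 * h * h) with (exp (Re z) * (4 * h ^ 2 * exp 1)) by ring.
    apply Rmult_le_compat_l; lra.
  - apply Rmult_le_compat_r; [exact Hh|].
    apply Rle_trans with (K * (e / K)); [apply Rmult_le_compat_l; lra | right; field; lra].
Qed.

Lemma cdf_Cexp (f : C -> C) (z : C) : cdf f z -> cdf (fun w => Cexp (f w)) z.
Proof. intros H; apply (cdf_comp Cexp f); [eexists; apply cder_Cexp | exact H]. Qed.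
#[export] Hint Resolve cdf_Cexp : cd.

(** * Cauchy's theorem on rectangles *)

(** Taken componentwise, so that the whole theory of the real integral [RInt] applies. *)
Definition CInt (u : R -> C) (a b : R) : C :=
  (RInt (fun s => Re (u s)) a b, RInt (fun s => Im (u s)) a b).

Definition pcont (u : R -> C) (a b : R) : Prop :=
  forall s, a <= s <= b ->
    continuous (fun s => Re (u s)) s /\ continuous (fun s => Im (u s)) s.

Lemma pcont_ex_RInt (u : R -> C) (a b : R) : a <= b -> pcont u a b ->
  ex_RInt (fun s => Re (u s)) a b /\ ex_RInt (fun s => Im (u s)) a b.
Proof.
  intros Hab H; split; apply (ex_RInt_continuous (V := R_CompleteNormedModule));
    rewrite Rmin_left, Rmax_right by lra; intros s Hs; apply (H s Hs).
Qed.

Lemma CInt_plus (u v : R -> C) (a b : R) : a <= b -> pcont u a b -> pcont v a b ->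
  CInt (fun s => u s + v s)%C a b = (CInt u a b + CInt v a b)%C.
Proof.
  intros Hab Hu Hv.
  destruct (pcont_ex_RInt u a b Hab Hu) as [U1 U2], (pcont_ex_RInt v a b Hab Hv) as [V1 V2].
  unfold CInt, Cplus; simpl; f_equal.
  - exact (RInt_plus _ _ a b U1 V1).
  - exact (RInt_plus _ _ a b U2 V2).
Qed.

Lemma CInt_scal (c : C) (u : R -> C) (a b : R) : a <= b -> pcont u a b ->
  CInt (fun s => c * u s)%C a b = (c * CInt u a b)%C.
Proof.
  intros Hab Hu.
  destruct (pcont_ex_RInt u a b Hab Hu) as [U1 U2], c as [c1 c2].
  pose proof (ex_RInt_scal _ a b c1 U1) as A1. pose proof (ex_RInt_scal _ a b c2 U1) as A2.
  pose proof (ex_RInt_scal _ a b c1 U2) as B1. pose proof (ex_RInt_scal _ a b c2 U2) as B2.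
  unfold CInt, Cmult; simpl; f_equal.
  - etransitivity; [exact (RInt_minus _ _ a b A1 B2)|].
    exact (f_equal2 Rminus (RInt_scal _ a b c1 U1) (RInt_scal _ a b c2 U2)).
  - etransitivity; [exact (RInt_plus _ _ a b B1 A2)|].
    exact (f_equal2 Rplus (RInt_scal _ a b c1 U2) (RInt_scal _ a b c2 U1)).
Qed.

Lemma CInt_Chasles (u : R -> C) (a b c : R) : a <= b -> b <= c -> pcont u a c ->
  CInt u a c = (CInt u a b + CInt u b c)%C.
Proof.
  intros Hab Hbc Hu.
  assert (Hu1 : pcont u a b) by (intros s Hs; apply Hu; lra).
  assert (Hu2 : pcont u b c) by (intros s Hs; apply Hu; lra).
  destruct (pcont_ex_RInt u a b Hab Hu1) as [U1 U2], (pcont_ex_RInt u b c Hbc Hu2) as [V1 V2].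
  unfold CInt, Cplus; simpl; f_equal; symmetry.
  - exact (RInt_Chasles _ a b c U1 V1).
  - exact (RInt_Chasles _ a b c U2 V2).
Qed.

Lemma CInt_ext (u v : R -> C) (a b : R) : a <= b ->
  (forall s, a <= s <= b -> u s = v s) -> CInt u a b = CInt v a b.
Proof.
  intros Hab H; unfold CInt; f_equal; apply RInt_ext;
    rewrite Rmin_left, Rmax_right by lra; intros s Hs; rewrite H; auto; lra.
Qed.

(** The factor 2 comes from bounding the two components separately; every later estimate tolerates
    it. *)
Lemma CInt_bound (u : R -> C) (a b M : R) : a <= b -> pcont u a b ->
  (forall s, a <= s <= b -> Cmod (u s) <= M) -> Cmod (CInt u a b) <= 2 * M * (b - a).
Proof.
  intros Hab Hu HM.
  destruct (pcont_ex_RInt u a b Hab Hu) as [U1 U2].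
  eapply Rle_trans; [apply Cmod_le_abs|].
  assert (H1 : Rabs (Re (CInt u a b)) <= (b - a) * M).
  { apply abs_RInt_le_const; auto. intros t Ht.
    eapply Rle_trans; [apply re_le_Cmod | apply HM, Ht]. }
  assert (H2 : Rabs (Im (CInt u a b)) <= (b - a) * M).
  { apply abs_RInt_le_const; auto. intros t Ht.
    eapply Rle_trans; [apply im_le_Cmod | apply HM, Ht]. }
  lra.
Qed.

Lemma ccont_line (f : C -> C) (p d : C) (s : R) : ccont f (p + s * d)%C ->
  continuous (fun s : R => Re (f (p + s * d)%C)) s /\
  continuous (fun s : R => Im (f (p + s * d)%C)) s.
Proof.
  intros H.
  assert (K : forall e : posreal, exists r : posreal, forall s' : R,
    Rabs (s' - s) < r -> Cmod (f (p + s' * d)%C - f (p + s * d)%C) < e).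
  { intros e; destruct (H e (cond_pos e)) as [r [Hr H']].
    pose proof (Cmod_ge_0 d) as Pd.
    assert (Hr' : 0 < r / (Cmod d + 1)) by (apply Rdiv_lt_0_compat; lra).
    exists (mkposreal _ Hr'); intros s' Hs'; simpl in Hs'. apply H'.
    replace (p + s' * d - (p + s * d))%C with ((s' - s)%R * d)%C
      by (rewrite RtoC_minus; ring).
    rewrite Cmod_mult, Cmod_R.
    apply (Rmult_lt_compat_r (Cmod d + 1)) in Hs'; [|lra].
    replace (r / (Cmod d + 1) * (Cmod d + 1)) with r in Hs' by (field; lra).
    pose proof (Rabs_pos (s' - s)); nra. }
  split; apply (proj2 (filterlim_locally _ _)); intros e; destruct (K e) as [r Hr];
    exists r; intros s' Hs'; specialize (Hr s' Hs');
    (eapply Rle_lt_trans; [|exact Hr]).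
  - apply (re_le_Cmod (f (p + s' * d) - f (p + s * d))%C).
  - apply (im_le_Cmod (f (p + s' * d) - f (p + s * d))%C).
Qed.

Lemma pair_line_h (x y : R) : (x, y) = ((0, y) + x * 1)%C.
Proof. unfold Cplus, Cmult, RtoC; simpl; f_equal; ring. Qed.
Lemma pair_line_v (x y : R) : (x, y) = ((x, 0) + y * Ci)%C.
Proof. unfold Cplus, Cmult, RtoC, Ci; simpl; f_equal; ring. Qed.

Lemma pcont_h (f : C -> C) (y a b : R) :
  (forall x, a <= x <= b -> ccont f (x, y)) -> pcont (fun x => f (x, y)) a b.
Proof.
  intros H s Hs. specialize (H s Hs). rewrite pair_line_h in H.
  apply ccont_line in H. destruct H as [H1 H2].
  split; [eapply continuous_ext; [|exact H1] | eapply continuous_ext; [|exact H2]];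
    intros x; simpl; rewrite <- pair_line_h; reflexivity.
Qed.
Lemma pcont_v (f : C -> C) (x a b : R) :
  (forall y, a <= y <= b -> ccont f (x, y)) -> pcont (fun y => f (x, y)) a b.
Proof.
  intros H s Hs. specialize (H s Hs). rewrite pair_line_v in H.
  apply ccont_line in H. destruct H as [H1 H2].
  split; [eapply continuous_ext; [|exact H1] | eapply continuous_ext; [|exact H2]];
    intros y; simpl; rewrite <- pair_line_v; reflexivity.
Qed.

Lemma cder_line (F : C -> C) (p d l : C) (s : R) : cder F (p + s * d)%C l ->
  is_derive (fun s : R => Re (F (p + s * d)%C)) s (Re (l * d)) /\
  is_derive (fun s : R => Im (F (p + s * d)%C)) s (Im (l * d)).
Proof.
  intros H.
  assert (K : forall e : R, 0 < e -> exists r : posreal, forall h : R,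
    h <> 0 -> Rabs h < r ->
    Cmod (F (p + (s + h)%R * d)%C - F (p + s * d)%C - l * d * h) < e * Rabs h).
  { intros e He; pose proof (Cmod_ge_0 d) as Pd.
    assert (He' : 0 < e / (Cmod d + 1)) by (apply Rdiv_lt_0_compat; lra).
    destruct (H _ He') as [r [Hr H']].
    assert (Hr' : 0 < r / (Cmod d + 1)) by (apply Rdiv_lt_0_compat; lra).
    exists (mkposreal _ Hr'); intros h Hh Hhr; simpl in Hhr.
    assert (E : (p + (s + h)%R * d - (p + s * d))%C = (h * d)%C)
      by (rewrite RtoC_plus; ring).
    assert (M : Cmod (h * d) = Rabs h * Cmod d) by (rewrite Cmod_mult, Cmod_R; reflexivity).
    pose proof (Rabs_pos_lt h Hh) as Ph.
    specialize (H' (p + (s + h)%R * d)%C). rewrite E, M in H'.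
    replace (l * d * h)%C with (l * (h * d))%C by ring.
    eapply Rle_lt_trans; [apply H'|].
    - apply (Rmult_lt_compat_r (Cmod d + 1)) in Hhr; [|lra].
      replace (r / (Cmod d + 1) * (Cmod d + 1)) with r in Hhr by (field; lra). nra.
    - apply Rlt_le_trans with (e / (Cmod d + 1) * (Rabs h * (Cmod d + 1))).
      + apply Rmult_lt_compat_l; [exact He'|]. apply Rmult_lt_compat_l; lra.
      + right; field; lra. }
  split; apply is_derive_Reals; intros e He; destruct (K e He) as [r Hr]; exists r;
    intros h Hh Hhr; specialize (Hr h Hh Hhr); pose proof (Rabs_pos_lt h Hh) as Ph;
    apply (Rmult_lt_reg_r (Rabs h)); try exact Ph; rewrite <- Rabs_mult;
    (eapply Rle_lt_trans; [|exact Hr]).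
  - eapply Rle_trans; [|apply re_le_Cmod]. right; f_equal.
    rewrite !Re_minus, re_scal_r. field; exact Hh.
  - eapply Rle_trans; [|apply im_le_Cmod]. right; f_equal.
    rewrite !Im_minus, im_scal_r. field; exact Hh.
Qed.

Lemma CInt_derive_h (F f : C -> C) (y a b : R) : a <= b ->
  (forall x, a <= x <= b -> cder F (x, y) (f (x, y))) ->
  (forall x, a <= x <= b -> ccont f (x, y)) ->
  CInt (fun x => f (x, y)) a b = (F (b, y) - F (a, y))%C.
Proof.
  intros Hab HF Hf.
  pose proof (pcont_h f y a b Hf) as P.
  assert (D : forall x, a <= x <= b ->
    is_derive (fun x => Re (F (x, y))) x (Re (f (x, y))) /\
    is_derive (fun x => Im (F (x, y))) x (Im (f (x, y)))).
  { intros x Hx. specialize (HF x Hx). rewrite (pair_line_h x y) in HF at 1.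
    apply cder_line in HF. rewrite Cmult_1_r in HF. destruct HF as [H1 H2].
    split; [eapply is_derive_ext; [|exact H1] | eapply is_derive_ext; [|exact H2]];
      intros t; simpl; rewrite <- pair_line_h; reflexivity. }
  unfold CInt. change (F (b, y) - F (a, y))%C with
    (Re (F (b, y)) - Re (F (a, y)), Im (F (b, y)) - Im (F (a, y)))%R.
  f_equal; apply is_RInt_unique.
  - apply (is_RInt_derive (fun x => Re (F (x, y)))); rewrite Rmin_left, Rmax_right by lra;
      intros x Hx; [apply D, Hx | apply P, Hx].
  - apply (is_RInt_derive (fun x => Im (F (x, y)))); rewrite Rmin_left, Rmax_right by lra;
      intros x Hx; [apply D, Hx | apply P, Hx].
Qed.

Lemma CInt_derive_v (F f : C -> C) (x a b : R) : a <= b ->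
  (forall y, a <= y <= b -> cder F (x, y) (f (x, y))) ->
  (forall y, a <= y <= b -> ccont f (x, y)) ->
  (Ci * CInt (fun y => f (x, y)) a b)%C = (F (x, b) - F (x, a))%C.
Proof.
  intros Hab HF Hf.
  assert (P : pcont (fun y => Ci * f (x, y))%C a b).
  { apply (pcont_v (fun z => Ci * f z)%C x a b). intros y Hy.
    apply ccont_mult; [apply (cder_ccont _ _ 0), cder_const | apply Hf, Hy]. }
  rewrite <- CInt_scal; [|exact Hab | exact (pcont_v f x a b Hf)].
  assert (D : forall y, a <= y <= b ->
    is_derive (fun y => Re (F (x, y))) y (Re (Ci * f (x, y))) /\
    is_derive (fun y => Im (F (x, y))) y (Im (Ci * f (x, y)))).
  { intros y Hy. specialize (HF y Hy). rewrite (pair_line_v x y) in HF at 1.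
    apply cder_line in HF. rewrite Cmult_comm in HF. destruct HF as [H1 H2].
    split; [eapply is_derive_ext; [|exact H1] | eapply is_derive_ext; [|exact H2]];
      intros t; simpl; rewrite <- pair_line_v; reflexivity. }
  unfold CInt. change (F (x, b) - F (x, a))%C with
    (Re (F (x, b)) - Re (F (x, a)), Im (F (x, b)) - Im (F (x, a)))%R.
  f_equal; apply is_RInt_unique.
  - apply (is_RInt_derive (fun y => Re (F (x, y)))); rewrite Rmin_left, Rmax_right by lra;
      intros y Hy; [apply D, Hy | apply P, Hy].
  - apply (is_RInt_derive (fun y => Im (F (x, y)))); rewrite Rmin_left, Rmax_right by lra;
      intros y Hy; [apply D, Hy | apply P, Hy].
Qed.

(** Counterclockwise boundary integral: bottom minus top, then right minus left with dz = i dy. *)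
Definition Rect (f : C -> C) (x1 x2 y1 y2 : R) : C :=
  (CInt (fun x => f (x, y1)) x1 x2 - CInt (fun x => f (x, y2)) x1 x2
   + Ci * CInt (fun y => f (x2, y)) y1 y2 - Ci * CInt (fun y => f (x1, y)) y1 y2)%C.

(** Continuity on the boundary alone, for integrands such as Cauchy kernels that have a pole
    inside. *)
Definition bcont (f : C -> C) (x1 x2 y1 y2 : R) : Prop :=
  forall x y, x1 <= x <= x2 -> y1 <= y <= y2 ->
    (x = x1 \/ x = x2 \/ y = y1 \/ y = y2) -> ccont f (x, y).
Definition rcont (f : C -> C) (x1 x2 y1 y2 : R) : Prop :=
  forall x y, x1 <= x <= x2 -> y1 <= y <= y2 -> ccont f (x, y).

Lemma rcont_bcont (f : C -> C) (x1 x2 y1 y2 : R) :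
  rcont f x1 x2 y1 y2 -> bcont f x1 x2 y1 y2.
Proof. intros H x y Hx Hy _; apply H; assumption. Qed.

Lemma bcont_sides (f : C -> C) (x1 x2 y1 y2 : R) : x1 <= x2 -> y1 <= y2 ->
  bcont f x1 x2 y1 y2 ->
  pcont (fun x => f (x, y1)) x1 x2 /\ pcont (fun x => f (x, y2)) x1 x2 /\
  pcont (fun y => f (x1, y)) y1 y2 /\ pcont (fun y => f (x2, y)) y1 y2.
Proof.
  intros Hx Hy H; refine (conj _ (conj _ (conj _ _)));
    (apply pcont_h || apply pcont_v); intros; apply H; try lra; auto.
Qed.

Lemma Rect_plus (f g : C -> C) (x1 x2 y1 y2 : R) : x1 <= x2 -> y1 <= y2 ->
  bcont f x1 x2 y1 y2 -> bcont g x1 x2 y1 y2 ->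
  Rect (fun z => f z + g z)%C x1 x2 y1 y2 = (Rect f x1 x2 y1 y2 + Rect g x1 x2 y1 y2)%C.
Proof.
  intros Hx Hy Hf Hg.
  destruct (bcont_sides f x1 x2 y1 y2 Hx Hy Hf) as (A1 & A2 & A3 & A4).
  destruct (bcont_sides g x1 x2 y1 y2 Hx Hy Hg) as (B1 & B2 & B3 & B4).
  unfold Rect. rewrite !CInt_plus by assumption. ring.
Qed.

Lemma Rect_scal (c : C) (f : C -> C) (x1 x2 y1 y2 : R) : x1 <= x2 -> y1 <= y2 ->
  bcont f x1 x2 y1 y2 ->
  Rect (fun z => c * f z)%C x1 x2 y1 y2 = (c * Rect f x1 x2 y1 y2)%C.
Proof.
  intros Hx Hy Hf.
  destruct (bcont_sides f x1 x2 y1 y2 Hx Hy Hf) as (A1 & A2 & A3 & A4).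
  unfold Rect. rewrite !CInt_scal by assumption. ring.
Qed.

Lemma Rect_ext (f g : C -> C) (x1 x2 y1 y2 : R) : x1 <= x2 -> y1 <= y2 ->
  (forall x y, x1 <= x <= x2 -> y1 <= y <= y2 ->
    (x = x1 \/ x = x2 \/ y = y1 \/ y = y2) -> f (x, y) = g (x, y)) ->
  Rect f x1 x2 y1 y2 = Rect g x1 x2 y1 y2.
Proof.
  intros Hx Hy H; unfold Rect.
  rewrite (CInt_ext (fun x => f (x, y1)) (fun x => g (x, y1))),
    (CInt_ext (fun x => f (x, y2)) (fun x => g (x, y2))),
    (CInt_ext (fun y => f (x1, y)) (fun y => g (x1, y))),
    (CInt_ext (fun y => f (x2, y)) (fun y => g (x2, y)));
    try assumption; try reflexivity; intros s Hs; apply H; try lra; auto.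
Qed.

Lemma Rect_bound (f : C -> C) (x1 x2 y1 y2 M : R) : x1 <= x2 -> y1 <= y2 ->
  bcont f x1 x2 y1 y2 ->
  (forall x y, x1 <= x <= x2 -> y1 <= y <= y2 ->
    (x = x1 \/ x = x2 \/ y = y1 \/ y = y2) -> Cmod (f (x, y)) <= M) ->
  Cmod (Rect f x1 x2 y1 y2) <= 4 * M * ((x2 - x1) + (y2 - y1)).
Proof.
  intros Hx Hy Hf HM.
  destruct (bcont_sides f x1 x2 y1 y2 Hx Hy Hf) as (A1 & A2 & A3 & A4).
  unfold Rect.
  pose proof (CInt_bound _ _ _ M Hx A1 ltac:(intros; apply HM; try lra; auto)) as B1.
  pose proof (CInt_bound _ _ _ M Hx A2 ltac:(intros; apply HM; try lra; auto)) as B2.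
  pose proof (CInt_bound _ _ _ M Hy A3 ltac:(intros; apply HM; try lra; auto)) as B3.
  pose proof (CInt_bound _ _ _ M Hy A4 ltac:(intros; apply HM; try lra; auto)) as B4.
  eapply Rle_trans; [apply Cmod_minus_le|].
  eapply Rle_trans; [apply Rplus_le_compat_r, Cmod_triangle|].
  eapply Rle_trans; [apply Rplus_le_compat_r, Rplus_le_compat_r, Cmod_minus_le|].
  rewrite !Cmod_mult, Cmod_Ci. lra.
Qed.

Lemma Rect_split_x (f : C -> C) (x1 m x2 y1 y2 : R) : x1 <= m <= x2 -> y1 <= y2 ->
  rcont f x1 x2 y1 y2 ->
  Rect f x1 x2 y1 y2 = (Rect f x1 m y1 y2 + Rect f m x2 y1 y2)%C.
Proof.
  intros Hm Hy Hf. unfold Rect.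
  rewrite (CInt_Chasles (fun x => f (x, y1)) x1 m x2),
    (CInt_Chasles (fun x => f (x, y2)) x1 m x2); try lra.
  - ring.
  - apply pcont_h; intros; apply Hf; lra.
  - apply pcont_h; intros; apply Hf; lra.
Qed.

Lemma Rect_split_y (f : C -> C) (x1 x2 y1 m y2 : R) : x1 <= x2 -> y1 <= m <= y2 ->
  rcont f x1 x2 y1 y2 ->
  Rect f x1 x2 y1 y2 = (Rect f x1 x2 y1 m + Rect f x1 x2 m y2)%C.
Proof.
  intros Hx Hm Hf. unfold Rect.
  rewrite (CInt_Chasles (fun y => f (x1, y)) y1 m y2),
    (CInt_Chasles (fun y => f (x2, y)) y1 m y2); try lra.
  - ring.
  - apply pcont_v; intros; apply Hf; lra.
  - apply pcont_v; intros; apply Hf; lra.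
Qed.

Lemma Rect_primitive (F f : C -> C) (x1 x2 y1 y2 : R) : x1 <= x2 -> y1 <= y2 ->
  bcont f x1 x2 y1 y2 ->
  (forall x y, x1 <= x <= x2 -> y1 <= y <= y2 -> cder F (x, y) (f (x, y))) ->
  Rect f x1 x2 y1 y2 = 0.
Proof.
  intros Hx Hy Hf HF. unfold Rect.
  rewrite (CInt_derive_h F f y1), (CInt_derive_h F f y2),
    (CInt_derive_v F f x1), (CInt_derive_v F f x2); try assumption;
    try (intros; first [apply HF | apply Hf]; auto; lra).
  ring.
Qed.

Lemma Rect_affine (a b : C) (x1 x2 y1 y2 : R) : x1 <= x2 -> y1 <= y2 ->
  Rect (fun z => a + b * z)%C x1 x2 y1 y2 = 0.
Proof.
  intros Hx Hy.
  apply (Rect_primitive (fun z => a * z + b / 2 * (z * z))%C); try assumption.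
  - intros x y _ _ _. apply cdf_ccont; auto with cd.
  - intros x y _ _.
    assert (H2 : RtoC 2 <> 0) by (intros E; apply RtoC_inj in E; lra).
    replace (a + b * (x, y))%C with
      (0 * (x, y) + a * 1 + (0 * ((x, y) * (x, y)) + b / 2 * (1 * (x, y) + (x, y) * 1)))%C
      by (field; exact H2).
    apply (cder_plus (fun z => a * z)%C (fun z => b / 2 * (z * z))%C).
    + apply (cder_mult (fun _ => a) (fun z => z)); [apply cder_const | apply cder_id].
    + apply (cder_mult (fun _ => b / 2)%C (fun z => z * z)%C); [apply cder_const|].
      apply (cder_mult (fun z => z) (fun z => z)); apply cder_id.
Qed.

(** * Goursat's theorem by bisection *)

Lemma nested_intervals_point (a b : nat -> R) :
  (forall n, a n <= a (S n)) -> (forall n, b (S n) <= b n) -> (forall n, a n <= b n) ->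
  exists x, forall n, a n <= x <= b n.
Proof.
  intros Ha Hb Hab.
  assert (Ma : forall n m, (n <= m)%nat -> a n <= a m).
  { intros n m H; induction H; [lra | eapply Rle_trans; [exact IHle | apply Ha]]. }
  assert (Mb : forall n m, (n <= m)%nat -> b m <= b n).
  { intros n m H; induction H; [lra | eapply Rle_trans; [apply Hb | exact IHle]]. }
  assert (Mab : forall n m, a n <= b m).
  { intros n m. apply Rle_trans with (a (max n m)); [apply Ma; lia|].
    apply Rle_trans with (b (max n m)); [apply Hab | apply Mb; lia]. }
  destruct (completeness (fun r => exists n, r = a n)) as [x [H1 H2]].
  - exists (b 0%nat); intros r [n ->]; apply Mab.
  - exists (a 0%nat), 0%nat; reflexivity.
  - exists x; intros n; split; [apply H1; exists n; reflexivity|].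
    apply H2; intros r [m ->]; apply Mab.
Qed.

Lemma Rect_quarter (f : C -> C) (x1 x2 y1 y2 : R) : x1 <= x2 -> y1 <= y2 ->
  rcont f x1 x2 y1 y2 ->
  exists u1 u2 v1 v2, x1 <= u1 /\ u2 <= x2 /\ y1 <= v1 /\ v2 <= y2 /\
    u2 - u1 = (x2 - x1) / 2 /\ v2 - v1 = (y2 - y1) / 2 /\
    Cmod (Rect f x1 x2 y1 y2) <= 4 * Cmod (Rect f u1 u2 v1 v2).
Proof.
  intros Hx Hy Hf.
  set (m := (x1 + x2) / 2). set (k := (y1 + y2) / 2).
  assert (Hm : x1 <= m <= x2) by (unfold m; lra).
  assert (Hk : y1 <= k <= y2) by (unfold k; lra).
  assert (E : Rect f x1 x2 y1 y2 =
    (Rect f x1 m y1 k + Rect f x1 m k y2 + (Rect f m x2 y1 k + Rect f m x2 k y2))%C).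
  { rewrite (Rect_split_x f x1 m x2 y1 y2 Hm Hy Hf).
    rewrite (Rect_split_y f x1 m y1 k y2), (Rect_split_y f m x2 y1 k y2); try lra; auto.
    - intros x y ? ?; apply Hf; lra.
    - intros x y ? ?; apply Hf; lra. }
  set (A := Cmod (Rect f x1 x2 y1 y2)).
  assert (T : A <= Cmod (Rect f x1 m y1 k) + Cmod (Rect f x1 m k y2)
     + (Cmod (Rect f m x2 y1 k) + Cmod (Rect f m x2 k y2))).
  { unfold A; rewrite E. eapply Rle_trans; [apply Cmod_triangle|].
    apply Rplus_le_compat; apply Cmod_triangle. }
  destruct (Rle_dec A (4 * Cmod (Rect f x1 m y1 k))) as [?|N1];
    [exists x1, m, y1, k; repeat split; try assumption; unfold m, k; lra|].
  destruct (Rle_dec A (4 * Cmod (Rect f x1 m k y2))) as [?|N2];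
    [exists x1, m, k, y2; repeat split; try assumption; unfold m, k; lra|].
  destruct (Rle_dec A (4 * Cmod (Rect f m x2 y1 k))) as [?|N3];
    [exists m, x2, y1, k; repeat split; try assumption; unfold m, k; lra|].
  exists m, x2, k, y2; repeat split; try assumption; unfold m, k in *; try lra.
Qed.

Theorem Goursat (f : C -> C) (x1 x2 y1 y2 : R) : x1 <= x2 -> y1 <= y2 ->
  (forall x y, x1 <= x <= x2 -> y1 <= y <= y2 -> cdf f (x, y)) ->
  Rect f x1 x2 y1 y2 = 0.
Proof.
  intros Hx Hy Hf.
  pose (T := (R * R * R * R)%type).
  pose (good := fun s : T => let '(u1, u2, v1, v2) := s in
     x1 <= u1 /\ u1 <= u2 /\ u2 <= x2 /\ y1 <= v1 /\ v1 <= v2 /\ v2 <= y2).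
  pose (nxt := fun s s' : T => let '(u1, u2, v1, v2) := s in let '(a1, a2, b1, b2) := s' in
     u1 <= a1 /\ a2 <= u2 /\ v1 <= b1 /\ b2 <= v2 /\
     a2 - a1 = (u2 - u1) / 2 /\ b2 - b1 = (v2 - v1) / 2 /\
     Cmod (Rect f u1 u2 v1 v2) <= 4 * Cmod (Rect f a1 a2 b1 b2)).
  assert (step : forall s : T, exists s' : T, good s -> good s' /\ nxt s s').
  { intros [[[u1 u2] v1] v2].
    (* A dummy successor for ill-formed quadruples makes the choice function [F] total, so that it
       can be iterated. *)
    destruct (classic (good (u1, u2, v1, v2))) as [G|G]; [|exists (0, 0, 0, 0); tauto].
    destruct G as (G1 & G2 & G3 & G4 & G5 & G6).
    destruct (Rect_quarter f u1 u2 v1 v2 G2 G5) as (a1 & a2 & b1 & b2 & A1 & A2 & A3 & A4 & A5 & A6 & A7).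
    { intros x y ? ?; apply cdf_ccont, Hf; lra. }
    exists (a1, a2, b1, b2); intros _; unfold good, nxt; repeat split; try assumption; lra. }
  pose (F := fun s : T => proj1_sig (constructive_indefinite_description _ (step s))).
  assert (HF : forall s, good s -> good (F s) /\ nxt s (F s)).
  { intros s; exact (proj2_sig (constructive_indefinite_description _ (step s))). }
  pose (S_ := fun n : nat => Nat.iter n F (x1, x2, y1, y2)).
  assert (G : forall n, good (S_ n)).
  { intros n; induction n as [|n IH]; [unfold good, S_; simpl; lra|].
    simpl; apply HF; exact IH. }
  pose (L := (x2 - x1) + (y2 - y1)).
  assert (HL : 0 <= L) by (unfold L; lra).
  pose (p1 := fun n => fst (fst (fst (S_ n)))). pose (p2 := fun n => snd (fst (fst (S_ n)))).
  pose (p3 := fun n => snd (fst (S_ n))). pose (p4 := fun n => snd (S_ n)).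
  assert (ES : forall n, S_ n = (p1 n, p2 n, p3 n, p4 n)).
  { intros n; unfold p1, p2, p3, p4; destruct (S_ n) as [[[? ?] ?] ?]; reflexivity. }
  assert (Gn : forall n, x1 <= p1 n /\ p1 n <= p2 n /\ p2 n <= x2 /\
     y1 <= p3 n /\ p3 n <= p4 n /\ p4 n <= y2).
  { intros n; specialize (G n); rewrite ES in G; exact G. }
  assert (Nn : forall n, p1 n <= p1 (S n) /\ p2 (S n) <= p2 n /\ p3 n <= p3 (S n) /\ p4 (S n) <= p4 n /\
     p2 (S n) - p1 (S n) = (p2 n - p1 n) / 2 /\ p4 (S n) - p3 (S n) = (p4 n - p3 n) / 2 /\
     Cmod (Rect f (p1 n) (p2 n) (p3 n) (p4 n)) <=
       4 * Cmod (Rect f (p1 (S n)) (p2 (S n)) (p3 (S n)) (p4 (S n)))).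
  { intros n. destruct (HF (S_ n) (G n)) as [_ N]. change (F (S_ n)) with (S_ (S n)) in N.
    rewrite !ES in N; exact N. }
  assert (Ln : forall n, (p2 n - p1 n) + (p4 n - p3 n) = L / 2 ^ n).
  { intros n; induction n as [|n IH]; [unfold L, p1, p2, p3, p4; simpl; field|].
    destruct (Nn n) as (_ & _ & _ & _ & E1 & E2 & _). rewrite E1, E2.
    replace (L / 2 ^ S n) with (L / 2 ^ n / 2) by (simpl; field; apply pow_nonzero; lra).
    rewrite <- IH; field. }
  assert (Cn : forall n, Cmod (Rect f x1 x2 y1 y2) <=
    4 ^ n * Cmod (Rect f (p1 n) (p2 n) (p3 n) (p4 n))).
  { intros n; induction n as [|n IH]; [unfold p1, p2, p3, p4; simpl; lra|].
    destruct (Nn n) as (_ & _ & _ & _ & _ & _ & E). simpl.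
    eapply Rle_trans; [exact IH|]. rewrite (Rmult_comm 4), Rmult_assoc.
    apply Rmult_le_compat_l; [apply pow_le; lra | exact E]. }
  destruct (nested_intervals_point p1 p2) as [x Hxn];
    [intros n; apply Nn | intros n; apply Nn | intros n; apply Gn|].
  destruct (nested_intervals_point p3 p4) as [y Hyn];
    [intros n; apply Nn | intros n; apply Nn | intros n; apply Gn|].
  assert (Hxy : cdf f (x, y)).
  { apply Hf; [specialize (Hxn 0%nat); specialize (Gn 0%nat) | specialize (Hyn 0%nat); specialize (Gn 0%nat)]; lra. }
  destruct Hxy as [l Hl].
  apply Cmod_small_eq; intros e0 He0.
  replace (Rect f x1 x2 y1 y2 - 0)%C with (Rect f x1 x2 y1 y2) by ring.
  (* At stage n the perimeter bound is L/2^n, so 4^n pieces of size 4e(L/2^n)² add up to 4eL². The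
     summand 1 covers degenerate rectangles with L = 0. *)
  pose (e := e0 / (4 * (L * L) + 1)).
  assert (He : 0 < e) by (apply Rdiv_lt_0_compat; nra).
  destruct (Hl e He) as [d [Hd H']].
  assert (Hn : exists n, L / 2 ^ n < d).
  { assert (Q : is_lim_seq (fun n => L * (/ 2) ^ n) (L * 0)).
    { apply (is_lim_seq_scal_l _ L 0). apply is_lim_seq_geom. rewrite Rabs_pos_eq; lra. }
    rewrite Rmult_0_r in Q. apply is_lim_seq_spec in Q.
    destruct (Q (mkposreal d Hd)) as [n Hn]. exists n. specialize (Hn n (Nat.le_refl n)).
    simpl in Hn. rewrite Rminus_0_r, pow_inv in Hn. eapply Rle_lt_trans; [apply Rle_abs | exact Hn]. }
  destruct Hn as [n Hn].
  specialize (Cn n). specialize (Ln n). destruct (Gn n) as (G1 & G2 & G3 & G4 & G5 & G6).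
  specialize (Hxn n). specialize (Hyn n).
  set (a1 := p1 n) in *. set (a2 := p2 n) in *. set (b1 := p3 n) in *. set (b2 := p4 n) in *.
  set (q := L / 2 ^ n) in *.
  assert (Hdist : forall x' y', a1 <= x' <= a2 -> b1 <= y' <= b2 -> Cmod ((x', y') - (x, y))%C <= q).
  { intros x' y' Hx' Hy'. eapply Rle_trans; [apply Cmod_le_abs|]. simpl.
    rewrite <- Ln. apply Rplus_le_compat; apply Rabs_le; lra. }
  assert (Q1 : Cmod (Rect f a1 a2 b1 b2) <= 4 * (e * q) * q).
  { rewrite <- Ln at 2.
    (* Subtracting the affine part at the limit point leaves the integral unchanged and makes the
       integrand o(|z - (x, y)|). *)
    pose (g := fun z : C => (f z + (- (f (x, y) - l * (x, y)) + (- l) * z))%C).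
    assert (Eg : Rect g a1 a2 b1 b2 = Rect f a1 a2 b1 b2).
    { unfold g. rewrite (Rect_plus f (fun z => - (f (x, y) - l * (x, y)) + (- l) * z)%C); try assumption.
      - rewrite Rect_affine by assumption; ring.
      - intros x' y' ? ? _; apply cdf_ccont, Hf; lra.
      - intros x' y' ? ? _; apply cdf_ccont; auto with cd. }
    rewrite <- Eg. apply Rect_bound; try assumption.
    - intros x' y' ? ? _; apply ccont_plus; [apply cdf_ccont, Hf; lra | apply cdf_ccont; auto with cd].
    - intros x' y' Hx' Hy' _. unfold g.
      replace (f (x', y') + (- (f (x, y) - l * (x, y)) + - l * (x', y')))%C with
        (f (x', y') - f (x, y) - l * ((x', y') - (x, y)))%C by ring.
      eapply Rle_trans; [apply H'|].
      + eapply Rle_lt_trans; [apply Hdist; assumption | exact Hn].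
      + apply Rmult_le_compat_l; [lra | apply Hdist; assumption]. }
  eapply Rle_trans; [exact Cn|].
  apply Rle_trans with (4 ^ n * (4 * (e * q) * q)).
  { apply Rmult_le_compat_l; [apply pow_le; lra | exact Q1]. }
  assert (Eq : 4 ^ n * (4 * (e * q) * q) = 4 * e * (L * L)).
  { unfold q. replace (4 ^ n) with (2 ^ n * 2 ^ n) by (rewrite <- Rpow_mult_distr; f_equal; lra).
    field. apply pow_nonzero; lra. }
  rewrite Eq.
  apply Rle_trans with (e * (4 * (L * L) + 1)); [nra|].
  right; unfold e; field; nra.
Qed.

(** * Uniform continuity and boundedness on rectangles *)

Lemma ccont_2d (f : C -> C) (x y : R) : ccont f (x, y) ->
  continuity_2d_pt (fun u v => Re (f (u, v))) x y /\
  continuity_2d_pt (fun u v => Im (f (u, v))) x y.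
Proof.
  intros H.
  assert (K : forall e : posreal, exists d : posreal, forall u v,
    Rabs (u - x) < d -> Rabs (v - y) < d -> Cmod (f (u, v) - f (x, y)) < e).
  { intros e; destruct (H e (cond_pos e)) as [d [Hd H']].
    assert (Hd2 : 0 < d / 2) by lra.
    exists (mkposreal _ Hd2); simpl; intros u v Hu Hv. apply H'.
    eapply Rle_lt_trans; [apply Cmod_le_abs|]. simpl. 
    change (Rabs (u - x) + Rabs (v - y) < d). lra. }
  split; intros e; destruct (K e) as [d Hd]; exists d; intros u v Hu Hv;
    specialize (Hd u v Hu Hv); (eapply Rle_lt_trans; [|exact Hd]).
  - apply (re_le_Cmod (f (u, v) - f (x, y))%C).
  - apply (im_le_Cmod (f (u, v) - f (x, y))%C).
Qed.

Lemma rcont_uniform (f : C -> C) (x1 x2 y1 y2 e : R) : rcont f x1 x2 y1 y2 -> 0 < e ->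
  exists d, 0 < d /\ forall x y u v, x1 <= x <= x2 -> y1 <= y <= y2 ->
    x1 <= u <= x2 -> y1 <= v <= y2 -> Rabs (u - x) < d -> Rabs (v - y) < d ->
    Cmod (f (u, v) - f (x, y)) < e.
Proof.
  intros H He.
  assert (He2 : 0 < e / 2) by lra.
  destruct (uniform_continuity_2d (fun u v => Re (f (u, v))) x1 x2 y1 y2) with (eps := mkposreal _ He2)
    as [d1 H1]; [intros x y Hx Hy; apply ccont_2d, H; assumption|].
  destruct (uniform_continuity_2d (fun u v => Im (f (u, v))) x1 x2 y1 y2) with (eps := mkposreal _ He2)
    as [d2 H2]; [intros x y Hx Hy; apply ccont_2d, H; assumption|].
  pose proof (cond_pos d1); pose proof (cond_pos d2).
  exists (Rmin d1 d2); split; [apply Rmin_pos; assumption|].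
  intros x y u v Hx Hy Hu Hv Hxu Hyv.
  pose proof (Rmin_l d1 d2); pose proof (Rmin_r d1 d2).
  specialize (H1 x y u v Hx Hy Hu Hv ltac:(lra) ltac:(lra)).
  specialize (H2 x y u v Hx Hy Hu Hv ltac:(lra) ltac:(lra)). simpl in H1, H2.
  eapply Rle_lt_trans; [apply Cmod_le_abs|]. rewrite Re_minus, Im_minus. lra.
Qed.

Lemma rcont_bounded (f : C -> C) (x1 x2 y1 y2 : R) : x1 <= x2 -> y1 <= y2 ->
  rcont f x1 x2 y1 y2 ->
  exists M, 0 < M /\ forall x y, x1 <= x <= x2 -> y1 <= y <= y2 -> Cmod (f (x, y)) <= M.
Proof.
  intros Hx Hy Hf.
  destruct (rcont_uniform f x1 x2 y1 y2 1 Hf Rlt_0_1) as [d [Hd H]].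
  set (L := (x2 - x1) + (y2 - y1)).
  (* The segment from the corner to (x, y) is walked in N equal steps, each shorter than d in both
     coordinates; f changes by less than 1 per step, hence the bound |f(corner)| + N. *)
  destruct (INR_unbounded (L / d + 1)) as [N HN].
  assert (HL : 0 <= L / d) by (apply Rdiv_le_0_compat; [unfold L; lra | exact Hd]).
  assert (PN : 0 < INR N) by lra.
  assert (HLN : L / INR N < d).
  { apply (Rmult_lt_reg_r (INR N)); [exact PN|].
    replace (L / INR N * INR N) with L by (field; lra).
    apply Rle_lt_trans with (d * (L / d)); [right; field; lra|].
    apply Rmult_lt_compat_l; lra. }
  exists (Cmod (f (x1, y1)) + INR N + 1); split.
  { pose proof (Cmod_ge_0 (f (x1, y1))); lra. }
  intros x y Hxx Hyy.
  set (X := fun j : nat => x1 + INR j / INR N * (x - x1)).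
  set (Y := fun j : nat => y1 + INR j / INR N * (y - y1)).
  assert (HXY : forall j, (j <= N)%nat -> x1 <= X j <= x2 /\ y1 <= Y j <= y2).
  { intros j Hj. apply le_INR in Hj. pose proof (pos_INR j).
    assert (0 <= INR j / INR N <= 1).
    { split; [apply Rdiv_le_0_compat; lra|]. apply (Rmult_le_reg_r (INR N)); [lra|].
      unfold Rdiv; rewrite Rmult_assoc, Rinv_l; lra. }
    unfold X, Y; nra. }
  assert (I : forall j, (j <= N)%nat -> Cmod (f (X j, Y j)) <= Cmod (f (x1, y1)) + INR j).
  { induction j as [|j IH]; intros Hj.
    - unfold X, Y; simpl. unfold Rdiv; rewrite !Rmult_0_l, !Rplus_0_r; lra.
    - specialize (IH ltac:(lia)).
      destruct (HXY j ltac:(lia)) as [A1 A2]. destruct (HXY (S j) Hj) as [B1 B2].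
      assert (EX : X (S j) - X j = (x - x1) / INR N) by (unfold X; rewrite S_INR; field; lra).
      assert (EY : Y (S j) - Y j = (y - y1) / INR N) by (unfold Y; rewrite S_INR; field; lra).
      specialize (H (X j) (Y j) (X (S j)) (Y (S j)) A1 A2 B1 B2).
      rewrite EX, EY in H.
      assert (D : Cmod (f (X (S j), Y (S j)) - f (X j, Y j)) < 1).
      { apply H; rewrite Rabs_pos_eq; try (apply Rdiv_le_0_compat; lra);
          (eapply Rle_lt_trans; [|exact HLN]); apply Rmult_le_compat_r;
          try (apply Rlt_le, Rinv_0_lt_compat; lra); unfold L; lra. }
      rewrite S_INR.
      replace (f (X (S j), Y (S j))) with ((f (X (S j), Y (S j)) - f (X j, Y j)) + f (X j, Y j))%C by ring.
      eapply Rle_trans; [apply Cmod_triangle|]; lra. }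
  specialize (I N (Nat.le_refl N)).
  replace (X N) with x in I by (unfold X; field; lra).
  replace (Y N) with y in I by (unfold Y; field; lra). lra.
Qed.

Lemma bcont_bounded (f : C -> C) (x1 x2 y1 y2 : R) : x1 <= x2 -> y1 <= y2 ->
  bcont f x1 x2 y1 y2 ->
  exists M, 0 < M /\ forall x y, x1 <= x <= x2 -> y1 <= y <= y2 ->
    (x = x1 \/ x = x2 \/ y = y1 \/ y = y2) -> Cmod (f (x, y)) <= M.
Proof.
  intros Hx Hy H.
  destruct (rcont_bounded f x1 x1 y1 y2) as [M1 [P1 H1]]; try lra.
  { intros x y ? ?; apply H; try lra; left; lra. }
  destruct (rcont_bounded f x2 x2 y1 y2) as [M2 [P2 H2]]; try lra.
  { intros x y ? ?; apply H; try lra; right; left; lra. }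
  destruct (rcont_bounded f x1 x2 y1 y1) as [M3 [P3 H3]]; try lra.
  { intros x y ? ?; apply H; try lra; right; right; left; lra. }
  destruct (rcont_bounded f x1 x2 y2 y2) as [M4 [P4 H4]]; try lra.
  { intros x y ? ?; apply H; try lra; right; right; right; lra. }
  exists (M1 + M2 + M3 + M4); split; [lra|]. intros x y Xx Yy [E|[E|[E|E]]]; subst.
  - specialize (H1 x1 y); lra.
  - specialize (H2 x2 y); lra.
  - specialize (H3 x y1); lra.
  - specialize (H4 x y2); lra.
Qed.

(** * Goursat's theorem with exceptional horizontal lines *)

(** On a flat rectangle the two horizontal integrals nearly cancel and the vertical ones are short;
    continuity alone makes the boundary integral small. *)
Lemma Rect_thin (f : C -> C) (x1 x2 y1 y2 e M : R) : x1 <= x2 -> y1 <= y2 ->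
  rcont f x1 x2 y1 y2 ->
  (forall x, x1 <= x <= x2 -> Cmod (f (x, y1) - f (x, y2)) <= e) ->
  (forall x y, x1 <= x <= x2 -> y1 <= y <= y2 -> Cmod (f (x, y)) <= M) ->
  Cmod (Rect f x1 x2 y1 y2) <= 2 * e * (x2 - x1) + 4 * M * (y2 - y1).
Proof.
  intros Hx Hy Hf He HM.
  destruct (bcont_sides f x1 x2 y1 y2 Hx Hy (rcont_bcont _ _ _ _ _ Hf)) as (A1 & A2 & A3 & A4).
  assert (A2' : pcont (fun x => (-1) * f (x, y2))%C x1 x2).
  { apply (pcont_h (fun z => (-1) * f z)%C). intros x ?.
    apply ccont_mult; [apply (cder_ccont _ _ 0), cder_const | apply Hf; lra]. }
  assert (E : Rect f x1 x2 y1 y2 = (CInt (fun x => f (x, y1) + (-1) * f (x, y2))%C x1 x2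
    + (Ci * CInt (fun y => f (x2, y)) y1 y2 - Ci * CInt (fun y => f (x1, y)) y1 y2))%C).
  { rewrite CInt_plus, CInt_scal by assumption. unfold Rect; ring. }
  rewrite E.
  eapply Rle_trans; [apply Cmod_triangle|]. apply Rplus_le_compat.
  - apply CInt_bound; [exact Hx | |].
    (* The integrand compares two heights, so it is presented as a function of [Re z] in order to
       count as the restriction of a complex function to one line. *)
    + apply (pcont_h (fun z => f (Re z, y1) + (-1) * f (Re z, y2))%C y1). intros x Hxx d Hd.
      destruct (Hf x y1 ltac:(lra) ltac:(lra) (d / 2) ltac:(lra)) as [d1 [Hd1 K1]].
      destruct (Hf x y2 ltac:(lra) ltac:(lra) (d / 2) ltac:(lra)) as [d2 [Hd2 K2]].
      exists (Rmin d1 d2); split; [apply Rmin_pos; lra|]; intros w Hw.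
      pose proof (Rmin_l d1 d2); pose proof (Rmin_r d1 d2).
      assert (Q : forall y, Cmod ((Re w, y) - (x, y)) <= Cmod (w - (x, y1))).
      { intros y. eapply Rle_trans; [apply Cmod_le_abs|].
        change (Rabs (Re w - x) + Rabs (y + - y) <= Cmod (w - (x, y1))).
        rewrite Rplus_opp_r, Rabs_R0, Rplus_0_r. apply (re_le_Cmod (w - (x, y1))%C). }
      specialize (K1 (Re w, y1)); specialize (K2 (Re w, y2)).
      pose proof (Q y1); pose proof (Q y2).
      simpl Re at 3 4.
      replace (f (Re w, y1) + -1 * f (Re w, y2) - (f (x, y1) + -1 * f (x, y2)))%C
        with ((f (Re w, y1) - f (x, y1)) - (f (Re w, y2) - f (x, y2)))%C by ring.
      eapply Rle_lt_trans; [apply Cmod_minus_le|].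
      specialize (K1 ltac:(lra)); specialize (K2 ltac:(lra)); lra.
    + intros x Hxx. replace (f (x, y1) + -1 * f (x, y2))%C with (f (x, y1) - f (x, y2))%C by ring.
      apply He, Hxx.
  - eapply Rle_trans; [apply Cmod_minus_le|]. rewrite !Cmod_mult, Cmod_Ci.
    pose proof (CInt_bound _ _ _ M Hy A3 ltac:(intros; apply HM; lra)).
    pose proof (CInt_bound _ _ _ M Hy A4 ltac:(intros; apply HM; lra)). lra.
Qed.

Lemma Goursat_open (f : C -> C) (x1 x2 y1 y2 : R) : x1 <= x2 -> y1 <= y2 ->
  rcont f x1 x2 y1 y2 ->
  (forall x y, x1 <= x <= x2 -> y1 < y < y2 -> cdf f (x, y)) ->
  Rect f x1 x2 y1 y2 = 0.
Proof.
  intros Hx Hy Hf Hd.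
  destruct (rcont_bounded f x1 x2 y1 y2 Hx Hy Hf) as [M [PM HM]].
  apply Cmod_small_eq; intros e He.
  replace (Rect f x1 x2 y1 y2 - 0)%C with (Rect f x1 x2 y1 y2) by ring.
  (* Each of the two strips cut off at bottom and top costs at most 2e'(x2 - x1) + 4Ms with s <=
     e'. *)
  set (e' := e / (4 * (x2 - x1) + 8 * M + 1)).
  assert (He' : 0 < e') by (apply Rdiv_lt_0_compat; lra).
  assert (Ee : e' * (4 * (x2 - x1) + 8 * M + 1) = e) by (unfold e'; field; lra).
  destruct (rcont_uniform f x1 x2 y1 y2 e' Hf He') as [d [Pd U]].
  destruct (Rle_lt_or_eq_dec _ _ Hy) as [Hy'|Hy'].
  - set (s := Rmin (Rmin (d / 2) e') ((y2 - y1) / 3)).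
    assert (Ps : 0 < s) by (repeat apply Rmin_pos; lra).
    assert (S1 : s <= d / 2) by (eapply Rle_trans; [apply Rmin_l | apply Rmin_l]).
    assert (S2 : s <= e') by (eapply Rle_trans; [apply Rmin_l | apply Rmin_r]).
    assert (S3 : s <= (y2 - y1) / 3) by apply Rmin_r.
    rewrite (Rect_split_y f x1 x2 y1 (y1 + s) y2), (Rect_split_y f x1 x2 (y1 + s) (y2 - s) y2);
      try lra; try assumption; try (intros x y ? ?; apply Hf; lra).
    rewrite (Goursat f x1 x2 (y1 + s) (y2 - s)); try lra; [|intros; apply Hd; lra].
    rewrite Cplus_0_l. eapply Rle_trans; [apply Cmod_triangle|].
    assert (T1 : Cmod (Rect f x1 x2 y1 (y1 + s)) <= 2 * e' * (x2 - x1) + 4 * M * (y1 + s - y1)).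
    { apply Rect_thin; try lra.
      - intros x y ? ?; apply Hf; lra.
      - intros x Hxx; left; apply U; try lra; apply Rabs_def1; lra.
      - intros x y ? ?; apply HM; lra. }
    assert (T2 : Cmod (Rect f x1 x2 (y2 - s) y2) <= 2 * e' * (x2 - x1) + 4 * M * (y2 - (y2 - s))).
    { apply Rect_thin; try lra.
      - intros x y ? ?; apply Hf; lra.
      - intros x Hxx; left; apply U; try lra; apply Rabs_def1; lra.
      - intros x y ? ?; apply HM; lra. }
    nra.
  - subst y2. eapply Rle_trans.
    + apply (Rect_thin f x1 x2 y1 y1 e' M); try lra; try assumption.
      intros x Hxx. replace (f (x, y1) - f (x, y1))%C with (RtoC 0) by ring. rewrite Cmod_0; lra.
    + nra.
Qed.

Lemma Goursat_line (f : C -> C) (x1 x2 y1 y2 p : R) : x1 <= x2 -> y1 <= y2 ->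
  rcont f x1 x2 y1 y2 ->
  (forall x y, x1 <= x <= x2 -> y1 < y < y2 -> y <> p -> cdf f (x, y)) ->
  Rect f x1 x2 y1 y2 = 0.
Proof.
  intros Hx Hy Hf Hd.
  destruct (classic (y1 <= p <= y2)) as [Hp|Hp].
  - rewrite (Rect_split_y f x1 x2 y1 p y2) by assumption.
    rewrite !Goursat_open; try lra; try (intros x y ? ?; apply Hf; lra);
      try (intros x y ? ?; apply Hd; lra). ring.
  - apply Goursat_open; try assumption. intros x y ? ?; apply Hd; try lra.
Qed.

(** One line is where f is only known to be continuous, the other passes through the base point of a
    difference quotient. *)
Lemma Goursat_two_lines (f : C -> C) (x1 x2 y1 y2 p q : R) : x1 <= x2 -> y1 <= y2 ->
  rcont f x1 x2 y1 y2 ->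
  (forall x y, x1 <= x <= x2 -> y1 < y < y2 -> y <> p -> y <> q -> cdf f (x, y)) ->
  Rect f x1 x2 y1 y2 = 0.
Proof.
  intros Hx Hy Hf Hd.
  destruct (classic (y1 <= q <= y2)) as [Hq|Hq].
  - rewrite (Rect_split_y f x1 x2 y1 q y2) by assumption.
    rewrite !(Goursat_line _ _ _ _ _ p); try lra; try (intros x y ? ?; apply Hf; lra);
      try (intros x y ? ? ?; apply Hd; lra). ring.
  - apply (Goursat_line _ _ _ _ _ p); try assumption. intros x y ? ? ?; apply Hd; try lra.
Qed.

(** * Cauchy's formula and removable singularities *)

(** Unnormalized winding number. Only its differentiability and a lower bound are established, not
    its value. *)
Definition wind (x1 x2 y1 y2 : R) (w : C) : C := Rect (fun z => / (z - w))%C x1 x2 y1 y2.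

Lemma ccont_const (c z : C) : ccont (fun _ => c) z.
Proof. apply cdf_ccont; auto with cd. Qed.

Lemma cdf_sub_inv (w z : C) : z <> w -> cdf (fun z => / (z - w))%C z.
Proof. intros H; apply cdf_inv; [auto with cd | apply Csub_neq_0, H]. Qed.

Lemma boundary_neq (x1 x2 y1 y2 x y : R) (w : C) :
  x1 < Re w < x2 -> y1 < Im w < y2 -> (x = x1 \/ x = x2 \/ y = y1 \/ y = y2) -> (x, y) <> w.
Proof. intros Hx Hy H E; subst w; simpl in *; destruct H as [H|[H|[H|H]]]; lra. Qed.

Lemma RInt_ge_const (g : R -> R) (a b c : R) : a <= b -> ex_RInt g a b ->
  (forall x, a <= x <= b -> c <= g x) -> c * (b - a) <= RInt g a b.
Proof.
  intros Hab Hg H.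
  replace (c * (b - a)) with (RInt (fun _ => c) a b).
  - apply RInt_le; [exact Hab | apply ex_RInt_const | exact Hg | intros; apply H; lra].
  - etransitivity; [apply RInt_const|]. change ((b - a) * c = c * (b - a)); ring.
Qed.

Lemma Re_inv_sub (x y a b : R) :
  Re (/ ((x, y) - (a, b))) = (x - a) / ((x - a) ^ 2 + (y - b) ^ 2).
Proof. reflexivity. Qed.

Lemma Im_inv_sub (x y a b : R) :
  Im (/ ((x, y) - (a, b))) = (b - y) / ((x - a) ^ 2 + (y - b) ^ 2).
Proof.
  change (- (y - b) / ((x - a) ^ 2 + (y - b) ^ 2) = (b - y) / ((x - a) ^ 2 + (y - b) ^ 2)).
  unfold Rdiv; f_equal; ring.
Qed.

(** Every side contributes a positive angle. On each side the integrand is at least the distance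
    from w to that side divided by the squared diagonal [S], and opposite distances add up to a full
    side length. *)
Lemma wind_lower (x1 x2 y1 y2 : R) (w : C) : x1 < Re w < x2 -> y1 < Im w < y2 ->
  2 * (x2 - x1) * (y2 - y1) / ((x2 - x1) ^ 2 + (y2 - y1) ^ 2) <= Im (wind x1 x2 y1 y2 w).
Proof.
  destruct w as [a b]; intros Ha Hb; change (x1 < a < x2) in Ha; change (y1 < b < y2) in Hb.
  assert (Bc : bcont (fun z => / (z - (a, b)))%C x1 x2 y1 y2).
  { intros x y ? ? Hb'. apply cdf_ccont, cdf_sub_inv.
    apply (boundary_neq x1 x2 y1 y2); auto. }
  destruct (bcont_sides _ x1 x2 y1 y2 ltac:(lra) ltac:(lra) Bc) as (A1 & A2 & A3 & A4).
  apply pcont_ex_RInt in A1; [|lra]. apply pcont_ex_RInt in A2; [|lra].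
  apply pcont_ex_RInt in A3; [|lra]. apply pcont_ex_RInt in A4; [|lra].
  set (S := (x2 - x1) ^ 2 + (y2 - y1) ^ 2).
  assert (PS : 0 < S) by (unfold S; nra).
  assert (E : Im (wind x1 x2 y1 y2 (a, b)) =
    RInt (fun x => Im (/ ((x, y1) - (a, b)))) x1 x2 - RInt (fun x => Im (/ ((x, y2) - (a, b)))) x1 x2
    + RInt (fun y => Re (/ ((x2, y) - (a, b)))) y1 y2 - RInt (fun y => Re (/ ((x1, y) - (a, b)))) y1 y2).
  { unfold wind, Rect, CInt. simpl. ring. }
  rewrite E.
  assert (Sq : forall u v d, - d <= u - v <= d -> (u - v) ^ 2 <= d ^ 2).
  { intros u v d H. apply pow_maj_Rabs, Rabs_le, H. }
  assert (Ps : forall u v, u <> v -> 0 < (u - v) ^ 2).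
  { intros u v H. apply pow2_gt_0; lra. }
  assert (Aux : forall v r, 0 < v -> 0 < r -> r <= S -> v / S <= v / r).
  { intros v r Hv Hr Hrs. apply Rmult_le_compat_l; [lra|]. apply Rinv_le_contravar; lra. }
  assert (B1 : (b - y1) / S * (x2 - x1) <= RInt (fun x => Im (/ ((x, y1) - (a, b)))) x1 x2).
  { apply RInt_ge_const; [lra | apply A1|]. intros x Hx. rewrite Im_inv_sub.
    pose proof (Sq x a (x2 - x1) ltac:(lra)); pose proof (Sq y1 b (y2 - y1) ltac:(lra)).
    pose proof (Ps y1 b ltac:(lra)); pose proof (pow2_ge_0 (x - a)).
    apply Aux; [lra | lra | unfold S; lra]. }
  assert (B2 : (y2 - b) / S * (x2 - x1) <= RInt (fun x => - Im (/ ((x, y2) - (a, b)))) x1 x2).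
  { apply RInt_ge_const; [lra | apply (ex_RInt_opp (V := R_NormedModule)), A2|].
    intros x Hx. rewrite Im_inv_sub.
    replace (- ((b - y2) / ((x - a) ^ 2 + (y2 - b) ^ 2))) with ((y2 - b) / ((x - a) ^ 2 + (y2 - b) ^ 2))
      by (unfold Rdiv; ring).
    pose proof (Sq x a (x2 - x1) ltac:(lra)); pose proof (Sq y2 b (y2 - y1) ltac:(lra)).
    pose proof (Ps y2 b ltac:(lra)); pose proof (pow2_ge_0 (x - a)).
    apply Aux; [lra | lra | unfold S; lra]. }
  assert (B3 : (x2 - a) / S * (y2 - y1) <= RInt (fun y => Re (/ ((x2, y) - (a, b)))) y1 y2).
  { apply RInt_ge_const; [lra | apply A4|]. intros y Hy. rewrite Re_inv_sub.
    pose proof (Sq x2 a (x2 - x1) ltac:(lra)); pose proof (Sq y b (y2 - y1) ltac:(lra)).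
    pose proof (Ps x2 a ltac:(lra)); pose proof (pow2_ge_0 (y - b)).
    apply Aux; [lra | lra | unfold S; lra]. }
  assert (B4 : (a - x1) / S * (y2 - y1) <= RInt (fun y => - Re (/ ((x1, y) - (a, b)))) y1 y2).
  { apply RInt_ge_const; [lra | apply (ex_RInt_opp (V := R_NormedModule)), A3|].
    intros y Hy. rewrite Re_inv_sub.
    replace (- ((x1 - a) / ((x1 - a) ^ 2 + (y - b) ^ 2))) with ((a - x1) / ((x1 - a) ^ 2 + (y - b) ^ 2))
      by (unfold Rdiv; ring).
    pose proof (Sq x1 a (x2 - x1) ltac:(lra)); pose proof (Sq y b (y2 - y1) ltac:(lra)).
    pose proof (Ps x1 a ltac:(lra)); pose proof (pow2_ge_0 (y - b)).
    apply Aux; [lra | lra | unfold S; lra]. }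
  assert (O2 : RInt (fun x => - Im (/ ((x, y2) - (a, b)))) x1 x2 = - RInt (fun x => Im (/ ((x, y2) - (a, b)))) x1 x2).
  { exact (RInt_opp _ _ _ (proj2 A2)). }
  assert (O4 : RInt (fun y => - Re (/ ((x1, y) - (a, b)))) y1 y2 = - RInt (fun y => Re (/ ((x1, y) - (a, b)))) y1 y2).
  { exact (RInt_opp _ _ _ (proj1 A3)). }
  rewrite O2 in B2; rewrite O4 in B4.
  replace (2 * (x2 - x1) * (y2 - y1) / S) with
    ((b - y1) / S * (x2 - x1) + (y2 - b) / S * (x2 - x1) + (x2 - a) / S * (y2 - y1) + (a - x1) / S * (y2 - y1))
    by (field; lra).
  lra.
Qed.

Lemma wind_neq_0 (x1 x2 y1 y2 : R) (w : C) : x1 < Re w < x2 -> y1 < Im w < y2 ->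
  wind x1 x2 y1 y2 w <> 0.
Proof.
  intros Hx Hy E. pose proof (wind_lower x1 x2 y1 y2 w Hx Hy) as L.
  rewrite E in L. simpl in L.
  assert (0 < 2 * (x2 - x1) * (y2 - y1) / ((x2 - x1) * ((x2 - x1) * 1) + (y2 - y1) * ((y2 - y1) * 1))).
  { apply Rdiv_lt_0_compat; nra. }
  lra.
Qed.

Lemma boundary_dist (x1 x2 y1 y2 : R) (w : C) : x1 < Re w < x2 -> y1 < Im w < y2 ->
  exists r, 0 < r /\ forall x y, x1 <= x <= x2 -> y1 <= y <= y2 ->
    (x = x1 \/ x = x2 \/ y = y1 \/ y = y2) -> r <= Cmod ((x, y) - w).
Proof.
  intros Hx Hy.
  exists (Rmin (Rmin (Re w - x1) (x2 - Re w)) (Rmin (Im w - y1) (y2 - Im w))); split.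
  { repeat apply Rmin_pos; lra. }
  set (r := Rmin _ _).
  assert (r <= Re w - x1) by (eapply Rle_trans; [apply Rmin_l | apply Rmin_l]).
  assert (r <= x2 - Re w) by (eapply Rle_trans; [apply Rmin_l | apply Rmin_r]).
  assert (r <= Im w - y1) by (eapply Rle_trans; [apply Rmin_r | apply Rmin_l]).
  assert (r <= y2 - Im w) by (eapply Rle_trans; [apply Rmin_r | apply Rmin_r]).
  intros x y Hxx Hyy Hb.
  pose proof (re_le_Cmod ((x, y) - w)%C) as R1. pose proof (im_le_Cmod ((x, y) - w)%C) as R2.
  rewrite Re_minus in R1; rewrite Im_minus in R2; simpl in R1, R2.
  destruct Hb as [E|[E|[E|E]]]; subst.
  - rewrite Rabs_left1 in R1 by lra; lra.
  - rewrite Rabs_pos_eq in R1 by lra; lra.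
  - rewrite Rabs_left1 in R2 by lra; lra.
  - rewrite Rabs_pos_eq in R2 by lra; lra.
Qed.

(** Differentiation under the integral for data that are only continuous on the boundary. This is
    where differentiability is gained from continuity. *)
Lemma kernel_cdf (f : C -> C) (x1 x2 y1 y2 : R) (w : C) :
  x1 < Re w < x2 -> y1 < Im w < y2 -> bcont f x1 x2 y1 y2 ->
  cdf (fun w => Rect (fun z => f z * / (z - w))%C x1 x2 y1 y2) w.
Proof.
  intros Hx Hy Hf.
  destruct (boundary_dist x1 x2 y1 y2 w Hx Hy) as [r [Pr Hr]].
  destruct (bcont_bounded f x1 x2 y1 y2 ltac:(lra) ltac:(lra) Hf) as [M [PM HM]].
  exists (Rect (fun z => f z * (/ (z - w) * / (z - w)))%C x1 x2 y1 y2).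
  intros e He.
  set (L := (x2 - x1) + (y2 - y1)).
  assert (PL : 0 < L) by (unfold L; lra).
  assert (Pr3 : 0 < r * r * (r / 2)) by (repeat apply Rmult_lt_0_compat; lra).
  set (K := 4 * (M * / (r * r * (r / 2))) * L).
  assert (PK : 0 < K).
  { unfold K. apply Rinv_0_lt_compat in Pr3. repeat apply Rmult_lt_0_compat; lra. }
  exists (Rmin (r / 2) (e / K)); split; [apply Rmin_pos; [lra | apply Rdiv_lt_0_compat; lra]|].
  intros w' Hw'.
  assert (D1 : Cmod (w' - w) < r / 2) by (eapply Rlt_le_trans; [exact Hw' | apply Rmin_l]).
  assert (D2 : Cmod (w' - w) < e / K) by (eapply Rlt_le_trans; [exact Hw' | apply Rmin_r]).
  assert (Hz : forall x y, x1 <= x <= x2 -> y1 <= y <= y2 ->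
    (x = x1 \/ x = x2 \/ y = y1 \/ y = y2) -> r / 2 <= Cmod ((x, y) - w')).
  { intros x y ? ? Hb. pose proof (Hr x y ltac:(assumption) ltac:(assumption) Hb).
    pose proof (Cmod_sub_triangle (x, y) w' w); lra. }
  assert (Nz : forall x y, x1 <= x <= x2 -> y1 <= y <= y2 ->
    (x = x1 \/ x = x2 \/ y = y1 \/ y = y2) -> (x, y) <> w /\ (x, y) <> w').
  { intros x y ? ? Hb. pose proof (Hr x y ltac:(assumption) ltac:(assumption) Hb).
    pose proof (Hz x y ltac:(assumption) ltac:(assumption) Hb).
    split; intros E; rewrite <- E in *;
      replace ((x, y) - (x, y))%C with (RtoC 0) in * by ring; rewrite Cmod_0 in *; lra. }
  assert (B1 : bcont (fun z => f z * / (z - w'))%C x1 x2 y1 y2).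
  { intros x y ? ? Hb; apply ccont_mult; [apply Hf; auto | apply cdf_ccont, cdf_sub_inv, Nz; auto]. }
  assert (B2 : bcont (fun z => f z * / (z - w))%C x1 x2 y1 y2).
  { intros x y ? ? Hb; apply ccont_mult; [apply Hf; auto | apply cdf_ccont, cdf_sub_inv, Nz; auto]. }
  assert (B3 : bcont (fun z => f z * (/ (z - w) * / (z - w)))%C x1 x2 y1 y2).
  { intros x y ? ? Hb; apply ccont_mult; [apply Hf; auto |].
    apply ccont_mult; apply cdf_ccont, cdf_sub_inv, Nz; auto. }
  assert (B4 : forall c : C, bcont (fun z => c * (f z * / (z - w)))%C x1 x2 y1 y2).
  { intros c x y ? ? Hb; apply ccont_mult; [apply ccont_const | apply B2; auto]. }
  assert (B5 : forall c : C, bcont (fun z => c * (f z * (/ (z - w) * / (z - w))))%C x1 x2 y1 y2).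
  { intros c x y ? ? Hb; apply ccont_mult; [apply ccont_const | apply B3; auto]. }
  (* The integrand of the first-order remainder; it equals f(z)(w' - w)²/((z - w)²(z - w')), which
     is quadratic in w' - w. *)
  set (g := fun z => (f z * / (z - w') + ((-1) * (f z * / (z - w)) + (- (w' - w)) * (f z * (/ (z - w) * / (z - w)))))%C).
  assert (B6 : bcont g x1 x2 y1 y2).
  { intros x y ? ? Hb. unfold g. apply ccont_plus; [apply B1; auto|].
    apply ccont_plus; [apply B4 | apply B5]; auto. }
  assert (E : (Rect (fun z => f z * / (z - w')) x1 x2 y1 y2 - Rect (fun z => f z * / (z - w)) x1 x2 y1 y2
     - Rect (fun z => f z * (/ (z - w) * / (z - w))) x1 x2 y1 y2 * (w' - w))%C = Rect g x1 x2 y1 y2).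
  { unfold g.
    rewrite (Rect_plus (fun z => f z * / (z - w'))%C
      (fun z => (-1) * (f z * / (z - w)) + (- (w' - w)) * (f z * (/ (z - w) * / (z - w))))%C); try lra; auto.
    2:{ intros x y ? ? Hb; apply ccont_plus; [apply B4 | apply B5]; auto. }
    rewrite (Rect_plus (fun z => (-1) * (f z * / (z - w)))%C
      (fun z => (- (w' - w)) * (f z * (/ (z - w) * / (z - w))))%C); try lra; auto.
    rewrite (Rect_scal (-1) (fun z => f z * / (z - w))%C),
      (Rect_scal (- (w' - w)) (fun z => f z * (/ (z - w) * / (z - w)))%C); try lra; auto.
    ring. }
  rewrite E.
  set (h := Cmod (w' - w)) in *.
  assert (Ph : 0 <= h) by apply Cmod_ge_0.
  eapply Rle_trans.
  - apply (Rect_bound g x1 x2 y1 y2 (M * / (r * r * (r / 2)) * (h * h))); try lra; auto.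
    intros x y Hxx Hyy Hb. destruct (Nz x y Hxx Hyy Hb) as [N1 N2].
    apply Csub_neq_0 in N1. apply Csub_neq_0 in N2.
    assert (Eg : g (x, y) = (f (x, y) * / (((x, y) - w) * ((x, y) - w) * ((x, y) - w')) * ((w' - w) * (w' - w)))%C).
    { unfold g. field. split; assumption. }
    rewrite Eg, !Cmod_mult, Cmod_inv, !Cmod_mult by (repeat apply Cmult_neq_0; assumption).
    fold h. apply Rmult_le_compat_r; [nra|].
    apply Rmult_le_compat; [apply Cmod_ge_0 | | apply HM; auto |].
    + apply Rlt_le, Rinv_0_lt_compat. apply Cmod_gt_0 in N1. apply Cmod_gt_0 in N2. 
      repeat apply Rmult_lt_0_compat; assumption.
    + apply Rinv_le_contravar; [exact Pr3|].
      pose proof (Hr x y Hxx Hyy Hb). pose proof (Hz x y Hxx Hyy Hb).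
      apply Rmult_le_compat; try nra.
  - fold L. replace (4 * (M * / (r * r * (r / 2)) * (h * h)) * L) with (K * h * h) by (unfold K; ring).
    apply Rmult_le_compat_r; [exact Ph|].
    apply Rle_trans with (K * (e / K)); [apply Rmult_le_compat_l; lra | right; field; lra].
Qed.

(** Difference quotient at a, completed by l at a itself; with l the derivative and f(a) = 0 it
    divides a zero out of f. *)
Definition dq (f : C -> C) (a l z : C) : C :=
  if excluded_middle_informative (z = a) then l else ((f z - f a) * / (z - a))%C.

Lemma dq_neq (f : C -> C) (a l z : C) : z <> a -> dq f a l z = ((f z - f a) * / (z - a))%C.
Proof. intros H; unfold dq; destruct (excluded_middle_informative (z = a)); tauto. Qed.

Lemma dq_eq (f : C -> C) (a l : C) : dq f a l a = l.
Proof. unfold dq; destruct (excluded_middle_informative (a = a)); tauto. Qed.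

Lemma dq_ccont_at (f : C -> C) (a l : C) : cder f a l -> ccont (dq f a l) a.
Proof.
  intros H e He. destruct (H (e / 2) ltac:(lra)) as [d [Hd H']].
  exists d; split; [exact Hd|]; intros w Hw. rewrite dq_eq.
  destruct (classic (w = a)) as [->|N].
  - rewrite dq_eq. replace (l - l)%C with (RtoC 0) by ring. rewrite Cmod_0; lra.
  - rewrite dq_neq by exact N. specialize (H' w Hw).
    pose proof (Csub_neq_0 w a N) as N'. pose proof (Cmod_sub_pos w a N) as Pw.
    replace ((f w - f a) * / (w - a) - l)%C with ((f w - f a - l * (w - a)) / (w - a))%C by (field; exact N').
    rewrite Cmod_div by exact N'.
    apply Rle_lt_trans with (e / 2); [|lra].
    apply (Rmult_le_reg_r (Cmod (w - a))); [exact Pw|].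
    unfold Rdiv at 1. rewrite Rmult_assoc, Rinv_l by lra. lra.
Qed.

Lemma dq_near (f : C -> C) (a l z : C) : z <> a ->
  exists r, 0 < r /\ forall w, Cmod (w - z) < r -> ((f w - f a) * / (w - a))%C = dq f a l w.
Proof.
  intros N. exists (Cmod (z - a)); split; [apply Cmod_sub_pos, N|].
  intros w Hw. rewrite dq_neq; [reflexivity|]. intros E; subst w.
  rewrite Cmod_sub_sym in Hw; lra.
Qed.

Lemma dq_ccont (f : C -> C) (a l z : C) : z <> a -> ccont f z -> ccont (dq f a l) z.
Proof.
  intros N H. destruct (dq_near f a l z N) as [r [Pr E]].
  apply (ccont_ext_loc _ _ z r Pr E).
  apply (ccont_mult (fun w => f w - f a)%C); [|apply cdf_ccont, cdf_sub_inv, N].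
  apply (ccont_plus f (fun _ => - f a)%C); [exact H | apply ccont_const].
Qed.

Lemma dq_cdf_off (f : C -> C) (a l z : C) : z <> a -> cdf f z -> cdf (dq f a l) z.
Proof.
  intros N H. destruct (dq_near f a l z N) as [r [Pr E]].
  apply (cdf_ext_loc _ _ z r Pr E).
  apply cdf_mult; [apply cdf_minus; auto with cd | apply cdf_sub_inv, N].
Qed.

(** Goursat for the difference quotient at w, whose differentiability is in doubt only on the
    heights p and [Im w]. *)
Lemma cauchy_off_line (f : C -> C) (x1 x2 y1 y2 p : R) (w : C) :
  x1 < Re w < x2 -> y1 < Im w < y2 -> Im w <> p -> rcont f x1 x2 y1 y2 ->
  (forall x y, x1 <= x <= x2 -> y1 <= y <= y2 -> y <> p -> cdf f (x, y)) ->
  (f w * wind x1 x2 y1 y2 w)%C = Rect (fun z => f z * / (z - w))%C x1 x2 y1 y2.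
Proof.
  intros Hx Hy Hp Hf Hd.
  assert (Dw : cdf f w).
  { destruct w as [a b]; simpl in *; apply Hd; lra. }
  destruct Dw as [l Hl].
  assert (Z : Rect (dq f w l) x1 x2 y1 y2 = 0).
  { apply (Goursat_two_lines _ _ _ _ _ p (Im w)); try lra.
    - intros x y ? ?. destruct (classic ((x, y) = w)) as [->|N].
      + apply dq_ccont_at, Hl.
      + apply dq_ccont; [exact N | apply Hf; assumption].
    - intros x y ? ? N1 N2. apply dq_cdf_off; [|apply Hd; try lra; exact N1].
      intros E; apply N2; rewrite <- E; reflexivity. }
  assert (Bn : forall x y, x1 <= x <= x2 -> y1 <= y <= y2 ->
    (x = x1 \/ x = x2 \/ y = y1 \/ y = y2) -> (x, y) <> w).
  { intros x y _ _ Hb; apply (boundary_neq x1 x2 y1 y2); assumption. }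
  assert (B1 : bcont (fun z => f z * / (z - w))%C x1 x2 y1 y2).
  { intros x y ? ? Hb; apply ccont_mult; [apply Hf; auto | apply cdf_ccont, cdf_sub_inv, Bn; auto]. }
  assert (B2 : bcont (fun z => / (z - w))%C x1 x2 y1 y2).
  { intros x y ? ? Hb; apply cdf_ccont, cdf_sub_inv, Bn; auto. }
  rewrite (Rect_ext _ (fun z => f z * / (z - w) + (- f w) * / (z - w))%C) in Z; try lra.
  - rewrite (Rect_plus (fun z => f z * / (z - w))%C (fun z => (- f w) * / (z - w))%C) in Z; try lra; auto.
    + rewrite (Rect_scal (- f w) (fun z => / (z - w))%C) in Z; try lra; auto.
      fold (wind x1 x2 y1 y2 w) in Z.
      transitivity (f w * wind x1 x2 y1 y2 w + 0)%C; [ring|]. rewrite <- Z; ring.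
    + intros x y ? ? Hb; apply ccont_mult; [apply ccont_const | apply B2; auto].
  - intros x y ? ? Hb. rewrite dq_neq by (apply Bn; auto). ring.
Qed.

Lemma wind_cdf (x1 x2 y1 y2 : R) (w : C) : x1 < Re w < x2 -> y1 < Im w < y2 ->
  cdf (wind x1 x2 y1 y2) w.
Proof.
  intros Hx Hy.
  pose proof (kernel_cdf (fun _ => RtoC 1) x1 x2 y1 y2 w Hx Hy) as H.
  apply (cdf_ext_loc (fun w => Rect (fun z => 1 * / (z - w)) x1 x2 y1 y2)%C _ w 1 Rlt_0_1).
  - intros w' _. unfold wind. f_equal. apply functional_extensionality; intros z; ring.
  - apply H. intros x y _ _ _; apply ccont_const.
Qed.

Lemma interior_ball (x1 x2 y1 y2 : R) (w : C) : x1 < Re w < x2 -> y1 < Im w < y2 ->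
  exists r, 0 < r /\ forall z, Cmod (z - w) < r -> x1 < Re z < x2 /\ y1 < Im z < y2.
Proof.
  intros Hx Hy.
  exists (Rmin (Rmin (Re w - x1) (x2 - Re w)) (Rmin (Im w - y1) (y2 - Im w))); split.
  { repeat apply Rmin_pos; lra. }
  set (r := Rmin _ _).
  assert (r <= Re w - x1) by (eapply Rle_trans; [apply Rmin_l | apply Rmin_l]).
  assert (r <= x2 - Re w) by (eapply Rle_trans; [apply Rmin_l | apply Rmin_r]).
  assert (r <= Im w - y1) by (eapply Rle_trans; [apply Rmin_r | apply Rmin_l]).
  assert (r <= y2 - Im w) by (eapply Rle_trans; [apply Rmin_r | apply Rmin_r]).
  intros z Hz.
  pose proof (re_le_Cmod (z - w)%C) as R1. pose proof (im_le_Cmod (z - w)%C) as R2.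
  rewrite Re_minus in R1; rewrite Im_minus in R2.
  apply Rabs_le_between in R1. apply Rabs_le_between in R2. lra.
Qed.

Lemma ccont_eq_limit (f g : C -> C) (w : C) : ccont f w -> ccont g w ->
  (forall r, 0 < r -> exists z, Cmod (z - w) < r /\ f z = g z) -> f w = g w.
Proof.
  intros Hf Hg H. apply Cmod_small_eq; intros e He.
  destruct (Hf (e / 2) ltac:(lra)) as [d1 [P1 H1]].
  destruct (Hg (e / 2) ltac:(lra)) as [d2 [P2 H2]].
  destruct (H (Rmin d1 d2)) as [z [Hz E]]; [apply Rmin_pos; lra|].
  pose proof (Rmin_l d1 d2); pose proof (Rmin_r d1 d2).
  specialize (H1 z ltac:(lra)). specialize (H2 z ltac:(lra)).
  replace (f w - g w)%C with ((g z - g w) - (f z - f w))%C by (rewrite E; ring).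
  eapply Rle_trans; [apply Cmod_minus_le|]; lra.
Qed.

(** Off the line, f times [wind] equals the kernel integral [K]. Both sides are continuous, so the
    identity extends to the line, and there f = K/[wind] is a quotient of differentiable
    functions. *)
Theorem line_removable_rect (f : C -> C) (x1 x2 y1 y2 p : R) (w : C) :
  x1 < Re w < x2 -> y1 < Im w < y2 -> rcont f x1 x2 y1 y2 ->
  (forall x y, x1 <= x <= x2 -> y1 <= y <= y2 -> y <> p -> cdf f (x, y)) ->
  cdf f w /\ (f w * wind x1 x2 y1 y2 w)%C = Rect (fun z => f z * / (z - w))%C x1 x2 y1 y2.
Proof.
  intros Hx Hy Hf Hd.
  set (K := fun w => Rect (fun z => f z * / (z - w))%C x1 x2 y1 y2).
  assert (HK : forall z, x1 < Re z < x2 -> y1 < Im z < y2 -> cdf K z).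
  { intros z Hzx Hzy; exact (kernel_cdf f x1 x2 y1 y2 z Hzx Hzy (rcont_bcont _ _ _ _ _ Hf)). }
  assert (Q : forall z, x1 < Re z < x2 -> y1 < Im z < y2 -> (f z * wind x1 x2 y1 y2 z)%C = K z).
  { intros z Hzx Hzy. destruct (Req_dec (Im z) p) as [Hp|Hp].
    - apply (ccont_eq_limit (fun z => f z * wind x1 x2 y1 y2 z)%C K z).
      + apply ccont_mult; [|apply cdf_ccont, wind_cdf; assumption].
        destruct z as [a b]; apply Hf; simpl in *; lra.
      + apply cdf_ccont, HK; assumption.
      + intros r Pr. destruct (interior_ball x1 x2 y1 y2 z Hzx Hzy) as [r' [Pr' Hr']].
        set (h := Rmin r r' / 2).
        assert (Ph : 0 < h) by (unfold h; pose proof (Rmin_pos r r' Pr Pr'); lra).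
        assert (Hh1 : h < r) by (unfold h in *; pose proof (Rmin_l r r'); lra).
        assert (Hh2 : h < r') by (unfold h in *; pose proof (Rmin_r r r'); lra).
        assert (Em : Cmod (z + h * Ci - z) = h).
        { replace (z + h * Ci - z)%C with (h * Ci)%C by ring.
          rewrite Cmod_mult, Cmod_R, Cmod_Ci, Rabs_pos_eq; lra. }
        (* A vertical displacement leaves the exceptional line. *)
        exists (z + h * Ci)%C. split; [lra|].
        destruct (Hr' (z + h * Ci)%C) as [I1 I2]; [lra|].
        apply (cauchy_off_line f x1 x2 y1 y2 p); auto.
        unfold Im, Re in *. simpl. lra.
    - apply (cauchy_off_line f x1 x2 y1 y2 p); auto. }
  split; [|apply Q; assumption].
  destruct (interior_ball x1 x2 y1 y2 w Hx Hy) as [r [Pr Hr]].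
  apply (cdf_ext_loc (fun z => K z * / wind x1 x2 y1 y2 z)%C f w r Pr).
  - intros z Hz. destruct (Hr z Hz) as [I1 I2]. rewrite <- Q by assumption.
    field. apply wind_neq_0; assumption.
  - apply cdf_mult; [apply HK; assumption|].
    apply cdf_inv; [apply wind_cdf | apply wind_neq_0]; assumption.
Qed.

Theorem line_removable (f : C -> C) (p : R) (a : C) (r : R) :
  (forall w, Cmod (w - a) < r -> ccont f w) ->
  (forall w, Cmod (w - a) < r -> Im w <> p -> cdf f w) ->
  forall w, Cmod (w - a) < r -> cdf f w.
Proof.
  intros Hc Hd w Hw.
  set (h := (r - Cmod (w - a)) / 4).
  assert (Ph : 0 < h) by (unfold h; lra).
  assert (Hin : forall x y, Re w - h <= x <= Re w + h -> Im w - h <= y <= Im w + h ->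
    Cmod ((x, y) - a) < r).
  { intros x y ? ?. eapply Rle_lt_trans; [apply (Cmod_sub_triangle _ w)|].
    assert (Cmod ((x, y) - w) <= 2 * h).
    { eapply Rle_trans; [apply Cmod_le_abs|]. rewrite Re_minus, Im_minus. simpl.
      assert (Rabs (x - Re w) <= h) by (apply Rabs_le; lra).
      assert (Rabs (y - Im w) <= h) by (apply Rabs_le; lra). lra. }
    unfold h in *; lra. }
  apply (line_removable_rect f (Re w - h) (Re w + h) (Im w - h) (Im w + h) p); try lra.
  - intros x y ? ?; apply Hc, Hin; assumption.
  - intros x y ? ? ?; apply Hd; [apply Hin; assumption | assumption].
Qed.

(** The quotient is continuous at a and differentiable elsewhere, so the horizontal line through a
    is removable. *)
Lemma dq_cdf (f : C -> C) (a l : C) (r : R) : cder f a l ->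
  (forall w, Cmod (w - a) < r -> cdf f w) ->
  forall w, Cmod (w - a) < r -> cdf (dq f a l) w.
Proof.
  intros Hl Hf. apply (line_removable _ (Im a)).
  - intros w Hw. destruct (classic (w = a)) as [->|N]; [apply dq_ccont_at, Hl|].
    apply dq_ccont; [exact N | apply cdf_ccont, Hf, Hw].
  - intros w Hw N. apply dq_cdf_off; [|apply Hf, Hw]. intros ->; apply N; reflexivity.
Qed.

Theorem Riemann_removable (f : C -> C) (a : C) (r K : R) : 0 < r ->
  (forall w, 0 < Cmod (w - a) < r -> cdf f w) ->
  (forall w, 0 < Cmod (w - a) < r -> Cmod (f w) <= K) ->
  exists g, (forall w, Cmod (w - a) < r -> cdf g w) /\
    forall w, 0 < Cmod (w - a) < r -> f w = g w.
Proof.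
  intros Pr Hd HK.
  (* The factor erases the arbitrary value f(a), and boundedness makes h continuous at a. The
     extension of f is then the difference quotient of h. *)
  set (h := fun z => ((z - a) * f z)%C).
  assert (Ha : h a = 0) by (unfold h; ring).
  assert (Hh : forall w, Cmod (w - a) < r -> cdf h w).
  { apply (line_removable _ (Im a)).
    - intros w Hw. destruct (classic (w = a)) as [->|N].
      + intros e He. pose proof (Rabs_pos K) as PK.
        exists (Rmin r (e / (Rabs K + 1))); split; [apply Rmin_pos; [lra|apply Rdiv_lt_0_compat; lra]|].
        intros w Hw'. rewrite Ha. replace (h w - 0)%C with (h w) by ring.
        assert (D1 : Cmod (w - a) < r) by (eapply Rlt_le_trans; [exact Hw' | apply Rmin_l]).
        assert (D2 : Cmod (w - a) < e / (Rabs K + 1)) by (eapply Rlt_le_trans; [exact Hw' | apply Rmin_r]).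
        destruct (classic (w = a)) as [->|N]; [rewrite Ha, Cmod_0; exact He|].
        pose proof (Cmod_sub_pos w a N) as Pw.
        unfold h. rewrite Cmod_mult. specialize (HK w ltac:(lra)).
        apply (Rmult_lt_compat_r (Rabs K + 1)) in D2; [|lra].
        replace (e / (Rabs K + 1) * (Rabs K + 1)) with e in D2 by (field; lra).
        pose proof (Rle_abs K). nra.
      + pose proof (Cmod_sub_pos w a N).
        apply cdf_ccont. unfold h. apply cdf_mult; [auto with cd | apply Hd; lra].
    - intros w Hw N. assert (N' : w <> a) by (intros ->; apply N; reflexivity).
      pose proof (Cmod_sub_pos w a N').
      unfold h. apply cdf_mult; [auto with cd | apply Hd; lra]. }
  destruct (Hh a) as [l Hl].
  { replace (a - a)%C with (RtoC 0) by ring. rewrite Cmod_0; exact Pr. }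
  exists (dq h a l); split; [apply (dq_cdf h a l r Hl Hh)|].
  intros w Hw. assert (N : w <> a).
  { intros ->. replace (a - a)%C with (RtoC 0) in Hw by ring. rewrite Cmod_0 in Hw; lra. }
  rewrite dq_neq by exact N. rewrite Ha. unfold h. field. apply Csub_neq_0, N.
Qed.

Theorem Liouville (f : C -> C) (M : R) : (forall z, cdf f z) -> (forall z, Cmod (f z) <= M) ->
  forall w, f w = f 0.
Proof.
  intros Hd HM w.
  set (g := fun z => (f z - f 0)%C).
  assert (Hg : forall z, cdf g z) by (intros z; unfold g; auto with cd).
  assert (PM : 0 <= M) by (eapply Rle_trans; [apply Cmod_ge_0 | apply (HM 0)]).
  assert (Bg : forall z, Cmod (g z) <= 2 * M).
  { intros z; unfold g. eapply Rle_trans; [apply Cmod_minus_le|].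
    pose proof (HM z); pose proof (HM 0); lra. }
  apply Cmod_small_eq; intros e He. fold (g w).
  pose proof (Cmod_ge_0 w) as Pw.
  (* Half-side of the contour: it keeps w within R0/2 of the origin and makes the final bound
     64M|w|/R0 at most e. *)
  set (R0 := 2 * Cmod w + 1 + 64 * M * Cmod w / e).
  assert (HQ : 0 <= 64 * M * Cmod w / e) by (apply Rdiv_le_0_compat; nra).
  assert (PR : 0 < R0) by (unfold R0; lra).
  assert (Rw : Cmod w <= R0 / 2) by (unfold R0; lra).
  assert (Iw : - R0 < Re w < R0 /\ - R0 < Im w < R0).
  { pose proof (re_le_Cmod w) as A; pose proof (im_le_Cmod w) as B.
    apply Rabs_le_between in A. apply Rabs_le_between in B. lra. }
  assert (I0 : - R0 < Re 0 < R0 /\ - R0 < Im 0 < R0) by (simpl; lra).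
  assert (Rc : rcont g (- R0) R0 (- R0) R0) by (intros x y _ _; apply cdf_ccont, Hg).
  destruct (line_removable_rect g (- R0) R0 (- R0) R0 0 w) as [_ Ew]; try tauto;
    [intros; apply Hg|].
  destruct (line_removable_rect g (- R0) R0 (- R0) R0 0 0) as [_ E0]; try tauto;
    [intros; apply Hg|].
  replace (g 0) with (RtoC 0) in E0 by (unfold g; ring).
  rewrite Cmult_0_l in E0.
  assert (Dz : forall x y, - R0 <= x <= R0 -> - R0 <= y <= R0 ->
    (x = - R0 \/ x = R0 \/ y = - R0 \/ y = R0) -> R0 <= Cmod (x, y) /\ R0 / 2 <= Cmod ((x, y) - w)).
  { intros x y ? ? Hb.
    assert (R0 <= Cmod (x, y)).
    { pose proof (re_le_Cmod (x, y)) as A; pose proof (im_le_Cmod (x, y)) as B; simpl in A, B.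
      pose proof (Rle_abs x); pose proof (Rle_abs y). pose proof (Rle_abs (- x)); pose proof (Rle_abs (- y)).
      rewrite Rabs_Ropp in *. destruct Hb as [E|[E|[E|E]]]; lra. }
    pose proof (Cmod_triangle_inv (x, y) w). lra. }
  assert (Nz : forall x y, - R0 <= x <= R0 -> - R0 <= y <= R0 ->
    (x = - R0 \/ x = R0 \/ y = - R0 \/ y = R0) -> (x, y) <> RtoC 0 /\ (x, y) <> w).
  { intros x y ? ? Hb. destruct (Dz x y) as [D1 D2]; auto. split; intros E.
    - rewrite E, Cmod_0 in D1; lra.
    - rewrite E in D2. replace (w - w)%C with (RtoC 0) in D2 by ring. rewrite Cmod_0 in D2; lra. }
  assert (B1 : bcont (fun z => g z * / (z - w))%C (- R0) R0 (- R0) R0).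
  { intros x y ? ? Hb; apply cdf_ccont, cdf_mult; [apply Hg | apply cdf_sub_inv, Nz; auto]. }
  assert (B2 : bcont (fun z => g z * / (z - 0))%C (- R0) R0 (- R0) R0).
  { intros x y ? ? Hb; apply cdf_ccont, cdf_mult; [apply Hg | apply cdf_sub_inv, Nz; auto]. }
  assert (B3 : bcont (fun z => (-1) * (g z * / (z - 0)))%C (- R0) R0 (- R0) R0).
  { intros x y ? ? Hb; apply ccont_mult; [apply ccont_const | apply B2; auto]. }
  (* Since g(0) = 0, the Cauchy integral at 0 vanishes and may be subtracted; the difference of
     kernels w/(z(z - w)) decays like 1/R0². *)
  set (k := fun z => (g z * / (z - w) + (-1) * (g z * / (z - 0)))%C).
  assert (E : (g w * wind (- R0) R0 (- R0) R0 w)%C = Rect k (- R0) R0 (- R0) R0).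
  { unfold k. rewrite (Rect_plus (fun z => g z * / (z - w))%C (fun z => (-1) * (g z * / (z - 0)))%C); try lra; auto.
    rewrite (Rect_scal (-1) (fun z => g z * / (z - 0))%C); try lra; auto.
    rewrite <- E0, <- Ew. ring. }
  (* For a square the lower bound of [wind_lower] is exactly 1, whatever its size. *)
  assert (Lw : 1 <= Cmod (wind (- R0) R0 (- R0) R0 w)).
  { eapply Rle_trans; [|apply im_le_Cmod]. eapply Rle_trans; [|apply Rle_abs].
    eapply Rle_trans; [|apply wind_lower; tauto].
    replace (R0 - - R0) with (2 * R0) by ring. right. field. pose proof (pow2_gt_0 (2 * R0) ltac:(lra)); lra. }
  assert (Bk : Cmod (Rect k (- R0) R0 (- R0) R0) <=
     4 * (2 * M * Cmod w * / (R0 * (R0 / 2))) * ((R0 - - R0) + (R0 - - R0))).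
  { apply Rect_bound; try lra.
    - intros x y ? ? Hb; apply ccont_plus; [apply B1 | apply B3]; auto.
    - intros x y ? ? Hb. destruct (Nz x y) as [N1 N2]; auto. destruct (Dz x y) as [D1 D2]; auto.
      assert (N2' := Csub_neq_0 _ _ N2).
      assert (Ek : k (x, y) = (g (x, y) * w * / ((x, y) * ((x, y) - w)))%C).
      { unfold k. field. split; assumption. }
      rewrite Ek, !Cmod_mult, Cmod_inv, Cmod_mult by (apply Cmult_neq_0; assumption).
      apply Rmult_le_compat.
      + apply Rmult_le_pos; apply Cmod_ge_0.
      + apply Rlt_le, Rinv_0_lt_compat. nra.
      + apply Rmult_le_compat_r; [exact Pw | apply Bg].
      + apply Rinv_le_contravar; [nra|]. apply Rmult_le_compat; lra. }
  rewrite <- E, Cmod_mult in Bk.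
  assert (Bw : Cmod (g w) <= 64 * M * Cmod w / R0).
  { apply Rle_trans with (Cmod (g w) * Cmod (wind (- R0) R0 (- R0) R0 w)).
    - pose proof (Cmod_ge_0 (g w)); nra.
    - eapply Rle_trans; [exact Bk|]. right. field. lra. }
  eapply Rle_trans; [exact Bw|].
  apply (Rmult_le_reg_r R0); [exact PR|].
  unfold Rdiv at 1. rewrite Rmult_assoc, Rinv_l, Rmult_1_r by lra.
  apply Rle_trans with (e * (64 * M * Cmod w / e)); [right; field; lra|].
  apply Rmult_le_compat_l; [lra|]. unfold R0. lra.
Qed.

Ltac Ceq := apply injective_projections; unfold RtoC, Ci, Cmult, Cplus, Copp, Cminus; simpl.

(** * Theta series *)

(** Gaussian decay beats every geometric rate, so the fixed ratio 1/e serves all arguments and only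
    K varies. *)
Definition gdom (u : nat -> C) (K : R) : Prop := forall k, Cmod (u k) <= K * exp (-1) ^ k.

Lemma exp_m1_bounds : 0 < exp (-1) < 1.
Proof. split; [apply exp_pos|]. rewrite <- exp_0. apply exp_increasing; lra. Qed.

Lemma gdom_ex (u : nat -> C) (K : R) : gdom u K ->
  ex_series (fun k => Re (u k)) /\ ex_series (fun k => Im (u k)).
Proof.
  intros H. pose proof exp_m1_bounds as B.
  assert (G : ex_series (fun k => K * exp (-1) ^ k)).
  { apply (ex_series_scal_l K (fun k => exp (-1) ^ k)). apply ex_series_geom.
    rewrite Rabs_pos_eq; lra. }
  split; apply (ex_series_le (V := R_CompleteNormedModule)) with (2 := G); intros k;
    (eapply Rle_trans; [|apply H]); [apply re_le_Cmod | apply im_le_Cmod].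
Qed.

Lemma CSeries_ext (u v : nat -> C) : (forall k, u k = v k) -> CSeries u = CSeries v.
Proof. intros H; unfold CSeries; f_equal; apply Series_ext; intros k; rewrite H; reflexivity. Qed.

Lemma CSeries_plus (u v : nat -> C) (K L : R) : gdom u K -> gdom v L ->
  CSeries (fun k => u k + v k)%C = (CSeries u + CSeries v)%C.
Proof.
  intros Hu Hv. destruct (gdom_ex u K Hu), (gdom_ex v L Hv).
  unfold CSeries, Cplus; simpl; f_equal; apply Series_plus; assumption.
Qed.

Lemma CSeries_scal (c : C) (u : nat -> C) (K : R) : gdom u K ->
  CSeries (fun k => c * u k)%C = (c * CSeries u)%C.
Proof.
  intros Hu. destruct (gdom_ex u K Hu) as [U1 U2], c as [a b].
  pose proof (ex_series_scal_l a _ U1); pose proof (ex_series_scal_l b _ U1).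
  pose proof (ex_series_scal_l a _ U2); pose proof (ex_series_scal_l b _ U2).
  unfold CSeries, Cmult; simpl; rewrite <- !Series_scal_l; f_equal.
  - apply Series_minus; assumption.
  - apply Series_plus; assumption.
Qed.

Lemma CSeries_scal_R (c : R) (u : nat -> C) :
  CSeries (fun k => RtoC c * u k)%C = (RtoC c * CSeries u)%C.
Proof.
  unfold CSeries. rewrite (Series_ext _ (fun k => c * Re (u k))) by (intros; apply re_scal_l).
  rewrite (Series_ext (fun k => Im (c * u k)) (fun k => c * Im (u k))) by (intros; apply im_scal_l).
  rewrite !Series_scal_l. Ceq; ring.
Qed.

Lemma CSeries_incr_1 (u : nat -> C) (K : R) : gdom u K ->
  CSeries u = (u 0%nat + CSeries (fun k => u (S k)))%C.
Proof.
  intros Hu. destruct (gdom_ex u K Hu) as [U1 U2].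
  unfold CSeries, Cplus; simpl; f_equal; apply (Series_incr_1 (fun k => _ (u k))); assumption.
Qed.

Lemma gdom_incr (u : nat -> C) (K : R) (n : nat) : 0 <= K -> gdom u K ->
  gdom (fun k => u (n + k)%nat) (K * exp (-1) ^ n).
Proof. intros PK H k. rewrite Rmult_assoc, <- pow_add. apply H. Qed.

Lemma CSeries_bound (u : nat -> C) (K : R) : gdom u K ->
  Cmod (CSeries u) <= 2 * K / (1 - exp (-1)).
Proof.
  intros Hu. destruct (gdom_ex u K Hu) as [U1 U2]. pose proof exp_m1_bounds as B.
  assert (G : ex_series (fun k => K * exp (-1) ^ k)).
  { apply (ex_series_scal_l K (fun k => exp (-1) ^ k)). apply ex_series_geom.
    rewrite Rabs_pos_eq; lra. }
  assert (E : Series (fun k => K * exp (-1) ^ k) = K / (1 - exp (-1))).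
  { rewrite Series_scal_l, Series_geom by (rewrite Rabs_pos_eq; lra). reflexivity. }
  assert (Q : forall v : nat -> R, (forall k, Rabs (v k) <= Cmod (u k)) -> Rabs (Series v) <= K / (1 - exp (-1))).
  { intros v Hv. rewrite <- E.
    assert (ex_series (fun k => Rabs (v k))).
    { apply (ex_series_le (V := R_CompleteNormedModule)) with (2 := G). intros k.
      change (Rabs (Rabs (v k)) <= K * exp (-1) ^ k). rewrite Rabs_Rabsolu.
      eapply Rle_trans; [apply Hv | apply Hu]. }
    eapply Rle_trans; [apply Series_Rabs; assumption|].
    apply Series_le; [|exact G]. intros k; split; [apply Rabs_pos|].
    eapply Rle_trans; [apply Hv | apply Hu]. }
  eapply Rle_trans; [apply Cmod_le_abs|].
  pose proof (Q (fun k => Re (u k)) (fun k => re_le_Cmod _)) as Q1.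
  pose proof (Q (fun k => Im (u k)) (fun k => im_le_Cmod _)) as Q2.
  simpl. unfold Rdiv in *. lra.
Qed.

(** * Partial sums and bilateral series *)

Fixpoint csum (u : nat -> C) (n : nat) : C :=
  match n with O => 0 | S n => (csum u n + u n)%C end.

Lemma CSeries_split (u : nat -> C) (K : R) (n : nat) : 0 <= K -> gdom u K ->
  CSeries u = (csum u n + CSeries (fun k => u (n + k)%nat))%C.
Proof.
  intros PK Hu. induction n as [|n IH]; simpl.
  - rewrite Cplus_0_l. reflexivity.
  - rewrite IH, (CSeries_incr_1 _ _ (gdom_incr u K n PK Hu)).
    rewrite Nat.add_0_r, Cplus_assoc. f_equal. apply CSeries_ext; intros k. f_equal; lia.
Qed.

Lemma csum_ext (u v : nat -> C) (n : nat) : (forall k, (k < n)%nat -> u k = v k) -> csum u n = csum v n.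
Proof. induction n as [|n IH]; intros H; simpl; [reflexivity|]. rewrite IH, H; auto. Qed.

Lemma csum_plus (u v : nat -> C) (n : nat) : csum (fun k => u k + v k)%C n = (csum u n + csum v n)%C.
Proof. induction n as [|n IH]; simpl; [|rewrite IH]; ring. Qed.

Lemma csum_scal (c : C) (u : nat -> C) (n : nat) : csum (fun k => c * u k)%C n = (c * csum u n)%C.
Proof. induction n as [|n IH]; simpl; [|rewrite IH]; ring. Qed.

Definition zdom (w : Z -> C) (K : R) : Prop := forall k, Cmod (w k) <= K * exp (- IZR (Z.abs k)).

(** Bilateral sum; -1 - n enumerates the negative integers and leaves 0 to the first half. *)
Definition BS (w : Z -> C) : C :=
  (CSeries (fun n => w (Z.of_nat n)) + CSeries (fun n => w (-1 - Z.of_nat n)%Z))%C.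

Lemma exp_nat_pow (x : R) (n : nat) : exp (INR n * x) = exp x ^ n.
Proof.
  induction n as [|n IH]; [simpl; rewrite Rmult_0_l; apply exp_0|].
  rewrite S_INR, Rmult_plus_distr_r, Rmult_1_l, exp_plus, IH. simpl; ring.
Qed.

Lemma zdom_gdom (w : Z -> C) (K : R) : 0 <= K -> zdom w K ->
  gdom (fun n => w (Z.of_nat n)) K /\ gdom (fun n => w (-1 - Z.of_nat n)%Z) K.
Proof.
  intros PK H; split; intros n; (eapply Rle_trans; [apply H|]); apply Rmult_le_compat_l; try exact PK;
    rewrite <- exp_nat_pow, INR_IZR_INZ.
  - right; f_equal. rewrite Z.abs_eq by lia. ring.
  - left; apply exp_increasing. rewrite Z.abs_neq by lia.
    rewrite opp_IZR, minus_IZR. lra.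
Qed.

Lemma BS_ext (u v : Z -> C) : (forall k, u k = v k) -> BS u = BS v.
Proof. intros H; unfold BS; f_equal; apply CSeries_ext; intros; apply H. Qed.

Lemma BS_plus (u v : Z -> C) (K L : R) : 0 <= K -> 0 <= L -> zdom u K -> zdom v L ->
  BS (fun k => u k + v k)%C = (BS u + BS v)%C.
Proof.
  intros PK PL Hu Hv. destruct (zdom_gdom u K PK Hu), (zdom_gdom v L PL Hv).
  unfold BS. rewrite (CSeries_plus (fun n => u (Z.of_nat n)) (fun n => v (Z.of_nat n)) K L) by assumption.
  rewrite (CSeries_plus (fun n => u (-1 - Z.of_nat n)%Z) (fun n => v (-1 - Z.of_nat n)%Z) K L) by assumption.
  ring.
Qed.

Lemma BS_scal (c : C) (u : Z -> C) (K : R) : 0 <= K -> zdom u K ->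
  BS (fun k => c * u k)%C = (c * BS u)%C.
Proof.
  intros PK Hu. destruct (zdom_gdom u K PK Hu).
  unfold BS. rewrite (CSeries_scal c (fun n => u (Z.of_nat n)) K) by assumption.
  rewrite (CSeries_scal c (fun n => u (-1 - Z.of_nat n)%Z) K) by assumption. ring.
Qed.

Lemma BS_bound (u : Z -> C) (K : R) : 0 <= K -> zdom u K ->
  Cmod (BS u) <= 4 * K / (1 - exp (-1)).
Proof.
  intros PK Hu. destruct (zdom_gdom u K PK Hu) as [H1 H2].
  unfold BS. eapply Rle_trans; [apply Cmod_triangle|].
  apply CSeries_bound in H1. apply CSeries_bound in H2. unfold Rdiv in *. lra.
Qed.

Lemma BS_shift (u : Z -> C) (K : R) : 0 <= K -> zdom u K -> BS (fun k => u (k + 1)%Z) = BS u.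
Proof.
  intros PK Hu. destruct (zdom_gdom u K PK Hu) as [H1 H2]. unfold BS.
  rewrite (CSeries_incr_1 (fun n => u (Z.of_nat n)) K H1).
  (* The shift passes the single term u(0) from one half to the other. The shifted negative half
     starts at index 0 and decays one step late, hence the factor e in the dominating constant. *)
  rewrite (CSeries_incr_1 (fun n => u (-1 - Z.of_nat n + 1)%Z) (K * exp 1)).
  - rewrite (CSeries_ext (fun k => u (Z.of_nat (S k))) (fun k => u (Z.of_nat k + 1)%Z))
      by (intros k; f_equal; lia).
    rewrite (CSeries_ext (fun k => u (-1 - Z.of_nat (S k) + 1)%Z) (fun k => u (-1 - Z.of_nat k)%Z))
      by (intros k; f_equal; lia).
    simpl. ring.
  - intros n. eapply Rle_trans; [apply Hu|]. rewrite Rmult_assoc. apply Rmult_le_compat_l; [exact PK|].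
    rewrite <- exp_nat_pow, INR_IZR_INZ, <- exp_plus.
    destruct n as [|n].
    + simpl. rewrite Rmult_0_l. rewrite Ropp_0. left; apply exp_increasing; lra.
    + rewrite Z.abs_neq by lia.
      replace (-1 - Z.of_nat (S n) + 1)%Z with (- Z.of_nat (S n))%Z by lia.
      rewrite Z.opp_involutive. left; apply exp_increasing. lra.
Qed.

(** * Periods of the exponential *)

Lemma Cexp_opp_mult (z : C) : (Cexp z * Cexp (- z) = 1)%C.
Proof. rewrite Cexp_opp. apply Cinv_r, Cexp_neq_0. Qed.

Lemma Cexp_PI_n (n : nat) : Cexp (Ci * RtoC (PI * INR n)) = RtoC ((-1) ^ n).
Proof.
  induction n as [|n IH].
  - replace (Ci * RtoC (PI * INR 0))%C with (RtoC 0) by (simpl INR; rewrite Rmult_0_r; ring).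
    apply Cexp_0.
  - replace (Ci * RtoC (PI * INR (S n)))%C with (Ci * RtoC (PI * INR n) + Ci * RtoC PI)%C
      by (rewrite S_INR, Rmult_plus_distr_l, RtoC_plus, Rmult_1_r; ring).
    rewrite Cexp_plus, IH.
    replace (Cexp (Ci * RtoC PI)) with (RtoC (-1)).
    + rewrite <- RtoC_mult. f_equal. simpl; ring.
    + unfold Cexp; simpl.
      replace (0 * PI - 1 * 0) with 0 by ring. replace (0 * 0 + 1 * PI) with PI by ring.
      rewrite exp_0, cos_PI, sin_PI. unfold RtoC; f_equal; ring.
Qed.

Lemma Cexp_2PI_nat (n : nat) : Cexp (Ci * RtoC (2 * PI * INR n)) = 1.
Proof.
  replace (2 * PI * INR n) with (PI * INR (2 * n)) by (rewrite mult_INR; simpl; ring).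
  rewrite Cexp_PI_n. rewrite pow_1_even. reflexivity.
Qed.

Lemma Cexp_2PI_Z (k : Z) : Cexp (Ci * RtoC (2 * PI * IZR k)) = 1.
Proof.
  destruct (Z_le_gt_dec 0 k) as [H|H].
  - rewrite <- (Z2Nat.id k H), <- INR_IZR_INZ. apply Cexp_2PI_nat.
  - replace (Ci * RtoC (2 * PI * IZR k))%C with (- (Ci * RtoC (2 * PI * INR (Z.to_nat (- k)))))%C.
    + rewrite Cexp_opp, Cexp_2PI_nat, <- RtoC_inv by lra. f_equal; field.
    + rewrite INR_IZR_INZ, Z2Nat.id by lia. rewrite opp_IZR. Ceq; ring.
Qed.

Lemma Cexp_eq_1 (w : C) : Cexp w = 1 -> exists k : Z, w = (Ci * RtoC (2 * PI * IZR k))%C.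
Proof.
  intros H.
  assert (HR : Re w = 0).
  { apply exp_inv. rewrite exp_0, <- Cmod_Cexp, H. apply Cmod_1. }
  assert (HS : sin (Im w) = 0).
  { apply (f_equal snd) in H. unfold Cexp in H; simpl in H. rewrite HR, exp_0 in H. lra. }
  assert (HC : cos (Im w) = 1).
  { apply (f_equal fst) in H. unfold Cexp in H; simpl in H. rewrite HR, exp_0 in H. lra. }
  apply sin_eq_0_0 in HS. destruct HS as [k Hk].
  assert (W : w = (Ci * RtoC (IZR k * PI))%C).
  { destruct w as [a b]; simpl in *; subst. Ceq; ring. }
  destruct (Zeven_odd_dec k) as [E|O].
  - apply Zeven_ex in E. destruct E as [j Hj]. exists j. rewrite W, Hj, mult_IZR. Ceq; ring.
  (* The vanishing sine only gives multiples of π; an odd multiple would make the exponential equal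
     to -1. *)
  - exfalso. apply Zodd_ex in O. destruct O as [j Hj].
    assert (X : Cexp w = RtoC (-1)).
    { rewrite W, Hj, plus_IZR, mult_IZR.
      replace (Ci * RtoC ((2 * IZR j + 1) * PI))%C with (Ci * RtoC (2 * PI * IZR j) + Ci * RtoC (PI * INR 1))%C
        by (simpl INR; Ceq; ring).
      rewrite Cexp_plus, Cexp_2PI_Z, Cexp_PI_n. Ceq; ring. }
    rewrite H in X. apply RtoC_inj in X. lra.
Qed.

(** * The bilateral theta series *)

Section Theta.
Variable t : R.
Hypothesis Ht : 0 < t.

Let tau : C := (0, t).
Let s : R := 2 * PI * t.

Lemma theta_s_pos : 0 < s.
Proof. unfold s. pose proof PI_RGT_0. nra. Qed.

(** The theta functions have modulus 2τ = 2it, so the nome is q = exp(-2πt) and this is q^(k²)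
    exp(2πikz), kept inside one exponential so that identities reduce to their exponents. *)
Definition tterm (z : C) (k : Z) : C :=
  Cexp (RtoC (- (2 * PI * t * IZR k ^ 2)) + Ci * RtoC (2 * PI * IZR k) * z).
Definition Theta (z : C) : C := BS (tterm z).

Lemma Cmod_tterm (z : C) (k : Z) :
  Cmod (tterm z k) <= exp (- (s * IZR k ^ 2) + 2 * PI * Cmod z * IZR (Z.abs k)).
Proof.
  unfold tterm; rewrite Cmod_Cexp.
  assert (E : Re (RtoC (- (2 * PI * t * IZR k ^ 2)) + Ci * RtoC (2 * PI * IZR k) * z)
     <= - (s * IZR k ^ 2) + 2 * PI * Cmod z * IZR (Z.abs k)).
  { replace (Re _) with (- (s * IZR k ^ 2) - 2 * PI * (IZR k * Im z))
      by (destruct z as [a b]; unfold s; simpl; ring).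
    rewrite abs_IZR. pose proof PI_RGT_0.
    assert (- (IZR k * Im z) <= Rabs (IZR k) * Cmod z).
    { apply Rle_trans with (Rabs (IZR k * Im z)); [rewrite <- Rabs_Ropp; apply Rle_abs|].
      rewrite Rabs_mult. apply Rmult_le_compat_l; [apply Rabs_pos | apply im_le_Cmod]. }
    nra. }
  destruct E as [E|E]; [left; apply exp_increasing, E | rewrite E; lra].
Qed.

(** Completing the square in -sx² + (B + 1)x. *)
Lemma gauss_bound (B x : R) : exp (- (s * x ^ 2) + B * x) <= exp ((B + 1) ^ 2 / (4 * s)) * exp (- x).
Proof.
  rewrite <- exp_plus. pose proof theta_s_pos as Ps.
  assert (E : - (s * x ^ 2) + B * x <= (B + 1) ^ 2 / (4 * s) + - x).
  { replace ((B + 1) ^ 2 / (4 * s) + - x) with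
      ((- (s * x ^ 2) + B * x) + s * (x - (B + 1) / (2 * s)) ^ 2) by (field; lra).
    pose proof (pow2_ge_0 (x - (B + 1) / (2 * s))). nra. }
  destruct E as [E|E]; [left; apply exp_increasing, E | rewrite E; lra].
Qed.

Lemma gauss_bound_Z (B : R) (k : Z) :
  exp (- (s * IZR k ^ 2) + B * IZR (Z.abs k)) <= exp ((B + 1) ^ 2 / (4 * s)) * exp (- IZR (Z.abs k)).
Proof.
  replace (IZR k ^ 2) with (IZR (Z.abs k) ^ 2) by (rewrite abs_IZR; apply pow2_abs).
  apply gauss_bound.
Qed.

Lemma tterm_zdom (z : C) : exists K, 0 <= K /\ zdom (tterm z) K.
Proof.
  exists (exp ((2 * PI * Cmod z + 1) ^ 2 / (4 * s))); split; [apply Rlt_le, exp_pos|].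
  intros k. eapply Rle_trans; [apply Cmod_tterm | apply gauss_bound_Z].
Qed.

(** Lets exponentials absorb the powers of the frequency produced by termwise differentiation. *)
Lemma sqr_le_exp (y : R) : 0 <= y -> y ^ 2 <= 4 * exp y /\ y <= exp y.
Proof.
  intros Hy. pose proof (exp_ineq1_le y). pose proof (exp_ineq1_le (y / 2)).
  replace y with (y / 2 + y / 2) at 2 by field. rewrite exp_plus. split; nra.
Qed.

Definition Theta' (z : C) : C := BS (fun k => Ci * RtoC (2 * PI * IZR k) * tterm z k)%C.

Lemma Cmod_freq (k : Z) : Cmod (Ci * RtoC (2 * PI * IZR k)) = 2 * PI * IZR (Z.abs k).
Proof.
  rewrite Cmod_mult, Cmod_Ci, Cmod_R, Rmult_1_l, Rabs_mult, <- abs_IZR.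
  rewrite (Rabs_pos_eq (2 * PI)); [reflexivity | pose proof PI_RGT_0; lra].
Qed.

Lemma cder_Theta (z : C) : cder Theta z (Theta' z).
Proof.
  pose proof PI_RGT_0 as PPI. pose proof theta_s_pos as Ps. pose proof exp_m1_bounds as B1.
  intros e He.
  (* With y = 2π|k| and h < 1 the Taylor remainder 4(yh)² exp(yh) is at most 16h² exp(2y). The
     factor exp(2y) = exp(4π|k|) is paid for by the extra 4π here, and 16 appears in [K]. *)
  set (B := 2 * PI * Cmod z + 4 * PI).
  set (K := 16 * exp ((B + 1) ^ 2 / (4 * s))).
  assert (PK : 0 < K) by (unfold K; pose proof (exp_pos ((B + 1) ^ 2 / (4 * s))); lra).
  set (L := 4 * K / (1 - exp (-1))).
  assert (PL : 0 < L) by (apply Rdiv_lt_0_compat; lra).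
  exists (Rmin 1 (e / L)); split; [apply Rmin_pos; [lra | apply Rdiv_lt_0_compat; lra]|].
  intros w Hw.
  assert (D1 : Cmod (w - z) < 1) by (eapply Rlt_le_trans; [exact Hw | apply Rmin_l]).
  assert (D2 : Cmod (w - z) < e / L) by (eapply Rlt_le_trans; [exact Hw | apply Rmin_r]).
  set (h := Cmod (w - z)) in *.
  assert (Ph : 0 <= h) by apply Cmod_ge_0.
  destruct (tterm_zdom z) as [Kz [PKz Hz]]. destruct (tterm_zdom w) as [Kw [PKw Hw']].
  assert (HD : zdom (fun k => Ci * RtoC (2 * PI * IZR k) * tterm z k)%C (exp ((B + 1) ^ 2 / (4 * s)))).
  { intros k. rewrite Cmod_mult, Cmod_freq.
    assert (Pk : 0 <= IZR (Z.abs k)) by (apply IZR_le; lia).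
    eapply Rle_trans; [apply Rmult_le_compat_l; [nra | apply Cmod_tterm]|].
    eapply Rle_trans; [|apply gauss_bound_Z].
    replace (- (s * IZR k ^ 2) + B * IZR (Z.abs k)) with
      (4 * PI * IZR (Z.abs k) + (- (s * IZR k ^ 2) + 2 * PI * Cmod z * IZR (Z.abs k))) by (unfold B; ring).
    rewrite (exp_plus (4 * PI * IZR (Z.abs k))). apply Rmult_le_compat_r; [apply Rlt_le, exp_pos|].
    apply Rle_trans with (4 * PI * IZR (Z.abs k)); [nra | apply sqr_le_exp; nra]. }
  set (u := fun k => (tterm z k * (Cexp (Ci * RtoC (2 * PI * IZR k) * (w - z)) - 1
                        - Ci * RtoC (2 * PI * IZR k) * (w - z)))%C).
  assert (Eu : (Theta w - Theta z - Theta' z * (w - z))%C = BS u).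
  { assert (Q1 : zdom (fun k => (-1) * tterm z k)%C Kz).
    { intros k. rewrite Cmod_mult, Cmod_R. replace (Rabs (-1)) with 1 by (rewrite Rabs_left; lra).
      rewrite Rmult_1_l. apply Hz. }
    assert (Q2 : zdom (fun k => (- (w - z)) * (Ci * RtoC (2 * PI * IZR k) * tterm z k))%C
       (h * exp ((B + 1) ^ 2 / (4 * s)))).
    { intros k. rewrite Cmod_mult, Cmod_opp. fold h.
      apply Rle_trans with (h * (exp ((B + 1) ^ 2 / (4 * s)) * exp (- IZR (Z.abs k)))); [|right; ring].
      apply Rmult_le_compat_l; [exact Ph | apply HD]. }
    pose proof (exp_pos ((B + 1) ^ 2 / (4 * s))) as PE.
    assert (Q3 : zdom (fun k => (-1) * tterm z k + (- (w - z)) * (Ci * RtoC (2 * PI * IZR k) * tterm z k))%C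
       (Kz + h * exp ((B + 1) ^ 2 / (4 * s)))).
    { intros k. eapply Rle_trans; [apply Cmod_triangle|]. pose proof (Q1 k); pose proof (Q2 k).
      rewrite Rmult_plus_distr_r; lra. }
    transitivity (BS (fun k => tterm w k + ((-1) * tterm z k + (- (w - z)) * (Ci * RtoC (2 * PI * IZR k) * tterm z k)))%C).
    - assert (PhE : 0 <= h * exp ((B + 1) ^ 2 / (4 * s))) by nra.
      assert (PhE2 : 0 <= Kz + h * exp ((B + 1) ^ 2 / (4 * s))) by lra.
      rewrite (BS_plus _ _ _ _ PKw PhE2 Hw' Q3), (BS_plus _ _ _ _ PKz PhE Q1 Q2).
      rewrite (BS_scal (-1) _ _ PKz Hz), (BS_scal (- (w - z)) _ _ (Rlt_le _ _ PE) HD).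
      unfold Theta, Theta'. ring.
    - apply BS_ext; intros k. unfold u, tterm.
      replace (RtoC (- (2 * PI * t * IZR k ^ 2)) + Ci * RtoC (2 * PI * IZR k) * w)%C with
        ((RtoC (- (2 * PI * t * IZR k ^ 2)) + Ci * RtoC (2 * PI * IZR k) * z)
          + Ci * RtoC (2 * PI * IZR k) * (w - z))%C by ring.
      rewrite (Cexp_plus (_ + _)). ring. }
  assert (Hu : zdom u (K * (h * h))).
  { intros k. unfold u. rewrite Cmod_mult.
    pose proof (Cexp_taylor (Ci * RtoC (2 * PI * IZR k) * (w - z))) as T.
    rewrite (Cmod_mult _ (w - z)), Cmod_freq in T. fold h in T.
    assert (Pk : 0 <= IZR (Z.abs k)) by (apply IZR_le; lia).
    set (y := 2 * PI * IZR (Z.abs k)) in *.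
    assert (Py : 0 <= y) by (unfold y; nra).
    assert (Eyh : exp (y * h) <= exp y).
    { assert (y * h <= y) as [Q|Q] by nra; [left; apply exp_increasing, Q | rewrite Q; lra]. }
    destruct (sqr_le_exp y Py) as [Y1 _]. pose proof (exp_pos y) as Pey. pose proof (exp_pos (y * h)).
    assert (T2 : 4 * (y * h) ^ 2 * exp (y * h) <= 16 * (h * h) * (exp y * exp y)).
    { replace (4 * (y * h) ^ 2 * exp (y * h)) with (4 * (h * h) * (y ^ 2 * exp (y * h))) by ring.
      replace (16 * (h * h) * (exp y * exp y)) with (4 * (h * h) * (4 * exp y * exp y)) by ring.
      apply Rmult_le_compat_l; [nra|]. apply Rmult_le_compat; try lra. apply pow2_ge_0. }
    eapply Rle_trans; [apply Rmult_le_compat; [apply Cmod_ge_0 | apply Cmod_ge_0 | apply Cmod_tterm | eapply Rle_trans; [exact T | exact T2]]|].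
    rewrite <- exp_plus.
    replace (exp (- (s * IZR k ^ 2) + 2 * PI * Cmod z * IZR (Z.abs k)) * (16 * (h * h) * exp (y + y)))
      with (16 * (h * h) * (exp (y + y) * exp (- (s * IZR k ^ 2) + 2 * PI * Cmod z * IZR (Z.abs k)))) by ring.
    rewrite <- exp_plus.
    replace (y + y + (- (s * IZR k ^ 2) + 2 * PI * Cmod z * IZR (Z.abs k)))
      with (- (s * IZR k ^ 2) + B * IZR (Z.abs k)) by (unfold B, y; ring).
    unfold K. replace (16 * exp ((B + 1) ^ 2 / (4 * s)) * (h * h) * exp (- IZR (Z.abs k)))
      with (16 * (h * h) * (exp ((B + 1) ^ 2 / (4 * s)) * exp (- IZR (Z.abs k)))) by ring.
    apply Rmult_le_compat_l; [nra | apply gauss_bound_Z]. }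
  rewrite Eu.
  apply Rle_trans with (L * h * h).
  - eapply Rle_trans; [apply (BS_bound u (K * (h * h))); [nra | exact Hu]|].
    right. unfold L. field. lra.
  - apply Rmult_le_compat_r; [exact Ph|].
    apply Rle_trans with (L * (e / L)); [apply Rmult_le_compat_l; lra | right; field; lra].
Qed.

Lemma Theta_1 (z : C) : Theta (z + 1) = Theta z.
Proof.
  apply BS_ext; intros k. unfold tterm.
  replace (RtoC (- (2 * PI * t * IZR k ^ 2)) + Ci * RtoC (2 * PI * IZR k) * (z + 1))%C with
    ((RtoC (- (2 * PI * t * IZR k ^ 2)) + Ci * RtoC (2 * PI * IZR k) * z) + Ci * RtoC (2 * PI * IZR k))%C by ring.
  rewrite Cexp_plus, Cexp_2PI_Z. ring.
Qed.

Definition mult2 (z : C) : C := Cexp (- (2 * Ci * PI * tau) - 2 * Ci * PI * z).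

(** Termwise, k² + 2k = (k + 1)² - 1: term k at z + 2τ is [mult2 z] times term k + 1 at z. *)
Lemma Theta_2tau (z : C) : Theta (z + 2 * tau) = (mult2 z * Theta z)%C.
Proof.
  destruct (tterm_zdom z) as [K [PK Hz]]. unfold Theta.
  rewrite <- (BS_scal _ _ K PK Hz). rewrite <- (BS_shift (fun k => mult2 z * tterm z k)%C (Cmod (mult2 z) * K)).
  - apply BS_ext; intros k. unfold tterm, mult2. rewrite <- Cexp_plus. f_equal.
    rewrite plus_IZR. destruct z as [a b]. unfold tau. Ceq; ring.
  - apply Rmult_le_pos; [apply Cmod_ge_0 | exact PK].
  - intros k. rewrite Cmod_mult, Rmult_assoc. apply Rmult_le_compat_l; [apply Cmod_ge_0 | apply Hz].
Qed.

Lemma Theta_unilateral (z : C) :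
  Theta z = (1 + CSeries (fun n => tterm z (Z.of_nat n + 1) + tterm z (-1 - Z.of_nat n)))%C.
Proof.
  destruct (tterm_zdom z) as [K [PK Hz]]. destruct (zdom_gdom _ K PK Hz) as [H1 H2].
  unfold Theta, BS. rewrite (CSeries_incr_1 _ K H1).
  rewrite (CSeries_ext (fun k => tterm z (Z.of_nat (S k))) (fun n => tterm z (Z.of_nat n + 1)))
    by (intros; f_equal; lia).
  rewrite (CSeries_plus (fun n => tterm z (Z.of_nat n + 1)) (fun n => tterm z (-1 - Z.of_nat n)) K K).
  - replace (tterm z (Z.of_nat 0)) with (RtoC 1); [ring|].
    unfold tterm. replace (RtoC _ + _)%C with (RtoC 0); [symmetry; apply Cexp_0|].
    destruct z; Ceq; ring.
  - intros n. eapply Rle_trans; [apply Hz|]. apply Rmult_le_compat_l; [exact PK|].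
    rewrite <- exp_nat_pow, INR_IZR_INZ. left; apply exp_increasing.
    rewrite Z.abs_eq, plus_IZR by lia. lra.
  - exact H2.
Qed.

(** Pairing n with -1 - n is symmetric about -1/2, which suits the half-integer frequencies of θ1
    and θ2; [Theta_unilateral] pairs k with -k for θ3 and θ4. *)
Lemma Theta_split (c z : C) :
  (c * Theta z)%C = CSeries (fun n => c * tterm z (Z.of_nat n) + c * tterm z (-1 - Z.of_nat n))%C.
Proof.
  destruct (tterm_zdom z) as [K [PK Hz]]. destruct (zdom_gdom _ K PK Hz) as [H1 H2].
  unfold Theta, BS. 
  assert (Q : forall u, gdom u K -> gdom (fun n => c * u n)%C (Cmod c * K)).
  { intros u Hu n. rewrite Cmod_mult, Rmult_assoc. apply Rmult_le_compat_l; [apply Cmod_ge_0 | apply Hu]. }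
  rewrite (CSeries_plus _ _ (Cmod c * K) (Cmod c * K)).
  - rewrite (CSeries_scal c _ K H1), (CSeries_scal c _ K H2). ring.
  - exact (Q _ H1).
  - exact (Q _ H2).
Qed.

(** * The Jacobi functions as half-period shifts of one series *)

Lemma Ci_sqr : (Ci * Ci)%C = RtoC (-1).
Proof. Ceq; ring. Qed.

Lemma theta3_Theta (p : C) : theta3 p (2 * tau) = Theta p.
Proof.
  unfold theta3. rewrite Theta_unilateral, <- CSeries_scal_R. f_equal.
  apply CSeries_ext; intros n. unfold qint, Ccos, tterm.
  rewrite S_INR, INR_IZR_INZ.
  transitivity (Cexp (Ci * PI * (2 * tau) * RtoC ((IZR (Z.of_nat n) + 1) ^ 2)) *
    Cexp (Ci * (RtoC (2 * (IZR (Z.of_nat n) + 1)) * PI * p)) +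
    Cexp (Ci * PI * (2 * tau) * RtoC ((IZR (Z.of_nat n) + 1) ^ 2)) *
    Cexp (- (Ci * (RtoC (2 * (IZR (Z.of_nat n) + 1)) * PI * p))))%C.
  { field. }
  rewrite <- !Cexp_plus, plus_IZR, minus_IZR. unfold tau. destruct p as [a b].
  f_equal; f_equal; Ceq; ring.
Qed.

Lemma theta4_Theta (p : C) : theta4 p (2 * tau) = Theta (p + / 2).
Proof.
  unfold theta4. rewrite Theta_unilateral, <- CSeries_scal_R. f_equal.
  apply CSeries_ext; intros n. unfold qint, Ccos, tterm.
  rewrite <- Cexp_PI_n.
  (* A sign is its own inverse; the second form matches the term of negative index. *)
  assert (E : Cexp (Ci * RtoC (PI * INR (S n))) = Cexp (- (Ci * RtoC (PI * INR (S n))))).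
  { rewrite Cexp_opp, Cexp_PI_n. rewrite <- RtoC_inv by (apply pow_nonzero; lra).
    f_equal. rewrite <- pow_inv. f_equal. field. }
  transitivity (Cexp (Ci * RtoC (PI * INR (S n))) * (Cexp (Ci * PI * (2 * tau) * RtoC (INR (S n) ^ 2)) *
    Cexp (Ci * (RtoC (2 * INR (S n)) * PI * p))) +
    Cexp (Ci * RtoC (PI * INR (S n))) * (Cexp (Ci * PI * (2 * tau) * RtoC (INR (S n) ^ 2)) *
    Cexp (- (Ci * (RtoC (2 * INR (S n)) * PI * p)))))%C.
  { field. }
  rewrite E at 2. rewrite <- !Cexp_plus, S_INR, INR_IZR_INZ, plus_IZR, minus_IZR.
  unfold tau. rewrite <- RtoC_inv by lra. destruct p as [a b].
  f_equal; f_equal; Ceq; field.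
Qed.

(** The shift by τ turns k² into (k + 1/2)² - 1/4; the prefactor restores q^(1/4) = exp(-πt/2) and
    the half frequency. *)
Lemma theta2_Theta (p : C) : theta2 p (2 * tau) =
  (Cexp (RtoC (- (PI * t / 2)) + Ci * PI * p) * Theta (p + tau))%C.
Proof.
  unfold theta2. rewrite Theta_split, <- CSeries_scal_R.
  apply CSeries_ext; intros n. unfold qhalf, Ccos, tterm.
  transitivity (Cexp (Ci * PI * (2 * tau) * RtoC ((INR n + / 2) ^ 2)) *
    Cexp (Ci * (RtoC (2 * INR n + 1) * PI * p)) +
    Cexp (Ci * PI * (2 * tau) * RtoC ((INR n + / 2) ^ 2)) *
    Cexp (- (Ci * (RtoC (2 * INR n + 1) * PI * p))))%C.
  { field. }
  rewrite <- !Cexp_plus, INR_IZR_INZ, minus_IZR. unfold tau. destruct p as [a b].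
  f_equal; f_equal; Ceq; field.
Qed.

Lemma theta1_Theta (p : C) : theta1 p (2 * tau) =
  (- Ci * Cexp (RtoC (- (PI * t / 2)) + Ci * PI * p) * Theta (p + tau + / 2))%C.
Proof.
  unfold theta1. rewrite Theta_split, <- CSeries_scal_R.
  apply CSeries_ext; intros n. unfold qhalf, Csin, tterm.
  rewrite <- Cexp_PI_n.
  assert (E : Cexp (Ci * RtoC (PI * INR n)) = Cexp (- (Ci * RtoC (PI * INR n)))).
  { rewrite Cexp_opp, Cexp_PI_n. rewrite <- RtoC_inv by (apply pow_nonzero; lra).
    f_equal. rewrite <- pow_inv. f_equal. field. }
  (* The minus sign inside the sine is absorbed into an exponential to match the terms with index -1
     - n. *)
  assert (E2 : (- (1) = Cexp (- (Ci * PI)))%C).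
  { rewrite Cexp_opp. replace (Ci * PI)%C with (Ci * RtoC (PI * INR 1))%C by (simpl INR; rewrite Rmult_1_r; reflexivity).
    rewrite Cexp_PI_n, <- RtoC_inv by (simpl; lra). simpl. rewrite <- RtoC_opp. f_equal. field. }
  transitivity (- Ci * (Cexp (Ci * RtoC (PI * INR n)) * (Cexp (Ci * PI * (2 * tau) * RtoC ((INR n + / 2) ^ 2)) *
    Cexp (Ci * (RtoC (2 * INR n + 1) * PI * p)))) +
    - Ci * (- (1) * Cexp (Ci * RtoC (PI * INR n)) * (Cexp (Ci * PI * (2 * tau) * RtoC ((INR n + / 2) ^ 2)) *
    Cexp (- (Ci * (RtoC (2 * INR n + 1) * PI * p))))))%C.
  { rewrite <- Ci_inv. field. apply Ci_nz. }
  rewrite E at 2. rewrite E2. rewrite <- !Cmult_assoc, <- !Cexp_plus, INR_IZR_INZ, minus_IZR.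
  unfold tau. rewrite <- RtoC_inv by lra. destruct p as [a b].
  f_equal; f_equal; f_equal; Ceq; field.
Qed.

End Theta.

(** * Zeros of the theta series *)

Fixpoint rprod (f : nat -> R) (n : nat) : R :=
  match n with O => 1 | S n => rprod f n * f n end.

Lemma rprod_pos (f : nat -> R) (n : nat) : (forall k, 0 < f k) -> 0 < rprod f n.
Proof. intros H; induction n; simpl; [lra | apply Rmult_lt_0_compat; auto]. Qed.

Lemma rprod_le (f g : nat -> R) (n : nat) : (forall k, 0 <= f k <= g k) -> 0 <= rprod f n <= rprod g n.
Proof.
  intros H; induction n as [|n IH]; simpl; [lra|]. specialize (H n). split.
  - apply Rmult_le_pos; lra.
  - apply Rmult_le_compat; lra.
Qed.

Lemma rprod_first (f : nat -> R) (n : nat) : rprod f (S n) = f 0%nat * rprod (fun k => f (S k)) n.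
Proof. induction n as [|n IH]; simpl in *; [|rewrite IH]; ring. Qed.

Lemma rprod_mult (f g : nat -> R) (n : nat) : rprod (fun k => f k * g k) n = rprod f n * rprod g n.
Proof. induction n as [|n IH]; simpl; [|rewrite IH]; ring. Qed.

Lemma rprod_ext (f g : nat -> R) (n : nat) : (forall k, f k = g k) -> rprod f n = rprod g n.
Proof. intros H; induction n as [|n IH]; simpl; [|rewrite IH, H]; reflexivity. Qed.

Lemma pow_small (x e : R) : 0 < x < 1 -> 0 < e -> exists n, x ^ n < e.
Proof.
  intros Hx He. assert (Q : is_lim_seq (fun n => x ^ n) 0).
  { apply is_lim_seq_geom. rewrite Rabs_pos_eq; lra. }
  apply is_lim_seq_spec in Q. destruct (Q (mkposreal e He)) as [n Hn].
  exists n. specialize (Hn n (Nat.le_refl n)). simpl in Hn. rewrite Rminus_0_r in Hn.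
  eapply Rle_lt_trans; [apply Rle_abs | exact Hn].
Qed.

(** A product with geometrically small defects stays away from 0. No logarithm is used: a head of m
    positive factors has finitely many partial products, and the tail obeys ∏(1 - a_k) >= 1 - Σ
    a_k. *)
Lemma rprod_lower (f : nat -> R) (A x : R) : 0 < x < 1 -> 0 <= A ->
  (forall k, 0 < f k) -> (forall k, 1 - A * x ^ k <= f k) ->
  exists d, 0 < d /\ forall n, d <= rprod f n.
Proof.
  intros Hx PA Pf Hf.
  (* m is chosen so that the total defect Ax^m/(1 - x) of the tail is at most 1/2. *)
  destruct (pow_small x ((1 - x) / (2 * (A + 1))) Hx) as [m Hm].
  { apply Rdiv_lt_0_compat; lra. }
  assert (Hm' : A * x ^ m / (1 - x) <= / 2).
  { apply (Rmult_le_reg_r (1 - x)); [lra|].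
    unfold Rdiv at 1. rewrite Rmult_assoc, Rinv_l, Rmult_1_r by lra.
    apply (Rmult_lt_compat_l (A + 1)) in Hm; [|lra].
    replace ((A + 1) * ((1 - x) / (2 * (A + 1)))) with ((1 - x) / 2) in Hm by (field; lra).
    assert (0 < x ^ m) by (apply pow_lt; lra). lra. }
  assert (Hd : exists d, 0 < d /\ forall n, (n <= m)%nat -> d <= rprod f n).
  { clear Hm Hm'. induction m as [|m [d [Pd IH]]].
    - exists 1; split; [lra|]; intros n Hn. replace n with 0%nat by lia. simpl; lra.
    - exists (Rmin d (rprod f (S m))); split; [apply Rmin_pos; [lra | apply rprod_pos, Pf]|].
      intros n Hn. destruct (Nat.eq_dec n (S m)) as [->|N]; [apply Rmin_r|].
      eapply Rle_trans; [apply Rmin_l | apply IH; lia]. }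
  destruct Hd as [d [Pd Hd]].
  assert (Pm : 0 < rprod f m) by (apply rprod_pos, Pf).
  exists (Rmin d (rprod f m / 2)); split; [apply Rmin_pos; lra|].
  assert (T : forall j, rprod f m * (1 - A * x ^ m * (1 - x ^ j) / (1 - x)) <= rprod f (m + j)).
  { induction j as [|j IH].
    - rewrite Nat.add_0_r. simpl. right. field. lra.
    - rewrite Nat.add_succ_r. simpl rprod.
      assert (Q : 0 < x ^ j) by (apply pow_lt; lra).
      assert (Q1 : x ^ j <= 1) by (rewrite <- (pow1 j); apply pow_incr; lra).
      assert (Qm : 0 < x ^ m) by (apply pow_lt; lra).
      (* [a] is the sum of the first j tail defects and [b] the next one; the induction uses (1 -
         a)(1 - b) >= 1 - (a + b). *)
      set (a := A * x ^ m * (1 - x ^ j) / (1 - x)) in *.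
      set (b := A * x ^ (m + j)).
      assert (Eab : A * x ^ m * (1 - x ^ S j) / (1 - x) = a + b).
      { unfold a, b. rewrite pow_add. simpl. field. lra. }
      assert (Ha : 0 <= a).
      { unfold a. apply Rdiv_le_0_compat; [|lra]. apply Rmult_le_pos; [nra | lra]. }
      assert (Hb : 0 <= b) by (unfold b; apply Rmult_le_pos; [lra | apply pow_le; lra]).
      assert (Hab : a + b <= / 2).
      { rewrite <- Eab. eapply Rle_trans; [|exact Hm'].
        unfold Rdiv. apply Rmult_le_compat_r; [apply Rlt_le, Rinv_0_lt_compat; lra|].
        assert (0 < x ^ S j) by (apply pow_lt; lra).
        assert (0 <= A * x ^ m) by nra. nra. }
      rewrite Eab.
      apply Rle_trans with (rprod f m * (1 - a) * (1 - b)).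
      + rewrite Rmult_assoc. apply Rmult_le_compat_l; [lra | nra].
      + apply Rmult_le_compat; [apply Rmult_le_pos; lra | lra | exact IH | apply Hf]. }
  intros n. destruct (Nat.le_gt_cases n m) as [H|H].
  - eapply Rle_trans; [apply Rmin_l | apply Hd, H].
  - eapply Rle_trans; [apply Rmin_r|]. replace n with (m + (n - m))%nat by lia.
    eapply Rle_trans; [|apply T]. unfold Rdiv. apply Rmult_le_compat_l; [lra|].
    assert (A * x ^ m * (1 - x ^ (n - m)) / (1 - x) <= / 2); [|lra].
    eapply Rle_trans; [|exact Hm'].
    unfold Rdiv. apply Rmult_le_compat_r; [apply Rlt_le, Rinv_0_lt_compat; lra|].
    assert (0 < x ^ (n - m)) by (apply pow_lt; lra).
    assert (0 < x ^ m) by (apply pow_lt; lra).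
    assert (0 <= A * x ^ m) by nra. nra.
Qed.

(** * The finite Jacobi triple product *)

Section TripleProduct.
Variable q : R.
Hypothesis Hq : 0 < q < 1.

Lemma qpow_pos (n : nat) : 0 < q ^ n.
Proof. apply pow_lt; lra. Qed.
Lemma qpow_le_1 (n : nat) : q ^ n <= 1.
Proof. rewrite <- (pow1 n); apply pow_incr; lra. Qed.
Lemma qpow_lt_1 (n : nat) : q ^ S n < 1.
Proof. simpl. pose proof (qpow_le_1 n). pose proof (qpow_pos n). nra. Qed.

(* Ratios of the Laurent coefficients of the finite product
   prod_(m < N) (1 + q^(2m+1) z)(1 + q^(2m+1) / z) to its constant coefficient. *)
Fixpoint tpr (N k : nat) : R :=
  match k with
  | O => 1
  | S k => tpr N k * (q * (q ^ (2 * k) - q ^ (2 * N)) / (1 - q ^ (2 * N + 2 * k + 2)))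
  end.

(** The factor at k = N contains q^(2N) - q^(2N): the finite product has degree N in z and in
    1/z. *)
Lemma tpr_zero (N j : nat) : tpr N (S N + j) = 0.
Proof.
  induction j as [|j IH].
  - rewrite Nat.add_0_r. simpl. unfold Rdiv. rewrite Rminus_diag. ring.
  - replace (S N + S j)%nat with (S (S N + j)) by lia. cbn [tpr] in *. rewrite IH. ring.
Qed.

(** Up to index N every ratio lies between 0 and q^(2k+1), and the odd exponents sum to a square.
    This N-independent bound is the majorant for the passage to the limit. *)
Lemma tpr_bounds (N k : nat) : 0 <= tpr N k <= q ^ (k * k).
Proof.
  destruct (Nat.le_gt_cases k N) as [H|H].
  - induction k as [|k IH]; [simpl; lra|].
    specialize (IH ltac:(lia)). cbn [tpr].
    set (F := q * (q ^ (2 * k) - q ^ (2 * N)) / (1 - q ^ (2 * N + 2 * k + 2))).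
    assert (Hb : q ^ (2 * N) <= q ^ (2 * k)).
    { replace (2 * N)%nat with (2 * k + 2 * (N - k))%nat by lia. rewrite pow_add.
      pose proof (qpow_le_1 (2 * (N - k))). pose proof (qpow_pos (2 * k)). nra. }
    assert (HD : 0 < 1 - q ^ (2 * N + 2 * k + 2)).
    { replace (2 * N + 2 * k + 2)%nat with (S (2 * N + 2 * k + 1)) by lia.
      pose proof (qpow_lt_1 (2 * N + 2 * k + 1)); lra. }
    assert (HF : 0 <= F <= q * q ^ (2 * k)).
    { unfold F; split.
      - apply Rdiv_le_0_compat; [apply Rmult_le_pos; lra | exact HD].
      - apply (Rmult_le_reg_r (1 - q ^ (2 * N + 2 * k + 2))); [exact HD|].
        unfold Rdiv. rewrite Rmult_assoc, Rinv_l, Rmult_1_r, !Rmult_assoc by lra.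
        apply Rmult_le_compat_l; [lra|].
        assert (q ^ (2 * k) * q ^ (2 * N + 2 * k + 2) <= q ^ (2 * N)); [|lra].
        rewrite <- pow_add. replace (2 * k + (2 * N + 2 * k + 2))%nat with (2 * N + (4 * k + 2))%nat by lia.
        rewrite pow_add. pose proof (qpow_le_1 (4 * k + 2)). pose proof (qpow_pos (2 * N)).
        rewrite <- (Rmult_1_r (q ^ (2 * N))) at 2. apply Rmult_le_compat_l; lra. }
    split; [apply Rmult_le_pos; lra|].
    replace (S k * S k)%nat with (k * k + (1 + 2 * k))%nat by lia.
    rewrite pow_add. apply Rmult_le_compat; try lra. rewrite pow_add. simpl (q ^ 1). lra.
  - replace k with (S N + (k - S N))%nat at 1 2 by lia. rewrite tpr_zero.
    split; [lra | apply Rlt_le, qpow_pos].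
Qed.

Lemma tpr_lim (k : nat) : is_lim_seq (fun N => tpr N k) (q ^ (k * k)).
Proof.
  assert (Q : forall j, is_lim_seq (fun N => q ^ (2 * N + j)) 0).
  { intros j. apply is_lim_seq_ext with (fun N => q ^ j * (q ^ 2) ^ N).
    - intros n. rewrite <- pow_mult, <- pow_add. f_equal; lia.
    - replace 0 with (q ^ j * 0) by ring. apply (is_lim_seq_scal_l _ _ 0).
      apply is_lim_seq_geom. rewrite Rabs_pos_eq by (apply pow_le; lra). apply (qpow_lt_1 1). }
  induction k as [|k IH]; [apply is_lim_seq_const|].
  replace (q ^ (S k * S k)) with (q ^ (k * k) * (q * (q ^ (2 * k) - 0) / (1 - 0))).
  - cbn [tpr]. apply is_lim_seq_mult'; [exact IH|].
    apply is_lim_seq_div'; [| |lra].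
    + apply is_lim_seq_mult'; [apply is_lim_seq_const|].
      apply is_lim_seq_minus'; [apply is_lim_seq_const|].
      apply is_lim_seq_ext with (2 := Q 0%nat). intros n; f_equal; lia.
    + apply is_lim_seq_minus'; [apply is_lim_seq_const|].
      apply is_lim_seq_ext with (2 := Q (2 * k + 2)%nat). intros n; f_equal; lia.
  - replace (S k * S k)%nat with (k * k + (1 + 2 * k))%nat by lia.
    rewrite !pow_add, Rminus_0_r, Rminus_0_r. simpl (q ^ 1). field.
Qed.

Lemma qden_neq (n : nat) : 1 - q ^ S n <> 0.
Proof. pose proof (qpow_lt_1 n); lra. Qed.

(** Compares N with N + 1. It is stated with cleared denominators since the factor q^(2k) - q^(2N+2)
    vanishes at k = N + 1; [tpr_succ] absorbs that factor into one more step of the recursion. *)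
Lemma tpr_succ_aux (N k : nat) :
  tpr (S N) k * (q ^ (2 * k) - q ^ (2 * N + 2)) * (1 - q ^ (2 * N + 2 * k + 2)) =
  q ^ (2 * k) * tpr N k * (1 - q ^ (2 * N + 2)) ^ 2.
Proof.
  induction k as [|k IH].
  - cbn [tpr]. rewrite Nat.mul_0_r, Nat.add_0_r. simpl (q ^ 0). ring.
  - cbn [tpr].
    replace (2 * S N + 2 * k + 2)%nat with (S (2 * N + 2 * k + 3)) by lia.
    replace (2 * N + 2 * S k + 2)%nat with (S (2 * N + 2 * k + 3)) by lia.
    replace (2 * S k)%nat with (2 * k + 2)%nat by lia.
    replace (2 * S N)%nat with (2 * N + 2)%nat by lia.
    replace (2 * N + 2 * k + 2)%nat with (S (2 * N + 2 * k + 1)) in * by lia.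
    pose proof (qden_neq (2 * N + 2 * k + 3)) as D1. pose proof (qden_neq (2 * N + 2 * k + 1)) as D2.
    set (d1 := q ^ S (2 * N + 2 * k + 3)) in *. set (d2 := q ^ S (2 * N + 2 * k + 1)) in *.
    rewrite !(pow_add q (2 * k) 2), (pow_add q (2 * N) 2) in *.
    set (a := q ^ (2 * N)) in *. set (b := q ^ (2 * k)) in *.
    transitivity (q * q ^ 2 * (b - a) * (tpr (S N) k * (b - a * q ^ 2) * (1 - d2)) / (1 - d2)).
    + field. split; assumption.
    + rewrite IH. field. assumption.
Qed.

Lemma tpr_succ (N k : nat) :
  tpr (S N) (S k) * ((1 - q ^ (2 * N + 2 * k + 2)) * (1 - q ^ (2 * N + 2 * k + 4))) =
  q * q ^ (2 * k) * tpr N k * (1 - q ^ (2 * N + 2)) ^ 2.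
Proof.
  cbn [tpr].
  replace (2 * S N + 2 * k + 2)%nat with (S (2 * N + 2 * k + 3)) by lia.
  replace (2 * N + 2 * k + 4)%nat with (S (2 * N + 2 * k + 3)) by lia.
  replace (2 * S N)%nat with (2 * N + 2)%nat by lia.
  pose proof (qden_neq (2 * N + 2 * k + 3)) as D1.
  transitivity (q * (tpr (S N) k * (q ^ (2 * k) - q ^ (2 * N + 2)) * (1 - q ^ (2 * N + 2 * k + 2)))).
  - field. assumption.
  - rewrite tpr_succ_aux. ring.
Qed.

(** Ratio of consecutive constant coefficients, that is, of consecutive central Gaussian binomials
    in base q². *)
Definition tprho (N : nat) : R :=
  (1 - q ^ (4 * N + 2)) * (1 + q ^ (2 * N + 2)) / (1 - q ^ (2 * N + 2)).

Lemma tprho_pos (N : nat) : 0 < tprho N.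
Proof.
  unfold tprho.
  replace (4 * N + 2)%nat with (S (4 * N + 1)) by lia.
  replace (2 * N + 2)%nat with (S (2 * N + 1)) by lia.
  pose proof (qpow_lt_1 (4 * N + 1)). pose proof (qpow_lt_1 (2 * N + 1)). pose proof (qpow_pos (S (2 * N + 1))).
  apply Rdiv_lt_0_compat; [apply Rmult_lt_0_compat; lra | lra].
Qed.

(** Coefficient of z^(k+1) after multiplication by the next factor 1 + q^(2N+1)(z + 1/z) + q^(4N+2);
    [tpr_rec_0] is the constant coefficient. *)
Lemma tpr_rec (N k : nat) :
  (1 + q ^ (4 * N + 2)) * tpr N (S k) + q ^ (2 * N + 1) * (tpr N k + tpr N (S (S k))) =
  tprho N * tpr (S N) (S k).
Proof.
  pose proof (tpr_succ N k) as E.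
  replace (2 * N + 2 * k + 2)%nat with (S (2 * N + 2 * k + 1)) in E by lia.
  replace (2 * N + 2 * k + 4)%nat with (S (2 * N + 2 * k + 3)) in E by lia.
  pose proof (qden_neq (2 * N + 2 * k + 3)) as D1. pose proof (qden_neq (2 * N + 2 * k + 1)) as D2.
  assert (E' : tpr (S N) (S k) = q * q ^ (2 * k) * tpr N k * (1 - q ^ (2 * N + 2)) ^ 2 /
    ((1 - q ^ S (2 * N + 2 * k + 1)) * (1 - q ^ S (2 * N + 2 * k + 3)))).
  { rewrite <- E. field. split; assumption. }
  rewrite E'. clear E E'. unfold tprho. cbn [tpr].
  replace (2 * N + 2)%nat with (S (2 * N + 1)) by lia.
  pose proof (qden_neq (2 * N + 1)) as D3.
  replace (k + S (k + 0))%nat with (2 * k + 1)%nat by lia.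
  replace (2 * N + 2 * k + 2)%nat with (S (2 * N + 2 * k + 1)) by lia.
  replace (2 * N + 2 * S k + 2)%nat with (S (2 * N + 2 * k + 3)) by lia.
  replace (2 * S k)%nat with (2 * k + 2)%nat by lia.
  assert (P1 : q ^ S (2 * N + 2 * k + 1) = q ^ (2 * N) * q ^ (2 * k) * q ^ 2)
    by (rewrite <- !pow_add; f_equal; lia).
  assert (P2 : q ^ S (2 * N + 2 * k + 3) = q ^ (2 * N) * q ^ (2 * k) * q ^ 4)
    by (rewrite <- !pow_add; f_equal; lia).
  assert (P3 : q ^ S (2 * N + 1) = q ^ (2 * N) * q ^ 2) by (rewrite <- !pow_add; f_equal; lia).
  assert (P4 : q ^ (4 * N + 2) = q ^ (2 * N) * q ^ (2 * N) * q ^ 2) by (rewrite <- !pow_add; f_equal; lia).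
  assert (P5 : q ^ (2 * N + 1) = q ^ (2 * N) * q) by (rewrite pow_add, pow_1; reflexivity).
  assert (P6 : q ^ (2 * k + 2) = q ^ (2 * k) * q ^ 2) by (rewrite pow_add; reflexivity).
  rewrite P1, P2, P3, P4, P5, P6 in *.
  set (a := q ^ (2 * N)) in *. set (b := q ^ (2 * k)) in *. set (r := tpr N k).
  field. repeat split; assumption.
Qed.

Lemma tpr_rec_0 (N : nat) :
  1 + q ^ (4 * N + 2) + 2 * q ^ (2 * N + 1) * tpr N 1 = tprho N.
Proof.
  unfold tprho. cbn [tpr]. rewrite Nat.mul_0_r, Nat.add_0_r.
  replace (2 * N + 2)%nat with (S (2 * N + 1)) by lia.
  pose proof (qden_neq (2 * N + 1)) as D3.
  assert (P3 : q ^ S (2 * N + 1) = q ^ (2 * N) * q ^ 2) by (rewrite <- !pow_add; f_equal; lia).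
  assert (P4 : q ^ (4 * N + 2) = q ^ (2 * N) * q ^ (2 * N) * q ^ 2) by (rewrite <- !pow_add; f_equal; lia).
  assert (P5 : q ^ (2 * N + 1) = q ^ (2 * N) * q) by (rewrite pow_add, pow_1; reflexivity).
  rewrite P3, P4, P5 in *.
  set (a := q ^ (2 * N)) in *. simpl (q ^ 0). field. assumption.
Qed.

(** X k stands for z^k + z^(-k), known only through its recurrence. The constant sequence 2 then
    qualifies as well as [cos2]. *)
Variable X : nat -> C.
Hypothesis X_0 : X 0%nat = 2.
Hypothesis X_rec : forall k, (X 1%nat * X (S k))%C = (X (S (S k)) + X k)%C.

Definition tpsum (N M : nat) : C := (1 + csum (fun k => RtoC (tpr N (S k)) * X (S k)) M)%C.

(** Multiplication by X 1 rearranged by the recurrence; the last two terms are truncation errors and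
    vanish once M > N. *)
Lemma tpsum_X1 (N M : nat) :
  (X 1%nat * tpsum N M)%C =
  (2 * tpr N 1 + csum (fun k => RtoC (tpr N k + tpr N (S (S k))) * X (S k)) M
   + RtoC (tpr N M) * X (S M) - RtoC (tpr N (S M)) * X M)%C.
Proof.
  unfold tpsum. induction M as [|M IH].
  - cbn [csum]. rewrite X_0. change (tpr N 0) with 1. ring.
  - cbn [csum]. rewrite Cplus_assoc, Cmult_plus_distr_l, IH.
    replace (X 1%nat * (RtoC (tpr N (S M)) * X (S M)))%C
      with (RtoC (tpr N (S M)) * (X 1%nat * X (S M)))%C by ring.
    rewrite X_rec, RtoC_plus. ring.
Qed.

Definition tpfactor (m : nat) : C := (1 + RtoC (q ^ (2 * m + 1)) * X 1%nat + RtoC (q ^ (4 * m + 2)))%C.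

Lemma tpsum_step (N M : nat) : (S N < M)%nat ->
  (tpfactor N * tpsum N M)%C = (RtoC (tprho N) * tpsum (S N) M)%C.
Proof.
  intros HM. unfold tpfactor.
  transitivity ((1 + RtoC (q ^ (4 * N + 2))) * tpsum N M + RtoC (q ^ (2 * N + 1)) * (X 1%nat * tpsum N M))%C; [ring|].
  rewrite tpsum_X1.
  replace (tpr N M) with 0 by (replace M with (S N + (M - S N))%nat by lia; rewrite tpr_zero; reflexivity).
  replace (tpr N (S M)) with 0 by (replace (S M) with (S N + (S M - S N))%nat by lia; rewrite tpr_zero; reflexivity).
  unfold tpsum.
  rewrite (Cmult_plus_distr_l (tprho N)), <- (csum_scal (tprho N)).
  rewrite (csum_ext (fun k => RtoC (tprho N) * (RtoC (tpr (S N) (S k)) * X (S k)))%C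
    (fun k => (1 + RtoC (q ^ (4 * N + 2))) * (RtoC (tpr N (S k)) * X (S k))
      + RtoC (q ^ (2 * N + 1)) * (RtoC (tpr N k + tpr N (S (S k))) * X (S k)))%C).
  - rewrite csum_plus, !csum_scal, <- tpr_rec_0.
    rewrite !RtoC_plus, !RtoC_mult. ring.
  - intros k _. rewrite Cmult_assoc, <- RtoC_mult, <- tpr_rec, RtoC_plus, !RtoC_mult, !RtoC_plus. ring.
Qed.

Fixpoint tpprod (N : nat) : C :=
  match N with O => 1 | S N => (tpprod N * tpfactor N)%C end.

Lemma finite_triple_product (N M : nat) : (N < M)%nat ->
  tpprod N = (RtoC (rprod tprho N) * tpsum N M)%C.
Proof.
  induction N as [|N IH]; intros HM.
  - simpl. unfold tpsum. rewrite (csum_ext _ (fun _ => 0 * 0)%C).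
    + rewrite csum_scal. ring.
    + intros k _. pose proof (tpr_zero 0 k) as Z. change (1 + k)%nat with (S k) in Z. rewrite Z. ring.
  - cbn [tpprod rprod]. rewrite IH by lia.
    transitivity (RtoC (rprod tprho N) * (tpfactor N * tpsum N M))%C; [ring|].
    rewrite tpsum_step by lia. rewrite RtoC_mult. ring.
Qed.

Lemma Cmod_tpprod (N : nat) : Cmod (tpprod N) = rprod (fun m => Cmod (tpfactor m)) N.
Proof. induction N as [|N IH]; simpl; [apply Cmod_1 | rewrite Cmod_mult, IH; reflexivity]. Qed.

End TripleProduct.

(* The specialization X = 2 of the product identity bounds the constant coefficient. *)
Lemma rprod_tprho_le (q : R) (N : nat) : 0 < q < 1 ->
  rprod (tprho q) N <= rprod (fun m => (1 + q ^ (2 * m + 1)) ^ 2) N.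
Proof.
  intros Hq.
  assert (X2 : forall k : nat, (2 * 2 = 2 + 2)%C) by (intros; ring).
  pose proof (finite_triple_product q Hq (fun _ => 2%C) eq_refl X2 N (S N) ltac:(lia)) as E.
  apply (f_equal Cmod) in E. rewrite Cmod_mult, Cmod_tpprod, Cmod_R in E.
  assert (P : 0 < rprod (tprho q) N) by (apply rprod_pos; intros; apply tprho_pos, Hq).
  rewrite (Rabs_pos_eq (rprod _ _)) in E by lra.
  assert (T : 1 <= Cmod (tpsum q (fun _ => 2%C) N (S N))).
  { assert (exists r, 0 <= r /\ csum (fun k => RtoC (tpr q N (S k)) * 2)%C (S N) = RtoC r) as [r [Pr Er]].
    { generalize (S N) as M. induction M as [|M [r [Pr Er]]].
      - exists 0; split; [lra | reflexivity].
      - exists (r + tpr q N (S M) * 2); split.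
        + pose proof (tpr_bounds q Hq N (S M)); lra.
        + cbn [csum]. rewrite Er, RtoC_plus, RtoC_mult. reflexivity. }
    unfold tpsum. rewrite Er, <- RtoC_plus, Cmod_R, Rabs_pos_eq; lra. }
  rewrite (rprod_ext (fun m => (1 + q ^ (2 * m + 1)) ^ 2) (fun m => Cmod (tpfactor q (fun _ => 2%C) m))).
  - rewrite E. nra.
  - intros m. unfold tpfactor. rewrite <- RtoC_mult, <- !RtoC_plus, Cmod_R.
    replace (4 * m + 2)%nat with ((2 * m + 1) + (2 * m + 1))%nat by lia.
    rewrite (pow_add q (2 * m + 1) (2 * m + 1)).
    pose proof (qpow_pos q Hq (2 * m + 1)). rewrite Rabs_pos_eq by nra; ring.
Qed.

(** Modulus of a factor relative to its value at X = 2. *)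
Definition tpratio (q : R) (X : nat -> C) (m : nat) : R :=
  Cmod (tpfactor q X m) / (1 + q ^ (2 * m + 1)) ^ 2.

(** The product is the constant coefficient times the sum, and that coefficient is at most the
    product at X = 2; dividing gives the bound with no limit involved. *)
Lemma tpsum_lower (q : R) (X : nat -> C) (N M : nat) : 0 < q < 1 -> X 0%nat = 2 ->
  (forall k, (X 1%nat * X (S k))%C = (X (S (S k)) + X k)%C) -> (N < M)%nat ->
  rprod (tpratio q X) N <= Cmod (tpsum q X N M).
Proof.
  intros Hq X0 XR HM.
  pose proof (finite_triple_product q Hq X X0 XR N M HM) as E.
  apply (f_equal Cmod) in E. rewrite Cmod_mult, Cmod_tpprod, Cmod_R in E.
  assert (P : 0 < rprod (tprho q) N) by (apply rprod_pos; intros; apply tprho_pos, Hq).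
  rewrite (Rabs_pos_eq (rprod _ _)) in E by lra.
  pose proof (rprod_tprho_le q N Hq) as L.
  assert (PQ : forall m, 0 < (1 + q ^ (2 * m + 1)) ^ 2).
  { intros m. apply pow_lt. pose proof (qpow_pos q Hq (2 * m + 1)); lra. }
  assert (E2 : rprod (tpratio q X) N * rprod (fun m => (1 + q ^ (2 * m + 1)) ^ 2) N =
    rprod (fun m => Cmod (tpfactor q X m)) N).
  { rewrite <- rprod_mult. apply rprod_ext. intros m. unfold tpratio. field.
    pose proof (qpow_pos q Hq (2 * m + 1)); lra. }
  assert (PT : 0 <= rprod (tpratio q X) N).
  { apply (rprod_le _ (tpratio q X)). intros m; split; [|lra].
    apply Rdiv_le_0_compat; [apply Cmod_ge_0 | apply PQ]. }
  apply (Rmult_le_reg_l (rprod (tprho q) N)); [exact P|].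
  rewrite <- E, <- E2, (Rmult_comm (rprod (tprho q) N)).
  apply Rmult_le_compat_l; assumption.
Qed.

(** Stated for predicates, so that zeros, poles, bounds and regularity all spread over a lattice
    from its two generators. *)
Lemma lattice_invariant (l1 l2 : C) (P : C -> Prop) :
  (forall z, P z <-> P (z + l1)%C) -> (forall z, P z <-> P (z + l2)%C) ->
  forall z w, in_lattice l1 l2 (w - z) -> (P z <-> P w).
Proof.
  intros H1 H2.
  assert (N : forall l, (forall z, P z <-> P (z + l)%C) -> forall (n : nat) z, P z <-> P (z + RtoC (INR n) * l)%C).
  { intros l H n z. induction n as [|n IH].
    - simpl. replace (z + 0 * l)%C with z by ring. tauto.
    - rewrite S_INR, RtoC_plus. rewrite IH, H.
      replace (z + (RtoC (INR n) + 1) * l)%C with (z + RtoC (INR n) * l + l)%C by ring. tauto. }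
  assert (Zl : forall l, (forall z, P z <-> P (z + l)%C) -> forall (k : Z) z, P z <-> P (z + RtoC (IZR k) * l)%C).
  { intros l H k z. destruct (Z_le_gt_dec 0 k) as [Hk|Hk].
    - rewrite <- (Z2Nat.id k Hk), <- INR_IZR_INZ. apply N, H.
    - rewrite (N l H (Z.to_nat (- k)) (z + RtoC (IZR k) * l)%C).
      rewrite INR_IZR_INZ, Z2Nat.id, opp_IZR, RtoC_opp by lia.
      replace (z + RtoC (IZR k) * l + - RtoC (IZR k) * l)%C with z by ring. tauto. }
  intros z w [a [b E]].
  replace w with (z + RtoC (IZR a) * l1 + RtoC (IZR b) * l2)%C.
  - rewrite (Zl l1 H1 a z). apply Zl, H2.
  - transitivity (z + (w - z))%C; [rewrite E|]; ring.
Qed.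

(** * Location and simplicity of the theta zeros *)

Section ThetaZeros.
Variable t : R.
Hypothesis Ht : 0 < t.

Let tau : C := (0, t).
Let q : R := exp (- (2 * PI * t)).

Lemma nome_bounds : 0 < q < 1.
Proof.
  unfold q; split; [apply exp_pos|]. rewrite <- exp_0. apply exp_increasing.
  pose proof PI_RGT_0; nra.
Qed.

Definition cos2 (z : C) (k : nat) : C :=
  (Cexp (Ci * RtoC (2 * PI * INR k) * z) + Cexp (- (Ci * RtoC (2 * PI * INR k) * z)))%C.

Lemma cos2_0 (z : C) : cos2 z 0 = 2.
Proof.
  unfold cos2. replace (Ci * RtoC (2 * PI * INR 0) * z)%C with (RtoC 0)
    by (simpl INR; rewrite Rmult_0_r; ring).
  replace (- 0)%C with (RtoC 0) by ring. rewrite Cexp_0. ring.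
Qed.

Lemma cos2_rec (z : C) (k : nat) :
  (cos2 z 1 * cos2 z (S k) = cos2 z (S (S k)) + cos2 z k)%C.
Proof.
  unfold cos2. rewrite !S_INR. simpl (INR 0).
  set (a := (Ci * RtoC (2 * PI) * z)%C).
  replace (Ci * RtoC (2 * PI * (0 + 1)) * z)%C with a by (unfold a; rewrite Rplus_0_l, Rmult_1_r; reflexivity).
  replace (Ci * RtoC (2 * PI * (INR k + 1)) * z)%C with (Ci * RtoC (2 * PI * INR k) * z + a)%C
    by (unfold a; rewrite !RtoC_mult, RtoC_plus; ring).
  replace (Ci * RtoC (2 * PI * (INR k + 1 + 1)) * z)%C with (Ci * RtoC (2 * PI * INR k) * z + a + a)%C
    by (unfold a; rewrite !RtoC_mult, !RtoC_plus; ring).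
  set (b := (Ci * RtoC (2 * PI * INR k) * z)%C).
  rewrite !Cexp_opp, !Cexp_plus. field. repeat split; apply Cexp_neq_0.
Qed.

Lemma tterm_cos2 (z : C) (n : nat) :
  (tterm t z (Z.of_nat n + 1) + tterm t z (-1 - Z.of_nat n))%C = (RtoC (q ^ (S n * S n)) * cos2 z (S n))%C.
Proof.
  unfold q. rewrite <- exp_nat_pow, mult_INR, <- Cexp_RtoC. unfold cos2, tterm.
  rewrite Cmult_plus_distr_l, <- !Cexp_plus, S_INR, INR_IZR_INZ, plus_IZR, minus_IZR.
  destruct z as [a b]. f_equal; f_equal; Ceq; ring.
Qed.

Lemma Theta_cos (z : C) :
  Theta t z = (1 + CSeries (fun n => RtoC (q ^ (S n * S n)) * cos2 z (S n)))%C.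
Proof.
  rewrite Theta_unilateral by exact Ht. f_equal. apply CSeries_ext; intros n; apply tterm_cos2.
Qed.

Lemma cos2_gdom (z : C) : exists K, 0 <= K /\ forall n,
  q ^ (S n * S n) * Cmod (cos2 z (S n)) <= K * exp (-1) ^ n.
Proof.
  destruct (tterm_zdom t Ht z) as [K [PK Hz]].
  exists (2 * K); split; [lra|]. intros n. pose proof nome_bounds as Hq.
  rewrite <- (Rabs_pos_eq (q ^ (S n * S n))) by (apply pow_le; lra).
  rewrite <- Cmod_R, <- Cmod_mult, <- tterm_cos2.
  eapply Rle_trans; [apply Cmod_triangle|].
  pose proof (Hz (Z.of_nat n + 1)%Z) as H1. pose proof (Hz (-1 - Z.of_nat n)%Z) as H2.
  rewrite Z.abs_eq in H1 by lia. rewrite Z.abs_neq in H2 by lia.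
  rewrite opp_IZR, minus_IZR in H2. rewrite plus_IZR in H1.
  rewrite <- exp_nat_pow, INR_IZR_INZ.
  replace (- - (-1 - IZR (Z.of_nat n))) with (- (IZR (Z.of_nat n) + 1)) in H2 by ring.
  assert (exp (- (IZR (Z.of_nat n) + 1)) <= exp (IZR (Z.of_nat n) * -1)).
  { left; apply exp_increasing; lra. }
  nra.
Qed.

(* Tannery's theorem: the finite products converge to the theta series. *)
Lemma Theta_lower (z : C) (d : R) :
  (forall N, d <= rprod (tpratio q (cos2 z)) (S N)) -> d <= Cmod (Theta t z).
Proof.
  intros Hd. pose proof nome_bounds as Hq. pose proof exp_m1_bounds as B1.
  destruct (cos2_gdom z) as [K [PK HK]].
  apply le_epsilon; intros e He.
  set (E1 := exp (-1)) in *.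
  (* Beyond index K0 the tail of the error series [v] is at most e/2 for every N; the first K0 terms
     are then made small by taking N large. *)
  destruct (pow_small E1 (e * (1 - E1) / (4 * (K + 1))) B1) as [K0 HK0].
  { apply Rdiv_lt_0_compat; [apply Rmult_lt_0_compat; lra | lra]. }
  set (v := fun N n => (RtoC (q ^ (S n * S n) - tpr q N (S n)) * cos2 z (S n))%C).
  assert (Hv : forall N, gdom (v N) K).
  { intros N n. unfold v. rewrite Cmod_mult, Cmod_R. eapply Rle_trans; [|apply HK].
    apply Rmult_le_compat_r; [apply Cmod_ge_0|].
    pose proof (tpr_bounds q Hq N (S n)). rewrite Rabs_pos_eq; lra. }
  assert (Hr : forall N, gdom (fun n => RtoC (tpr q N (S n)) * cos2 z (S n))%C K).
  { intros N n. rewrite Cmod_mult, Cmod_R. eapply Rle_trans; [|apply HK].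
    apply Rmult_le_compat_r; [apply Cmod_ge_0|].
    pose proof (tpr_bounds q Hq N (S n)). rewrite Rabs_pos_eq; lra. }
  assert (Hlim : forall m e, 0 < e -> exists N0, forall N, (N0 <= N)%nat -> Cmod (csum (v N) m) <= e).
  { clear - Ht. pose proof nome_bounds as Hq. induction m as [|m IH]; intros e He.
    - exists 0%nat; intros N _. simpl. rewrite Cmod_0; lra.
    - destruct (IH (e / 2) ltac:(lra)) as [N1 H1].
      pose proof (tpr_lim q Hq (S m)) as L. apply is_lim_seq_spec in L.
      pose proof (Cmod_ge_0 (cos2 z (S m))) as PX.
      assert (Pe : 0 < e / (2 * (Cmod (cos2 z (S m)) + 1))) by (apply Rdiv_lt_0_compat; lra).
      destruct (L (mkposreal _ Pe)) as [N2 H2]. simpl pos in H2.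
      exists (max N1 N2); intros N HN. cbn [csum].
      specialize (H1 N ltac:(lia)). specialize (H2 N ltac:(lia)).
      eapply Rle_trans; [apply Cmod_triangle|]. unfold v at 2. rewrite Cmod_mult, Cmod_R.
      rewrite Rabs_minus_sym in H2.
      assert (Rabs (q ^ (S m * S m) - tpr q N (S m)) * Cmod (cos2 z (S m)) <= e / 2); [|lra].
      apply Rle_trans with (e / (2 * (Cmod (cos2 z (S m)) + 1)) * (Cmod (cos2 z (S m)) + 1)).
      + apply Rmult_le_compat; try lra. apply Rabs_pos.
      + right; field; lra. }
  destruct (Hlim K0 (e / 2) ltac:(lra)) as [N HN]. specialize (HN (S N) ltac:(lia)).
  specialize (Hd N). eapply Rle_trans; [exact Hd|].
  eapply Rle_trans; [apply (tpsum_lower q (cos2 z) (S N) (S (S N)) Hq (cos2_0 z) (cos2_rec z)); lia|].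
  assert (EQ : Theta t z = (tpsum q (cos2 z) (S N) (S (S N)) + CSeries (v (S N)))%C).
  { rewrite Theta_cos. unfold tpsum.
    rewrite (CSeries_ext _ (fun n => v (S N) n + RtoC (tpr q (S N) (S n)) * cos2 z (S n))%C)
      by (intros n; unfold v; rewrite RtoC_minus; ring).
    rewrite (CSeries_plus (v (S N)) _ K K (Hv _) (Hr _)).
    rewrite (CSeries_split (fun n => RtoC (tpr q (S N) (S n)) * cos2 z (S n))%C K (S (S N)) PK (Hr _)).
    rewrite (CSeries_ext (fun k => RtoC (tpr q (S N) (S (S (S N) + k))) * cos2 z (S (S (S N) + k)))%C (fun k => RtoC 0 * 0)%C).
    - rewrite CSeries_scal_R. ring.
    - intros k. replace (S (S (S N) + k)) with (S (S N) + S k)%nat at 1 by lia.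
      rewrite tpr_zero. ring. }
  assert (Bv : Cmod (CSeries (v (S N))) <= e).
  { rewrite (CSeries_split (v (S N)) K K0 PK (Hv _)). eapply Rle_trans; [apply Cmod_triangle|].
    pose proof (CSeries_bound _ _ (gdom_incr (v (S N)) K K0 PK (Hv _))) as T. fold E1 in T.
    assert (2 * (K * E1 ^ K0) / (1 - E1) <= e / 2); [|lra].
    apply (Rmult_le_reg_r (1 - E1)); [lra|]. unfold Rdiv at 1. rewrite Rmult_assoc, Rinv_l, Rmult_1_r by lra.
    apply (Rmult_lt_compat_l (K + 1)) in HK0; [|lra].
    replace ((K + 1) * (e * (1 - E1) / (4 * (K + 1)))) with (e * (1 - E1) / 4) in HK0 by (field; lra).
    assert (0 < E1 ^ K0) by (apply pow_lt; lra). nra. }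
  replace (tpsum q (cos2 z) (S N) (S (S N))) with (Theta t z - CSeries (v (S N)))%C by (rewrite EQ; ring).
  eapply Rle_trans; [apply Cmod_minus_le|]. lra.
Qed.

Lemma pow_odd_split (m : nat) : q ^ (2 * m + 1) = q * (q ^ 2) ^ m.
Proof. rewrite <- pow_mult, Nat.add_comm. reflexivity. Qed.

(** With Q = q^(2m+1) the factor is 1 + QX + Q² = (1 + Q)² + Q(X - 2). *)
Lemma tpratio_lower (z : C) (m : nat) (A : R) : Cmod (cos2 z 1 - 2) <= A ->
  1 - A * (q ^ (2 * m + 1) / (1 + q ^ (2 * m + 1)) ^ 2) <= tpratio q (cos2 z) m.
Proof.
  intros HA. pose proof nome_bounds as Hq. unfold tpratio, tpfactor.
  replace (4 * m + 2)%nat with ((2 * m + 1) + (2 * m + 1))%nat by lia.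
  rewrite (pow_add q (2 * m + 1) (2 * m + 1)).
  pose proof (qpow_pos q Hq (2 * m + 1)) as PQ. set (Q := q ^ (2 * m + 1)) in *.
  assert (PQ2 : 0 < (1 + Q) ^ 2) by (apply pow_lt; lra).
  apply (Rmult_le_reg_r ((1 + Q) ^ 2)); [exact PQ2|].
  replace (Cmod (1 + Q * cos2 z 1 + RtoC (Q * Q)) / (1 + Q) ^ 2 * (1 + Q) ^ 2)
    with (Cmod (1 + Q * cos2 z 1 + RtoC (Q * Q))) by (field; lra).
  replace ((1 - A * (Q / (1 + Q) ^ 2)) * (1 + Q) ^ 2) with ((1 + Q) ^ 2 - A * Q) by (field; lra).
  replace (1 + Q * cos2 z 1 + RtoC (Q * Q))%C with (RtoC ((1 + Q) ^ 2) - (- RtoC Q) * (cos2 z 1 - 2))%C.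
  - pose proof (Cmod_triangle_inv (RtoC ((1 + Q) ^ 2)) ((- RtoC Q) * (cos2 z 1 - 2))) as T.
    rewrite Cmod_mult, Cmod_opp, !Cmod_R in T. rewrite (Rabs_pos_eq ((1 + Q) ^ 2)), (Rabs_pos_eq Q) in T by lra. nra.
  - replace ((1 + Q) ^ 2) with (1 + 2 * Q + Q * Q) by ring. rewrite !RtoC_plus, !RtoC_mult. ring.
Qed.

Lemma cos2_1 (z : C) : cos2 z 1 = (Cexp (Ci * RtoC (2 * PI) * z) + Cexp (- (Ci * RtoC (2 * PI) * z)))%C.
Proof. unfold cos2. simpl INR. rewrite Rmult_1_r. reflexivity. Qed.

(** The half-period 1/2 + τ of the lattice generated by 1 and 2τ. *)
Definition zero_pt : C := (/ 2, t).

Lemma tpfactor_factored (z : C) (m : nat) : tpfactor q (cos2 z) m =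
  ((1 + RtoC (q ^ (2 * m + 1)) * Cexp (Ci * RtoC (2 * PI) * z)) *
   (1 + RtoC (q ^ (2 * m + 1)) * Cexp (- (Ci * RtoC (2 * PI) * z))))%C.
Proof.
  unfold tpfactor. replace (4 * m + 2)%nat with ((2 * m + 1) + (2 * m + 1))%nat by lia.
  rewrite (pow_add q (2 * m + 1) (2 * m + 1)), cos2_1,
    (RtoC_mult (q ^ (2 * m + 1)) (q ^ (2 * m + 1))).
  pose proof (Cexp_opp_mult (Ci * RtoC (2 * PI) * z)) as E.
  set (a := Cexp (Ci * RtoC (2 * PI) * z)) in *. set (b := Cexp (- (Ci * RtoC (2 * PI) * z))) in *.
  transitivity (1 + RtoC (q ^ (2 * m + 1)) * (a + b) + RtoC (q ^ (2 * m + 1)) * RtoC (q ^ (2 * m + 1)) * (a * b))%C;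
    [rewrite E|]; ring.
Qed.

Lemma PI_neq_0' : PI <> 0.
Proof. pose proof PI_RGT_0; lra. Qed.

Lemma factor_zero_lattice (z : C) (x : R) :
  (1 + RtoC (exp x) * Cexp (Ci * RtoC (2 * PI) * z))%C = 0 ->
  exists k : Z, z = (IZR k + / 2, x / (2 * PI)).
Proof.
  intros H.
  (* Writing -1 as exp(iπ) turns the vanishing factor into a period of the exponential. *)
  assert (E : Cexp (RtoC x + Ci * RtoC (2 * PI) * z + Ci * RtoC (PI * INR 1)) = 1).
  { rewrite !Cexp_plus, Cexp_RtoC, Cexp_PI_n.
    transitivity (1 - (1 + RtoC (exp x) * Cexp (Ci * RtoC (2 * PI) * z)))%C; [simpl; Ceq; ring|].
    rewrite H. ring. }
  apply Cexp_eq_1 in E. destruct E as [k Hk]. exists (k - 1)%Z.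
  destruct z as [a b]. rewrite minus_IZR.
  pose proof (f_equal fst Hk) as H1. pose proof (f_equal snd Hk) as H2.
  simpl in H1, H2. pose proof PI_neq_0'.
  f_equal.
  - apply (Rmult_eq_reg_l (2 * PI)); [|lra]. lra.
  - apply (Rmult_eq_reg_l (2 * PI)); [|lra].
    replace (2 * PI * (x / (2 * PI))) with x by (field; assumption). lra.
Qed.

Lemma tpfactor_zero (z : C) (m : nat) : tpfactor q (cos2 z) m = 0 ->
  in_lattice 1 (2 * tau) (z - zero_pt).
Proof.
  rewrite tpfactor_factored. intros H.
  assert (EQ : q ^ (2 * m + 1) = exp (INR (2 * m + 1) * - (2 * PI * t))).
  { rewrite exp_nat_pow. reflexivity. }
  rewrite EQ in H. pose proof PI_neq_0'.
  destruct (classic ((1 + RtoC (exp (INR (2 * m + 1) * - (2 * PI * t))) * Cexp (Ci * RtoC (2 * PI) * z))%C = 0)) as [H1|H1].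
  - apply factor_zero_lattice in H1. destruct H1 as [k ->].
    exists k, (- Z.of_nat m - 1)%Z. rewrite plus_INR, mult_INR, minus_IZR, opp_IZR, <- INR_IZR_INZ. simpl (INR _).
    unfold zero_pt, tau. Ceq; field; assumption.
  - destruct (classic ((1 + RtoC (exp (INR (2 * m + 1) * - (2 * PI * t))) * Cexp (- (Ci * RtoC (2 * PI) * z)))%C = 0)) as [H2|H2].
    + replace (- (Ci * RtoC (2 * PI) * z))%C with (Ci * RtoC (2 * PI) * - z)%C in H2 by ring.
      apply factor_zero_lattice in H2. destruct H2 as [k Hk].
      replace z with (- - z)%C by ring. rewrite Hk.
      exists (- k - 1)%Z, (Z.of_nat m)%Z. rewrite plus_INR, mult_INR, minus_IZR, opp_IZR, <- INR_IZR_INZ. simpl (INR _).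
      unfold zero_pt, tau. Ceq; field; assumption.
    + exfalso. revert H. apply Cmult_neq_0; assumption.
Qed.

(** All factors are nonzero, and since q^(2m+1) = q(q²)^m their defects decay geometrically with
    ratio q²; the partial products stay above some d > 0, hence so does the limit. *)
Lemma Theta_neq_0 (z : C) : ~ in_lattice 1 (2 * tau) (z - zero_pt) -> Theta t z <> 0.
Proof.
  intros Hz. pose proof nome_bounds as Hq.
  pose proof (Cmod_ge_0 (cos2 z 1 - 2)) as PA.
  destruct (rprod_lower (tpratio q (cos2 z)) (Cmod (cos2 z 1 - 2) * q) (q ^ 2)) as [d [Pd Hd]].
  - split; [apply pow_lt; lra | apply (qpow_lt_1 q Hq 1)].
  - apply Rmult_le_pos; lra.
  - intros m. unfold tpratio. apply Rdiv_lt_0_compat.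
    + apply Cmod_gt_0. intros E. apply Hz, (tpfactor_zero z m E).
    + apply pow_lt. pose proof (qpow_pos q Hq (2 * m + 1)); lra.
  - intros m. eapply Rle_trans; [|apply (tpratio_lower z m _ (Rle_refl _))].
    rewrite Rmult_assoc, <- pow_odd_split.
    pose proof (qpow_pos q Hq (2 * m + 1)) as PQ. set (Q := q ^ (2 * m + 1)) in *.
    assert (Q / (1 + Q) ^ 2 <= Q).
    { apply (Rmult_le_reg_r ((1 + Q) ^ 2)); [apply pow_lt; lra|].
      unfold Rdiv. rewrite Rmult_assoc, Rinv_l by (apply pow_nonzero; lra). nra. }
    nra.
  - pose proof (Theta_lower z d (fun N => Hd (S N))) as L.
    intros E. rewrite E, Cmod_0 in L. lra.
Qed.

Lemma Csin_0 : Csin 0 = 0.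
Proof.
  unfold Csin. replace (Ci * 0)%C with (RtoC 0) by ring. replace (- 0)%C with (RtoC 0) by ring.
  rewrite Cexp_0. unfold Cdiv. ring.
Qed.

(** Read off from θ1(0) = 0, which holds termwise because the sine vanishes. *)
Lemma Theta_zero_pt : Theta t zero_pt = 0.
Proof.
  pose proof (theta1_Theta t Ht 0) as E.
  assert (E0 : theta1 0 (2 * (0, t)) = 0).
  { unfold theta1. rewrite (CSeries_ext _ (fun _ => RtoC 0 * 0)%C).
    - rewrite CSeries_scal_R. ring.
    - intros k. rewrite Cmult_0_r, Csin_0. ring. }
  rewrite E0 in E.
  replace (0 + (0, t) + / 2)%C with zero_pt in E.
  - apply NNPP; intros N. symmetry in E. revert E.
    apply Cmult_neq_0; [apply Cmult_neq_0 | exact N]; [|apply Cexp_neq_0].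
    intros E. apply Ci_nz. replace Ci with (- - Ci)%C by ring. rewrite E. ring.
  - rewrite <- RtoC_inv by lra. unfold zero_pt. Ceq; ring.
Qed.

Lemma Cexp_zero_pt : Cexp (Ci * RtoC (2 * PI) * zero_pt) = RtoC (- q).
Proof.
  replace (Ci * RtoC (2 * PI) * zero_pt)%C with (Ci * RtoC (PI * INR 1) + RtoC (- (2 * PI * t)))%C
    by (unfold zero_pt; simpl INR; Ceq; field).
  rewrite Cexp_plus, Cexp_PI_n, Cexp_RtoC. fold q. rewrite <- RtoC_mult. f_equal. simpl; ring.
Qed.

Lemma cdf_cos2 (z : C) : cdf (fun w => cos2 w 1) z.
Proof. unfold cos2. auto 10 with cd. Qed.

(** Only the factor m = 0 vanishes at [zero_pt]. The remaining factors must be bounded below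
    uniformly in w, which a bound on |X - 2| over a small ball provides. *)
Lemma Theta_lower_near_zero : exists r d, 0 < r /\ 0 < d /\
  forall w, Cmod (w - zero_pt) < r -> d * Cmod (tpfactor q (cos2 w) 0) <= Cmod (Theta t w).
Proof.
  pose proof nome_bounds as Hq.
  set (b1 := q ^ 3 / (1 + q ^ 3) ^ 2).
  assert (P3 : 0 < q ^ 3) by (apply pow_lt; lra).
  assert (Pb : 0 < b1) by (unfold b1; apply Rdiv_lt_0_compat; [exact P3 | apply pow_lt; lra]).
  assert (E0 : Cmod (cos2 zero_pt 1 - 2) = (1 + q) ^ 2 / q).
  { rewrite cos2_1, Cexp_opp, Cexp_zero_pt, <- RtoC_inv by lra.
    rewrite <- RtoC_plus, <- RtoC_minus, Cmod_R, Rabs_left1.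
    - field. lra.
    - assert (0 < / q) by (apply Rinv_0_lt_compat; lra).
      replace (/ - q) with (- / q) by (field; lra). lra. }
  (* [b1] is the largest weight Q/(1 + Q)² among the factors m >= 1. At [zero_pt] one has |X - 2| =
     (1 + q)²/q, and the inequality reduces to q(1 + q) < 1 + q³, that is, (1 - q)²(1 + q) > 0. *)
  assert (L0 : (1 + q) ^ 2 / q < / b1).
  { unfold b1. replace (/ (q ^ 3 / (1 + q ^ 3) ^ 2)) with ((1 + q ^ 3) ^ 2 / q ^ 3) by (field; split; lra).
    apply (Rmult_lt_reg_r (q ^ 3)); [exact P3|].
    replace ((1 + q) ^ 2 / q * q ^ 3) with ((q * (1 + q)) ^ 2) by (field; lra).
    replace ((1 + q ^ 3) ^ 2 / q ^ 3 * q ^ 3) with ((1 + q ^ 3) ^ 2) by (field; lra).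
    assert (0 < (1 - q) ^ 2 * (1 + q)) by (apply Rmult_lt_0_compat; [apply pow_lt; lra | lra]).
    assert (q * (1 + q) < 1 + q ^ 3) by nra. assert (0 < q * (1 + q)) by nra.
    simpl. nra. }
  (* The midpoint leaves room both for moving w away from [zero_pt] and for keeping every factor
     with m >= 1 positive. *)
  set (A := ((1 + q) ^ 2 / q + / b1) / 2).
  assert (HA1 : (1 + q) ^ 2 / q < A) by (unfold A; lra).
  assert (HA2 : A * b1 < 1).
  { apply Rlt_le_trans with (/ b1 * b1); [apply Rmult_lt_compat_r; [exact Pb | unfold A; lra]|].
    rewrite Rinv_l; lra. }
  assert (PA : 0 < A).
  { eapply Rlt_trans; [|exact HA1]. apply Rdiv_lt_0_compat; [apply pow_lt; lra | lra]. }
  destruct (cdf_ccont _ _ (cdf_cos2 zero_pt) (A - (1 + q) ^ 2 / q) ltac:(lra)) as [r [Pr Hr]].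
  set (psi := fun m : nat => 1 - A * (q ^ (2 * S m + 1) / (1 + q ^ (2 * S m + 1)) ^ 2)).
  assert (Hb : forall m, 0 < q ^ (2 * S m + 1) / (1 + q ^ (2 * S m + 1)) ^ 2 <= b1).
  { intros m. pose proof (qpow_pos q Hq (2 * S m + 1)) as PQ.
    assert (HQ : q ^ (2 * S m + 1) <= q ^ 3).
    { replace (2 * S m + 1)%nat with (3 + 2 * m)%nat by lia. rewrite pow_add.
      pose proof (qpow_le_1 q Hq (2 * m)). pose proof (qpow_pos q Hq (2 * m)). nra. }
    pose proof (qpow_le_1 q Hq 3) as H31.
    set (Q := q ^ (2 * S m + 1)) in *. set (c := q ^ 3) in *.
    split; [apply Rdiv_lt_0_compat; [lra | apply pow_lt; lra]|].
    unfold b1. apply (Rmult_le_reg_r ((1 + Q) ^ 2 * (1 + c) ^ 2)).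
    { apply Rmult_lt_0_compat; apply pow_lt; lra. }
    replace (Q / (1 + Q) ^ 2 * ((1 + Q) ^ 2 * (1 + c) ^ 2)) with (Q * (1 + c) ^ 2) by (field; lra).
    replace (c / (1 + c) ^ 2 * ((1 + Q) ^ 2 * (1 + c) ^ 2)) with (c * (1 + Q) ^ 2) by (field; lra).
    (* This is the monotonicity of x/(1 + x)² on [0, 1]. *)
    assert (0 <= (c - Q) * (1 - Q * c)); [apply Rmult_le_pos; [lra | nra] | nra]. }
  destruct (rprod_lower psi (A * q ^ 3) (q ^ 2)) as [d [Pd Hd]].
  - split; [apply pow_lt; lra | apply (qpow_lt_1 q Hq 1)].
  - nra.
  - intros m. unfold psi. specialize (Hb m). nra.
  - intros m. unfold psi. specialize (Hb m).
    rewrite Rmult_assoc, <- pow_mult, <- pow_add. replace (3 + 2 * m)%nat with (2 * S m + 1)%nat by lia.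
    pose proof (qpow_pos q Hq (2 * S m + 1)) as PQ. set (Q := q ^ (2 * S m + 1)) in *.
    assert (Q / (1 + Q) ^ 2 <= Q).
    { apply (Rmult_le_reg_r ((1 + Q) ^ 2)); [apply pow_lt; lra|].
      unfold Rdiv. rewrite Rmult_assoc, Rinv_l by (apply pow_nonzero; lra). nra. }
    nra.
  - exists r, (d / (1 + q) ^ 2).
    assert (Pq2 : 0 < (1 + q) ^ 2) by (apply pow_lt; lra).
    split; [exact Pr|]. split; [apply Rdiv_lt_0_compat; lra|].
    intros w Hw. apply Theta_lower. intros N. rewrite rprod_first.
    replace (d / (1 + q) ^ 2 * Cmod (tpfactor q (cos2 w) 0)) with (tpratio q (cos2 w) 0 * d).
    2:{ unfold tpratio. simpl (2 * 0 + 1)%nat. rewrite pow_1. field. lra. }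
    apply Rmult_le_compat_l.
    { unfold tpratio. simpl (2 * 0 + 1)%nat. rewrite pow_1.
      apply Rdiv_le_0_compat; [apply Cmod_ge_0 | exact Pq2]. }
    eapply Rle_trans; [apply (Hd N)|]. apply rprod_le. intros m. split.
    + unfold psi. specialize (Hb m). nra.
    + unfold psi. apply tpratio_lower. specialize (Hr w Hw). simpl in Hr.
      replace (cos2 w 1 - 2)%C with ((cos2 w 1 - cos2 zero_pt 1) + (cos2 zero_pt 1 - 2))%C by ring.
      eapply Rle_trans; [apply Cmod_triangle|]. rewrite E0. lra.
Qed.

(** The theta series dominates a multiple of the first factor, which has a simple zero; a vanishing
    derivative would make the series o(h) at distance h. *)
Lemma Theta'_zero_pt : Theta' t zero_pt <> 0.
Proof.
  pose proof nome_bounds as Hq. intros E.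
  destruct Theta_lower_near_zero as (r & d & Pr & Pd & H).
  set (p := fun w => tpfactor q (cos2 w) 0).
  assert (Hp : exists l, cder p zero_pt l /\ l <> 0).
  (* At [zero_pt] the exponential exp(2πiz) equals -q, so E1 = 1 - q² is nonzero while E2 = 1 - q/q
     vanishes. *)
  { set (E1 := fun w => (1 + RtoC q * Cexp (Ci * RtoC (2 * PI) * w))%C).
    set (E2 := fun w => (1 + RtoC q * Cexp ((- (Ci * RtoC (2 * PI))) * w))%C).
    assert (D : forall a w, cder (fun w => (1 + RtoC q * Cexp (a * w))%C) w (RtoC q * (Cexp (a * w) * a))%C).
    { intros a w.
      replace (RtoC q * (Cexp (a * w) * a))%C with
        (0 + (0 * Cexp (a * w) + RtoC q * (Cexp (a * w) * (0 * w + a * 1))))%C by ring.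
      apply (cder_plus (fun _ => 1)%C (fun w => RtoC q * Cexp (a * w))%C); [apply cder_const|].
      apply (cder_mult (fun _ => RtoC q) (fun w => Cexp (a * w))); [apply cder_const|].
      apply (cder_comp Cexp (fun w => (a * w)%C)); [apply cder_Cexp|].
      apply (cder_mult (fun _ => a) (fun w => w)); [apply cder_const | apply cder_id]. }
    pose proof (cder_mult E1 E2 zero_pt _ _ (D _ _) (D _ _)) as DM.
    assert (X1 : E2 zero_pt = 0).
    { unfold E2. replace (- (Ci * RtoC (2 * PI)) * zero_pt)%C with (- (Ci * RtoC (2 * PI) * zero_pt))%C by ring.
      rewrite Cexp_opp, Cexp_zero_pt, <- RtoC_inv, <- RtoC_mult, <- RtoC_plus by lra. f_equal. field. lra. }
    assert (X2 : E1 zero_pt <> 0).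
    { unfold E1. rewrite Cexp_zero_pt, <- RtoC_mult, <- RtoC_plus. intros X; apply RtoC_inj in X.
      assert (q * q < 1) by nra. lra. }
    eexists; split.
    - apply (cder_ext_loc (fun w => E1 w * E2 w)%C p zero_pt _ 1 Rlt_0_1); [|exact DM].
      intros w _. unfold E1, E2, p. rewrite tpfactor_factored. simpl (2 * 0 + 1)%nat. rewrite pow_1.
      replace (- (Ci * RtoC (2 * PI)) * w)%C with (- (Ci * RtoC (2 * PI) * w))%C by ring. reflexivity.
    - rewrite X1, Cmult_0_r, Cplus_0_l. repeat apply Cmult_neq_0.
      + exact X2.
      + intros X; apply RtoC_inj in X; lra.
      + apply Cexp_neq_0.
      + intros X. apply (f_equal snd) in X. simpl in X. pose proof PI_RGT_0. lra. }
  destruct Hp as [l [Hl Nl]]. apply Cmod_gt_0 in Nl.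
  assert (P0 : p zero_pt = 0).
  { unfold p. rewrite tpfactor_factored. simpl (2 * 0 + 1)%nat. rewrite pow_1.
    rewrite Cexp_opp, Cexp_zero_pt, <- RtoC_inv by lra.
    rewrite <- !RtoC_mult, <- !RtoC_plus, <- RtoC_mult. f_equal. field. lra. }
  destruct (Hl (Cmod l / 2) ltac:(lra)) as [r1 [Pr1 H1]].
  pose proof (cder_Theta t Ht zero_pt) as DT. rewrite E in DT.
  destruct (DT (d * Cmod l / 4)) as [r2 [Pr2 H2]]; [nra|].
  set (h := Rmin r (Rmin r1 r2) / 2).
  assert (Ph : 0 < h) by (unfold h; pose proof (Rmin_pos r (Rmin r1 r2) Pr (Rmin_pos _ _ Pr1 Pr2)); lra).
  assert (Hh : h < r /\ h < r1 /\ h < r2).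
  { unfold h in *. pose proof (Rmin_l r (Rmin r1 r2)); pose proof (Rmin_r r (Rmin r1 r2)).
    pose proof (Rmin_l r1 r2); pose proof (Rmin_r r1 r2). lra. }
  assert (Em : (zero_pt + RtoC h - zero_pt)%C = RtoC h) by ring.
  specialize (H (zero_pt + RtoC h)%C). specialize (H1 (zero_pt + RtoC h)%C). specialize (H2 (zero_pt + RtoC h)%C).
  rewrite Em, Cmod_R, Rabs_pos_eq in H, H1, H2 by lra.
  specialize (H ltac:(lra)). specialize (H1 ltac:(lra)). specialize (H2 ltac:(lra)).
  rewrite Theta_zero_pt in H2. rewrite P0 in H1. fold (p (zero_pt + RtoC h)%C) in H.
  replace (Theta t (zero_pt + RtoC h) - 0 - 0 * RtoC h)%C with (Theta t (zero_pt + RtoC h)) in H2 by ring.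
  assert (B : Cmod l / 2 * h <= Cmod (p (zero_pt + RtoC h)%C)).
  { pose proof (Cmod_triangle_inv (l * RtoC h) (l * RtoC h - p (zero_pt + RtoC h)%C)) as T.
    replace (l * RtoC h - (l * RtoC h - p (zero_pt + RtoC h)))%C with (p (zero_pt + RtoC h)%C) in T by ring.
    rewrite (Cmod_sub_sym (l * RtoC h)), Cmod_mult, Cmod_R, (Rabs_pos_eq h) in T by lra.
    replace (p (zero_pt + RtoC h) - 0 - l * RtoC h)%C with (p (zero_pt + RtoC h) - l * RtoC h)%C in H1 by ring.
    lra. }
  assert (d * (Cmod l / 2 * h) <= d * Cmod l / 4 * h) by nra.
  assert (0 < d * Cmod l * h) by (apply Rmult_lt_0_compat; [apply Rmult_lt_0_compat; lra | exact Ph]). lra.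
Qed.

Lemma Theta_zero_iff (z : C) : Theta t z = 0 <-> in_lattice 1 (2 * tau) (z - zero_pt).
Proof.
  split.
  - intros E. apply NNPP; intros N. exact (Theta_neq_0 z N E).
  - intros L. apply (lattice_invariant 1 (2 * tau) (fun z => Theta t z = 0)) with (z := zero_pt); [| |exact L|].
    + intros w. rewrite Theta_1 by exact Ht. tauto.
    + intros w. unfold tau. rewrite Theta_2tau by exact Ht. split; intros E.
      * rewrite E; ring.
      * apply NNPP; intros N. revert E. apply Cmult_neq_0; [apply Cexp_neq_0 | exact N].
    + apply Theta_zero_pt.
Qed.

End ThetaZeros.

(** * Elliptic functions with at most one simple pole *)

Definition hol (g : C -> C) (z : C) : Prop :=
  exists r, 0 < r /\ forall w, Cmod (w - z) < r -> cdf g w.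

Lemma hol_holo_at (g : C -> C) (z : C) : hol g z <-> holo_at g z.
Proof.
  split; intros [r [Pr H]]; exists r; (split; [exact Pr|]); intros w Hw; apply cdf_Cdiff, H, Hw.
Qed.

Lemma hol_cdf (g : C -> C) (z : C) : hol g z -> cdf g z.
Proof.
  intros [r [Pr H]]. apply H. replace (z - z)%C with (RtoC 0) by ring. rewrite Cmod_0; exact Pr.
Qed.

Lemma entire_hol (g : C -> C) (z : C) : (forall w, cdf g w) -> hol g z.
Proof. intros H; exists 1; split; [lra | auto]. Qed.

Lemma hol_mult (f g : C -> C) (z : C) : hol f z -> hol g z -> hol (fun w => f w * g w)%C z.
Proof.
  intros [r1 [P1 H1]] [r2 [P2 H2]]. exists (Rmin r1 r2); split; [apply Rmin_pos; lra|].
  intros w Hw. pose proof (Rmin_l r1 r2); pose proof (Rmin_r r1 r2).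
  apply cdf_mult; [apply H1 | apply H2]; lra.
Qed.

Lemma hol_plus (f g : C -> C) (z : C) : hol f z -> hol g z -> hol (fun w => f w + g w)%C z.
Proof.
  intros [r1 [P1 H1]] [r2 [P2 H2]]. exists (Rmin r1 r2); split; [apply Rmin_pos; lra|].
  intros w Hw. pose proof (Rmin_l r1 r2); pose proof (Rmin_r r1 r2).
  apply cdf_plus; [apply H1 | apply H2]; lra.
Qed.

Lemma hol_inv (g : C -> C) (z : C) : hol g z -> g z <> 0 -> hol (fun w => / g w)%C z.
Proof.
  intros Hg Nz. destruct (ccont_ball g z (cdf_ccont _ _ (hol_cdf _ _ Hg)) Nz) as [r1 [P1 H1]].
  destruct Hg as [r2 [P2 H2]]. exists (Rmin r1 r2); split; [apply Rmin_pos; lra|].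
  intros w Hw. pose proof (Rmin_l r1 r2); pose proof (Rmin_r r1 r2).
  apply cdf_inv; [apply H2 | apply H1]; lra.
Qed.

Lemma hol_shift (g : C -> C) (z l : C) : hol g (z + l) -> hol (fun w => g (w + l)%C) z.
Proof.
  intros [r [Pr H]]. exists r; split; [exact Pr|]. intros w Hw.
  apply (cdf_comp g (fun w => w + l)%C); [|auto with cd].
  apply H. replace (w + l - (z + l))%C with (w - z)%C by ring. exact Hw.
Qed.

Lemma hol_dq (g : C -> C) (a l : C) : hol g a -> cder g a l -> hol (dq g a l) a.
Proof.
  intros [r [Pr H]] Hl. exists r; split; [exact Pr|]. apply (dq_cdf g a l r Hl H).
Qed.

Lemma hol_ext_loc (f g : C -> C) (z : C) (r : R) : 0 < r ->
  (forall w, Cmod (w - z) < r -> f w = g w) -> hol f z -> hol g z.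
Proof.
  intros Pr E [r' [Pr' H]]. exists (Rmin r r'); split; [apply Rmin_pos; lra|].
  intros w Hw. pose proof (Rmin_l r r'); pose proof (Rmin_r r r').
  apply (cdf_ext_loc f g w (r - Cmod (w - z))); [lra| |apply H; lra].
  intros u Hu. apply E. pose proof (Cmod_sub_triangle u w z). lra.
Qed.

(** * Functions prescribed only off the grid, their gluing, and constancy of elliptic quotients *)

Section Elliptic.
Variable t : R.
Hypothesis Ht : 0 < t.
Let tau : C := (0, t).

(* A dense open set avoiding every jump line and every possible pole of the problem. *)
Definition offgrid (z : C) : Prop := forall k : Z, Im z <> IZR k * (t / 2).

Lemma offgrid_1 (z : C) : offgrid z <-> offgrid (z + 1).
Proof.
  unfold offgrid. replace (Im (z + 1)) with (Im z) by (simpl; unfold Im; ring). tauto.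
Qed.

Lemma offgrid_shift (z : C) (m : Z) : offgrid z <-> offgrid (z + IZR m * tau).
Proof.
  unfold offgrid. replace (Im (z + IZR m * tau)) with (Im z + IZR (2 * m) * (t / 2))
    by (rewrite mult_IZR; unfold tau, Im; simpl; field).
  split; intros H k E.
  - apply (H (k - 2 * m)%Z). rewrite minus_IZR. lra.
  - apply (H (k + 2 * m)%Z). rewrite plus_IZR. lra.
Qed.

Lemma offgrid_2tau (z : C) : offgrid z <-> offgrid (z + 2 * tau).
Proof. exact (offgrid_shift z 2). Qed.

Lemma offgrid_dense (z : C) (r : R) : 0 < r -> exists w, Cmod (w - z) < r /\ offgrid w.
Proof.
  (* Two candidates at heights h and 2h above z differ by less than the grid spacing t/2, so at most
     one of them lies on the grid. *)
  intros Pr. set (h := Rmin r (t / 2) / 3).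
  assert (Ph : 0 < h) by (unfold h; pose proof (Rmin_pos r (t / 2) Pr ltac:(lra)); lra).
  assert (H1 : 2 * h < r) by (unfold h in *; pose proof (Rmin_l r (t / 2)); lra).
  assert (H2 : h < t / 2) by (unfold h in *; pose proof (Rmin_r r (t / 2)); lra).
  assert (M : forall c, 0 < c < r -> Cmod (z + RtoC c * Ci - z) < r).
  { intros c Hc. replace (z + RtoC c * Ci - z)%C with (RtoC c * Ci)%C by ring.
    rewrite Cmod_mult, Cmod_R, Cmod_Ci, Rabs_pos_eq; lra. }
  assert (I : forall c, Im (z + RtoC c * Ci) = Im z + c) by (intros c; unfold Im; simpl; ring).
  destruct (classic (offgrid (z + RtoC h * Ci))) as [G|G].
  - exists (z + RtoC h * Ci)%C. split; [apply M; lra | exact G].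
  - exists (z + RtoC (2 * h) * Ci)%C. split; [apply M; lra|].
    apply not_all_ex_not in G. destruct G as [k Hk]. apply NNPP in Hk.
    intros j Hj. rewrite I in Hk, Hj.
    assert (E : h = IZR (j - k) * (t / 2)) by (rewrite minus_IZR; lra).
    assert (0 < IZR (j - k) < 1) as [A B] by (rewrite E in Ph, H2; split; nra).
    apply lt_IZR in A. apply lt_IZR in B. lia.
Qed.

Lemma offgrid_agree (f g : C -> C) (z : C) (r : R) : 0 < r -> ccont f z -> ccont g z ->
  (forall w, Cmod (w - z) < r -> offgrid w -> f w = g w) -> f z = g z.
Proof.
  intros Pr Hf Hg H. apply (ccont_eq_limit f g z Hf Hg). intros r' Pr'.
  destruct (offgrid_dense z (Rmin r r')) as [w [Hw Uw]]; [apply Rmin_pos; lra|].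
  pose proof (Rmin_l r r'); pose proof (Rmin_r r r').
  exists w. split; [lra | apply H; [lra | exact Uw]].
Qed.

(** Holomorphic at z after a change of values on the grid. This is the right notion for solutions
    whose values on jump lines and at poles are arbitrary. *)
Definition reg (v : C -> C) (z : C) : Prop :=
  exists g r, 0 < r /\ (forall w, Cmod (w - z) < r -> cdf g w) /\
    forall w, Cmod (w - z) < r -> offgrid w -> v w = g w.

Lemma hol_reg (g : C -> C) (z : C) : hol g z -> reg g z.
Proof. intros [r [Pr H]]; exists g, r; auto. Qed.

Lemma reg_ext (u v : C -> C) (z : C) (r : R) : 0 < r ->
  (forall w, Cmod (w - z) < r -> offgrid w -> u w = v w) -> reg u z -> reg v z.
Proof.
  intros Pr E (g & r' & Pr' & H1 & H2). exists g, (Rmin r r').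
  pose proof (Rmin_l r r'); pose proof (Rmin_r r r').
  split; [apply Rmin_pos; lra|]. split; intros w Hw; [apply H1; lra|].
  intros Uw. rewrite <- E by (assumption || lra). apply H2; [lra | exact Uw].
Qed.

Lemma reg_mult (u v : C -> C) (z : C) : reg u z -> reg v z -> reg (fun w => u w * v w)%C z.
Proof.
  intros (g1 & r1 & P1 & H1 & E1) (g2 & r2 & P2 & H2 & E2).
  exists (fun w => g1 w * g2 w)%C, (Rmin r1 r2).
  pose proof (Rmin_l r1 r2); pose proof (Rmin_r r1 r2).
  split; [apply Rmin_pos; lra|]. split; intros w Hw.
  - apply cdf_mult; [apply H1 | apply H2]; lra.
  - intros Uw. rewrite E1, E2 by (assumption || lra). reflexivity.
Qed.

Lemma reg_shift (v : C -> C) (z l : C) : (forall w, offgrid w <-> offgrid (w + l)) ->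
  reg v (z + l) -> reg (fun w => v (w + l)%C) z.
Proof.
  intros HU (g & r & Pr & H & E). exists (fun w => g (w + l)%C), r.
  assert (M : forall w, Cmod (w - z) < r -> Cmod (w + l - (z + l)) < r).
  { intros w Hw. replace (w + l - (z + l))%C with (w - z)%C by ring. exact Hw. }
  split; [exact Pr|]. split; intros w Hw.
  - apply (cdf_comp g (fun w => w + l)%C); [apply H, M, Hw | auto with cd].
  - intros Uw. apply E; [apply M, Hw | exact (proj1 (HU w) Uw)].
Qed.

Lemma reg_shift_iff (v : C -> C) (z l : C) : (forall w, offgrid w <-> offgrid (w + l)) ->
  (reg v (z + l) <-> reg (fun w => v (w + l)%C) z).
Proof.
  intros HU. split; [apply reg_shift, HU|]. intros H.
  assert (HU' : forall w, offgrid w <-> offgrid (w + - l)).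
  { intros w. rewrite (HU (w + - l)%C). replace (w + - l + l)%C with w by ring. tauto. }
  apply (reg_ext (fun w => v (w + - l + l)%C) v (z + l) 1 Rlt_0_1).
  - intros w _ _. f_equal; ring.
  - apply (reg_shift (fun w => v (w + l)%C) (z + l) (- l) HU').
    replace (z + l + - l)%C with z by ring. exact H.
Qed.

Lemma reg_scal_iff (v : C -> C) (c z : C) : c <> 0 -> (reg v z <-> reg (fun w => c * v w)%C z).
Proof.
  intros Hc. split; intros H.
  - apply reg_mult; [apply hol_reg, entire_hol; auto with cd | exact H].
  - apply (reg_ext (fun w => / c * (c * v w))%C v z 1 Rlt_0_1).
    + intros w _ _. field. exact Hc.
    + apply (reg_mult (fun _ => / c)%C (fun w => c * v w)%C); [apply hol_reg, entire_hol; auto with cd | exact H].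
Qed.

(** V(z) is the value at z of a germ chosen for z. Near z the germs chosen at other points agree
    with it, since they coincide on a dense set and are continuous. *)
Lemma glue (v : C -> C) : exists V : C -> C, forall z, reg v z -> cdf V z /\ (offgrid z -> V z = v z).
Proof.
  assert (H : forall z, exists g : C -> C, reg v z -> exists r, 0 < r /\
    (forall w, Cmod (w - z) < r -> cdf g w) /\ forall w, Cmod (w - z) < r -> offgrid w -> v w = g w).
  { intros z. destruct (classic (reg v z)) as [(g & H)|N]; [exists g; auto | exists v; tauto]. }
  set (G := fun z => proj1_sig (constructive_indefinite_description _ (H z))).
  assert (HG : forall z, reg v z -> exists r, 0 < r /\
    (forall w, Cmod (w - z) < r -> cdf (G z) w) /\ forall w, Cmod (w - z) < r -> offgrid w -> v w = G z w).
  { intros z. exact (proj2_sig (constructive_indefinite_description _ (H z))). }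
  exists (fun z => G z z). intros z Rz.
  destruct (HG z Rz) as (r & Pr & H1 & H2).
  assert (Z0 : Cmod (z - z) < r) by (replace (z - z)%C with (RtoC 0) by ring; rewrite Cmod_0; exact Pr).
  split.
  - apply (cdf_ext_loc (G z) _ z r Pr); [|apply H1, Z0]. intros w Hw.
    assert (Rw : reg v w).
    { exists (G z), (r - Cmod (w - z)). split; [lra|].
      assert (M : forall u, Cmod (u - w) < r - Cmod (w - z) -> Cmod (u - z) < r).
      { intros u Hu. pose proof (Cmod_sub_triangle u w z). lra. }
      split; intros u Hu; [apply H1, M, Hu | apply H2, M, Hu]. }
    destruct (HG w Rw) as (r' & Pr' & H1' & H2').
    apply (offgrid_agree (G z) (G w) w (Rmin r' (r - Cmod (w - z)))).
    + apply Rmin_pos; lra.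
    + apply cdf_ccont, H1, Hw.
    + apply cdf_ccont, H1'. replace (w - w)%C with (RtoC 0) by ring. rewrite Cmod_0; exact Pr'.
    + intros u Hu Uu. pose proof (Rmin_l r' (r - Cmod (w - z))). pose proof (Rmin_r r' (r - Cmod (w - z))).
      pose proof (Cmod_sub_triangle u w z).
      rewrite <- H2, <- H2' by (assumption || lra). reflexivity.
  - intros Uz. symmetry. apply H2; assumption.
Qed.

Lemma glue_periodic (v V : C -> C) (l : C) :
  (forall w, offgrid w <-> offgrid (w + l)) -> (forall w, offgrid w -> v (w + l)%C = v w) ->
  (forall z, reg v z -> cdf V z /\ (offgrid z -> V z = v z)) ->
  forall z, reg v z -> V (z + l)%C = V z.
Proof.
  intros HU Hp HV z Rz.
  assert (Rl : reg v (z + l)%C).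
  { apply reg_shift_iff; [exact HU|]. apply (reg_ext v _ z 1 Rlt_0_1); [|exact Rz].
    intros w _ Uw. symmetry; apply Hp, Uw. }
  assert (Near : exists r, 0 < r /\ forall w, Cmod (w - z) < r -> reg v w).
  { destruct Rz as (g & r & Pr & H1 & H2). exists r; split; [exact Pr|]. intros w Hw.
    exists g, (r - Cmod (w - z)). split; [lra|].
    split; intros u Hu; [apply H1 | apply H2]; pose proof (Cmod_sub_triangle u w z); lra. }
  destruct Near as (r & Pr & Near).
  apply (offgrid_agree (fun w => V (w + l)%C) V z r Pr).
  - apply cdf_ccont, (cdf_comp V (fun w => w + l)%C); [apply HV, Rl | auto with cd].
  - apply cdf_ccont, HV, Rz.
  - intros w Hw Uw. specialize (Near w Hw).
    assert (Rwl : reg v (w + l)%C).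
    { apply reg_shift_iff; [exact HU|]. apply (reg_ext v _ w 1 Rlt_0_1); [|exact Near].
      intros u _ Uu. symmetry; apply Hp, Uu. }
    rewrite (proj2 (HV _ Rwl) (proj1 (HU w) Uw)), (proj2 (HV _ Near) Uw). apply Hp, Uw.
Qed.

Lemma cell_representative (z : C) : exists x y, 0 <= x <= 1 /\ 0 <= y <= 2 * t /\
  in_lattice 1 (2 * tau) ((x, y) - z).
Proof.
  destruct z as [a b].
  exists (a - IZR (Int_part a)), (b - IZR (Int_part (b / (2 * t))) * (2 * t)).
  destruct (base_Int_part a) as [A1 A2]. destruct (base_Int_part (b / (2 * t))) as [B1 B2].
  split; [lra|]. split.
  - set (k := IZR (Int_part (b / (2 * t)))) in *.
    replace b with (b / (2 * t) * (2 * t)) by (field; lra).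
    replace (b / (2 * t) * (2 * t) / (2 * t)) with (b / (2 * t)) by (field; lra). fold k. nra.
  - exists (- Int_part a)%Z, (- Int_part (b / (2 * t)))%Z. rewrite !opp_IZR. unfold tau. Ceq; ring.
Qed.

Lemma elliptic_regular_const (v : C -> C) :
  (forall z, offgrid z -> v (z + 1)%C = v z /\ v (z + 2 * tau)%C = v z) ->
  (forall z, reg v z) -> exists c, forall z, offgrid z -> v z = c.
Proof.
  intros Hp Hr. destruct (glue v) as [V HV].
  assert (V1 : forall z, V (z + 1)%C = V z).
  { intros z. apply (glue_periodic v V 1 offgrid_1); auto. intros w Uw; apply Hp, Uw. }
  assert (V2 : forall z, V (z + 2 * tau)%C = V z).
  { intros z. apply (glue_periodic v V (2 * tau) offgrid_2tau); auto. intros w Uw; apply Hp, Uw. }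
  assert (D : forall z, cdf V z) by (intros z; apply HV, Hr).
  destruct (rcont_bounded V 0 1 0 (2 * t)) as [M [PM HM]]; try lra.
  { intros x y _ _; apply cdf_ccont, D. }
  exists (V 0). intros z Uz. rewrite <- (proj2 (HV z (Hr z)) Uz).
  apply (Liouville V M D). intros w.
  destruct (cell_representative w) as (x & y & Hx & Hy & L).
  apply (lattice_invariant 1 (2 * tau) (fun u => Cmod (V u) <= M)) with (w := (x, y)).
  - intros u; rewrite V1; tauto.
  - intros u; rewrite V2; tauto.
  - exact L.
  - apply HM; assumption.
Qed.

(** The boundary integral over a period cell around e vanishes by periodicity, and also equals the
    residue times a nonzero index integral. *)
Theorem elliptic_simple_pole_const (v : C -> C) (e : C) : ~ offgrid e ->
  (forall z, offgrid z -> v (z + 1)%C = v z /\ v (z + 2 * tau)%C = v z) ->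
  (forall z, ~ in_lattice 1 (2 * tau) (z - e) -> reg v z) ->
  reg (fun z => (z - e) * v z)%C e ->
  exists c, forall z, offgrid z -> v z = c.
Proof.
  intros Ne Hp Hr (g & r & Pr & Hg & Eg).
  assert (Z0 : Cmod (e - e) < r) by (replace (e - e)%C with (RtoC 0) by ring; rewrite Cmod_0; exact Pr).
  destruct (Hg e Z0) as [l Hl].
  assert (Hdq : forall w, Cmod (w - e) < r -> cdf (dq g e l) w) by (apply (dq_cdf g e l r Hl Hg)).
  assert (Nu : forall w, offgrid w -> w <> e) by (intros w Uw ->; exact (Ne Uw)).
  assert (V0 : forall w, Cmod (w - e) < r -> offgrid w -> v w = (dq g e l w + g e * / (w - e))%C).
  { intros w Hw Uw. pose proof (Nu w Uw) as N. rewrite dq_neq by exact N.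
    rewrite <- (Eg w Hw Uw). field. apply Csub_neq_0, N. }
  assert (G0 : g e = 0).
  (* Centering the cell at e keeps all other translates of e outside the closed rectangle. *)
  { set (x1 := Re e - / 2). set (x2 := Re e + / 2). set (y1 := Im e - t). set (y2 := Im e + t).
    set (W := fun z => (v z + (- g e) * / (z - e))%C).
    assert (Ncell : forall x y, x1 <= x <= x2 -> y1 <= y <= y2 -> (x, y) <> e ->
       ~ in_lattice 1 (2 * tau) ((x, y) - e)).
    { intros x y Hx Hy N [a [b E]]. apply N. destruct e as [ex ey]. unfold x1, x2, y1, y2, tau in *.
      pose proof (f_equal fst E) as E1. pose proof (f_equal snd E) as E2. simpl in E1, E2, Hx, Hy.
      assert (A : -1 < IZR a < 1) by lra. assert (B : -1 < IZR b < 1) by nra.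
      destruct A as [A1 A2], B as [B1 B2]. apply lt_IZR in A1, A2, B1, B2.
      assert (a = 0)%Z by lia. assert (b = 0)%Z by lia. subst. f_equal; lra. }
    assert (RW : forall x y, x1 <= x <= x2 -> y1 <= y <= y2 -> reg W (x, y)).
    { intros x y Hx Hy. destruct (classic ((x, y) = e)) as [->|N].
      - exists (dq g e l), r. split; [exact Pr|]. split; [exact Hdq|].
        intros w Hw Uw. unfold W. rewrite (V0 w Hw Uw). ring.
      - destruct (Hr (x, y) (Ncell x y Hx Hy N)) as (k & r' & Pr' & Hk & Ek).
        pose proof (Cmod_sub_pos _ _ N) as PN.
        exists (fun z => k z + (- g e) * / (z - e))%C, (Rmin r' (Cmod ((x, y) - e))).
        pose proof (Rmin_l r' (Cmod ((x, y) - e))). pose proof (Rmin_r r' (Cmod ((x, y) - e))).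
        split; [apply Rmin_pos; lra|]. split; intros w Hw.
        + apply cdf_plus; [apply Hk; lra|]. apply cdf_mult; [apply cdf_const|]. apply cdf_sub_inv.
          intros ->. rewrite Cmod_sub_sym in Hw. lra.
        + intros Uw. unfold W. rewrite (Ek w) by (assumption || lra). reflexivity. }
    destruct (glue W) as [Q HQ]. destruct (glue v) as [V HV].
    assert (ZQ : Rect Q x1 x2 y1 y2 = 0).
    { apply Goursat; try (unfold x1, x2, y1, y2; lra). intros x y Hx Hy. apply HQ, RW; assumption. }
    assert (Nb : forall x y, x1 <= x <= x2 -> y1 <= y <= y2 ->
      (x = x1 \/ x = x2 \/ y = y1 \/ y = y2) -> (x, y) <> e).
    { intros x y _ _ Hb E. destruct e as [ex ey]. injection E as -> ->. unfold x1, x2, y1, y2 in Hb. simpl in Hb. lra. }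
    assert (Rv : forall x y, x1 <= x <= x2 -> y1 <= y <= y2 ->
      (x = x1 \/ x = x2 \/ y = y1 \/ y = y2) -> reg v (x, y)).
    { intros x y Hx Hy Hb. apply Hr, Ncell; auto. }
    assert (BV : bcont V x1 x2 y1 y2).
    { intros x y Hx Hy Hb. apply cdf_ccont, HV, Rv; auto. }
    assert (BI : bcont (fun z => / (z - e))%C x1 x2 y1 y2).
    { intros x y Hx Hy Hb. apply cdf_ccont, cdf_sub_inv, Nb; auto. }
    rewrite (Rect_ext Q (fun z => V z + (- g e) * / (z - e))%C) in ZQ; try (unfold x1, x2, y1, y2; lra).
    (* Q and V come from separate gluings; on the boundary they are compared through their common
       values off the grid and continuity. *)
    2:{ intros x y Hx Hy Hb.
      pose proof (Nb x y Hx Hy Hb) as N. pose proof (Rv x y Hx Hy Hb) as R1. pose proof (RW x y Hx Hy) as R2.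
      assert (S : forall u z, reg u z -> exists r, 0 < r /\ forall w, Cmod (w - z) < r -> reg u w).
      { intros u z (k & r' & Pr' & H1 & H2). exists r'; split; [exact Pr'|]. intros w Hw.
        exists k, (r' - Cmod (w - z)). split; [lra|].
        split; intros a Ha; [apply H1 | apply H2]; pose proof (Cmod_sub_triangle a w z); lra. }
      destruct (S _ _ R1) as (s1 & Ps1 & S1). destruct (S _ _ R2) as (s2 & Ps2 & S2).
      apply (offgrid_agree Q (fun z => V z + (- g e) * / (z - e))%C (x, y) (Rmin s1 s2)); [apply Rmin_pos; lra | | |].
      - apply cdf_ccont, HQ, R2.
      - apply cdf_ccont, cdf_plus; [apply HV, R1|]. apply cdf_mult; [apply cdf_const | apply cdf_sub_inv, N].
      - intros w Hw Uw. pose proof (Rmin_l s1 s2); pose proof (Rmin_r s1 s2).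
        rewrite (proj2 (HQ w (S2 w ltac:(lra))) Uw), (proj2 (HV w (S1 w ltac:(lra))) Uw). reflexivity. }
    rewrite (Rect_plus V (fun z => (- g e) * / (z - e))%C) in ZQ; try (unfold x1, x2, y1, y2; lra); auto.
    2:{ intros x y Hx Hy Hb. apply ccont_mult; [apply ccont_const | apply BI; auto]. }
    rewrite (Rect_scal (- g e) (fun z => / (z - e))%C) in ZQ; try (unfold x1, x2, y1, y2; lra); auto.
    fold (wind x1 x2 y1 y2 e) in ZQ.
    assert (PV : Rect V x1 x2 y1 y2 = 0).
    { unfold Rect.
      rewrite (CInt_ext (fun x => V (x, y2)) (fun x => V (x, y1))); [|unfold x1, x2; lra|].
      2:{ intros x Hx. replace (x, y2) with ((x, y1) + 2 * tau)%C by (unfold y1, y2, tau; Ceq; ring).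
        apply (glue_periodic v V (2 * tau) offgrid_2tau); auto.
        - intros w Uw; apply Hp, Uw.
        - apply Rv; auto. unfold y1, y2; lra. }
      rewrite (CInt_ext (fun y => V (x2, y)) (fun y => V (x1, y))); [|unfold y1, y2; lra|].
      2:{ intros y Hy. replace (x2, y) with ((x1, y) + 1)%C by (unfold x1, x2; Ceq; field).
        apply (glue_periodic v V 1 offgrid_1); auto.
        - intros w Uw; apply Hp, Uw.
        - apply Rv; auto. unfold x1, x2; lra. }
      ring. }
    rewrite PV, Cplus_0_l in ZQ.
    apply NNPP; intros N. revert ZQ. apply Cmult_neq_0.
    - intros E. apply N. replace (g e) with (- - g e)%C by ring. rewrite E; ring.
    - apply wind_neq_0; unfold x1, x2, y1, y2; lra. }
  assert (Re_ : reg v e).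
  { exists (dq g e l), r. split; [exact Pr|]. split; [exact Hdq|].
    intros w Hw Uw. rewrite (V0 w Hw Uw), G0. ring. }
  apply elliptic_regular_const; [exact Hp|]. intros z.
  destruct (classic (in_lattice 1 (2 * tau) (z - e))) as [L|L]; [|apply Hr, L].
  assert (Inv : forall l, (forall w, offgrid w <-> offgrid (w + l)) ->
     (forall w, offgrid w -> v (w + l)%C = v w) -> forall z, reg v z <-> reg v (z + l)%C).
  { intros p HU Hv w. rewrite (reg_shift_iff v w p HU).
    split; apply reg_ext with (r := 1); try lra; intros u _ Uu; [symmetry|]; apply Hv, Uu. }
  apply (lattice_invariant 1 (2 * tau) (reg v)) with (z := e); auto.
  - apply Inv; [apply offgrid_1 | intros w Uw; apply Hp, Uw].
  - apply Inv; [apply offgrid_2tau | intros w Uw; apply Hp, Uw].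
Qed.

End Elliptic.

(** * The four theta functions *)

Lemma Cinv_0 : (/ 0)%C = 0.
Proof. unfold Cinv, RtoC; simpl. f_equal; unfold Rdiv; ring. Qed.

Lemma in_lattice_add (l1 l2 z w : C) : in_lattice l1 l2 z -> in_lattice l1 l2 w -> in_lattice l1 l2 (z + w).
Proof.
  intros [a [b ->]] [c [d ->]]. exists (a + c)%Z, (b + d)%Z. rewrite !plus_IZR, !RtoC_plus. ring.
Qed.

(** Half-periods: [hpt 0] is a zero of θ2 and [hpt t] a zero of θ3. *)
Definition hpt (y : R) : C := (/ 2, y).

Section ThetaFunctions.
Variable t : R.
Hypothesis Ht : 0 < t.
Let tau : C := (0, t).
Let L (z : C) : Prop := in_lattice 1 (2 * tau) z.

Lemma lattice_coords (z : C) : in_lattice 1 (2 * (0, t)) z ->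
  exists a b : Z, Re z = IZR a /\ Im z = IZR b * (2 * t).
Proof. intros [a [b ->]]. exists a, b. unfold Re, Im; simpl. split; ring. Qed.

Lemma offgrid_not_lattice (z b : C) (k : Z) : offgrid t z -> Im b = IZR k * (t / 2) ->
  ~ in_lattice 1 (2 * (0, t)) (z - b).
Proof.
  intros U Hb HL. apply lattice_coords in HL. destruct HL as (m & j & _ & E).
  apply (U (k + 4 * j)%Z). rewrite Im_minus, Hb in E. rewrite plus_IZR, mult_IZR. lra.
Qed.

Lemma th1_Theta (p : C) : th1 tau p =
  (- Ci * Cexp (RtoC (- (PI * t / 2)) + Ci * PI * p) * Theta t (p + (tau + / 2)))%C.
Proof. unfold th1, tau. rewrite theta1_Theta by exact Ht. do 2 f_equal. ring. Qed.
Lemma th2_Theta (p : C) : th2 tau p =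
  (Cexp (RtoC (- (PI * t / 2)) + Ci * PI * p) * Theta t (p + tau))%C.
Proof. unfold th2, tau. apply theta2_Theta, Ht. Qed.
Lemma th3_Theta (p : C) : th3 tau p = Theta t p.
Proof. unfold th3, tau. apply theta3_Theta, Ht. Qed.
Lemma th4_Theta (p : C) : th4 tau p = Theta t (p + / 2).
Proof. unfold th4, tau. apply theta4_Theta, Ht. Qed.

Lemma cdf_Theta (z : C) : cdf (Theta t) z.
Proof. eexists; apply cder_Theta, Ht. Qed.

Lemma cdf_ext (f g : C -> C) (z : C) : (forall w, f w = g w) -> cdf f z -> cdf g z.
Proof. intros E; apply (cdf_ext_loc f g z 1 Rlt_0_1); auto. Qed.

Lemma cdf_th1 (z : C) : cdf (th1 tau) z.
Proof.
  apply (cdf_ext _ _ _ (fun w => eq_sym (th1_Theta w))).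
  apply cdf_mult; [auto 10 with cd|]. apply (cdf_comp (Theta t)); [apply cdf_Theta | auto with cd].
Qed.
Lemma cdf_th2 (z : C) : cdf (th2 tau) z.
Proof.
  apply (cdf_ext _ _ _ (fun w => eq_sym (th2_Theta w))).
  apply cdf_mult; [auto 10 with cd|]. apply (cdf_comp (Theta t)); [apply cdf_Theta | auto with cd].
Qed.
Lemma cdf_th3 (z : C) : cdf (th3 tau) z.
Proof. apply (cdf_ext _ _ _ (fun w => eq_sym (th3_Theta w))), cdf_Theta. Qed.
Lemma cdf_th4 (z : C) : cdf (th4 tau) z.
Proof.
  apply (cdf_ext _ _ _ (fun w => eq_sym (th4_Theta w))).
  apply (cdf_comp (Theta t)); [apply cdf_Theta | auto with cd].
Qed.

Lemma Copp_Ci_neq_0 : (- Ci)%C <> 0.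
Proof. intros E. apply Ci_nz. replace Ci with (- - Ci)%C by ring. rewrite E. ring. Qed.

Lemma Cmult_eq_0_iff (a b : C) : a <> 0 -> ((a * b)%C = 0 <-> b = 0).
Proof.
  intros Ha. split; intros E; [|rewrite E; ring].
  apply NNPP; intros N. revert E. apply Cmult_neq_0; assumption.
Qed.

Lemma th1_zero (p : C) : th1 tau p = 0 <-> L p.
Proof.
  rewrite th1_Theta, Cmult_eq_0_iff, Theta_zero_iff by
    (exact Ht || (apply Cmult_neq_0; [apply Copp_Ci_neq_0 | apply Cexp_neq_0])).
  replace (p + (tau + / 2) - zero_pt t)%C with p; [tauto|].
  rewrite <- RtoC_inv by lra. unfold hpt, zero_pt, tau. destruct p; Ceq; ring.
Qed.
Lemma th2_zero (p : C) : th2 tau p = 0 <-> L (p - (hpt 0)).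
Proof.
  rewrite th2_Theta, Cmult_eq_0_iff, Theta_zero_iff by (exact Ht || apply Cexp_neq_0).
  replace (p + tau - zero_pt t)%C with (p - (hpt 0))%C; [tauto|].
  unfold hpt, zero_pt, tau. destruct p; Ceq; ring.
Qed.
Lemma th3_zero (p : C) : th3 tau p = 0 <-> L (p - (hpt t)).
Proof. rewrite th3_Theta, Theta_zero_iff by exact Ht. tauto. Qed.
Lemma th4_zero (p : C) : th4 tau p = 0 <-> L (p - tau).
Proof.
  rewrite th4_Theta, Theta_zero_iff by exact Ht.
  replace (p + / 2 - zero_pt t)%C with (p - tau)%C; [tauto|].
  rewrite <- RtoC_inv by lra. unfold hpt, zero_pt, tau. destruct p; Ceq; ring.
Qed.

(** Each theta function is a nowhere vanishing factor times a shifted series; at a zero of the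
    latter the product rule leaves only k(b) times its nonzero derivative. *)
Lemma cder_factor_Theta (F k : C -> C) (s b : C) :
  (forall w, F w = (k w * Theta t (w + s))%C) -> (forall w, cdf k w) -> k b <> 0 ->
  (b + s)%C = zero_pt t -> exists l : C, l <> 0 /\ cder F b l.
Proof.
  intros E Hk Nk Hb. destruct (Hk b) as [m Hm].
  exists (m * Theta t (b + s) + k b * (Theta' t (b + s) * (1 + 0)))%C. split.
  - rewrite Hb, (Theta_zero_pt t Ht), Cmult_0_r, Cplus_0_l.
    apply Cmult_neq_0; [exact Nk|]. rewrite Cplus_0_r, Cmult_1_r. apply Theta'_zero_pt, Ht.
  - apply (cder_ext_loc (fun w => k w * Theta t (w + s))%C F b _ 1 Rlt_0_1); [intros; symmetry; apply E|].
    apply (cder_mult k (fun w => Theta t (w + s)%C)); [exact Hm|]. apply (cder_comp (Theta t) (fun w => w + s)%C); [apply cder_Theta, Ht|].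
    apply (cder_plus (fun w => w) (fun _ => s)); [apply cder_id | apply cder_const].
Qed.

Lemma th1_simple : exists l : C, l <> 0 /\ cder (th1 tau) 0 l.
Proof.
  apply (cder_factor_Theta _ _ _ _ th1_Theta); [intros; auto 10 with cd | |].
  - apply Cmult_neq_0; [apply Copp_Ci_neq_0 | apply Cexp_neq_0].
  - rewrite <- RtoC_inv by lra. unfold hpt, zero_pt, tau. Ceq; ring.
Qed.
Lemma th2_simple : exists l : C, l <> 0 /\ cder (th2 tau) (hpt 0) l.
Proof.
  apply (cder_factor_Theta _ _ _ _ th2_Theta); [intros; auto 10 with cd | apply Cexp_neq_0 |].
  unfold hpt, zero_pt, tau. Ceq; ring.
Qed.
Lemma th3_simple : exists l : C, l <> 0 /\ cder (th3 tau) (hpt t) l.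
Proof.
  apply (cder_factor_Theta _ (fun _ => 1)%C 0).
  - intros w. rewrite th3_Theta, Cplus_0_r. ring.
  - auto with cd.
  - apply C1_nz.
  - unfold hpt, zero_pt. ring.
Qed.
Lemma th4_simple : exists l : C, l <> 0 /\ cder (th4 tau) tau l.
Proof.
  apply (cder_factor_Theta _ (fun _ => 1)%C (/ 2)).
  - intros w. rewrite th4_Theta. ring.
  - auto with cd.
  - apply C1_nz.
  - rewrite <- RtoC_inv by lra. unfold hpt, zero_pt, tau. Ceq; ring.
Qed.

Lemma Cexp_iPI : Cexp (Ci * PI) = RtoC (-1).
Proof.
  replace (Ci * PI)%C with (Ci * RtoC (PI * INR 1))%C by (simpl INR; rewrite Rmult_1_r; reflexivity).
  rewrite Cexp_PI_n. simpl. f_equal; ring.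
Qed.

Lemma Cexp_miPI : Cexp (- (Ci * PI)) = RtoC (-1).
Proof. rewrite Cexp_opp, Cexp_iPI, <- RtoC_inv by lra. f_equal; field. Qed.

Lemma th1_1 (p : C) : th1 tau (p + 1) = (- th1 tau p)%C.
Proof.
  rewrite !th1_Theta.
  replace (RtoC (- (PI * t / 2)) + Ci * PI * (p + 1))%C with (RtoC (- (PI * t / 2)) + Ci * PI * p + Ci * PI)%C by ring.
  replace (p + 1 + (tau + / 2))%C with (p + (tau + / 2) + 1)%C by ring.
  rewrite Theta_1, (Cexp_plus (_ + _)), Cexp_iPI by exact Ht. ring.
Qed.
Lemma th2_1 (p : C) : th2 tau (p + 1) = (- (1) * th2 tau p)%C.
Proof.
  rewrite !th2_Theta.
  replace (RtoC (- (PI * t / 2)) + Ci * PI * (p + 1))%C with (RtoC (- (PI * t / 2)) + Ci * PI * p + Ci * PI)%C by ring.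
  replace (p + 1 + tau)%C with (p + tau + 1)%C by ring.
  rewrite Theta_1, (Cexp_plus (_ + _)), Cexp_iPI by exact Ht. ring.
Qed.
Lemma th3_1 (p : C) : th3 tau (p + 1) = (1 * th3 tau p)%C.
Proof. rewrite !th3_Theta, Theta_1 by exact Ht. ring. Qed.
Lemma th4_1 (p : C) : th4 tau (p + 1) = (1 * th4 tau p)%C.
Proof.
  rewrite !th4_Theta. replace (p + 1 + / 2)%C with (p + / 2 + 1)%C by ring.
  rewrite Theta_1 by exact Ht. ring.
Qed.

Lemma mult2_shift (p s : C) : mult2 t (p + s) = (mult2 t p * Cexp (- (2 * Ci * PI * s)))%C.
Proof. unfold mult2. rewrite <- Cexp_plus. f_equal. ring. Qed.

Lemma mult2_neq_0 (p : C) : mult2 t p <> 0.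
Proof. apply Cexp_neq_0. Qed.

Lemma th1_2tau (p : C) : th1 tau (p + 2 * tau) = (- (mult2 t p * th1 tau p))%C.
Proof.
  rewrite !th1_Theta.
  replace (p + 2 * tau + (tau + / 2))%C with (p + (tau + / 2) + 2 * tau)%C by ring.
  unfold tau. rewrite Theta_2tau, mult2_shift by exact Ht. fold tau.
  replace (RtoC (- (PI * t / 2)) + Ci * PI * (p + 2 * tau))%C
    with (RtoC (- (PI * t / 2)) + Ci * PI * p + 2 * Ci * PI * tau)%C by ring.
  rewrite (Cexp_plus (_ + _)).
  replace (Cexp (- (2 * Ci * PI * (tau + / 2)))) with (- Cexp (- (2 * Ci * PI * tau)))%C.
  - pose proof (Cexp_opp_mult (2 * Ci * PI * tau)) as E.
    transitivity (- Ci * Cexp (RtoC (- (PI * t / 2)) + Ci * PI * p) * mult2 t p * Theta t (p + (tau + / 2)) *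
      - (Cexp (2 * Ci * PI * tau) * Cexp (- (2 * Ci * PI * tau))))%C; [ring|]. rewrite E. ring.
  - replace (- (2 * Ci * PI * (tau + / 2)))%C with (- (2 * Ci * PI * tau) + - (Ci * PI))%C by field.
    rewrite Cexp_plus, Cexp_miPI. ring.
Qed.
Lemma th2_2tau (p : C) : th2 tau (p + 2 * tau) = (mult2 t p * th2 tau p)%C.
Proof.
  rewrite !th2_Theta.
  replace (p + 2 * tau + tau)%C with (p + tau + 2 * tau)%C by ring.
  unfold tau. rewrite Theta_2tau, mult2_shift by exact Ht. fold tau.
  replace (RtoC (- (PI * t / 2)) + Ci * PI * (p + 2 * tau))%C
    with (RtoC (- (PI * t / 2)) + Ci * PI * p + 2 * Ci * PI * tau)%C by ring.
  rewrite (Cexp_plus (_ + _)).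
  pose proof (Cexp_opp_mult (2 * Ci * PI * tau)) as E.
  transitivity (Cexp (RtoC (- (PI * t / 2)) + Ci * PI * p) * mult2 t p * Theta t (p + tau) *
      (Cexp (2 * Ci * PI * tau) * Cexp (- (2 * Ci * PI * tau))))%C; [ring|]. rewrite E. ring.
Qed.
Lemma th3_2tau (p : C) : th3 tau (p + 2 * tau) = (mult2 t p * th3 tau p)%C.
Proof. rewrite !th3_Theta. apply Theta_2tau, Ht. Qed.
Lemma th4_2tau (p : C) : th4 tau (p + 2 * tau) = (- (mult2 t p * th4 tau p))%C.
Proof.
  rewrite !th4_Theta. replace (p + 2 * tau + / 2)%C with (p + / 2 + 2 * tau)%C by ring.
  unfold tau. rewrite Theta_2tau, mult2_shift by exact Ht.
  replace (- (2 * Ci * PI * / 2))%C with (- (Ci * PI))%C by field. rewrite Cexp_miPI. ring.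
Qed.

Lemma Csin_opp (z : C) : Csin (- z) = (- Csin z)%C.
Proof.
  unfold Csin. replace (Ci * - z)%C with (- (Ci * z))%C by ring.
  replace (- - (Ci * z))%C with (Ci * z)%C by ring. field. apply Ci_nz.
Qed.

Lemma th1_opp (p : C) : th1 tau (- p) = (- th1 tau p)%C.
Proof.
  unfold th1, theta1. rewrite (CSeries_ext _ (fun k => RtoC (-1) *
    (RtoC ((-1) ^ k) * qhalf (2 * tau) k * Csin (RtoC (2 * INR k + 1) * PI * p)))%C).
  - rewrite CSeries_scal_R. ring.
  - intros k. replace (RtoC (2 * INR k + 1) * PI * - p)%C with (- (RtoC (2 * INR k + 1) * PI * p))%C by ring.
    rewrite Csin_opp. ring.
Qed.

(* Half-period shifts: [tau] is half of the period [2 * tau] of these theta functions. *)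
Definition halfmult (p : C) : C := Cexp (RtoC (PI * t / 2) - Ci * PI * p).

Lemma halfmult_inv (p : C) : (halfmult p * Cexp (RtoC (- (PI * t / 2)) + Ci * PI * p))%C = 1.
Proof.
  unfold halfmult. rewrite <- Cexp_plus, RtoC_opp.
  replace (RtoC (PI * t / 2) - Ci * PI * p + (- RtoC (PI * t / 2) + Ci * PI * p))%C with (RtoC 0) by ring.
  apply Cexp_0.
Qed.

Lemma th3_tau (p : C) : th3 tau (p + tau) = (halfmult p * th2 tau p)%C.
Proof.
  rewrite th3_Theta, th2_Theta, Cmult_assoc, halfmult_inv. ring.
Qed.
Lemma th4_tau (p : C) : th4 tau (p + tau) = (Ci * halfmult p * th1 tau p)%C.
Proof.
  rewrite th4_Theta, th1_Theta.
  transitivity (- (Ci * Ci) * (halfmult p * Cexp (RtoC (- (PI * t / 2)) + Ci * PI * p)) * Theta t (p + (tau + / 2)))%C; [|ring].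
  rewrite halfmult_inv, Ci_sqr. replace (p + tau + / 2)%C with (p + (tau + / 2))%C by ring. ring.
Qed.
Lemma th2_tau (p : C) : th2 tau (p + tau) = (halfmult p * th3 tau p)%C.
Proof.
  rewrite th3_Theta, th2_Theta.
  replace (p + tau + tau)%C with (p + 2 * tau)%C by ring. unfold tau. rewrite Theta_2tau by exact Ht.
  rewrite Cmult_assoc. f_equal. unfold mult2, halfmult. rewrite <- Cexp_plus. f_equal.
  destruct p; Ceq; field.
Qed.

End ThetaFunctions.

(** * Quotients of theta functions on the doubled curve *)

(** Holds also for y = 0 by the convention 1/0 = 0. As a result the multiplier identities of theta
    quotients hold at their poles too. *)
Lemma Cdiv_scal (c d x y : C) : d <> 0 -> ((c * x) / (d * y))%C = (c / d * (x / y))%C.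
Proof.
  intros Hd. destruct (classic (y = 0)) as [->|Hy].
  - rewrite Cmult_0_r. unfold Cdiv. rewrite Cinv_0. ring.
  - field. split; assumption.
Qed.

Lemma dq_factor (f : C -> C) (a l w : C) : f a = 0 -> f w = ((w - a) * dq f a l w)%C.
Proof.
  intros Ha. destruct (classic (w = a)) as [->|N].
  - rewrite Ha. ring.
  - rewrite dq_neq, Ha by exact N. field. apply Csub_neq_0, N.
Qed.

(** Beyond the pole order it records the residue A(b)/l, from which the normalization of M at 0 is
    read off. *)
Lemma simple_zero_quotient (A B : C -> C) (b l : C) :
  hol A b -> hol B b -> B b = 0 -> cder B b l -> l <> 0 ->
  exists g r, 0 < r /\ hol g b /\ g b = (A b / l)%C /\
    forall w, 0 < Cmod (w - b) < r -> (A w / B w)%C = (g w / (w - b))%C.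
Proof.
  intros HA HB B0 Hl Nl. pose proof (hol_dq B b l HB Hl) as Hdq.
  assert (Nd : dq B b l b <> 0) by (rewrite dq_eq; exact Nl).
  destruct (ccont_ball _ _ (cdf_ccont _ _ (hol_cdf _ _ Hdq)) Nd) as [r [Pr Hr]].
  exists (fun w => A w * / dq B b l w)%C, r. split; [exact Pr|]. split; [|split].
  - apply hol_mult; [exact HA | apply hol_inv; assumption].
  - rewrite dq_eq. reflexivity.
  - intros w [H0 Hw]. specialize (Hr w Hw). rewrite (dq_factor B b l w B0).
    apply Cmod_gt_0 in H0. field. split; assumption.
Qed.

Lemma at_most_simple_pole_shift (f : C -> C) (c l z : C) : c <> 0 ->
  (forall w, f (w + l)%C = (c * f w)%C) ->
  (at_most_simple_pole f z <-> at_most_simple_pole f (z + l)).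
Proof.
  intros Hc E. split; intros (g & r & Pr & Hg & Eg).
  - exists (fun w => c * g (w + - l)%C)%C, r. split; [exact Pr|]. split.
    + apply hol_holo_at, hol_mult; [apply entire_hol; auto with cd|]. apply hol_shift.
      replace (z + l + - l)%C with z by ring. apply hol_holo_at, Hg.
    + intros w Hw. replace w with (w + - l + l)%C at 1 by ring.
      rewrite E, Eg by (replace (w + - l - z)%C with (w - (z + l))%C by ring; exact Hw).
      replace (w + - l - z)%C with (w - (z + l))%C by ring. unfold Cdiv. ring.
  - exists (fun w => / c * g (w + l)%C)%C, r. split; [exact Pr|]. split.
    + apply hol_holo_at, hol_mult; [apply entire_hol; auto with cd|]. apply hol_shift, hol_holo_at, Hg.
    + intros w Hw. replace (f w) with (/ c * f (w + l)%C)%C by (rewrite E; field; exact Hc).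
      assert (EQ : (w + l - (z + l))%C = (w - z)%C) by ring.
      rewrite Eg by (rewrite EQ; exact Hw). rewrite EQ. unfold Cdiv. ring.
Qed.

Lemma at_most_simple_pole_meromorphic (f : C -> C) (z : C) :
  at_most_simple_pole f z -> meromorphic_at f z.
Proof.
  intros (g & r & Pr & Hg & Eg). exists 1%nat, g, r. split; [exact Pr|]. split; [exact Hg|].
  intros w Hw. rewrite Eg by exact Hw. simpl. rewrite Cmult_1_r. reflexivity.
Qed.

Lemma hol_meromorphic (f : C -> C) (z : C) : hol f z -> meromorphic_at f z.
Proof.
  intros H. exists 0%nat, f, 1. split; [lra|]. split; [apply hol_holo_at, H|].
  intros w _. simpl. field.
Qed.

Lemma sgn_cases (n : nat) : sgn n = 1 \/ sgn n = RtoC (-1).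
Proof.
  unfold sgn. induction (n - 1)%nat as [|k [IH|IH]]; [left; reflexivity | right | left];
    apply RtoC_inj in IH; simpl; rewrite IH; f_equal; ring.
Qed.

Lemma sgn_neq_0 (n : nat) : sgn n <> 0.
Proof. destruct (sgn_cases n) as [->| ->]; intros E; apply RtoC_inj in E; lra. Qed.

(** * The common form of f and h for both parities of n *)

Section ThetaQuotient.
Variables (t D : R).
Hypothesis (Ht : 0 < t) (HD : 0 < D < 1).
Let tau : C := (0, t).
Let L (z : C) : Prop := in_lattice 1 (2 * tau) z.

Lemma not_lattice_Re (z : C) : (forall i : Z, Re z <> IZR i) -> ~ L z.
Proof. intros H HL. apply lattice_coords in HL. destruct HL as (i & _ & E & _). exact (H i E). Qed.

Lemma not_lattice_Im (z : C) (k : Z) : Im z = IZR (2 * k + 1) * t -> ~ L z.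
Proof.
  intros H HL. apply lattice_coords in HL. destruct HL as (_ & j & _ & E). rewrite H in E.
  assert (E' : IZR (2 * k + 1) = IZR (2 * j)) by (rewrite (mult_IZR 2 j); nra).
  apply eq_IZR in E'. lia.
Qed.

Lemma D_not_int (i : Z) : D <> IZR i.
Proof. intros E. destruct HD as [A B]. rewrite E in A, B. apply lt_IZR in A, B. lia. Qed.

Lemma half_not_int (i : Z) : / 2 <> IZR i.
Proof.
  intros E. assert (E' : 1 = IZR (2 * i)) by (rewrite mult_IZR; lra). apply eq_IZR in E'. lia.
Qed.

(** X is the exponential prefactor, N the theta factor of the numerator with zero e, P that of the
    denominator with zero a. Under z + 1 the two θ1 factors cancel and X changes sign, so the
    multiplier is sg = -eN/eP. *)
Variables (X N P : C -> C) (a e sg eN eP : C).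
Hypotheses (HX : forall z, cdf X z) (HX0 : forall z, X z <> 0)
  (HX1 : forall z, X (z + 1)%C = (- X z)%C)
  (HX2 : forall z, X (z + 2 * tau)%C = (Cexp (- (2 * Ci * PI * tau)) * X z)%C).
Hypotheses (HN : forall z, cdf N z) (HP : forall z, cdf P z)
  (HNz : forall z, N z = 0 <-> in_lattice 1 (2 * tau) (z - e))
  (HPz : forall z, P z = 0 <-> in_lattice 1 (2 * tau) (z - a))
  (HN1 : forall z, N (z + 1)%C = (eN * N z)%C) (HP1 : forall z, P (z + 1)%C = (eP * P z)%C)
  (HN2 : forall z, N (z + 2 * tau)%C = (mult2 t z * N z)%C)
  (HP2 : forall z, P (z + 2 * tau)%C = (- (mult2 t z * P z))%C)
  (HNs : exists l : C, l <> 0 /\ cder N e l) (HPs : exists l : C, l <> 0 /\ cder P a l)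
  (HeP : eP <> 0) (HeN : eN <> 0) (Hsg : (sg * eP)%C = (- eN)%C)
  (Ha : a = 0 \/ a = tau) (He : e = hpt 0 \/ e = hpt t).

Definition thquot (z : C) : C :=
  (X z * (th1 tau (z - RtoC D - tau) * N z) / (th1 tau (z - RtoC D) * P z))%C.

Lemma sg_neq_0 : sg <> 0.
Proof.
  intros E. rewrite E in Hsg. apply HeN. transitivity (- - eN)%C; [ring|]. rewrite <- Hsg. ring.
Qed.

Lemma thquot_1 (z : C) : thquot (z + 1) = (sg * thquot z)%C.
Proof.
  unfold thquot.
  replace (z + 1 - RtoC D - tau)%C with (z - RtoC D - tau + 1)%C by ring.
  replace (z + 1 - RtoC D)%C with (z - RtoC D + 1)%C by ring.
  rewrite HX1, HN1, HP1. unfold tau. rewrite !th1_1 by exact Ht. fold tau.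
  replace (- X z * (- th1 tau (z - RtoC D - tau) * (eN * N z)))%C
    with (eN * (X z * (th1 tau (z - RtoC D - tau) * N z)))%C by ring.
  replace (- th1 tau (z - RtoC D) * (eP * P z))%C with (- eP * (th1 tau (z - RtoC D) * P z))%C by ring.
  assert (Hn : (- eP)%C <> 0).
  { intros E. apply HeP. transitivity (- - eP)%C; [ring|]. rewrite E. ring. }
  rewrite Cdiv_scal by exact Hn. f_equal.
  replace eN with (- (sg * eP))%C by (rewrite Hsg; ring). field. exact HeP.
Qed.

(** The argument shift by τ in one θ1 factor produces exp(2πiτ), and the multiplier of X undoes it;
    this is why the quotient has a constant multiplier under 2τ. *)
Lemma mult2_tau (z : C) :
  (Cexp (- (2 * Ci * PI * tau)) * mult2 t (z - tau))%C = mult2 t z.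
Proof.
  replace (z - tau)%C with (z + - tau)%C by ring. rewrite mult2_shift.
  replace (- (2 * Ci * PI * - tau))%C with (2 * Ci * PI * tau)%C by ring.
  pose proof (Cexp_opp_mult (2 * Ci * PI * tau)) as E.
  transitivity (Cexp (2 * Ci * PI * tau) * Cexp (- (2 * Ci * PI * tau)) * mult2 t z)%C; [ring|].
  rewrite E. ring.
Qed.

Lemma thquot_2tau (z : C) : thquot (z + 2 * tau) = (- thquot z)%C.
Proof.
  unfold thquot.
  replace (z + 2 * tau - RtoC D - tau)%C with (z - RtoC D - tau + 2 * tau)%C by ring.
  replace (z + 2 * tau - RtoC D)%C with (z - RtoC D + 2 * tau)%C by ring.
  rewrite HX2, HN2, HP2. unfold tau. rewrite !th1_2tau by exact Ht. fold tau.
  replace (Cexp (- (2 * Ci * PI * tau)) * X z *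
    (- (mult2 t (z - RtoC D - tau) * th1 tau (z - RtoC D - tau)) * (mult2 t z * N z)))%C
    with (- (Cexp (- (2 * Ci * PI * tau)) * mult2 t (z - RtoC D - tau) * mult2 t z) *
      (X z * (th1 tau (z - RtoC D - tau) * N z)))%C by ring.
  rewrite mult2_tau.
  replace (- (mult2 t (z - RtoC D) * th1 tau (z - RtoC D)) * - (mult2 t z * P z))%C
    with (mult2 t (z - RtoC D) * mult2 t z * (th1 tau (z - RtoC D) * P z))%C by ring.
  rewrite Cdiv_scal by (apply Cmult_neq_0; apply mult2_neq_0).
  pose proof (mult2_neq_0 t z) as M1. pose proof (mult2_neq_0 t (z - RtoC D)) as M2.
  set (m1 := mult2 t z) in *. set (m2 := mult2 t (z - RtoC D)) in *.
  replace (- (m2 * m1) / (m2 * m1))%C with (- (1))%C by (field; split; assumption). ring.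
Qed.

Lemma cdf_th1_shift (b z : C) : cdf (fun w => th1 tau (w - b)) z.
Proof. apply (cdf_comp (th1 tau) (fun w => w - b)%C); [apply cdf_th1, Ht | auto with cd]. Qed.

Lemma cdf_th1_shift2 (b c z : C) : cdf (fun w => th1 tau (w - b - c)) z.
Proof. apply (cdf_comp (th1 tau) (fun w => w - b - c)%C); [apply cdf_th1, Ht | auto with cd]. Qed.

Lemma cdf_thquot_num (z : C) : cdf (fun z => X z * (th1 tau (z - RtoC D - tau) * N z))%C z.
Proof.
  apply cdf_mult; [apply HX|]. apply cdf_mult; [apply cdf_th1_shift2 | apply HN].
Qed.

Lemma cdf_thquot_den (z : C) : cdf (fun z => th1 tau (z - RtoC D) * P z)%C z.
Proof. apply cdf_mult; [apply cdf_th1_shift | apply HP]. Qed.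

Lemma th1_neq_0 (z : C) : ~ L z -> th1 tau z <> 0.
Proof. intros H E. apply H, th1_zero; assumption. Qed.

Lemma P_neq_0 (z : C) : ~ L (z - a) -> P z <> 0.
Proof. intros H E. apply H, HPz, E. Qed.

Lemma N_neq_0 (z : C) : ~ L (z - e) -> N z <> 0.
Proof. intros H E. apply H, HNz, E. Qed.

Lemma hol_thquot (z : C) : ~ L (z - a) -> ~ L (z - RtoC D) -> hol thquot z.
Proof.
  intros H1 H2. apply hol_mult; [apply entire_hol, cdf_thquot_num|].
  apply hol_inv; [apply entire_hol, cdf_thquot_den|].
  apply Cmult_neq_0; [apply th1_neq_0, H2 | apply P_neq_0, H1].
Qed.

Lemma Re_a : Re a = 0.
Proof. destruct Ha as [->| ->]; reflexivity. Qed.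

Lemma nl_a_D : ~ L (a - RtoC D).
Proof.
  apply not_lattice_Re. intros i. rewrite Re_minus, Re_a, re_RtoC. intros E.
  apply (D_not_int (- i)). rewrite opp_IZR. lra.
Qed.
Lemma nl_D_a : ~ L (RtoC D - a).
Proof.
  apply not_lattice_Re. intros i. rewrite Re_minus, Re_a, re_RtoC. intros E.
  apply (D_not_int i). lra.
Qed.
Lemma nl_a_Dtau : ~ L (a - RtoC D - tau).
Proof.
  apply not_lattice_Re. intros i. rewrite !Re_minus, Re_a, re_RtoC. unfold tau; simpl. intros E.
  apply (D_not_int (- i)). rewrite opp_IZR. lra.
Qed.
Lemma nl_Dtau_a : ~ L (RtoC D + tau - a).
Proof.
  apply not_lattice_Re. intros i. rewrite !Re_minus, Re_a. unfold tau; simpl. intros E.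
  apply (D_not_int i). lra.
Qed.
Lemma nl_D_Dtau : ~ L (RtoC D - RtoC D - tau).
Proof. apply (not_lattice_Im _ (-1)). unfold tau, Im; simpl. ring. Qed.
Lemma nl_Dtau_D : ~ L (RtoC D + tau - RtoC D).
Proof. apply (not_lattice_Im _ 0). unfold tau, Im; simpl. ring. Qed.

Lemma thquot_pole_a : at_most_simple_pole thquot a.
Proof.
  destruct HPs as [l [Nl Hl]].
  destruct (cdf_th1_shift (RtoC D) a) as [m Hm].
  destruct (simple_zero_quotient (fun z => X z * (th1 tau (z - RtoC D - tau) * N z))%C
    (fun z => th1 tau (z - RtoC D) * P z)%C a (m * P a + th1 tau (a - RtoC D) * l)%C)
    as (g & r & Pr & Hg & _ & Eg).
  - apply entire_hol, cdf_thquot_num.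
  - apply entire_hol, cdf_thquot_den.
  - rewrite (proj2 (HPz a)); [ring|]. replace (a - a)%C with (RtoC 0) by ring. exists 0%Z, 0%Z. ring.
  - apply (cder_mult (fun z => th1 tau (z - RtoC D)) P); assumption.
  - rewrite (proj2 (HPz a)), Cmult_0_r, Cplus_0_l.
    + apply Cmult_neq_0; [apply th1_neq_0, nl_a_D | exact Nl].
    + replace (a - a)%C with (RtoC 0) by ring. exists 0%Z, 0%Z. ring.
  - exists g, r. split; [exact Pr|]. split; [apply hol_holo_at, Hg | exact Eg].
Qed.

Lemma th1_shift_simple (b : C) :
  exists l : C, l <> 0 /\ cder (fun z => th1 tau (z - b)) b l.
Proof.
  destruct (th1_simple t Ht) as [l [Nl Hl]]. exists (l * (1 + 0))%C. split.
  - rewrite Cplus_0_r, Cmult_1_r. exact Nl.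
  - apply (cder_comp (th1 tau) (fun z => z + - b)%C).
    + replace (b + - b)%C with (RtoC 0) by ring. exact Hl.
    + apply (cder_plus (fun z => z) (fun _ => - b)%C); [apply cder_id | apply cder_const].
Qed.

Lemma th1_at_0 : th1 tau 0 = 0.
Proof. apply th1_zero; [exact Ht|]. exists 0%Z, 0%Z. ring. Qed.

Lemma thquot_pole_D : at_most_simple_pole thquot (RtoC D).
Proof.
  destruct (th1_shift_simple (RtoC D)) as [l [Nl Hl]].
  destruct (HP (RtoC D)) as [m Hm].
  assert (Z : th1 tau (RtoC D - RtoC D) = 0) by (replace (RtoC D - RtoC D)%C with (RtoC 0) by ring; apply th1_at_0).
  destruct (simple_zero_quotient (fun z => X z * (th1 tau (z - RtoC D - tau) * N z))%C
    (fun z => th1 tau (z - RtoC D) * P z)%C (RtoC D) (l * P (RtoC D) + th1 tau (RtoC D - RtoC D) * m)%C)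
    as (g & r & Pr & Hg & _ & Eg).
  - apply entire_hol, cdf_thquot_num.
  - apply entire_hol, cdf_thquot_den.
  - rewrite Z. ring.
  - apply (cder_mult (fun z => th1 tau (z - RtoC D)) P); assumption.
  - rewrite Z, Cmult_0_l, Cplus_0_r. apply Cmult_neq_0; [exact Nl | apply P_neq_0, nl_D_a].
  - exists g, r. split; [exact Pr|]. split; [apply hol_holo_at, Hg | exact Eg].
Qed.

Lemma Copp_1_neq_0 : (- (1))%C <> 0.
Proof. intros E. apply C1_nz. transitivity (- - (1))%C; [ring|]. rewrite E. ring. Qed.

Lemma thquot_pole (z b : C) : L (z - b) -> at_most_simple_pole thquot b -> at_most_simple_pole thquot z.
Proof.
  intros HL. refine (proj1 (lattice_invariant 1 (2 * tau) (at_most_simple_pole thquot) _ _ b z HL)).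
  - intros w. apply (at_most_simple_pole_shift _ sg); [apply sg_neq_0 | apply thquot_1].
  - intros w. apply (at_most_simple_pole_shift _ (- (1))%C); [apply Copp_1_neq_0|].
    intros u. rewrite thquot_2tau. ring.
Qed.

Lemma thquot_zero (z : C) : L (z - (RtoC D + tau)) -> thquot z = 0.
Proof.
  intros HL. unfold thquot.
  replace (th1 tau (z - RtoC D - tau)) with (RtoC 0); [unfold Cdiv; ring|].
  symmetry. apply th1_zero; [exact Ht|]. fold tau.
  replace (z - RtoC D - tau)%C with (z - (RtoC D + tau))%C by ring. exact HL.
Qed.

Lemma thquot_fh_props (n : nat) : sg = sgn n -> fh_props n tau D a thquot.
Proof.
  intros Esg. unfold fh_props, cong2.
  assert (S : forall z, L (z - a) \/ L (z - RtoC D) -> at_most_simple_pole thquot z).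
  { intros z [H|H]; [apply (thquot_pole z a H thquot_pole_a) | apply (thquot_pole z _ H thquot_pole_D)]. }
  split; [|split; [|split; [|split]]].
  - intros z. destruct (classic (L (z - a) \/ L (z - RtoC D))) as [H|H].
    + apply at_most_simple_pole_meromorphic, S, H.
    + apply hol_meromorphic, hol_thquot; tauto.
  - intros z H1 H2. apply hol_holo_at, hol_thquot; assumption.
  - exact S.
  - apply thquot_zero.
  - intros z _ _. rewrite thquot_1, thquot_2tau, Esg. split; reflexivity.
Qed.

(** * Characterization by divisor and multipliers *)

Section Uniqueness.
Variable F : C -> C.
(** Conditions weak enough to cover both the functions described by [fh_props] and the unfolded rows
    of a solution, which are controlled only off the grid. *)
Hypotheses (HF : forall z, offgrid t z -> F (z + 1)%C = (sg * F z)%C /\ F (z + 2 * tau)%C = (- F z)%C)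
  (HFr : forall z, ~ in_lattice 1 (2 * tau) (z - a) -> ~ in_lattice 1 (2 * tau) (z - RtoC D) -> reg t F z)
  (HFa : reg t (fun w => (w - a) * F w)%C a)
  (HFD : reg t (fun w => (w - RtoC D) * F w)%C (RtoC D))
  (HFt : reg t (fun w => F w * / (w - (RtoC D + tau)))%C (RtoC D + tau)).

(** F divided by the quotient except for the factor XN. The poles and the zero of F are cancelled
    here, so only N can produce a pole of v = G/(XN). *)
Let G (z : C) : C := (F z * (th1 tau (z - RtoC D) * P z * / th1 tau (z - RtoC D - tau)))%C.

Let reg_G_generic (z : C) : ~ L (z - a) -> ~ L (z - RtoC D) -> ~ L (z - RtoC D - tau) -> reg t G z.
Proof.
  intros H1 H2 H3. apply reg_mult; [apply HFr; assumption|].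
  apply hol_reg, hol_mult; [apply entire_hol, cdf_thquot_den|].
  apply hol_inv; [apply entire_hol; intros; apply cdf_th1_shift2 | apply th1_neq_0, H3].
Qed.

Let reg_G_a : reg t G a.
Proof.
  destruct HPs as [l [Nl Hl]].
  assert (P0 : P a = 0).
  { apply HPz. replace (a - a)%C with (RtoC 0) by ring. exists 0%Z, 0%Z. ring. }
  apply (reg_ext t (fun w => ((w - a) * F w) * (th1 tau (w - RtoC D) * dq P a l w * / th1 tau (w - RtoC D - tau)))%C
    G a 1 Rlt_0_1).
  - intros w _ _. unfold G. rewrite (dq_factor P a l w P0). ring.
  - apply reg_mult; [exact HFa|]. apply hol_reg, hol_mult; [apply hol_mult|].
    + apply entire_hol; intros; apply cdf_th1_shift.
    + apply hol_dq; [apply entire_hol, HP | exact Hl].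
    + apply hol_inv; [apply entire_hol; intros; apply cdf_th1_shift2 | apply th1_neq_0, nl_a_Dtau].
Qed.

Let reg_G_D : reg t G (RtoC D).
Proof.
  destruct (th1_shift_simple (RtoC D)) as [l [Nl Hl]].
  assert (Z : th1 tau (RtoC D - RtoC D) = 0) by (replace (RtoC D - RtoC D)%C with (RtoC 0) by ring; apply th1_at_0).
  set (h := fun z => th1 tau (z - RtoC D)) in *.
  apply (reg_ext t (fun w => ((w - RtoC D) * F w) * (dq h (RtoC D) l w * P w * / th1 tau (w - RtoC D - tau)))%C
    G (RtoC D) 1 Rlt_0_1).
  - intros w _ _. unfold G. fold (h w). rewrite (dq_factor h (RtoC D) l w Z). ring.
  - apply reg_mult; [exact HFD|]. apply hol_reg, hol_mult; [apply hol_mult|].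
    + apply hol_dq; [apply entire_hol; intros; apply cdf_th1_shift | exact Hl].
    + apply entire_hol, HP.
    + apply hol_inv; [apply entire_hol; intros; apply cdf_th1_shift2 | apply th1_neq_0, nl_D_Dtau].
Qed.

Let offgrid_D (z : C) : offgrid t z -> ~ L (z - RtoC D).
Proof. intros U. apply (offgrid_not_lattice t z _ 0 U). simpl; ring. Qed.
Let offgrid_Dtau (z : C) : offgrid t z -> ~ L (z - (RtoC D + tau)).
Proof. intros U. apply (offgrid_not_lattice t z _ 2 U). unfold tau, Im; simpl; field. Qed.
Let offgrid_a (z : C) : offgrid t z -> ~ L (z - a).
Proof.
  intros U. destruct Ha as [->| ->];
    [apply (offgrid_not_lattice t z _ 0 U) | apply (offgrid_not_lattice t z _ 2 U)];
    unfold tau, Im; simpl; field.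
Qed.
Let offgrid_e (z : C) : offgrid t z -> ~ L (z - e).
Proof.
  intros U. destruct He as [->| ->];
    [apply (offgrid_not_lattice t z _ 0 U) | apply (offgrid_not_lattice t z _ 2 U)];
    unfold hpt, Im; simpl; field.
Qed.

Let lattice_0 (b : C) : L (b - b).
Proof. replace (b - b)%C with (RtoC 0) by ring. exists 0%Z, 0%Z. ring. Qed.

Let reg_G_Dtau : reg t G (RtoC D + tau).
Proof.
  destruct (th1_shift_simple (RtoC D + tau)) as [l [Nl Hl]].
  set (b := (RtoC D + tau)%C) in *.
  assert (Z : th1 tau (b - b) = 0) by (replace (b - b)%C with (RtoC 0) by ring; apply th1_at_0).
  set (h := fun z => th1 tau (z - b)) in *.
  apply (reg_ext t (fun w => (F w * / (w - b)) * (th1 tau (w - RtoC D) * P w * / dq h b l w))%C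
    G b 1 Rlt_0_1).
  - intros w _ Uw. unfold G.
    replace (w - RtoC D - tau)%C with (w - b)%C by (unfold b; ring). fold (h w).
    assert (Nh : h w <> 0) by (apply th1_neq_0, offgrid_Dtau, Uw).
    rewrite (dq_factor h b l w Z) in Nh |- *. field.
    split; intros E; apply Nh; rewrite E; ring.
  - apply reg_mult; [exact HFt|]. apply hol_reg, hol_mult; [apply entire_hol, cdf_thquot_den|].
    apply hol_inv; [apply hol_dq; [apply entire_hol; intros; apply cdf_th1_shift | exact Hl]|].
    rewrite dq_eq. exact Nl.
Qed.

Let v (z : C) : C := (G z * / (X z * N z))%C.

Let v_periodic (z : C) : offgrid t z -> v (z + 1)%C = v z /\ v (z + 2 * tau)%C = v z.
Proof.
  intros U. destruct (HF z U) as [F1 F2].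
  pose proof (th1_neq_0 _ (offgrid_Dtau z U)) as N1.
  replace (z - (RtoC D + tau))%C with (z - RtoC D - tau)%C in N1 by ring.
  pose proof (N_neq_0 z (offgrid_e z U)) as N2. pose proof (HX0 z) as N3.
  unfold v, G.
  replace (z + 1 - RtoC D - tau)%C with (z - RtoC D - tau + 1)%C by ring.
  replace (z + 1 - RtoC D)%C with (z - RtoC D + 1)%C by ring.
  replace (z + 2 * tau - RtoC D - tau)%C with (z - RtoC D - tau + 2 * tau)%C by ring.
  replace (z + 2 * tau - RtoC D)%C with (z - RtoC D + 2 * tau)%C by ring.
  rewrite F1, F2, HX1, HX2, HN1, HN2, HP1, HP2.
  unfold tau. rewrite !th1_1, !th1_2tau by exact Ht. fold tau. split.
  - replace eN with (- (sg * eP))%C by (rewrite Hsg; ring). field.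
    repeat split; try assumption. apply sg_neq_0.
  - rewrite <- (mult2_tau (z - RtoC D)). field.
    repeat split; try assumption; try apply mult2_neq_0; apply Cexp_neq_0.
Qed.

Let reg_v (z : C) : ~ L (z - e) -> reg t G z -> reg t v z.
Proof.
  intros H1 H2. apply reg_mult; [exact H2|].
  apply hol_reg, hol_inv; [apply entire_hol; intros; apply cdf_mult; [apply HX | apply HN]|].
  apply Cmult_neq_0; [apply HX0 | apply N_neq_0, H1].
Qed.

Let reg_v_lattice (z b : C) : L (z - b) -> ~ L (z - e) -> reg t G b -> reg t v z.
Proof.
  intros Hb Hz Hr.
  assert (Rb : reg t v b).
  { apply reg_v; [|exact Hr]. intros E. apply Hz.
    replace (z - e)%C with ((z - b) + (b - e))%C by ring. apply in_lattice_add; assumption. }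
  refine (proj1 (lattice_invariant 1 (2 * tau) (reg t v) _ _ b z Hb) Rb).
  - intros w. rewrite (reg_shift_iff t v w 1 (offgrid_1 t)).
    split; apply reg_ext with (r := 1); try lra; intros u _ Uu; [symmetry|]; apply v_periodic, Uu.
  - intros w. unfold tau. rewrite (reg_shift_iff t v w _ (offgrid_2tau t)).
    split; apply reg_ext with (r := 1); try lra; intros u _ Uu; [symmetry|]; apply v_periodic, Uu.
Qed.

Let reg_G_e : reg t G e.
Proof.
  (* For D = 1/2 the zero of N can coincide with D or D + τ; otherwise e avoids all three special
     classes modulo the lattice. *)
  destruct (classic (e = RtoC D)) as [->|N1]; [exact reg_G_D|].
  destruct (classic (e = (RtoC D + tau)%C)) as [->|N2]; [exact reg_G_Dtau|].
  assert (Hh : forall i : Z, / 2 - D = IZR i -> D = / 2).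
  { intros i E. destruct HD as [A B]. assert (C1 : -1 < IZR i < 1) by lra.
    destruct C1 as [C1 C2]. apply lt_IZR in C1, C2. assert (i = 0)%Z by lia. subst. lra. }
  apply reg_G_generic.
  - apply not_lattice_Re. intros i. rewrite Re_minus, Re_a. intros E. apply (half_not_int i).
    destruct He as [->| ->]; simpl in E; lra.
  - intros HL. destruct He as [E| E].
    + apply N1. apply lattice_coords in HL. destruct HL as (i & j & E1 & _).
      rewrite E in *. unfold hpt in *. simpl in E1. rewrite (Hh i) by lra. reflexivity.
    + revert HL. apply (not_lattice_Im _ 0). rewrite E. unfold hpt, Im; simpl. ring.
  - intros HL. destruct He as [E| E].
    + revert HL. apply (not_lattice_Im _ (-1)). rewrite E. unfold hpt, tau, Im; simpl. ring.
    + apply N2. apply lattice_coords in HL. destruct HL as (i & j & E1 & _).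
      rewrite E in *. unfold hpt, tau in *. simpl in E1. rewrite (Hh i) by lra. Ceq; ring.
Qed.

Theorem thquot_unique : exists c : C, forall z, offgrid t z -> F z = (c * thquot z)%C.
Proof.
  destruct (elliptic_simple_pole_const t Ht v e) as [c Hc].
  - intros U. exact (offgrid_e e U (lattice_0 e)).
  - exact v_periodic.
  - intros z Hz.
    destruct (classic (L (z - a))) as [H1|H1]; [exact (reg_v_lattice z a H1 Hz reg_G_a)|].
    destruct (classic (L (z - RtoC D))) as [H2|H2]; [exact (reg_v_lattice z _ H2 Hz reg_G_D)|].
    destruct (classic (L (z - RtoC D - tau))) as [H3|H3].
    + apply (reg_v_lattice z (RtoC D + tau)); [|exact Hz | exact reg_G_Dtau].
      replace (z - (RtoC D + tau))%C with (z - RtoC D - tau)%C by ring. exact H3.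
    + apply reg_v; [exact Hz | apply reg_G_generic; assumption].
  - destruct HNs as [l [Nl Hl]].
    assert (N0 : N e = 0) by (apply HNz, lattice_0).
    apply (reg_ext t (fun w => G w * / (X w * dq N e l w))%C _ e 1 Rlt_0_1).
    + intros w _ Uw. unfold v. pose proof (N_neq_0 w (offgrid_e w Uw)) as Nw.
      rewrite (dq_factor N e l w N0) in Nw |- *. pose proof (HX0 w) as Xw.
      assert (D1 : (w - e)%C <> 0) by (intros E; apply Nw; rewrite E; ring).
      assert (D2 : dq N e l w <> 0) by (intros E; apply Nw; rewrite E; ring).
      field. repeat split; assumption.
    + apply reg_mult; [exact reg_G_e|]. apply hol_reg, hol_inv.
      * apply hol_mult; [apply entire_hol, HX | apply hol_dq; [apply entire_hol, HN | exact Hl]].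
      * rewrite dq_eq. apply Cmult_neq_0; [apply HX0 | exact Nl].
  - exists c. intros z U. rewrite <- (Hc z U). unfold v, G, thquot.
    pose proof (th1_neq_0 _ (offgrid_Dtau z U)) as N1.
    replace (z - (RtoC D + tau))%C with (z - RtoC D - tau)%C in N1 by ring.
    pose proof (HX0 z) as N2. pose proof (N_neq_0 z (offgrid_e z U)) as N3.
    pose proof (P_neq_0 z (offgrid_a z U)) as N4. pose proof (th1_neq_0 _ (offgrid_D z U)) as N5.
    field. repeat split; assumption.
Qed.

End Uniqueness.

(** The zero prescribed at D + τ becomes regularity of a difference quotient. Proportionality off
    the grid then extends by continuity to every point that is not a pole. *)
Lemma thquot_unique_fh (n : nat) (F : C -> C) : sg = sgn n -> fh_props n tau D a F ->
  exists c : C, forall z, ~ cong2 tau z a -> ~ cong2 tau z (RtoC D) -> F z = (c * thquot z)%C.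
Proof.
  intros Esg (_ & H2 & H3 & H4 & H5). unfold cong2 in *.
  assert (S0 : forall b, L (b - b)).
  { intros b. replace (b - b)%C with (RtoC 0) by ring. exists 0%Z, 0%Z. ring. }
  assert (Sp : forall b, L (b - a) \/ L (b - RtoC D) -> reg t (fun w => (w - b) * F w)%C b).
  { intros b Hb. destruct (H3 b Hb) as (g & r & Pr & [r' [Pr' Hg]] & Eg).
    destruct (classic (offgrid t b)) as [U|U].
    - exfalso. destruct Hb as [Hb|Hb].
      + destruct Ha as [E|E]; rewrite E in Hb;
          [revert Hb; apply (offgrid_not_lattice t b _ 0 U) | revert Hb; apply (offgrid_not_lattice t b _ 2 U)];
          unfold tau, Im; simpl; field.
      + revert Hb; apply (offgrid_not_lattice t b _ 0 U). simpl; ring.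
    - exists g, (Rmin r r'). pose proof (Rmin_l r r'); pose proof (Rmin_r r r').
      split; [apply Rmin_pos; lra|]. split; intros w Hw.
      + apply cdf_Cdiff, Hg; lra.
      + intros Uw. assert (Nw : w <> b) by (intros ->; exact (U Uw)).
        pose proof (Cmod_sub_pos w b Nw). rewrite Eg by lra. field. apply Csub_neq_0, Nw. }
  destruct (thquot_unique F) as [c Hc].
  - intros z U. rewrite <- Esg in H5. apply H5.
    + destruct Ha as [->| ->];
        [apply (offgrid_not_lattice t z _ 0 U) | apply (offgrid_not_lattice t z _ 2 U)]; unfold tau, Im; simpl; field.
    + apply (offgrid_not_lattice t z _ 0 U). simpl; ring.
  - intros z Z1 Z2. apply hol_reg, hol_holo_at, H2; assumption.
  - apply Sp. left. apply S0.
  - apply Sp. right. apply S0.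
  - assert (Hb : hol F (RtoC D + tau)) by (apply hol_holo_at, H2; [apply nl_Dtau_a | apply nl_Dtau_D]).
    destruct (hol_cdf _ _ Hb) as [l Hl].
    assert (F0 : F (RtoC D + tau)%C = 0) by (apply H4, S0).
    apply (reg_ext t (dq F (RtoC D + tau) l) _ _ 1 Rlt_0_1); [|apply hol_reg, hol_dq; assumption].
    intros w _ Uw. rewrite dq_neq, F0; [ring|]. intros ->.
    apply (Uw 2%Z). unfold tau, Im; simpl. field.
  - exists c. intros z Z1 Z2.
    apply (offgrid_agree t Ht F (fun w => c * thquot w)%C z 1 Rlt_0_1).
    + apply cdf_ccont, hol_cdf, hol_holo_at, H2; assumption.
    + apply cdf_ccont, cdf_mult; [apply cdf_const | apply hol_cdf, hol_thquot; assumption].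
    + intros w _ Uw. apply Hc, Uw.
Qed.

End ThetaQuotient.

(** * Existence *)

Lemma hol_at_most_simple_pole (f : C -> C) (z : C) : hol f z -> at_most_simple_pole f z.
Proof.
  intros H. exists (fun w => (w - z) * f w)%C, 1. split; [lra|]. split.
  - apply hol_holo_at, hol_mult; [apply entire_hol; auto with cd | exact H].
  - intros w [Hw _]. apply Cmod_gt_0 in Hw. field. exact Hw.
Qed.

(* [a] is the pole besides [D]: [0] for [f_sol] and [tau] for [h_sol]. *)
Record pole_data (n : nat) (t D : R) (a : C) (F : C -> C) : Prop := {
  pd_1 : forall z, F (z + 1)%C = (sgn n * F z)%C;
  pd_2tau : forall z, F (z + 2 * (0, t))%C = (- F z)%C;
  pd_hol : forall z, ~ in_lattice 1 (2 * (0, t)) (z - a) -> ~ in_lattice 1 (2 * (0, t)) (z - RtoC D) -> hol F z;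
  pd_pole : forall z, at_most_simple_pole F z;
  pd_zero : F (RtoC D + (0, t))%C = 0;
  pd_fh : fh_props n (0, t) D a F;
  pd_unique : forall G : C -> C,
    (forall z, offgrid t z -> G (z + 1)%C = (sgn n * G z)%C /\ G (z + 2 * (0, t))%C = (- G z)%C) ->
    (forall z, ~ in_lattice 1 (2 * (0, t)) (z - a) -> ~ in_lattice 1 (2 * (0, t)) (z - RtoC D) -> reg t G z) ->
    reg t (fun w => (w - a) * G w)%C a ->
    reg t (fun w => (w - RtoC D) * G w)%C (RtoC D) ->
    reg t (fun w => G w * / (w - (RtoC D + (0, t))))%C (RtoC D + (0, t)) ->
    exists c : C, forall z, offgrid t z -> G z = (c * F z)%C;
  pd_unique_fh : forall G : C -> C, fh_props n (0, t) D a G ->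
    exists c : C, forall z, ~ cong2 (0, t) z a -> ~ cong2 (0, t) z (RtoC D) -> G z = (c * F z)%C }.

Lemma thquot_pole_data (n : nat) (t D : R) (X N P : C -> C) (a e eN eP : C) :
  0 < t -> 0 < D < 1 ->
  (forall z, cdf X z) -> (forall z, X z <> 0) -> (forall z, X (z + 1)%C = (- X z)%C) ->
  (forall z, X (z + 2 * (0, t))%C = (Cexp (- (2 * Ci * PI * (0, t))) * X z)%C) ->
  (forall z, cdf N z) -> (forall z, cdf P z) ->
  (forall z, N z = 0 <-> in_lattice 1 (2 * (0, t)) (z - e)) ->
  (forall z, P z = 0 <-> in_lattice 1 (2 * (0, t)) (z - a)) ->
  (forall z, N (z + 1)%C = (eN * N z)%C) -> (forall z, P (z + 1)%C = (eP * P z)%C) ->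
  (forall z, N (z + 2 * (0, t))%C = (mult2 t z * N z)%C) ->
  (forall z, P (z + 2 * (0, t))%C = (- (mult2 t z * P z))%C) ->
  (exists l : C, l <> 0 /\ cder N e l) -> (exists l : C, l <> 0 /\ cder P a l) ->
  eP <> 0 -> eN <> 0 -> (sgn n * eP)%C = (- eN)%C ->
  a = 0 \/ a = (0, t) -> e = hpt 0 \/ e = hpt t ->
  pole_data n t D a (thquot t D X N P).
Proof.
  intros Ht HD HX HX0 HX1 HX2 HN HP HNz HPz HN1 HP1 HN2 HP2 HNs HPs HeP HeN Hsg Ha He.
  assert (Hfh : fh_props n (0, t) D a (thquot t D X N P)).
  { apply (thquot_fh_props t D Ht HD X N P a e (sgn n) eN eP); auto. }
  assert (Hhol : forall z, ~ in_lattice 1 (2 * (0, t)) (z - a) ->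
    ~ in_lattice 1 (2 * (0, t)) (z - RtoC D) -> hol (thquot t D X N P) z).
  { apply (hol_thquot t D Ht X N P a HX HN HP HPz). }
  constructor.
  - apply (thquot_1 t D Ht X N P (sgn n) eN eP); auto.
  - apply (thquot_2tau t D Ht X N P); auto.
  - exact Hhol.
  - intros z. destruct Hfh as (_ & _ & H3 & _).
    destruct (classic (cong2 (0, t) z a \/ cong2 (0, t) z (RtoC D))) as [H|H]; [apply H3, H|].
    apply hol_at_most_simple_pole, Hhol; tauto.
  - apply thquot_zero; [exact Ht|].
    replace (RtoC D + (0, t) - (RtoC D + (0, t)))%C with (RtoC 0) by ring. exists 0%Z, 0%Z. ring.
  - exact Hfh.
  - intros G. apply (thquot_unique t D Ht HD X N P a e (sgn n) eN eP); auto.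
  - intros G. apply (thquot_unique_fh t D Ht HD X N P a e (sgn n) eN eP); auto.
Qed.

(** At n = 0 truncated subtraction would give the sign 1, so positivity of n enters here. *)
Lemma sgn_even (n : nat) : (1 <= n)%nat -> sgn n = if Nat.even n then (- (1))%C else RtoC 1.
Proof.
  intros Hn. unfold sgn. destruct (Nat.even n) eqn:E.
  - apply Nat.even_spec in E. destruct E as [k ->].
    replace (2 * k - 1)%nat with (S (2 * (k - 1))) by lia. rewrite pow_1_odd. Ceq; ring.
  - assert (O : Nat.odd n = true) by (rewrite <- Nat.negb_even, E; reflexivity).
    apply Nat.odd_spec in O. destruct O as [k ->].
    replace (2 * k + 1 - 1)%nat with (2 * k)%nat by lia. rewrite pow_1_even. reflexivity.
Qed.

Lemma f_pole_data (n : nat) (t D : R) : (1 <= n)%nat -> 0 < t -> 0 < D < 1 ->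
  pole_data n t D 0 (f_sol n (0, t) D).
Proof.
  intros Hn Ht HD. pose proof (sgn_even n Hn) as Es.
  set (X := fun p : C => Cexp (- (Ci * PI * p))).
  assert (HX1 : forall z, X (z + 1)%C = (- X z)%C).
  { intros z. unfold X. replace (- (Ci * PI * (z + 1)))%C with (- (Ci * PI * z) + - (Ci * PI))%C by ring.
    rewrite Cexp_plus, Cexp_miPI. Ceq; ring. }
  assert (HX2 : forall z, X (z + 2 * (0, t))%C = (Cexp (- (2 * Ci * PI * (0, t))) * X z)%C).
  { intros z. unfold X. rewrite <- Cexp_plus. f_equal. ring. }
  assert (HP1 : forall z, th1 (0, t) (z + 1) = (- (1) * th1 (0, t) z)%C).
  { intros z. rewrite th1_1 by exact Ht. ring. }
  assert (HPz : forall z, th1 (0, t) z = 0 <-> in_lattice 1 (2 * (0, t)) (z - 0)).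
  { intros z. rewrite th1_zero by exact Ht. replace (z - 0)%C with z by ring. tauto. }
  destruct (Nat.even n) eqn:Ev.
  - replace (f_sol n (0, t) D) with (thquot t D X (th2 (0, t)) (th1 (0, t)))
      by (unfold f_sol; rewrite Ev; reflexivity).
    apply (thquot_pole_data n t D _ _ _ 0 (hpt 0) (- (1)) (- (1))); auto.
    + unfold X; auto with cd.
    + intros; apply Cexp_neq_0.
    + apply cdf_th2, Ht.
    + apply cdf_th1, Ht.
    + apply th2_zero, Ht.
    + apply th2_1, Ht.
    + apply th2_2tau, Ht.
    + apply th1_2tau, Ht.
    + apply th2_simple, Ht.
    + apply th1_simple, Ht.
    + apply Copp_1_neq_0.
    + apply Copp_1_neq_0.
    + rewrite Es; ring.
  - replace (f_sol n (0, t) D) with (thquot t D X (th3 (0, t)) (th1 (0, t)))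
      by (unfold f_sol; rewrite Ev; reflexivity).
    apply (thquot_pole_data n t D _ _ _ 0 (hpt t) 1 (- (1))); auto.
    + unfold X; auto with cd.
    + intros; apply Cexp_neq_0.
    + apply cdf_th3, Ht.
    + apply cdf_th1, Ht.
    + apply th3_zero, Ht.
    + apply th3_1, Ht.
    + apply th3_2tau, Ht.
    + apply th1_2tau, Ht.
    + apply th3_simple, Ht.
    + apply th1_simple, Ht.
    + apply Copp_1_neq_0.
    + apply C1_nz.
    + rewrite Es; ring.
Qed.

Lemma h_pole_data (n : nat) (t D : R) : (1 <= n)%nat -> 0 < t -> 0 < D < 1 ->
  pole_data n t D (0, t) (h_sol n (0, t) D).
Proof.
  intros Hn Ht HD. pose proof (sgn_even n Hn) as Es.
  set (X := fun p : C => Cexp (- (Ci * PI * p) + Ci * PI * (0, t) + 2 * Ci * PI * RtoC D - Ci * PI / 2)).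
  assert (HX1 : forall z, X (z + 1)%C = (- X z)%C).
  { intros z. unfold X.
    replace (- (Ci * PI * (z + 1)) + Ci * PI * (0, t) + 2 * Ci * PI * RtoC D - Ci * PI / 2)%C
      with (- (Ci * PI * z) + Ci * PI * (0, t) + 2 * Ci * PI * RtoC D - Ci * PI / 2 + - (Ci * PI))%C by ring.
    rewrite (Cexp_plus (_ - _)), Cexp_miPI. Ceq; ring. }
  assert (HX2 : forall z, X (z + 2 * (0, t))%C = (Cexp (- (2 * Ci * PI * (0, t))) * X z)%C).
  { intros z. unfold X. rewrite <- Cexp_plus. f_equal. ring. }
  assert (HX : forall z, cdf X z).
  { intros z. unfold X, Cminus. auto 20 with cd. }
  destruct (Nat.even n) eqn:Ev.
  - replace (h_sol n (0, t) D) with (thquot t D X (th3 (0, t)) (th4 (0, t)))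
      by (unfold h_sol; rewrite Ev; reflexivity).
    apply (thquot_pole_data n t D _ _ _ (0, t) (hpt t) 1 1); auto.
    + intros; apply Cexp_neq_0.
    + apply cdf_th3, Ht.
    + apply cdf_th4, Ht.
    + apply th3_zero, Ht.
    + apply th4_zero, Ht.
    + apply th3_1, Ht.
    + apply th4_1, Ht.
    + apply th3_2tau, Ht.
    + apply th4_2tau, Ht.
    + apply th3_simple, Ht.
    + apply th4_simple, Ht.
    + apply C1_nz.
    + apply C1_nz.
    + rewrite Es; ring.
  - replace (h_sol n (0, t) D) with (thquot t D X (th2 (0, t)) (th4 (0, t)))
      by (unfold h_sol; rewrite Ev; reflexivity).
    apply (thquot_pole_data n t D _ _ _ (0, t) (hpt 0) (- (1)) 1); auto.
    + intros; apply Cexp_neq_0.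
    + apply cdf_th2, Ht.
    + apply cdf_th4, Ht.
    + apply th2_zero, Ht.
    + apply th4_zero, Ht.
    + apply th2_1, Ht.
    + apply th4_1, Ht.
    + apply th2_2tau, Ht.
    + apply th4_2tau, Ht.
    + apply th2_simple, Ht.
    + apply th4_simple, Ht.
    + apply C1_nz.
    + apply Copp_1_neq_0.
    + rewrite Es; ring.
Qed.

Lemma bounded_near_ext (F G : C -> C) (a : C) (r : R) : 0 < r ->
  (forall w, 0 < Cmod (w - a) < r -> F w = G w) -> bounded_near F a -> bounded_near G a.
Proof.
  intros Pr E (r' & K & Pr' & H). exists (Rmin r r'), K. split; [apply Rmin_pos; lra|].
  pose proof (Rmin_l r r'); pose proof (Rmin_r r r').
  intros w Hw. rewrite <- E by lra. apply H; lra.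
Qed.

Lemma hol_bounded_near (F : C -> C) (a : C) : hol F a -> bounded_near F a.
Proof.
  intros H. destruct (cdf_ccont _ _ (hol_cdf _ _ H) 1 Rlt_0_1) as [d [Pd Hd]].
  exists d, (Cmod (F a) + 1). split; [exact Pd|]. intros w [_ Hw]. specialize (Hd w Hw).
  replace (F w) with ((F w - F a) + F a)%C by ring.
  eapply Rle_trans; [apply Cmod_triangle|]; lra.
Qed.

Lemma simple_pole_bounded_near (F : C -> C) (a : C) :
  at_most_simple_pole F a -> bounded_near (fun w => (w - a) * F w)%C a.
Proof.
  intros (g & r & Pr & Hg & Eg). apply (bounded_near_ext g _ a r Pr).
  - intros w Hw. rewrite (Eg w Hw). destruct Hw as [Hw _]. apply Cmod_gt_0 in Hw. field. exact Hw.
  - apply hol_bounded_near, hol_holo_at, Hg.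
Qed.

Lemma hol_zero_bounded_near (F : C -> C) (a : C) : hol F a -> F a = 0 ->
  bounded_near (fun w => F w / (w - a))%C a.
Proof.
  intros H F0. destruct (hol_cdf _ _ H) as [l Hl].
  apply (bounded_near_ext (dq F a l) _ a 1 Rlt_0_1); [|apply hol_bounded_near, hol_dq; assumption].
  intros w [Hw _]. apply Cmod_gt_0 in Hw.
  rewrite dq_neq, F0 by (intros ->; apply Hw; ring). unfold Cdiv. ring.
Qed.

Lemma simple_pole_residue_1 (F g : C -> C) (r : R) : 0 < r -> hol g 0 -> g 0 = 1 ->
  (forall w, 0 < Cmod (w - 0) < r -> F w = (g w / (w - 0))%C) ->
  bounded_near (fun w => F w - / w)%C 0.
Proof.
  intros Pr Hg G0 E.
  apply (bounded_near_ext (fun w => (g w - 1) / (w - 0))%C _ 0 r Pr).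
  - intros w Hw. rewrite (E w Hw). destruct Hw as [Hw _]. apply Cmod_gt_0 in Hw.
    replace (w - 0)%C with w in * by ring. field. exact Hw.
  - apply (hol_zero_bounded_near (fun w => g w - 1)%C).
    + apply hol_plus; [exact Hg | apply entire_hol; auto with cd].
    + rewrite G0. ring.
Qed.

(** * The explicit solution off the jump lines *)

Section Existence.
Variables (n : nat) (t D : R).
Hypotheses (Hn : (1 <= n)%nat) (Ht : 0 < t) (HD : 0 < D < 1).
Let tau : C := (0, t).
Let f : C -> C := f_sol n tau D.
Let h : C -> C := h_sol n tau D.
Let c1 : C := (a_const tau D * kappa n tau)%C.
Let c2 : C := (kappa n tau / a_const tau D)%C.

(** One analytic expression for M on the whole strip |Im p| < t/2 between two jump lines, instead of
    the two half-strip formulas. *)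
Definition M_center (p : C) : Mat2 :=
  mk2 (c1 * f p) (c1 * f (p + tau)) (c2 * h p) (c2 * h (p + tau)).

Let Hf : pole_data n t D 0 f := f_pole_data n t D Hn Ht HD.
Let Hh : pole_data n t D tau h := h_pole_data n t D Hn Ht HD.

Lemma M_sol_center (p : C) (k : Z) : Rabs (Im p - IZR k * t) < t / 2 ->
  M_sol n tau D p = M_center (p - IZR k * tau).
Proof.
  intros Hk. apply Rabs_def2 in Hk.
  unfold M_sol. change (Im tau) with t. set (j := Int_part (Im p / t)).
  destruct (base_Int_part (Im p / t)) as [J1 J2]. fold j in J1, J2.
  assert (J1' : IZR j * t <= Im p).
  { apply (Rmult_le_compat_r t) in J1; [|lra]. replace (Im p / t * t) with (Im p) in J1 by (field; lra). exact J1. }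
  assert (J2' : Im p < IZR j * t + t).
  { assert (Im p / t < IZR j + 1) by lra. apply (Rmult_lt_compat_r t) in H; [|lra].
    replace (Im p / t * t) with (Im p) in H by (field; lra). lra. }
  unfold M_strip. change (Im tau) with t.
  replace (Im (p - IZR j * tau)) with (Im p - IZR j * t) by (unfold tau, Im; simpl; ring).
  destruct (Rlt_dec (Im p - IZR j * t) (t / 2)) as [H|H].
  - assert (E : j = k).
    { assert (A1 : -1 < IZR (j - k) < 1) by (rewrite minus_IZR; split; nra).
      destruct A1 as [A1 A2]. apply lt_IZR in A1, A2. lia. }
    rewrite <- E. unfold Cmat, mmul, M_center, mk2, m11, m12, m21, m22. simpl.
    fold c1 c2 f h. f_equal; f_equal; ring.
  (* The upper half of a floor strip belongs to the next center; there the formula with minus signs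
     becomes the central one because f(p - τ) = -f(p + τ), and likewise for h. *)
  - assert (E : k = (j + 1)%Z).
    { assert (A1 : 0 < IZR (k - j) < 2) by (rewrite minus_IZR; split; nra).
      destruct A1 as [A1 A2]. apply lt_IZR in A1, A2. lia. }
    subst k.
    assert (Ep : (p - IZR (j + 1) * tau)%C = (p - IZR j * tau - tau)%C) by (rewrite plus_IZR, RtoC_plus; ring).
    rewrite Ep. set (p' := (p - IZR j * tau)%C).
    unfold Cmat, mmul, M_center, mk2, m11, m12, m21, m22. simpl. fold c1 c2 f h.
    assert (F1 : f (p' - tau)%C = (- f (p' + tau))%C).
    { replace (p' + tau)%C with (p' - tau + 2 * (0, t))%C by (unfold tau; ring).
      rewrite (pd_2tau _ _ _ _ _ Hf). ring. }
    assert (H1 : h (p' - tau)%C = (- h (p' + tau))%C).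
    { replace (p' + tau)%C with (p' - tau + 2 * (0, t))%C by (unfold tau; ring).
      rewrite (pd_2tau _ _ _ _ _ Hh). ring. }
    replace (p' - tau + tau)%C with p' by ring. rewrite F1, H1.
    f_equal; f_equal; ring.
Qed.

Lemma off_lines_center (p : C) : ~ on_lines tau p -> exists k : Z, Rabs (Im p - IZR k * t) < t / 2.
Proof.
  intros H. set (j := Int_part (Im p / t)).
  destruct (base_Int_part (Im p / t)) as [J1 J2]. fold j in J1, J2.
  assert (J1' : IZR j * t <= Im p).
  { apply (Rmult_le_compat_r t) in J1; [|lra]. replace (Im p / t * t) with (Im p) in J1 by (field; lra). exact J1. }
  assert (J2' : Im p < IZR j * t + t).
  { assert (Q : Im p / t < IZR j + 1) by lra. apply (Rmult_lt_compat_r t) in Q; [|lra].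
    replace (Im p / t * t) with (Im p) in Q by (field; lra). lra. }
  destruct (Rtotal_order (Im p) ((IZR j + / 2) * t)) as [Q|[Q|Q]].
  - exists j. apply Rabs_def1; lra.
  - exfalso. apply H. exists j. exact Q.
  - exists (j + 1)%Z. rewrite plus_IZR. apply Rabs_def1; lra.
Qed.

Lemma center_near (z : C) (k : Z) : Rabs (Im z - IZR k * t) < t / 2 ->
  exists r, 0 < r /\ forall w, Cmod (w - z) < r -> Rabs (Im w - IZR k * t) < t / 2.
Proof.
  intros H. exists (t / 2 - Rabs (Im z - IZR k * t)). split; [lra|]. intros w Hw.
  replace (Im w - IZR k * t) with (Im (w - z) + (Im z - IZR k * t)) by (rewrite Im_minus; ring).
  eapply Rle_lt_trans; [apply Rabs_triang|]. pose proof (im_le_Cmod (w - z)). lra.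
Qed.

Lemma center_0 : Rabs (Im 0 - IZR 0 * t) < t / 2.
Proof. simpl. rewrite Rmult_0_l, Rminus_0_r, Rabs_R0. lra. Qed.

Lemma center_D : Rabs (Im (RtoC D) - IZR 0 * t) < t / 2.
Proof. simpl. rewrite Rmult_0_l, Rminus_0_r, Rabs_R0. lra. Qed.

Lemma M_sol_near_0 (z : C) : Rabs (Im z - IZR 0 * t) < t / 2 ->
  exists r, 0 < r /\ forall w, Cmod (w - z) < r -> M_sol n tau D w = M_center w.
Proof.
  intros H. destruct (center_near z 0 H) as [r [Pr Hr]]. exists r; split; [exact Pr|].
  intros w Hw. rewrite (M_sol_center w 0 (Hr w Hw)). f_equal. ring.
Qed.

Lemma in_lattice_double (z : C) : in_lattice 1 (2 * tau) z -> in_lattice 1 tau z.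
Proof. intros [a [b ->]]. exists a, (2 * b)%Z. rewrite mult_IZR, RtoC_mult. ring. Qed.

Lemma in_lattice_tau (z : C) (k : Z) : in_lattice 1 tau (z - IZR k * tau) -> in_lattice 1 tau z.
Proof.
  intros [a [b E]]. exists a, (b + k)%Z. rewrite plus_IZR, RtoC_plus.
  transitivity (z - IZR k * tau + IZR k * tau)%C; [ring|]. rewrite E. ring.
Qed.

Lemma good_tau_shift (p : C) (k : Z) (s b : C) : good tau D p ->
  (b = RtoC 0 \/ b = RtoC D) -> (exists j : Z, s = (IZR j * tau)%C) ->
  ~ in_lattice 1 (2 * tau) (p - IZR k * tau + s - b).
Proof.
  intros (_ & G1 & G2) Hb [j ->] HL. apply in_lattice_double in HL.
  replace (p - IZR k * tau + IZR j * tau - b)%C with (p - b - IZR (k - j) * tau)%C in HL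
    by (rewrite minus_IZR, RtoC_minus; ring).
  apply in_lattice_tau in HL. destruct Hb as [->| ->]; [|exact (G2 HL)].
  apply G1. replace p with (p - 0)%C by ring. exact HL.
Qed.

Lemma M_sol_center_entries (P : (C -> C) -> C -> Prop) (z : C) (k : Z) :
  (forall F G r, 0 < r -> (forall w, Cmod (w - z) < r -> F w = G w) -> P F z -> P G z) ->
  Rabs (Im z - IZR k * t) < t / 2 ->
  P (fun w => c1 * f (w - IZR k * tau))%C z -> P (fun w => c1 * f (w - IZR k * tau + tau))%C z ->
  P (fun w => c2 * h (w - IZR k * tau))%C z -> P (fun w => c2 * h (w - IZR k * tau + tau))%C z ->
  entries_all (fun F => P F z) (M_sol n tau D).
Proof.
  intros Ext Hk H1 H2 H3 H4. destruct (center_near z k Hk) as [r [Pr Hr]].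
  assert (E : forall w, Cmod (w - z) < r -> M_center (w - IZR k * tau) = M_sol n tau D w).
  { intros w Hw. rewrite (M_sol_center w k (Hr w Hw)). reflexivity. }
  unfold entries_all. refine (conj _ (conj _ (conj _ _))).
  - apply (Ext (fun w => c1 * f (w - IZR k * tau))%C _ r Pr); [|exact H1].
    intros w Hw. rewrite <- (E w Hw). reflexivity.
  - apply (Ext (fun w => c1 * f (w - IZR k * tau + tau))%C _ r Pr); [|exact H2].
    intros w Hw. rewrite <- (E w Hw). reflexivity.
  - apply (Ext (fun w => c2 * h (w - IZR k * tau))%C _ r Pr); [|exact H3].
    intros w Hw. rewrite <- (E w Hw). reflexivity.
  - apply (Ext (fun w => c2 * h (w - IZR k * tau + tau))%C _ r Pr); [|exact H4].
    intros w Hw. rewrite <- (E w Hw). reflexivity.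
Qed.

Lemma at_most_simple_pole_scal_shift (F : C -> C) (c s z : C) :
  (forall w, at_most_simple_pole F w) -> at_most_simple_pole (fun w => c * F (w + s)%C)%C z.
Proof.
  intros H. destruct (H (z + s)%C) as (g & r & Pr & Hg & Eg).
  exists (fun w => c * g (w + s)%C)%C, r. split; [exact Pr|]. split.
  - apply hol_holo_at, hol_mult; [apply entire_hol; auto with cd | apply hol_shift, hol_holo_at, Hg].
  - intros w Hw. assert (EQ : (w + s - (z + s))%C = (w - z)%C) by ring.
    rewrite Eg by (rewrite EQ; exact Hw). rewrite EQ. unfold Cdiv. ring.
Qed.

Lemma M_sol_meromorphic (p : C) : ~ on_lines tau p ->
  entries_all (fun F => meromorphic_at F p) (M_sol n tau D).
Proof.
  intros Hp. destruct (off_lines_center p Hp) as [k Hk].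
  apply (M_sol_center_entries meromorphic_at p k); [|exact Hk| | | |];
    try (apply at_most_simple_pole_meromorphic;
      apply (at_most_simple_pole_scal_shift _ _ (- (IZR k * tau)) p);
      first [apply (pd_pole _ _ _ _ _ Hf) | apply (pd_pole _ _ _ _ _ Hh)]).
  - intros F G r Pr E (m & g & r' & Pr' & Hg & Eg). exists m, g, (Rmin r r').
    pose proof (Rmin_l r r'); pose proof (Rmin_r r r').
    split; [apply Rmin_pos; lra|]. split; [exact Hg|]. intros w Hw. rewrite <- E by lra. apply Eg; lra.
  - apply at_most_simple_pole_meromorphic.
    replace (fun w => c1 * f (w - IZR k * tau + tau))%C with (fun w => c1 * f (w + (tau - IZR k * tau)))%C
      by (apply functional_extensionality; intros w; do 2 f_equal; ring).
    apply at_most_simple_pole_scal_shift, (pd_pole _ _ _ _ _ Hf).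
  - apply at_most_simple_pole_meromorphic.
    replace (fun w => c2 * h (w - IZR k * tau + tau))%C with (fun w => c2 * h (w + (tau - IZR k * tau)))%C
      by (apply functional_extensionality; intros w; do 2 f_equal; ring).
    apply at_most_simple_pole_scal_shift, (pd_pole _ _ _ _ _ Hh).
Qed.

Lemma hol_scal (F : C -> C) (c z : C) : hol F z -> hol (fun w => c * F w)%C z.
Proof. intros H; apply hol_mult; [apply entire_hol; auto with cd | exact H]. Qed.

Lemma M_sol_holo (p : C) : good tau D p -> entries_all (fun F => holo_at F p) (M_sol n tau D).
Proof.
  intros G. destruct (off_lines_center p (proj1 G)) as [k Hk].
  assert (Sf : forall s, (exists j : Z, s = (IZR j * tau)%C) -> hol f (p - IZR k * tau + s)).
  { intros s Hs. apply (pd_hol _ _ _ _ _ Hf); apply good_tau_shift; auto. }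
  assert (Sh : forall s, (exists j : Z, s = (IZR j * tau)%C) -> hol h (p - IZR k * tau + s)).
  { intros s [j Hs]. apply (pd_hol _ _ _ _ _ Hh).
    - fold tau. replace (p - IZR k * tau + s - tau)%C with (p - IZR k * tau + (s - tau) - 0)%C by ring.
      apply good_tau_shift; auto. exists (j - 1)%Z. rewrite Hs, minus_IZR, RtoC_minus. ring.
    - apply good_tau_shift; auto. exists j; exact Hs. }
  assert (Z0 : exists j : Z, RtoC 0 = (IZR j * tau)%C) by (exists 0%Z; ring).
  assert (Z1 : exists j : Z, tau = (IZR j * tau)%C) by (exists 1%Z; ring).
  assert (E : forall F : C -> C, (fun w => F (w - IZR k * tau)%C) = (fun w => F (w + (0 - IZR k * tau))%C)).
  { intros F. apply functional_extensionality; intros w; f_equal; ring. }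
  assert (E' : forall F : C -> C, (fun w => F (w - IZR k * tau + tau)%C) = (fun w => F (w + (tau - IZR k * tau))%C)).
  { intros F. apply functional_extensionality; intros w; f_equal; ring. }
  apply (M_sol_center_entries holo_at p k); [|exact Hk| | | |].
  - intros F Q r Pr EQ H. apply hol_holo_at. apply hol_holo_at in H. exact (hol_ext_loc F Q p r Pr EQ H).
  - apply hol_holo_at, hol_scal. rewrite E. apply hol_shift.
    replace (p + (0 - IZR k * tau))%C with (p - IZR k * tau + 0)%C by ring. apply Sf, Z0.
  - apply hol_holo_at, hol_scal. rewrite E'. apply hol_shift.
    replace (p + (tau - IZR k * tau))%C with (p - IZR k * tau + tau)%C by ring. apply Sf, Z1.
  - apply hol_holo_at, hol_scal. rewrite E. apply hol_shift.
    replace (p + (0 - IZR k * tau))%C with (p - IZR k * tau + 0)%C by ring. apply Sh, Z0.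
  - apply hol_holo_at, hol_scal. rewrite E'. apply hol_shift.
    replace (p + (tau - IZR k * tau))%C with (p - IZR k * tau + tau)%C by ring. apply Sh, Z1.
Qed.

Lemma M_sol_periods (p : C) : ~ on_lines tau p ->
  M_sol n tau D (p + 1)%C = mscal (sgn n) (M_sol n tau D p) /\
  M_sol n tau D (p + tau)%C = M_sol n tau D p.
Proof.
  intros Hp. destruct (off_lines_center p Hp) as [k Hk].
  rewrite (M_sol_center p k Hk). split.
  - rewrite (M_sol_center (p + 1) k).
    + replace (p + 1 - IZR k * tau)%C with (p - IZR k * tau + 1)%C by ring.
      unfold M_center, mscal, mk2, m11, m12, m21, m22. simpl.
      replace (p - IZR k * tau + 1 + tau)%C with (p - IZR k * tau + tau + 1)%C by ring.
      rewrite !(pd_1 _ _ _ _ _ Hf), !(pd_1 _ _ _ _ _ Hh). f_equal; f_equal; ring.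
    + replace (Im (p + 1)) with (Im p) by (unfold Im; simpl; ring). exact Hk.
  - rewrite (M_sol_center (p + tau) (k + 1)).
    + f_equal. rewrite plus_IZR, RtoC_plus. ring.
    + rewrite plus_IZR. replace (Im (p + tau) - (IZR k + 1) * t) with (Im p - IZR k * t)
        by (unfold tau, Im; simpl; ring). exact Hk.
Qed.

End Existence.

Lemma Cderiv_eq (F : C -> C) (z l : C) : cder F z l -> Cderiv F z = l.
Proof.
  intros H. unfold Cderiv.
  apply (cder_unique F z); [|exact H]. apply cder_is_derive.
  apply epsilon_spec. exists l. apply cder_is_derive, H.
Qed.

Definition entries_close (A B : Mat2) (e : R) : Prop :=
  Cmod (m11 A - m11 B) < e /\ Cmod (m12 A - m12 B) < e /\
  Cmod (m21 A - m21 B) < e /\ Cmod (m22 A - m22 B) < e.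

(** Translates convergence in the product uniform structure of [Mat2] into moduli of the four
    entries. *)
Lemma filterlim_entries {T : Type} (F : (T -> Prop) -> Prop) {FF : Filter F} (M : T -> Mat2) (B : Mat2) :
  filterlim M F (locally B) <-> forall e, 0 < e -> F (fun x => entries_close (M x) B e).
Proof.
  split.
  - intros H e He. unfold filterlim, filter_le, filtermap in H.
    apply (H (fun A => entries_close A B e)).
    assert (He2 : 0 < e / 2) by lra.
    exists (mkposreal _ He2). intros A [[[H1 H2] [H3 H4]] [[H5 H6] [H7 H8]]].
    assert (Q : forall a b : C, ball (fst b) (e / 2) (fst a) -> ball (snd b) (e / 2) (snd a) -> Cmod (a - b) < e).
    { intros a b Q1 Q2. eapply Rle_lt_trans; [apply Cmod_le_abs|].
      change (Rabs (fst a - fst b) < e / 2) in Q1. change (Rabs (snd a - snd b) < e / 2) in Q2.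
      change (Rabs (fst a - fst b) + Rabs (snd a - snd b) < e). lra. }
    repeat split; apply Q; assumption.
  - intros H P [eps HP]. specialize (H eps (cond_pos eps)). unfold filtermap.
    revert H. apply filter_imp. intros x (H1 & H2 & H3 & H4). apply HP.
    assert (Q : forall a b : C, Cmod (a - b) < eps -> ball b eps a).
    { intros a b Q. split.
      - change (Rabs (fst a - fst b) < eps). eapply Rle_lt_trans; [apply (re_le_Cmod (a - b)%C) | exact Q].
      - change (Rabs (snd a - snd b) < eps). eapply Rle_lt_trans; [apply (im_le_Cmod (a - b)%C) | exact Q]. }
    repeat split; apply Q; assumption.
Qed.

Lemma locally_Cmod (z : C) (P : C -> Prop) :
  locally z P <-> exists d, 0 < d /\ forall w, Cmod (w - z) < d -> P w.
Proof.
  split.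
  - intros [eps H]. exists eps. split; [apply cond_pos|]. intros w Hw. apply H. split.
    + change (Rabs (fst w - fst z) < eps). eapply Rle_lt_trans; [apply (re_le_Cmod (w - z)%C) | exact Hw].
    + change (Rabs (snd w - snd z) < eps). eapply Rle_lt_trans; [apply (im_le_Cmod (w - z)%C) | exact Hw].
  - intros [d [Pd H]]. assert (Pd2 : 0 < d / 2) by lra. exists (mkposreal _ Pd2). intros w [H1 H2]. apply H.
    eapply Rle_lt_trans; [apply Cmod_le_abs|].
    change (Rabs (fst w - fst z) < d / 2) in H1. change (Rabs (snd w - snd z) < d / 2) in H2.
    change (Rabs (fst w - fst z) + Rabs (snd w - snd z) < d). lra.
Qed.

(** * Normalization at 0 and boundary values of the explicit solution *)

Section ExistenceBoundary.
Variables (n : nat) (t D : R).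
Hypotheses (Hn : (1 <= n)%nat) (Ht : 0 < t) (HD : 0 < D < 1).
Let tau : C := (0, t).
Let f : C -> C := f_sol n tau D.
Let h : C -> C := h_sol n tau D.
Let c1 : C := (a_const tau D * kappa n tau)%C.
Let c2 : C := (kappa n tau / a_const tau D)%C.
Let Hf : pole_data n t D 0 f := f_pole_data n t D Hn Ht HD.
Let Hh : pole_data n t D tau h := h_pole_data n t D Hn Ht HD.
Let Nf (w : C) : C := if Nat.even n then th2 tau w else th3 tau w.

Let cdf_Nf (z : C) : cdf Nf z.
Proof. unfold Nf. destruct (Nat.even n); [apply cdf_th2, Ht | apply cdf_th3, Ht]. Qed.

Let Nf_0 : Nf 0 <> 0.
Proof.
  assert (H : forall y, ~ in_lattice 1 (2 * (0, t)) (0 - hpt y)).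
  { intros y. apply not_lattice_Re. intros i E. apply (half_not_int (- i)). rewrite opp_IZR. simpl in E. lra. }
  unfold Nf, tau. destruct (Nat.even n); intros E.
  - apply th2_zero in E; [exact (H 0 E) | exact Ht].
  - apply th3_zero in E; [exact (H t E) | exact Ht].
Qed.

Let th1_D : th1 tau (RtoC D) <> 0.
Proof.
  apply th1_neq_0; [exact Ht|]. apply not_lattice_Re. intros i. rewrite re_RtoC. apply D_not_int, HD.
Qed.

Let th1_Dtau : th1 tau (RtoC D + tau) <> 0.
Proof.
  apply th1_neq_0; [exact Ht|]. apply (not_lattice_Im t Ht _ 0). unfold tau, Im; simpl. ring.
Qed.

(** Oddness combined with quasi-periodicity; this is the origin of the factor exp(2πiD) in h. *)
Let th1_tau_D : th1 tau (tau - RtoC D) = (Cexp (2 * Ci * PI * RtoC D) * th1 tau (RtoC D + tau))%C.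
Proof.
  replace (RtoC D + tau)%C with (RtoC D - tau + 2 * (0, t))%C by (unfold tau; ring).
  unfold tau. rewrite th1_2tau by exact Ht. fold tau.
  replace (tau - RtoC D)%C with (- (RtoC D - tau))%C by ring. unfold tau. rewrite th1_opp. fold tau.
  assert (E : mult2 t (RtoC D - tau) = Cexp (- (2 * Ci * PI * RtoC D))).
  { unfold mult2. f_equal. unfold tau. ring. }
  rewrite E. pose proof (Cexp_opp_mult (2 * Ci * PI * RtoC D)) as M.
  transitivity (- (Cexp (2 * Ci * PI * RtoC D) * Cexp (- (2 * Ci * PI * RtoC D)) * th1 tau (RtoC D - tau)))%C;
    [rewrite M|]; ring.
Qed.

Lemma f_residue : bounded_near (fun w => c1 * f w - / w)%C 0.
Proof.
  destruct (th1_simple t Ht) as [l [Nl Hl]]. fold tau in Hl.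
  destruct (cdf_th1_shift t Ht (RtoC D) 0) as [m Hm]. fold tau in Hm.
  pose proof (th1_at_0 t Ht) as T0. fold tau in T0.
  assert (TD : th1 tau (0 - RtoC D) = (- th1 tau (RtoC D))%C).
  { replace (0 - RtoC D)%C with (- RtoC D)%C by ring. apply th1_opp. }
  assert (TDt : th1 tau (0 - RtoC D - tau) = (- th1 tau (RtoC D + tau))%C).
  { replace (0 - RtoC D - tau)%C with (- (RtoC D + tau))%C by ring. apply th1_opp. }
  set (A := fun w => (Cexp (- (Ci * PI * w)) * (th1 tau (w - RtoC D - tau) * Nf w))%C).
  set (B := fun w => (th1 tau (w - RtoC D) * th1 tau w)%C).
  destruct (simple_zero_quotient A B 0 (m * th1 tau 0 + th1 tau (0 - RtoC D) * l)%C)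
    as (g & r & Pr & Hg & G0 & Eg).
  - apply entire_hol; intros w. apply cdf_mult; [auto with cd|].
    apply cdf_mult; [apply cdf_th1_shift2, Ht | apply cdf_Nf].
  - apply entire_hol; intros w. apply cdf_mult; [apply cdf_th1_shift, Ht | apply cdf_th1, Ht].
  - unfold B. rewrite T0. ring.
  - apply (cder_mult (fun w => th1 tau (w - RtoC D)) (th1 tau)); assumption.
  - rewrite T0, TD, Cmult_0_r, Cplus_0_l. apply Cmult_neq_0; [|exact Nl].
    intros E. apply th1_D. transitivity (- - th1 tau (RtoC D))%C; [ring|]. rewrite E. ring.
  - apply (simple_pole_residue_1 _ (fun w => c1 * g w)%C r Pr).
    + apply hol_scal, Hg.
    + rewrite G0. unfold c1, A, a_const, kappa. fold (Nf 0). rewrite (Cderiv_eq _ _ _ Hl), T0, TD, TDt.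
      replace (- (Ci * PI * 0))%C with (RtoC 0) by ring. rewrite Cexp_0. field.
      repeat split; assumption.
    + intros w Hw. change (f w) with (A w / B w)%C. rewrite (Eg w Hw). unfold Cdiv. ring.
Qed.

Lemma h_residue : bounded_near (fun w => c2 * h (w + tau) - / w)%C 0.
Proof.
  destruct (th1_simple t Ht) as [l [Nl Hl]]. fold tau in Hl.
  set (X := fun p : C => Cexp (- (Ci * PI * p) + Ci * PI * tau + 2 * Ci * PI * RtoC D - Ci * PI / 2)).
  set (k := fun w => th1 tau (w + (tau - RtoC D))).
  assert (Ck : forall w, cdf k w).
  { intros w. apply (cdf_comp (th1 tau) (fun w => w + (tau - RtoC D))%C); [apply cdf_th1, Ht | auto with cd]. }
  destruct (Ck 0) as [m Hm].
  pose proof (th1_at_0 t Ht) as T0. fold tau in T0.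
  assert (K0 : k 0 = (Cexp (2 * Ci * PI * RtoC D) * th1 tau (RtoC D + tau))%C).
  { unfold k. replace (0 + (tau - RtoC D))%C with (tau - RtoC D)%C by ring. apply th1_tau_D. }
  assert (TD : th1 tau (0 - RtoC D) = (- th1 tau (RtoC D))%C).
  { replace (0 - RtoC D)%C with (- RtoC D)%C by ring. apply th1_opp. }
  (* The term iπτ in the prefactor of h cancels the shift by τ, and -iπ/2 gives the -i that meets
     the i in θ4(w + τ). *)
  assert (X0 : X (0 + tau)%C = (- Ci * Cexp (2 * Ci * PI * RtoC D))%C).
  { unfold X. replace (- (Ci * PI * (0 + tau)) + Ci * PI * tau + 2 * Ci * PI * RtoC D - Ci * PI / 2)%C
      with (2 * Ci * PI * RtoC D + - (Ci * PI / 2))%C by ring.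
    rewrite Cexp_plus. replace (Cexp (- (Ci * PI / 2))) with (- Ci)%C; [ring|].
    unfold Cexp. replace (- (Ci * PI / 2))%C with (RtoC 0 + Ci * RtoC (- (PI / 2)))%C.
    - replace (Re (0 + Ci * RtoC (- (PI / 2)))) with 0 by (simpl; ring).
      replace (Im (0 + Ci * RtoC (- (PI / 2)))) with (- (PI / 2)) by (simpl; ring).
      rewrite exp_0, cos_neg, sin_neg, cos_PI2, sin_PI2. Ceq; ring.
    - rewrite RtoC_opp, RtoC_div by lra. unfold Cdiv. ring. }
  pose proof (Cexp_neq_0 (2 * Ci * PI * RtoC D)) as NE.
  set (A := fun w => (X (w + tau) * (th1 tau (w - RtoC D) * Nf w))%C).
  set (B := fun w => (k w * (Ci * th1 tau w))%C).
  destruct (simple_zero_quotient A B 0 (m * (Ci * th1 tau 0) + k 0 * (0 * th1 tau 0 + Ci * l))%C)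
    as (g & r & Pr & Hg & G0 & Eg).
  - apply entire_hol; intros w. apply cdf_mult.
    + unfold X, Cminus. auto 20 with cd.
    + apply cdf_mult; [apply cdf_th1_shift, Ht | apply cdf_Nf].
  - apply entire_hol; intros w. apply cdf_mult; [apply Ck|]. apply cdf_mult; [apply cdf_const | apply cdf_th1, Ht].
  - unfold B. rewrite T0. ring.
  - apply (cder_mult k (fun w => Ci * th1 tau w)%C); [exact Hm|].
    apply (cder_mult (fun _ => Ci) (th1 tau)); [apply cder_const | exact Hl].
  - rewrite T0, !Cmult_0_r, !Cplus_0_l, K0.
    apply Cmult_neq_0; apply Cmult_neq_0; try assumption. apply Ci_nz.
  - apply (simple_pole_residue_1 _ (fun w => c2 * g w)%C r Pr).
    + apply hol_scal, Hg.
    + rewrite G0. unfold c2, A, a_const, kappa. fold (Nf 0). rewrite (Cderiv_eq _ _ _ Hl), T0, TD, K0, X0.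
      pose proof Ci_nz. field. repeat split; assumption.
    + intros w Hw.
      assert (E : h (w + tau)%C = (A w / B w)%C).
      { unfold h, h_sol. fold (X (w + tau)%C).
        replace (w + tau - RtoC D - tau)%C with (w - RtoC D)%C by ring.
        replace (w + tau - RtoC D)%C with (w + (tau - RtoC D))%C by ring. fold (k w).
        (* Under the shift by τ the numerator of h becomes that of f and θ4 becomes θ1, with the
           same half-period multiplier above and below. *)
        replace (if Nat.even n then th3 tau (w + tau) else th2 tau (w + tau)) with (halfmult t w * Nf w)%C.
        - unfold tau. rewrite th4_tau by exact Ht. fold tau.
          replace (X (w + tau) * (th1 tau (w - RtoC D) * (halfmult t w * Nf w)))%C with (halfmult t w * A w)%C
            by (unfold A; ring).
          replace (k w * (Ci * halfmult t w * th1 tau w))%C with (halfmult t w * B w)%C by (unfold B; ring).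
          assert (NH : halfmult t w <> 0) by apply Cexp_neq_0.
          rewrite Cdiv_scal by exact NH. unfold Cdiv at 1. rewrite Cinv_r by exact NH. ring.
        - unfold Nf, tau. destruct (Nat.even n); symmetry; [apply th3_tau, Ht | apply th2_tau, Ht]. }
      rewrite E, (Eg w Hw). unfold Cdiv. ring.
Qed.

Let nlat_0_D : ~ in_lattice 1 (2 * tau) (0 - RtoC D).
Proof.
  apply not_lattice_Re. intros i E. apply (D_not_int D HD (- i)). rewrite opp_IZR. simpl in E. lra.
Qed.
Let nlat_tau (b : C) : Im b = 0 -> ~ in_lattice 1 (2 * tau) (b + tau).
Proof. intros Hb. apply (not_lattice_Im t Ht _ 0). unfold tau. unfold Im in *. simpl. rewrite Hb. ring. Qed.
Let nlat_mtau (b : C) : Im b = 0 -> ~ in_lattice 1 (2 * tau) (b - tau).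
Proof. intros Hb. apply (not_lattice_Im t Ht _ (-1)). unfold tau. unfold Im in *. simpl. rewrite Hb. ring. Qed.

Lemma hol_f_tau (b : C) : Im b = 0 -> hol (fun w => f (w + tau)%C) b.
Proof.
  intros Hb. apply hol_shift, (pd_hol _ _ _ _ _ Hf).
  - replace (b + tau - 0)%C with (b + tau)%C by ring. apply nlat_tau, Hb.
  - replace (b + tau - RtoC D)%C with (b - RtoC D + tau)%C by ring. apply nlat_tau.
    rewrite Im_minus, Hb, im_RtoC. ring.
Qed.

Lemma hol_h_0 : hol h 0.
Proof. apply (pd_hol _ _ _ _ _ Hh); [apply nlat_mtau; reflexivity | exact nlat_0_D]. Qed.

Lemma hol_h_Dtau : hol (fun w => h (w + tau)%C) (RtoC D).
Proof.
  apply hol_shift, (pd_hol _ _ _ _ _ Hh).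
  - fold tau. replace (RtoC D + tau - tau)%C with (RtoC D) by ring.
    apply not_lattice_Re. intros i. rewrite re_RtoC. apply D_not_int, HD.
  - fold tau. replace (RtoC D + tau - RtoC D)%C with (0 + tau)%C by ring. apply nlat_tau. reflexivity.
Qed.

(** All poles of f and h lie at heights in tZ, so the central expression is continuous across both
    edges of its strip. *)
Lemma M_center_close (p : C) (j : Z) : Im p = (IZR j + / 2) * t -> forall e, 0 < e ->
  exists d, 0 < d /\ forall w, Cmod (w - p) < d -> entries_close (M_center n t D w) (M_center n t D p) e.
Proof.
  intros Hp e He.
  assert (NL : forall (b : C) (i : Z), Im b = IZR i * t -> ~ in_lattice 1 (2 * tau) (p - b)).
  { intros b i Hb HL. apply lattice_coords in HL. destruct HL as (_ & q & _ & E).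
    rewrite Im_minus, Hp, Hb in E.
    assert (E2 : IZR (2 * j + 1) = IZR (2 * (i + 2 * q))).
    { rewrite plus_IZR, !mult_IZR, plus_IZR, mult_IZR.
      apply (Rmult_eq_reg_r t); [|lra]. lra. }
    apply eq_IZR in E2. lia. }
  assert (CC : forall F : C -> C, hol F p -> exists d, 0 < d /\ forall w, Cmod (w - p) < d -> Cmod (F w - F p) < e).
  { intros F HF. exact (cdf_ccont _ _ (hol_cdf _ _ HF) e He). }
  assert (F0 : hol f p).
  { apply (pd_hol _ _ _ _ _ Hf); [apply (NL 0 0%Z) | apply (NL (RtoC D) 0%Z)]; simpl; ring. }
  assert (F1 : hol (fun w => f (w + tau)%C) p).
  { apply hol_shift, (pd_hol _ _ _ _ _ Hf); fold tau.
    - replace (p + tau - 0)%C with (p - (- tau))%C by ring. apply (NL _ (-1)%Z). unfold tau, Im; simpl; ring.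
    - replace (p + tau - RtoC D)%C with (p - (RtoC D - tau))%C by ring. apply (NL _ (-1)%Z). unfold tau, Im; simpl; ring. }
  assert (H0 : hol h p).
  { apply (pd_hol _ _ _ _ _ Hh); [apply (NL tau 1%Z) | apply (NL (RtoC D) 0%Z)]; unfold tau, Im; simpl; ring. }
  assert (H1 : hol (fun w => h (w + tau)%C) p).
  { apply hol_shift, (pd_hol _ _ _ _ _ Hh); fold tau.
    - replace (p + tau - tau)%C with (p - 0)%C by ring. apply (NL _ 0%Z). unfold Im; simpl; ring.
    - replace (p + tau - RtoC D)%C with (p - (RtoC D - tau))%C by ring. apply (NL _ (-1)%Z). unfold tau, Im; simpl; ring. }
  destruct (CC _ (hol_scal _ c1 p F0)) as [d1 [P1 D1]]. destruct (CC _ (hol_scal _ c1 p F1)) as [d2 [P2 D2]].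
  destruct (CC _ (hol_scal _ c2 p H0)) as [d3 [P3 D3]]. destruct (CC _ (hol_scal _ c2 p H1)) as [d4 [P4 D4]].
  exists (Rmin (Rmin d1 d2) (Rmin d3 d4)). split; [repeat apply Rmin_pos; lra|]. intros w Hw.
  assert (Q1 : Cmod (w - p) < d1) by (eapply Rlt_le_trans; [exact Hw | eapply Rle_trans; [apply Rmin_l | apply Rmin_l]]).
  assert (Q2 : Cmod (w - p) < d2) by (eapply Rlt_le_trans; [exact Hw | eapply Rle_trans; [apply Rmin_l | apply Rmin_r]]).
  assert (Q3 : Cmod (w - p) < d3) by (eapply Rlt_le_trans; [exact Hw | eapply Rle_trans; [apply Rmin_r | apply Rmin_l]]).
  assert (Q4 : Cmod (w - p) < d4) by (eapply Rlt_le_trans; [exact Hw | eapply Rle_trans; [apply Rmin_r | apply Rmin_r]]).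
  exact (conj (D1 w Q1) (conj (D2 w Q2) (conj (D3 w Q3) (D4 w Q4)))).
Qed.

Lemma M_sol_boundary (k : Z) : exists Bp Bm : R -> Mat2,
  (forall x : R, continuous Bp x /\ continuous Bm x) /\
  (forall x : R,
     filterlim (M_sol n tau D) (within (fun w => Im (line_pt tau k x) < Im w) (locally (line_pt tau k x)))
               (locally (Bp x)) /\
     filterlim (M_sol n tau D) (within (fun w => Im w < Im (line_pt tau k x)) (locally (line_pt tau k x)))
               (locally (Bm x))) /\
  (forall x : R, Bp x = mmul (Bm x) Jmat).
Proof.
  set (z := fun x : R => line_pt tau k x).
  assert (Iz : forall x, Im (z x) = (IZR k + / 2) * t) by reflexivity.
  (* From above, the line is the lower edge of the strip with center k + 1; from below, the upper
     edge of the strip with center k. The jump compares the central expression at p - τ and p. *)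
  exists (fun x => M_center n t D (z x - IZR (k + 1) * tau)), (fun x => M_center n t D (z x - IZR k * tau)).
  assert (Ip : forall x, Im (z x - IZR (k + 1) * tau) = (IZR (-1) + / 2) * t).
  { intros x. rewrite Im_minus, Iz, im_scal_l, plus_IZR. unfold tau, Im; simpl. lra. }
  assert (Im' : forall x, Im (z x - IZR k * tau) = (IZR 0 + / 2) * t).
  { intros x. rewrite Im_minus, Iz, im_scal_l. unfold tau, Im; simpl. lra. }
  assert (Dz : forall x x' : R, Cmod (z x' - z x) = Rabs (x' - x)).
  { intros x x'. replace (z x' - z x)%C with (RtoC (x' - x)) by (unfold z, line_pt; Ceq; ring). apply Cmod_R. }
  split; [|split].
  - intros x. split; apply filterlim_entries; try apply locally_filter; intros e He.
    + destruct (M_center_close _ _ (Ip x) e He) as [d [Pd Hd]]. exists (mkposreal d Pd). intros x' Hx'.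
      apply Hd. replace (z x' - IZR (k + 1) * tau - (z x - IZR (k + 1) * tau))%C with (z x' - z x)%C by ring.
      rewrite Dz. exact Hx'.
    + destruct (M_center_close _ _ (Im' x) e He) as [d [Pd Hd]]. exists (mkposreal d Pd). intros x' Hx'.
      apply Hd. replace (z x' - IZR k * tau - (z x - IZR k * tau))%C with (z x' - z x)%C by ring.
      rewrite Dz. exact Hx'.
  - intros x. fold (z x). rewrite Iz.
    assert (Bd : forall w, Cmod (w - z x) < t / 2 -> Rabs (Im w - (IZR k + / 2) * t) < t / 2).
    { intros w Hw. rewrite <- (Iz x), <- Im_minus. eapply Rle_lt_trans; [apply im_le_Cmod | exact Hw]. }
    split; apply filterlim_entries; try apply within_filter, locally_filter; intros e He;
      apply locally_Cmod.
    + destruct (M_center_close _ _ (Ip x) e He) as [d [Pd Hd]].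
      exists (Rmin d (t / 2)). pose proof (Rmin_l d (t / 2)); pose proof (Rmin_r d (t / 2)).
      split; [apply Rmin_pos; lra|]. intros w Hw Hlt.
      specialize (Bd w ltac:(lra)). apply Rabs_def2 in Bd.
      pose proof (M_sol_center n t D Hn Ht HD w (k + 1) ltac:(rewrite plus_IZR; apply Rabs_def1; lra)) as EM.
      fold tau in EM. rewrite EM. apply Hd.
      replace (w - IZR (k + 1) * tau - (z x - IZR (k + 1) * tau))%C with (w - z x)%C by ring. lra.
    + destruct (M_center_close _ _ (Im' x) e He) as [d [Pd Hd]].
      exists (Rmin d (t / 2)). pose proof (Rmin_l d (t / 2)); pose proof (Rmin_r d (t / 2)).
      split; [apply Rmin_pos; lra|]. intros w Hw Hlt.
      specialize (Bd w ltac:(lra)). apply Rabs_def2 in Bd.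
      pose proof (M_sol_center n t D Hn Ht HD w k ltac:(apply Rabs_def1; lra)) as EM.
      fold tau in EM. rewrite EM. apply Hd.
      replace (w - IZR k * tau - (z x - IZR k * tau))%C with (w - z x)%C by ring. lra.
  - intros x. replace (z x - IZR (k + 1) * tau)%C with (z x - IZR k * tau - tau)%C
      by (rewrite plus_IZR, RtoC_plus; ring).
    set (p := (z x - IZR k * tau)%C).
    unfold M_center, mmul, Jmat, mk2, m11, m12, m21, m22. simpl. fold tau f h.
    assert (F1 : f (p - tau)%C = (- f (p + tau))%C).
    { replace (p + tau)%C with (p - tau + 2 * (0, t))%C by (unfold tau; ring).
      rewrite (pd_2tau _ _ _ _ _ Hf). ring. }
    assert (H1 : h (p - tau)%C = (- h (p + tau))%C).
    { replace (p + tau)%C with (p - tau + 2 * (0, t))%C by (unfold tau; ring).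
      rewrite (pd_2tau _ _ _ _ _ Hh). ring. }
    replace (p - tau + tau)%C with p by ring. rewrite F1, H1. f_equal; f_equal; ring.
Qed.

Theorem M_sol_solution : RHP_solution n tau D (M_sol n tau D).
Proof.
  destruct (M_sol_near_0 n t D Hn Ht HD 0 (center_0 t Ht)) as (r0 & P0 & E0).
  destruct (M_sol_near_0 n t D Hn Ht HD (RtoC D) (center_D t D Ht)) as (rD & PD & ED).
  fold tau in E0, ED.
  assert (Zf : f (RtoC D + tau)%C = 0) by apply (pd_zero _ _ _ _ _ Hf).
  assert (Zh : h (RtoC D + tau)%C = 0) by apply (pd_zero _ _ _ _ _ Hh).
  unfold RHP_solution.
  refine (conj _ (conj _ (conj _ (conj _ (conj _ (conj _ (conj _ (conj _ (conj _ (conj _ (conj _ _))))))))))).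
  - apply M_sol_meromorphic; assumption.
  - intros p Hp. apply M_sol_periods; try assumption. apply Hp.
  - apply (bounded_near_ext (fun w => c1 * f w - / w)%C _ 0 r0 P0); [|apply f_residue].
    intros w [_ Hw]. rewrite (E0 w Hw). reflexivity.
  - apply (bounded_near_ext (fun w => c1 * f (w + tau))%C _ 0 r0 P0).
    + intros w [_ Hw]. rewrite (E0 w Hw). reflexivity.
    + apply hol_bounded_near, hol_scal, hol_f_tau. reflexivity.
  - apply (bounded_near_ext (fun w => c2 * h w)%C _ 0 r0 P0).
    + intros w [_ Hw]. rewrite (E0 w Hw). reflexivity.
    + apply hol_bounded_near, hol_scal, hol_h_0.
  - apply (bounded_near_ext (fun w => c2 * h (w + tau) - / w)%C _ 0 r0 P0); [|apply h_residue].
    intros w [_ Hw]. rewrite (E0 w Hw). reflexivity.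
  (* The shift by 0 brings the entry into the form of [at_most_simple_pole_scal_shift]. *)
  - apply (bounded_near_ext (fun w => (w - RtoC D) * (c1 * f (w + 0)))%C _ (RtoC D) rD PD).
    + intros w [_ Hw]. rewrite (ED w Hw). rewrite Cplus_0_r. reflexivity.
    + apply simple_pole_bounded_near, at_most_simple_pole_scal_shift, (pd_pole _ _ _ _ _ Hf).
  - apply (bounded_near_ext (fun w => (w - RtoC D) * (c2 * h (w + 0)))%C _ (RtoC D) rD PD).
    + intros w [_ Hw]. rewrite (ED w Hw). rewrite Cplus_0_r. reflexivity.
    + apply simple_pole_bounded_near, at_most_simple_pole_scal_shift, (pd_pole _ _ _ _ _ Hh).
  - apply (bounded_near_ext (fun w => c1 * f (w + tau) / (w - RtoC D))%C _ (RtoC D) rD PD).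
    + intros w [_ Hw]. rewrite (ED w Hw). reflexivity.
    + apply (hol_zero_bounded_near (fun w => c1 * f (w + tau))%C).
      * apply hol_scal, hol_f_tau. reflexivity.
      * rewrite Zf. ring.
  - apply (bounded_near_ext (fun w => c2 * h (w + tau) / (w - RtoC D))%C _ (RtoC D) rD PD).
    + intros w [_ Hw]. rewrite (ED w Hw). reflexivity.
    + apply (hol_zero_bounded_near (fun w => c2 * h (w + tau))%C).
      * apply hol_scal, hol_h_Dtau.
      * rewrite Zh. ring.
  - apply M_sol_holo; assumption.
  - exact M_sol_boundary.
Qed.

End ExistenceBoundary.

(** * Uniqueness *)

(* Analytic continuation of the row [(u, v)] of a solution across the jump lines. *)
Definition sheet (k : Z) (u v : C) : C :=
  match (k mod 4)%Z with 0%Z => u | 1%Z => v | 2%Z => (- u)%C | _ => (- v)%C end.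

Lemma mod4_cases (k : Z) : (k mod 4 = 0 \/ k mod 4 = 1 \/ k mod 4 = 2 \/ k mod 4 = 3)%Z.
Proof. pose proof (Z.mod_pos_bound k 4 ltac:(lia)). lia. Qed.

(** Right multiplication by [Jmat] sends the row (u, v) to (-v, u); moving up one sheet compensates
    it. *)
Lemma sheet_succ (k : Z) (u v : C) : sheet (k + 1) (- v) u = sheet k u v.
Proof.
  unfold sheet. rewrite <- Zplus_mod_idemp_l.
  destruct (mod4_cases k) as [E|[E|[E|E]]]; rewrite E; simpl; ring.
Qed.

Lemma sheet_add_2 (k : Z) (u v : C) : sheet (k + 2) u v = (- sheet k u v)%C.
Proof.
  unfold sheet. rewrite <- Zplus_mod_idemp_l.
  destruct (mod4_cases k) as [E|[E|[E|E]]]; rewrite E; simpl; ring.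
Qed.

Lemma sheet_scal (k : Z) (c u v : C) : sheet k (c * u) (c * v) = (c * sheet k u v)%C.
Proof.
  unfold sheet. destruct (mod4_cases k) as [E|[E|[E|E]]]; rewrite E; simpl; ring.
Qed.

Lemma sheet_close (k : Z) (u v u' v' : C) (e : R) :
  Cmod (u - u') < e -> Cmod (v - v') < e -> Cmod (sheet k u v - sheet k u' v') < e.
Proof.
  intros H1 H2. unfold sheet. destruct (mod4_cases k) as [E|[E|[E|E]]]; rewrite E; simpl; try assumption.
  - replace (- u - - u')%C with (- (u - u'))%C by ring. rewrite Cmod_opp. exact H1.
  - replace (- v - - v')%C with (- (v - v'))%C by ring. rewrite Cmod_opp. exact H2.
Qed.

Lemma hol_sheet (k : Z) (u v : C -> C) (z : C) : hol u z -> hol v z ->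
  hol (fun w => sheet k (u w) (v w)) z.
Proof.
  intros [r1 [P1 H1]] [r2 [P2 H2]]. exists (Rmin r1 r2). pose proof (Rmin_l r1 r2); pose proof (Rmin_r r1 r2).
  split; [apply Rmin_pos; lra|]. intros w Hw. specialize (H1 w ltac:(lra)). specialize (H2 w ltac:(lra)).
  unfold sheet. destruct (mod4_cases k) as [E|[E|[E|E]]]; rewrite E; auto with cd.
Qed.

Lemma Riemann_reg (t : R) (G : C -> C) (b : C) (r : R) : 0 < r -> ~ offgrid t b ->
  (forall w, 0 < Cmod (w - b) < r -> cdf G w) -> bounded_near G b -> reg t G b.
Proof.
  intros Pr Nb Hd (r' & K & Pr' & HK).
  pose proof (Rmin_l r r'); pose proof (Rmin_r r r').
  destruct (Riemann_removable G b (Rmin r r') K) as [g [Hg Eg]].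
  - apply Rmin_pos; lra.
  - intros w Hw. apply Hd; lra.
  - intros w Hw. apply HK; lra.
  - exists g, (Rmin r r'). split; [apply Rmin_pos; lra|]. split; [exact Hg|].
    intros w Hw Uw. apply Eg. split; [|exact Hw]. apply Cmod_sub_pos. intros ->. exact (Nb Uw).
Qed.

(** * Points away from the jump lines and the poles *)

Section Good.
Variables (t D : R).
Hypotheses (Ht : 0 < t) (HD : 0 < D < 1).
Let tau : C := (0, t).

Lemma lattice_tau_coords (z : C) : in_lattice 1 (0, t) z ->
  exists a b : Z, Re z = IZR a /\ Im z = IZR b * t.
Proof. intros [a [b ->]]. exists a, b. unfold Re, Im; simpl. split; ring. Qed.

Lemma offgrid_good (p : C) : offgrid t p -> good tau D p.
Proof.
  intros U. split; [|split].
  - intros [k H]. unfold on_line in H. change (Im tau) with t in H. apply (U (2 * k + 1)%Z).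
    rewrite plus_IZR, mult_IZR. lra.
  - intros HL. apply lattice_tau_coords in HL. destruct HL as (a & b & _ & E).
    apply (U (2 * b)%Z). rewrite mult_IZR. lra.
  - intros HL. apply lattice_tau_coords in HL. destruct HL as (a & b & _ & E).
    rewrite Im_minus, im_RtoC in E. apply (U (2 * b)%Z). rewrite mult_IZR. lra.
Qed.

Lemma good_shift (p : C) (j : Z) : good tau D p -> good tau D (p + IZR j * tau).
Proof.
  intros (G1 & G2 & G3). split; [|split].
  - intros [k H]. apply G1. exists (k - j)%Z. unfold on_line in *. change (Im tau) with t in *.
    replace (Im (p + IZR j * tau)) with (Im p + IZR j * t) in H by (unfold tau, Im; simpl; ring).
    rewrite minus_IZR. lra.
  - intros HL. apply G2, (in_lattice_tau t p (- j)). fold tau. rewrite opp_IZR, RtoC_opp.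
    replace (p - - RtoC (IZR j) * tau)%C with (p + IZR j * tau)%C by ring. exact HL.
  - intros HL. apply G3, (in_lattice_tau t _ (- j)). fold tau. rewrite opp_IZR, RtoC_opp.
    replace (p - RtoC D - - RtoC (IZR j) * tau)%C with (p + IZR j * tau - RtoC D)%C by ring. exact HL.
Qed.

Lemma good_near (b : C) : b = 0 \/ b = RtoC D ->
  exists r, 0 < r /\ r <= t / 2 /\ forall w, 0 < Cmod (w - b) < r -> good tau D w.
Proof.
  intros Hb. exists (Rmin (t / 2) (Rmin D (1 - D))).
  pose proof (Rmin_l (t / 2) (Rmin D (1 - D))). pose proof (Rmin_r (t / 2) (Rmin D (1 - D))).
  pose proof (Rmin_l D (1 - D)). pose proof (Rmin_r D (1 - D)).
  split; [repeat apply Rmin_pos; lra|]. split; [assumption|].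
  intros w [Hw0 Hw].
  assert (Ib : Im b = 0) by (destruct Hb as [->| ->]; reflexivity).
  assert (Rb : Re b = 0 \/ Re b = D) by (destruct Hb as [->| ->]; [left | right]; reflexivity).
  pose proof (re_le_Cmod (w - b)%C) as R1. pose proof (im_le_Cmod (w - b)%C) as R2.
  rewrite Re_minus in R1. rewrite Im_minus, Ib, Rminus_0_r in R2.
  assert (Iw : Rabs (Im w) < t / 2) by lra. apply Rabs_def2 in Iw.
  assert (Rw : Rabs (Re w - Re b) < Rmin D (1 - D)) by lra. apply Rabs_def2 in Rw.
  assert (Nw : w <> b) by (intros ->; replace (b - b)%C with (RtoC 0) in Hw0 by ring; rewrite Cmod_0 in Hw0; lra).
  assert (Int0 : forall j : Z, Im w = IZR j * t -> Im w = 0).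
  { intros j E. assert (A : -1 < IZR j < 1) by (split; nra). destruct A as [A1 A2].
    apply lt_IZR in A1, A2. assert (j = 0)%Z by lia. subst. lra. }
  assert (Zero : forall a : Z, -1 < IZR a < 1 -> IZR a = 0).
  { intros a [A1 A2]. apply lt_IZR in A1, A2. assert (a = 0)%Z by lia. subst. reflexivity. }
  split; [|split].
  - intros [k E]. unfold on_line in E. change (Im tau) with t in E.
    assert (A : -1 < IZR k < 0) by (split; nra). destruct A as [A1 A2]. apply lt_IZR in A1, A2. lia.
  - intros HL. apply lattice_tau_coords in HL. destruct HL as (a & j & E1 & E2). apply Int0 in E2.
    pose proof (Zero a) as Z. destruct Rb as [E|E]; rewrite E in Rw.
    + apply Nw. destruct w as [x y], b as [x' y']. simpl in *. f_equal; lra.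
    + rewrite E1 in Rw. specialize (Z ltac:(lra)). lra.
  - intros HL. apply lattice_tau_coords in HL. destruct HL as (a & j & E1 & E2).
    rewrite Re_minus, re_RtoC in E1. rewrite Im_minus, im_RtoC, Rminus_0_r in E2. apply Int0 in E2.
    pose proof (Zero a) as Z. destruct Rb as [E|E]; rewrite E in Rw.
    + specialize (Z ltac:(lra)). lra.
    + apply Nw. destruct w as [x y], b as [x' y']. simpl in *. f_equal; lra.
Qed.

Lemma lattice_parity (z : C) : in_lattice 1 tau z ->
  in_lattice 1 (2 * tau) z \/ in_lattice 1 (2 * tau) (z - tau).
Proof.
  intros [a [b ->]]. destruct (Zeven_odd_dec b) as [E|O].
  - left. apply Zeven_ex in E. destruct E as [m ->]. exists a, m. rewrite mult_IZR, RtoC_mult. ring.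
  - right. apply Zodd_ex in O. destruct O as [m ->]. exists a, m. rewrite plus_IZR, mult_IZR, RtoC_plus, RtoC_mult. ring.
Qed.

End Good.

(** * One row of a solution, continued across the jump lines *)

Section Row.
Variables (n : nat) (t D : R).
Hypotheses (Hn : (1 <= n)%nat) (Ht : 0 < t) (HD : 0 < D < 1).
Let tau : C := (0, t).
(** An abstract row, used for both rows of M. In [Mjump] the functions q1, q2 are the boundary
    values from below, and (-q2, q1) is what the jump prescribes above. *)
Variables m1 m2 : C -> C.
Hypotheses
  (M1 : forall p, good tau D p -> m1 (p + 1)%C = (sgn n * m1 p)%C /\ m2 (p + 1)%C = (sgn n * m2 p)%C)
  (Mtau : forall p, good tau D p -> m1 (p + tau)%C = m1 p /\ m2 (p + tau)%C = m2 p)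
  (Mhol : forall p, good tau D p -> hol m1 p /\ hol m2 p)
  (MD1 : bounded_near (fun w => (w - RtoC D) * m1 w)%C (RtoC D))
  (MD2 : bounded_near (fun w => m2 w / (w - RtoC D))%C (RtoC D))
  (Mjump : forall k : Z, exists q1 q2 : R -> C, forall x e, 0 < e -> exists d, 0 < d /\
    (forall x', Rabs (x' - x) < d -> Cmod (q1 x' - q1 x) < e /\ Cmod (q2 x' - q2 x) < e) /\
    forall w, Cmod (w - (x, (IZR k + / 2) * t)) < d ->
      ((IZR k + / 2) * t < Im w -> Cmod (m1 w - - q2 x) < e /\ Cmod (m2 w - q1 x) < e) /\
      (Im w < (IZR k + / 2) * t -> Cmod (m1 w - q1 x) < e /\ Cmod (m2 w - q2 x) < e)).

(** Adding 1/2 before the floor gives the index of the strip centered at height kt that contains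
    p. *)
Definition unfolded_row (p : C) : C := sheet (Int_part (Im p / t + / 2)) (m1 p) (m2 p).
Let Phi : C -> C := unfolded_row.

Lemma unfolded_row_center (p : C) (k : Z) : Rabs (Im p - IZR k * t) < t / 2 ->
  Phi p = sheet k (m1 p) (m2 p).
Proof.
  intros H. apply Rabs_def2 in H. unfold Phi, unfolded_row. f_equal.
  destruct (base_Int_part (Im p / t + / 2)) as [J1 J2]. set (j := Int_part (Im p / t + / 2)) in *.
  assert (E : Im p = Im p / t * t) by (field; lra).
  set (y := Im p / t) in *. rewrite E in H.
  assert (A : -1 < IZR (j - k) < 1) by (rewrite minus_IZR; split; nra).
  destruct A as [A1 A2]. apply lt_IZR in A1, A2. lia.
Qed.

Let offgrid_center (p : C) : offgrid t p -> exists k : Z, Rabs (Im p - IZR k * t) < t / 2.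
Proof. intros U. apply off_lines_center; [exact Ht|]. apply (offgrid_good t D p U). Qed.

Lemma unfolded_row_periods (p : C) : offgrid t p ->
  Phi (p + 1)%C = (sgn n * Phi p)%C /\ Phi (p + 2 * tau)%C = (- Phi p)%C.
Proof.
  intros U. pose proof (offgrid_good t D p U) as G. fold tau in G.
  destruct (offgrid_center p U) as [k Hk].
  rewrite (unfolded_row_center p k Hk). split.
  - rewrite (unfolded_row_center (p + 1) k).
    + destruct (M1 p G) as [-> ->]. apply sheet_scal.
    + replace (Im (p + 1)) with (Im p) by (unfold Im; simpl; ring). exact Hk.
  - rewrite (unfolded_row_center (p + 2 * tau) (k + 2)).
    + rewrite sheet_add_2. do 2 f_equal.
      * replace (p + 2 * tau)%C with (p + tau + tau)%C by ring.
        pose proof (good_shift t D p 1 G) as G'. fold tau in G'. replace (p + IZR 1 * tau)%C with (p + tau)%C in G' by ring.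
        rewrite (proj1 (Mtau _ G')). apply Mtau, G.
      * replace (p + 2 * tau)%C with (p + tau + tau)%C by ring.
        pose proof (good_shift t D p 1 G) as G'. fold tau in G'. replace (p + IZR 1 * tau)%C with (p + tau)%C in G' by ring.
        rewrite (proj2 (Mtau _ G')). apply Mtau, G.
    + rewrite plus_IZR. replace (Im (p + 2 * tau) - (IZR k + 2) * t) with (Im p - IZR k * t)
        by (unfold tau, Im; simpl; ring). exact Hk.
Qed.

Let Phi_near (z : C) (k : Z) : Rabs (Im z - IZR k * t) < t / 2 ->
  exists r, 0 < r /\ forall w, Cmod (w - z) < r -> Phi w = sheet k (m1 w) (m2 w).
Proof.
  intros H. destruct (center_near t z k H) as [r [Pr Hr]]. exists r. split; [exact Pr|].
  intros w Hw. apply unfolded_row_center, Hr, Hw.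
Qed.

Lemma unfolded_row_hol (p : C) : good tau D p -> hol Phi p.
Proof.
  intros G. destruct (off_lines_center t Ht p (proj1 G)) as [k Hk].
  destruct (Phi_near p k Hk) as [r [Pr Hr]].
  apply (hol_ext_loc (fun w => sheet k (m1 w) (m2 w)) Phi p r Pr).
  - intros w Hw. symmetry. apply Hr, Hw.
  - apply hol_sheet; apply Mhol, G.
Qed.

Lemma good_between (w : C) (k : Z) : Rabs (Im w - (IZR k + / 2) * t) < t / 2 ->
  Im w <> (IZR k + / 2) * t -> good tau D w.
Proof.
  intros H N. apply Rabs_def2 in H.
  assert (L : forall j : Z, Im w <> IZR j * t).
  { intros j E. rewrite E in H. assert (A : IZR k < IZR j < IZR (k + 1)) by (rewrite plus_IZR; split; nra).
    destruct A as [A1 A2]. apply lt_IZR in A1, A2. lia. }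
  split; [|split].
  - intros [j E]. unfold on_line in E. change (Im tau) with t in E. rewrite E in H.
    assert (A : -1 < IZR (j - k) < 1) by (rewrite minus_IZR; split; nra).
    destruct A as [A1 A2]. apply lt_IZR in A1, A2. assert (j = k)%Z by lia. subst. exact (N E).
  - intros HL. apply lattice_tau_coords in HL. destruct HL as (a & b & _ & E). exact (L b E).
  - intros HL. apply lattice_tau_coords in HL. destruct HL as (a & b & _ & E).
    rewrite Im_minus, im_RtoC, Rminus_0_r in E. exact (L b E).
Qed.

Lemma unfolded_row_reg_line (z : C) (k : Z) : Im z = (IZR k + / 2) * t -> reg t Phi z.
Proof.
  intros Hz. destruct (Mjump k) as (q1 & q2 & HJ).
  set (y0 := (IZR k + / 2) * t) in *.
  (* The line is filled with the lower boundary values; by [sheet_succ] the limit from above is the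
     same, so g is continuous and the line is removable. *)
  set (g := fun w => if Req_EM_T (Im w) y0 then sheet k (q1 (Re w)) (q2 (Re w)) else Phi w).
  assert (Near : forall w, Cmod (w - z) < t / 4 -> Rabs (Im w - y0) < t / 2).
  { intros w Hw. rewrite <- Hz, <- Im_minus. eapply Rle_lt_trans; [apply im_le_Cmod|]. lra. }
  assert (Eoff : forall w, Im w <> y0 -> g w = Phi w).
  { intros w N. unfold g. destruct (Req_EM_T (Im w) y0); [contradiction | reflexivity]. }
  assert (Doff : forall w, Cmod (w - z) < t / 4 -> Im w <> y0 -> cdf g w).
  { intros w Hw N.
    assert (G : good tau D w) by (apply (good_between w k); [apply Near, Hw | exact N]).
    assert (Pn : 0 < Rabs (Im w - y0)) by (apply Rabs_pos_lt; lra).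
    apply (cdf_ext_loc Phi g w (Rabs (Im w - y0)) Pn); [|apply hol_cdf, unfolded_row_hol, G].
    intros u Hu. symmetry. apply Eoff. intros E.
    pose proof (im_le_Cmod (u - w)) as A. rewrite Im_minus, E, Rabs_minus_sym in A. lra. }
  assert (Con : forall w, Cmod (w - z) < t / 4 -> ccont g w).
  { intros w Hw. destruct (Req_EM_T (Im w) y0) as [Ew|Nw]; [|apply cdf_ccont, Doff; assumption].
    intros e He. destruct (HJ (Re w) e He) as (d & Pd & Hq & Hm).
    exists (Rmin d (t / 2)). pose proof (Rmin_l d (t / 2)); pose proof (Rmin_r d (t / 2)).
    split; [apply Rmin_pos; lra|]. intros u Hu.
    assert (gw : g w = sheet k (q1 (Re w)) (q2 (Re w))).
    { unfold g. destruct (Req_EM_T (Im w) y0); [reflexivity | contradiction]. }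
    assert (Eww : w = (Re w, y0)) by (rewrite <- Ew; destruct w; reflexivity).
    assert (Hu' : Cmod (u - (Re w, y0)) < d) by (rewrite <- Eww; lra).
    destruct (Hm u Hu') as [Ha Hb].
    assert (Iu : Rabs (Im u - y0) < t / 2).
    { rewrite <- Ew, <- Im_minus. eapply Rle_lt_trans; [apply im_le_Cmod|]. lra. }
    apply Rabs_def2 in Iu. rewrite gw.
    destruct (Rtotal_order (Im u) y0) as [Q|[Q|Q]].
    - rewrite Eoff by lra. rewrite (unfolded_row_center u k) by (unfold y0 in *; apply Rabs_def1; lra).
      apply sheet_close; apply Hb, Q.
    - unfold g. destruct (Req_EM_T (Im u) y0); [|contradiction].
      assert (Hx : Rabs (Re u - Re w) < d).
      { rewrite <- Re_minus. eapply Rle_lt_trans; [apply re_le_Cmod|]. lra. }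
      apply sheet_close; apply Hq, Hx.
    - rewrite Eoff by lra.
      rewrite (unfolded_row_center u (k + 1)) by (rewrite plus_IZR; unfold y0 in *; apply Rabs_def1; lra).
      rewrite <- (sheet_succ k). apply sheet_close; apply Ha, Q. }
  exists g, (t / 4). split; [lra|]. split.
  - apply (line_removable g y0 z (t / 4) Con Doff).
  - intros w _ Uw. symmetry. apply Eoff. intros E. apply (Uw (2 * k + 1)%Z).
    rewrite plus_IZR, mult_IZR, E. unfold y0. lra.
Qed.

Lemma unfolded_row_reg_invariant (z w : C) : in_lattice 1 (2 * tau) (w - z) -> (reg t Phi z <-> reg t Phi w).
Proof.
  apply lattice_invariant.
  - intros u. rewrite (reg_shift_iff t Phi u 1 (offgrid_1 t)).
    rewrite (reg_scal_iff t Phi (sgn n) u (sgn_neq_0 n)).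
    split; apply reg_ext with (r := 1); try lra; intros v _ Uv; [symmetry|]; apply unfolded_row_periods, Uv.
  - intros u. unfold tau. rewrite (reg_shift_iff t Phi u _ (offgrid_2tau t)).
    rewrite (reg_scal_iff t Phi (- (1)) u Copp_1_neq_0).
    split; apply reg_ext with (r := 1); try lra; intros v _ Uv;
      pose proof (proj2 (unfolded_row_periods v Uv)) as E; unfold tau in E; rewrite E; ring.
Qed.

Let not_offgrid (b : C) : b = 0 \/ b = RtoC D -> ~ offgrid t b.
Proof. intros Hb U. apply (U 0%Z). destruct Hb as [->| ->]; simpl; ring. Qed.

(* Transfers a bound on the entries near [0] or [D] to the unfolded row, on the first and second sheets. *)
Let reg_first (b : C) (k : C -> C) : b = 0 \/ b = RtoC D ->
  (forall w, w <> b -> cdf k w) -> bounded_near (fun w => k w * m1 w)%C b ->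
  reg t (fun w => k w * Phi w)%C b.
Proof.
  intros Hb Hk HB. destruct (good_near t D Ht HD b Hb) as (r & Pr & Hr & Hg).
  assert (Ib : Im b = 0) by (destruct Hb as [->| ->]; reflexivity).
  apply (reg_ext t (fun w => k w * m1 w)%C _ b r Pr).
  - intros w Hw _. f_equal. rewrite (unfolded_row_center w 0); [reflexivity|].
    rewrite Rmult_0_l, Rminus_0_r. replace (Im w) with (Im (w - b)) by (rewrite Im_minus, Ib; ring).
    eapply Rle_lt_trans; [apply im_le_Cmod|]. lra.
  - apply (Riemann_reg t _ b r Pr); [apply not_offgrid, Hb | | exact HB].
    intros w Hw. apply cdf_mult; [|apply hol_cdf, Mhol, Hg, Hw].
    apply Hk. intros ->. replace (b - b)%C with (RtoC 0) in Hw by ring. rewrite Cmod_0 in Hw. lra.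
Qed.

Let reg_second (b : C) (k : C -> C) : b = 0 \/ b = RtoC D ->
  (forall w, w <> b -> cdf k w) -> bounded_near (fun w => k w * m2 w)%C b ->
  reg t (fun w => k (w - tau) * Phi w)%C (b + tau).
Proof.
  intros Hb Hk HB. destruct (good_near t D Ht HD b Hb) as (r & Pr & Hr & Hg).
  assert (Ib : Im b = 0) by (destruct Hb as [->| ->]; reflexivity).
  assert (HU : forall w, offgrid t w <-> offgrid t (w + tau)%C).
  { intros w. rewrite (offgrid_shift t w 1). fold tau. replace (w + IZR 1 * tau)%C with (w + tau)%C by ring. tauto. }
  apply (reg_shift_iff t (fun w => k (w - tau)%C * Phi w)%C b tau HU).
  apply (reg_ext t (fun w => k w * m2 w)%C _ b r Pr).
  - intros w Hw Uw. replace (w + tau - tau)%C with w by ring. f_equal.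
    rewrite (unfolded_row_center (w + tau) 1).
    + unfold sheet. change (1 mod 4)%Z with 1%Z. symmetry. apply Mtau, (offgrid_good t D w Uw).
    + replace (Im (w + tau) - IZR 1 * t) with (Im w) by (unfold tau, Im; simpl; ring).
      replace (Im w) with (Im (w - b)) by (rewrite Im_minus, Ib; ring).
      eapply Rle_lt_trans; [apply im_le_Cmod|]. lra.
  - apply (Riemann_reg t _ b r Pr); [apply not_offgrid, Hb | | exact HB].
    intros w Hw. apply cdf_mult; [|apply hol_cdf, Mhol, Hg, Hw].
    apply Hk. intros ->. replace (b - b)%C with (RtoC 0) in Hw by ring. rewrite Cmod_0 in Hw. lra.
Qed.

Let reg_D : reg t (fun w => (w - RtoC D) * Phi w)%C (RtoC D).
Proof. apply (reg_first (RtoC D) (fun w => w - RtoC D)%C); auto with cd. Qed.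

Let reg_Dtau : reg t (fun w => Phi w * / (w - (RtoC D + tau)))%C (RtoC D + tau).
Proof.
  apply (reg_ext t (fun w => / (w - tau - RtoC D) * Phi w)%C _ _ 1 Rlt_0_1).
  - intros w _ _. replace (w - tau - RtoC D)%C with (w - (RtoC D + tau))%C by ring. ring.
  - apply (reg_second (RtoC D) (fun w => / (w - RtoC D))%C); auto.
    + intros w Hw. apply cdf_sub_inv, Hw.
    + apply (bounded_near_ext (fun w => m2 w / (w - RtoC D))%C _ _ 1 Rlt_0_1); [|exact MD2].
      intros w _. unfold Cdiv. ring.
Qed.

Let reg_Phi_Dtau : reg t Phi (RtoC D + tau).
Proof.
  apply (reg_ext t (fun w => (w - (RtoC D + tau)) * (Phi w * / (w - (RtoC D + tau))))%C _ _ 1 Rlt_0_1).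
  - intros w _ Uw. field. apply Csub_neq_0. intros ->. apply (Uw 2%Z). unfold tau, Im; simpl. field.
  - apply reg_mult; [apply hol_reg, entire_hol; auto with cd | exact reg_Dtau].
Qed.

(** A point off the poles a and D is good, on a jump line, or a doubled-lattice translate of either
    D + τ, where the row vanishes, or of whichever of 0 and τ differs from a. *)
Let reg_generic (a z : C) : (a = 0 -> reg t Phi tau) -> (a = tau -> reg t Phi 0) -> a = 0 \/ a = tau ->
  ~ in_lattice 1 (2 * tau) (z - a) -> ~ in_lattice 1 (2 * tau) (z - RtoC D) -> reg t Phi z.
Proof.
  intros H0 H1 Ha Na ND.
  destruct (classic (good tau D z)) as [G|G]; [apply hol_reg, unfolded_row_hol, G|].
  destruct (classic (on_lines tau z)) as [[k E]|NL]; [apply (unfolded_row_reg_line z k E)|].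
  destruct (classic (in_lattice 1 tau z)) as [L1|N1].
  - destruct (lattice_parity t z L1) as [Q|Q]; fold tau in Q; destruct Ha as [Ea|Ea]; subst a.
    + exfalso. apply Na. replace (z - 0)%C with z by ring. exact Q.
    + apply (unfolded_row_reg_invariant 0 z); [|auto]. replace (z - 0)%C with z by ring. exact Q.
    + apply (unfolded_row_reg_invariant tau z); [exact Q | auto].
    + exfalso. exact (Na Q).
  - assert (L2 : in_lattice 1 tau (z - RtoC D)).
    { apply NNPP. intros N2. apply G. split; [exact NL | split; assumption]. }
    destruct (lattice_parity t _ L2) as [Q|Q]; fold tau in Q; [contradiction|].
    apply (unfolded_row_reg_invariant (RtoC D + tau) z); [|exact reg_Phi_Dtau].
    replace (z - (RtoC D + tau))%C with (z - RtoC D - tau)%C by ring. exact Q.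
Qed.

(** For the first row the pole at 0 sits in m1. Near τ the unfolded row is m2 near 0, which is
    bounded; the second row has these roles exchanged. *)
Lemma unfolded_row_first (F : C -> C) : pole_data n t D 0 F ->
  bounded_near (fun w => w * m1 w)%C 0 -> bounded_near m2 0 ->
  exists c : C, forall p, offgrid t p -> Phi p = (c * F p)%C.
Proof.
  intros HF B1 B2. apply (pd_unique _ _ _ _ _ HF Phi).
  - exact unfolded_row_periods.
  - intros z. apply reg_generic; auto.
    + intros _. apply (reg_ext t (fun w => 1 * Phi w)%C _ _ 1 Rlt_0_1); [intros; ring|].
      replace tau with (0 + tau)%C by ring.
      apply (reg_second 0 (fun _ => 1)%C); auto with cd.
      apply (bounded_near_ext m2 _ 0 1 Rlt_0_1); [intros; ring | exact B2].
    + intros E. exfalso. apply (f_equal snd) in E. unfold tau in E; simpl in E. lra.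
  - apply (reg_first 0 (fun w => w - 0)%C); auto with cd.
    apply (bounded_near_ext (fun w => w * m1 w)%C _ 0 1 Rlt_0_1); [intros; ring | exact B1].
  - exact reg_D.
  - exact reg_Dtau.
Qed.

Lemma unfolded_row_second (F : C -> C) : pole_data n t D tau F ->
  bounded_near m1 0 -> bounded_near (fun w => w * m2 w)%C 0 ->
  exists c : C, forall p, offgrid t p -> Phi p = (c * F p)%C.
Proof.
  intros HF B1 B2. apply (pd_unique _ _ _ _ _ HF Phi).
  - exact unfolded_row_periods.
  - intros z. apply reg_generic; auto.
    + intros E. exfalso. apply (f_equal snd) in E. unfold tau in E; simpl in E. lra.
    + intros _. apply (reg_ext t (fun w => 1 * Phi w)%C _ _ 1 Rlt_0_1); [intros; ring|].
      apply (reg_first 0 (fun _ => 1)%C); auto with cd.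
      apply (bounded_near_ext m1 _ 0 1 Rlt_0_1); [intros; ring | exact B1].
  - pose proof (reg_second 0 (fun w => w) (or_introl eq_refl) (fun w _ => cdf_id w) B2) as Q.
    rewrite Cplus_0_l in Q. exact Q.
  - exact reg_D.
  - exact reg_Dtau.
Qed.

Lemma unfolded_row_entries (F : C -> C) (c : C) :
  (forall p, offgrid t p -> Phi p = (c * F p)%C) ->
  forall p, offgrid t p -> Rabs (Im p) < t / 2 -> m1 p = (c * F p)%C /\ m2 p = (c * F (p + tau))%C.
Proof.
  intros H p U Hp. split.
  - rewrite <- (H p U), (unfolded_row_center p 0); [reflexivity|]. rewrite Rmult_0_l, Rminus_0_r. exact Hp.
  - assert (U' : offgrid t (p + tau)).
    { replace (p + tau)%C with (p + IZR 1 * tau)%C by ring. apply (offgrid_shift t p 1), U. }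
    rewrite <- (H _ U'), (unfolded_row_center (p + tau) 1).
    + unfold sheet. change (1 mod 4)%Z with 1%Z. symmetry. apply Mtau, (offgrid_good t D p U).
    + replace (Im (p + tau) - IZR 1 * t) with (Im p) by (unfold tau, Im; simpl; ring). exact Hp.
Qed.

End Row.

(** * The normalization at 0 fixes the constant *)

Lemma residue_unique (t : R) (F G : C -> C) (c c' : C) (r : R) : 0 < t -> 0 < r ->
  bounded_near (fun w => c' * F w - / w)%C 0 -> bounded_near (fun w => G w - / w)%C 0 ->
  (forall w, offgrid t w -> Cmod w < r -> G w = (c * F w)%C) -> c = c'.
Proof.
  intros Ht Pr (r1 & K1 & P1 & B1) (r2 & K2 & P2 & B2) E.
  apply Cmod_small_eq. intros e He.
  pose proof (Cmod_ge_0 c); pose proof (Cmod_ge_0 c').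
  pose proof (Rabs_pos K1); pose proof (Rabs_pos K2).
  set (S := (Cmod c' + Cmod c) * (Rabs K1 + Rabs K2)).
  assert (PS : 0 <= S) by (unfold S; apply Rmult_le_pos; lra).
  set (d := Rmin (Rmin r (e / (S + 1))) (Rmin r1 r2)).
  assert (Pd : 0 < d).
  { unfold d; repeat apply Rmin_pos; try lra. apply Rdiv_lt_0_compat; lra. }
  destruct (offgrid_dense t Ht 0 d Pd) as [w [Hw Uw]].
  assert (D1 : Cmod (w - 0) < r) by (eapply Rlt_le_trans; [exact Hw | eapply Rle_trans; [apply Rmin_l | apply Rmin_l]]).
  assert (D2 : Cmod (w - 0) < e / (S + 1)) by (eapply Rlt_le_trans; [exact Hw | eapply Rle_trans; [apply Rmin_l | apply Rmin_r]]).
  assert (D3 : Cmod (w - 0) < r1) by (eapply Rlt_le_trans; [exact Hw | eapply Rle_trans; [apply Rmin_r | apply Rmin_l]]).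
  assert (D4 : Cmod (w - 0) < r2) by (eapply Rlt_le_trans; [exact Hw | eapply Rle_trans; [apply Rmin_r | apply Rmin_r]]).
  assert (Nw : w <> 0).
  { intros ->. apply (Uw 0%Z). simpl. ring. }
  pose proof (Cmod_sub_pos w 0 Nw) as Pw.
  specialize (B1 w ltac:(lra)). specialize (B2 w ltac:(lra)).
  replace (w - 0)%C with w in * by ring. specialize (E w Uw D1).
  (* The terms with F cancel because G = cF, and what remains is O(|w|) as w tends to 0 off the
     grid. *)
  assert (EQ : (c - c')%C = (c' * (w * (G w - / w)) - c * (w * (c' * F w - / w)))%C).
  { rewrite E. field. exact Nw. }
  rewrite EQ. eapply Rle_trans; [apply Cmod_minus_le|]. rewrite !Cmod_mult.
  pose proof (Rle_abs K1); pose proof (Rle_abs K2).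
  apply Rle_trans with (S * Cmod w).
  - unfold S. 
    assert (Q1 : Cmod c' * (Cmod w * Cmod (G w - / w)) <= Cmod c' * (Cmod w * Rabs K2)).
    { apply Rmult_le_compat_l; [lra|]. apply Rmult_le_compat_l; lra. }
    assert (Q2 : Cmod c * (Cmod w * Cmod (c' * F w - / w)) <= Cmod c * (Cmod w * Rabs K1)).
    { apply Rmult_le_compat_l; [lra|]. apply Rmult_le_compat_l; lra. }
    assert (0 <= Cmod c' * Cmod w * Rabs K1) by (repeat apply Rmult_le_pos; lra).
    assert (0 <= Cmod c * Cmod w * Rabs K2) by (repeat apply Rmult_le_pos; lra).
    lra.
  - apply Rle_trans with ((S + 1) * (e / (S + 1))); [|right; field; lra].
    apply Rmult_le_compat; lra.
Qed.

Lemma bounded_near_mult_id (m : C -> C) :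
  bounded_near (fun w => m w - / w)%C 0 -> bounded_near (fun w => w * m w)%C 0.
Proof.
  intros (r & K & Pr & HK). exists (Rmin r 1), (Rabs K + 1).
  pose proof (Rmin_l r 1); pose proof (Rmin_r r 1).
  split; [apply Rmin_pos; lra|]. intros w Hw. specialize (HK w ltac:(lra)).
  replace (w - 0)%C with w in Hw by ring. destruct Hw as [Hw0 Hw].
  assert (Nw : w <> 0) by (apply Cmod_gt_0, Hw0).
  replace (w * m w)%C with (w * (m w - / w) + 1)%C by (field; exact Nw).
  eapply Rle_trans; [apply Cmod_triangle|]. rewrite Cmod_1, Cmod_mult.
  pose proof (Rle_abs K). pose proof (Cmod_ge_0 (m w - / w)). nra.
Qed.

(** * Uniqueness of the matrix solution *)

Section RHPUniqueness.
Variables (n : nat) (t D : R).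
Hypotheses (Hn : (1 <= n)%nat) (Ht : 0 < t) (HD : 0 < D < 1).
Let tau : C := (0, t).
Variable M : C -> Mat2.
Hypothesis HM : RHP_solution n tau D M.

Let M_jump (r1 r2 : Mat2 -> C) :
  (r1 = m11 /\ r2 = m12) \/ (r1 = m21 /\ r2 = m22) ->
  forall k : Z, exists q1 q2 : R -> C, forall x e, 0 < e -> exists d, 0 < d /\
    (forall x', Rabs (x' - x) < d -> Cmod (q1 x' - q1 x) < e /\ Cmod (q2 x' - q2 x) < e) /\
    forall w, Cmod (w - (x, (IZR k + / 2) * t)) < d ->
      ((IZR k + / 2) * t < Im w -> Cmod (r1 (M w) - - q2 x) < e /\ Cmod (r2 (M w) - q1 x) < e) /\
      (Im w < (IZR k + / 2) * t -> Cmod (r1 (M w) - q1 x) < e /\ Cmod (r2 (M w) - q2 x) < e).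
Proof.
  intros Hr k. destruct HM as (_ & _ & _ & _ & _ & _ & _ & _ & _ & _ & _ & HB).
  destruct (HB k) as (Bp & Bm & Hc & Hl & HJ).
  exists (fun x => r1 (Bm x)), (fun x => r2 (Bm x)). intros x e He.
  assert (J1 : r1 (Bp x) = (- r2 (Bm x))%C /\ r2 (Bp x) = r1 (Bm x)).
  { rewrite HJ. destruct Hr as [[-> ->]|[-> ->]]; unfold mmul, Jmat, mk2, m11, m12, m21, m22; simpl;
      split; ring. }
  destruct (Hc x) as [_ Cm]. destruct (Hl x) as [Lp Lm].
  unfold continuous in Cm.
  pose proof (proj1 (filterlim_entries (locally x) Bm (Bm x)) Cm e He) as [d1 C1].
  pose proof (proj1 (filterlim_entries _ M (Bp x)) Lp e He) as U. apply locally_Cmod in U.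
  pose proof (proj1 (filterlim_entries _ M (Bm x)) Lm e He) as W. apply locally_Cmod in W.
  destruct U as [d2 [P2 U]]. destruct W as [d3 [P3 W]].
  pose proof (cond_pos d1) as P1.
  exists (Rmin d1 (Rmin d2 d3)).
  pose proof (Rmin_l d1 (Rmin d2 d3)). pose proof (Rmin_r d1 (Rmin d2 d3)).
  pose proof (Rmin_l d2 d3). pose proof (Rmin_r d2 d3).
  split; [repeat apply Rmin_pos; lra|]. split.
  - intros x' Hx'. destruct (C1 x') as (E1 & E2 & E3 & E4).
    { change (Rabs (x' - x) < d1). lra. }
    destruct Hr as [[-> ->]|[-> ->]]; split; assumption.
  - intros w Hw. destruct J1 as [J1 J2]. split; intros Hi.
    + rewrite <- J1, <- J2. destruct (U w ltac:(unfold line_pt; change (Im tau) with t; lra) Hi) as (E1 & E2 & E3 & E4).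
      destruct Hr as [[-> ->]|[-> ->]]; split; assumption.
    + destruct (W w ltac:(unfold line_pt; change (Im tau) with t; lra) Hi) as (E1 & E2 & E3 & E4).
      destruct Hr as [[-> ->]|[-> ->]]; split; assumption.
Qed.

Let M_period_1 (p : C) : good tau D p -> M (p + 1)%C = mscal (sgn n) (M p).
Proof. intros G. destruct HM as (_ & H2 & _). apply H2, G. Qed.
Let M_period_tau (p : C) : good tau D p -> M (p + tau)%C = M p.
Proof. intros G. destruct HM as (_ & H2 & _). apply H2, G. Qed.

Let M_shift (p : C) (k : Z) : good tau D p -> M (p + IZR k * tau)%C = M p.
Proof.
  assert (N : forall (j : nat) q, good tau D q -> M (q + IZR (Z.of_nat j) * tau)%C = M q).
  { intros j q G. induction j as [|j IH].
    - f_equal. simpl. ring.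
    - rewrite Nat2Z.inj_succ, <- Z.add_1_r, plus_IZR, RtoC_plus.
      replace (q + (IZR (Z.of_nat j) + 1) * tau)%C with (q + IZR (Z.of_nat j) * tau + tau)%C by ring.
      rewrite M_period_tau by (apply (good_shift t D), G). exact IH. }
  intros G. destruct (Z_le_gt_dec 0 k) as [H|H].
  - rewrite <- (Z2Nat.id k H). apply N, G.
  - rewrite <- (N (Z.to_nat (- k)) (p + IZR k * tau)%C) by (apply (good_shift t D), G).
    f_equal. rewrite Z2Nat.id, opp_IZR, RtoC_opp by lia. ring.
Qed.

Let M_eq_center (p : C) : offgrid t p -> Rabs (Im p) < t / 2 -> M p = M_center n t D p.
Proof.
  intros U Hp.
  pose proof HM as (_ & _ & B11 & B12 & B21 & B22 & D11 & D21 & D12 & D22 & Hh & _).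
  assert (Ex : exists r, 0 < r /\ forall w, Cmod w < r -> Rabs (Im w) < t / 2).
  { exists (t / 2). split; [lra|]. intros w Hw. eapply Rle_lt_trans; [apply im_le_Cmod | exact Hw]. }
  destruct Ex as [r [Pr Er]].
  assert (R1 : forall q, offgrid t q -> Rabs (Im q) < t / 2 ->
    m11 (M q) = (a_const tau D * kappa n tau * f_sol n tau D q)%C /\
    m12 (M q) = (a_const tau D * kappa n tau * f_sol n tau D (q + tau))%C).
  { assert (HM1 : forall p, good tau D p -> m11 (M (p + 1)%C) = (sgn n * m11 (M p))%C /\ m12 (M (p + 1)%C) = (sgn n * m12 (M p))%C).
    { intros q G. rewrite (M_period_1 q G). split; reflexivity. }
    assert (HMt : forall p, good tau D p -> m11 (M (p + tau)%C) = m11 (M p) /\ m12 (M (p + tau)%C) = m12 (M p)).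
    { intros q G. rewrite (M_period_tau q G). split; reflexivity. }
    assert (HMh : forall p, good tau D p -> hol (fun w => m11 (M w)) p /\ hol (fun w => m12 (M w)) p).
    { intros q G. destruct (Hh q G) as (A1 & A2 & _ & _). split; apply hol_holo_at; assumption. }
    pose proof (M_jump m11 m12 ltac:(auto)) as HJ.
    destruct (unfolded_row_first n t D Hn Ht HD (fun w => m11 (M w)) (fun w => m12 (M w)) HM1 HMt HMh D11 D12 HJ
      (f_sol n tau D) (f_pole_data n t D Hn Ht HD)) as [c Hc].
    - apply bounded_near_mult_id, B11.
    - exact B12.
    - pose proof (unfolded_row_entries n t D Hn Ht HD (fun w => m11 (M w)) (fun w => m12 (M w)) HMt
        (f_sol n tau D) c Hc) as HE.
      assert (Ec : c = (a_const tau D * kappa n tau)%C).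
      { apply (residue_unique t (f_sol n tau D) (fun w => m11 (M w)) c _ r Ht Pr).
        - exact (f_residue n t D Ht HD).
        - exact B11.
        - intros w Uw Hw. apply HE; [exact Uw | apply Er, Hw]. }
      rewrite <- Ec. exact HE. }
  assert (R2 : forall q, offgrid t q -> Rabs (Im q) < t / 2 ->
    m21 (M q) = (kappa n tau / a_const tau D * h_sol n tau D q)%C /\
    m22 (M q) = (kappa n tau / a_const tau D * h_sol n tau D (q + tau))%C).
  { assert (HM1 : forall p, good tau D p -> m21 (M (p + 1)%C) = (sgn n * m21 (M p))%C /\ m22 (M (p + 1)%C) = (sgn n * m22 (M p))%C).
    { intros q G. rewrite (M_period_1 q G). split; reflexivity. }
    assert (HMt : forall p, good tau D p -> m21 (M (p + tau)%C) = m21 (M p) /\ m22 (M (p + tau)%C) = m22 (M p)).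
    { intros q G. rewrite (M_period_tau q G). split; reflexivity. }
    assert (HMh : forall p, good tau D p -> hol (fun w => m21 (M w)) p /\ hol (fun w => m22 (M w)) p).
    { intros q G. destruct (Hh q G) as (_ & _ & A1 & A2). split; apply hol_holo_at; assumption. }
    pose proof (M_jump m21 m22 ltac:(auto)) as HJ.
    destruct (unfolded_row_second n t D Hn Ht HD (fun w => m21 (M w)) (fun w => m22 (M w)) HM1 HMt HMh D21 D22 HJ
      (h_sol n tau D) (h_pole_data n t D Hn Ht HD)) as [c Hc].
    - exact B21.
    - apply bounded_near_mult_id, B22.
    - pose proof (unfolded_row_entries n t D Hn Ht HD (fun w => m21 (M w)) (fun w => m22 (M w)) HMt
        (h_sol n tau D) c Hc) as HE.
      assert (Ec : c = (kappa n tau / a_const tau D)%C).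
      { apply (residue_unique t (fun w => h_sol n tau D (w + tau)%C) (fun w => m22 (M w)) c _ r Ht Pr).
        - exact (h_residue n t D Ht HD).
        - exact B22.
        - intros w Uw Hw. apply HE; [exact Uw | apply Er, Hw]. }
      rewrite <- Ec. exact HE. }
  destruct (R1 p U Hp) as [E1 E2]. destruct (R2 p U Hp) as [E3 E4].
  unfold M_center, mk2. fold tau. rewrite <- E1, <- E2, <- E3, <- E4.
  unfold m11, m12, m21, m22. destruct (M p) as [[? ?] [? ?]]. reflexivity.
Qed.

Let M_eq_offgrid (p : C) : offgrid t p -> M p = M_sol n tau D p.
Proof.
  intros U. pose proof (offgrid_good t D p U) as G. fold tau in G.
  destruct (off_lines_center t Ht p (proj1 G)) as [k Hk].
  pose proof (M_sol_center n t D Hn Ht HD p k Hk) as E. fold tau in E. rewrite E.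
  rewrite <- (M_shift p (- k) G), opp_IZR, RtoC_opp.
  replace (p + - RtoC (IZR k) * tau)%C with (p - IZR k * tau)%C by ring.
  apply M_eq_center.
  - replace (p - IZR k * tau)%C with (p + IZR (- k) * tau)%C by (rewrite opp_IZR, RtoC_opp; ring).
    apply (offgrid_shift t p (- k)), U.
  - replace (Im (p - IZR k * tau)) with (Im p - IZR k * t) by (unfold tau, Im; simpl; ring). exact Hk.
Qed.

(** Equality off the grid extends to good points on the grid, for instance real points away from the
    poles, because both sides are holomorphic there. *)
Theorem RHP_solution_unique (p : C) : good tau D p -> M p = M_sol n tau D p.
Proof.
  intros G.
  assert (H1 : entries_all (fun F => holo_at F p) M) by (destruct HM as (_ & _ & _ & _ & _ & _ & _ & _ & _ & _ & H & _); apply H, G).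
  pose proof (M_sol_holo n t D Hn Ht HD p G) as H2. fold tau in H2.
  assert (Q : forall r : Mat2 -> C, holo_at (fun w => r (M w)) p -> holo_at (fun w => r (M_sol n tau D w)) p ->
    r (M p) = r (M_sol n tau D p)).
  { intros r A B. apply (offgrid_agree t Ht (fun w => r (M w)) (fun w => r (M_sol n tau D w)) p 1 Rlt_0_1).
    - apply cdf_ccont, hol_cdf, hol_holo_at, A.
    - apply cdf_ccont, hol_cdf, hol_holo_at, B.
    - intros w _ Uw. rewrite (M_eq_offgrid w Uw). reflexivity. }
  destruct H1 as (A1 & A2 & A3 & A4), H2 as (B1 & B2 & B3 & B4).
  pose proof (Q _ A1 B1) as E1. pose proof (Q _ A2 B2) as E2.
  pose proof (Q _ A3 B3) as E3. pose proof (Q _ A4 B4) as E4.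
  unfold m11, m12, m21, m22 in E1, E2, E3, E4.
  destruct (M p) as [[? ?] [? ?]], (M_sol n tau D p) as [[? ?] [? ?]]. simpl in *. subst. reflexivity.
Qed.

End RHPUniqueness.

Theorem theorem3p9 (n : nat) (t D : R) :
  (1 <= n)%nat -> 0 < t -> 0 < D < 1 ->
  let tau : C := (0, t) in
  (* existence: the explicit M solves the model RHP *)
  RHP_solution n tau D (M_sol n tau D) /\
  (* uniqueness (off the lines and the pole lattices) *)
  (forall M : C -> Mat2, RHP_solution n tau D M ->
     forall p : C, good tau D p -> M p = M_sol n tau D p) /\
  (* properties of f and h on E_{2 tau} *)
  fh_props n tau D 0 (f_sol n tau D) /\
  fh_props n tau D tau (h_sol n tau D) /\
  (* these properties characterize f and h up to a multiplicative constant *)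
  (forall F : C -> C, fh_props n tau D 0 F ->
     exists c : C, forall z, ~ cong2 tau z 0 -> ~ cong2 tau z (RtoC D) ->
       F z = (c * f_sol n tau D z)%C) /\
  (forall F : C -> C, fh_props n tau D tau F ->
     exists c : C, forall z, ~ cong2 tau z tau -> ~ cong2 tau z (RtoC D) ->
       F z = (c * h_sol n tau D z)%C).
Proof.
  intros Hn Ht HD tau.
  pose proof (f_pole_data n t D Hn Ht HD) as Hf. pose proof (h_pole_data n t D Hn Ht HD) as Hh.
  refine (conj _ (conj _ (conj _ (conj _ (conj _ _))))).
  - exact (M_sol_solution n t D Hn Ht HD).
  - intros M HM p Hp. exact (RHP_solution_unique n t D Hn Ht HD M HM p Hp).
  - exact (pd_fh _ _ _ _ _ Hf).
  - exact (pd_fh _ _ _ _ _ Hh).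
  - exact (pd_unique_fh _ _ _ _ _ Hf).
  - exact (pd_unique_fh _ _ _ _ _ Hh).
Qed.
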